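(* Let $f\in Z^\infty(\mathbb{D})$. Then $I_{H^\infty(\mathbb{D})}(f)$ is an $M$-ideal in $H^\infty(\mathbb{D})$ if and only if $f$ is an outer function.
   Context: $\mathbb{D}$ is the open unit disc, $\mathbb{T}$ the unit circle, $\mu$ normalized Lebesgue measure on $\mathbb{T}$. $H^\infty(\mathbb{D})$ is the Banach algebra of bounded analytic functions on $\mathbb{D}$ with the supremum norm; $\tilde f(z)=\lim_{r\to1^-}f(rz)$ for a.e. $z\in\mathbb{T}$. $I_{H^\infty(\mathbb{D})}(f)$ is the norm closure in $H^\infty(\mathbb{D})$ of $\{fg:g\in H^\infty(\mathbb{D})\}$. A function $f\in H^\infty(\mathbb{D})$ is outer if $\overline{\operatorname{span}}^{H^2(\mathbb{D})}\{z^mf:m\ge0\}=H^2(\mathbb{D})$, where $H^2(\mathbb{D})$ is the Hardy space. Every nonzero $f\in H^\infty(\mathbb{D})$ factors as $f=f_If_O$ with $f_I$ inner ($|\tilde f_I|=1$ a.e. on $\mathbb{T}$) and $f_O$ outer, uniquely up to unimodular constants. Zero sets: $z\in\mathbb{T}$ is an essential zero of an outer function $f\in H^\infty(\mathbb{D})$ if for every $\varepsilon>0$ and every open neighborhood $N_z\subset\mathbb{T}$ of $z$, $\mu(|\tilde f|^{-1}(0,\varepsilon)\cap N_z)\ne0$; $Z_{\mathbb{T}}(f)$ is the set of essential zeros of $f$. For a general nonzero $f\in H^\infty(\mathbb{D})$, $Z_{\mathbb{T}}(f):=Z_{\mathbb{T}}(f_O)$. $Z^\infty(\mathbb{D})$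 is the set of all nonzero $f\in H^\infty(\mathbb{D})$ that have a continuous extension to $\mathbb{D}\cup Z_{\mathbb{T}}(f)$. $M$-ideal: a closed subspace $C$ of a complex Banach space $X$ is an $M$-ideal in $X$ if there is a bounded linear projection $P:X^*\to X^*$ ($P^2=P$) with $\operatorname{ran}P=C^\perp=\{x^*\in X^*: x^*|_C\equiv0\}$ and $\|Px^*\|+\|(I-P)x^*\|=\|x^*\|$ for all $x^*\in X^*$. *)

(* Defs.v *)
From HB Require Import structures.
From mathcomp Require Import all_boot all_order all_algebra.
From mathcomp Require Import all_classical all_reals all_analysis.
From mathcomp Require Import measurable_realfun complex.

Set Implicit Arguments.
Unset Strict Implicit.
Unset Printing Implicit Defensive.

Import Order.TTheory GRing.Theory Num.Theory.
Import numFieldNormedType.Exports.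
Import Normc.

Local Open Scope classical_set_scope.
Local Open Scope ring_scope.
Local Open Scope complex_scope.

(* MathComp-Analysis puts a topology and a norm on K^o for every numFieldType
   K, but on K itself only when K is an abstract variable. *)
HB.instance Definition _ (R : realType) := NormedModule.copy R[i] R[i]^o.

(* The norm of the numFieldType R[i] takes its values in R[i];
   normc is its real-valued version: `|z| = (normc z)%:C. *)
Section SupNorm.
Context {R : realType} {T : Type}.
Implicit Types (A : set T) (f g : T -> R[i]).

Definition bounded_on A f := exists M : R, forall x, A x -> normc (f x) <= M.

Definition sup_norm A f : R := sup [set normc (f x) | x in A].

Lemma normc_ge0 (z : R[i]) : 0 <= normc z.
Proof. by case: z => a b; rewrite sqrtr_ge0. Qed.

Lemma normcE_Re (z : R[i]) : `|z| = (normc z)%:C.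
Proof. by []. Qed.

Lemma sup_norm_ub A f x : bounded_on A f -> A x -> normc (f x) <= sup_norm A f.
Proof.
move=> [M fM] Ax; apply: ub_le_sup; last by exists x.
by exists M => _ [y Ay <-]; exact: fM.
Qed.

Lemma sup_norm_le A f (M : R) : A !=set0 ->
  (forall x, A x -> normc (f x) <= M) -> sup_norm A f <= M.
Proof.
move=> [x Ax] fM; apply: ge_sup; first by exists (normc (f x)), x.
by move=> _ [y Ay <-]; exact: fM.
Qed.

Lemma bounded_on0 A : bounded_on A (0 : T -> R[i]).
Proof. by exists 0 => x _; rewrite normc0. Qed.

Lemma bounded_onD A f g :
  bounded_on A f -> bounded_on A g -> bounded_on A (f + g).
Proof.
move=> [M fM] [N gN]; exists (M + N) => x Ax.
by apply: le_trans (le_normcD _ _) _; apply: lerD; [exact: fM|exact: gN].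
Qed.

Lemma bounded_onZ A (a : R[i]) f : bounded_on A f -> bounded_on A (a *: f).
Proof.
move=> [M fM]; exists (normc a * M) => x Ax.
by rewrite [(a *: f) x]/(a * f x) normcM ler_wpM2l ?normc_ge0 ?fM.
Qed.

Lemma sup_norm_triangle A f g : A !=set0 -> bounded_on A f -> bounded_on A g ->
  sup_norm A (f + g) <= sup_norm A f + sup_norm A g.
Proof.
move=> A0 bf bg; apply: sup_norm_le => // x Ax.
by apply: le_trans (le_normcD _ _) _; apply: lerD; exact: sup_norm_ub.
Qed.

Lemma sup_normZ A (a : R[i]) f : A !=set0 -> bounded_on A f ->
  sup_norm A (a *: f) = normc a * sup_norm A f.
Proof.
move=> A0 bf; apply/eqP; rewrite eq_le; apply/andP; split.
  apply: sup_norm_le => // x Ax.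
  by rewrite [(a *: f) x]/(a * f x) normcM ler_wpM2l ?normc_ge0 ?sup_norm_ub.
have [a0|a0] := eqVneq a 0.
  rewrite a0 normc0 mul0r; have [x Ax] := A0.
  by apply: le_trans (sup_norm_ub (bounded_onZ _ bf) Ax); exact: normc_ge0.
have na0 : 0 < normc a.
  by rewrite lt_neqAle normc_ge0 andbT eq_sym; apply: contra_neq a0 => /eq0_normc.
rewrite mulrC -ler_pdivlMr//; apply: sup_norm_le => // x Ax.
rewrite ler_pdivlMr// mulrC -normcM.
exact: (@sup_norm_ub A (a *: f) x (bounded_onZ _ bf) Ax).
Qed.

Lemma sup_norm_eq0 A f : bounded_on A f -> sup_norm A f = 0 ->
  forall x, A x -> f x = 0.
Proof.
move=> bf f0 x Ax; apply: eq0_normc; apply/eqP.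
by rewrite eq_le normc_ge0 andbT -f0 sup_norm_ub.
Qed.

End SupNorm.

Section Dual.
Context {R : realType} (X : normedModType R[i]).

Definition dual_pred : {pred X -> R[i]} :=
  mem [set phi : X -> R[i] | linear phi /\ continuous phi].

Record dual := Dual { dual_fun :> X -> R[i]; _ : dual_fun \in dual_pred }.

HB.instance Definition _ := [isSub for dual_fun].
HB.instance Definition _ := [Choice of dual by <:].

Lemma dual_submod_closed : submod_closed dual_pred.
Proof.
split=> [|a phi psi].
  rewrite inE; split=> [a x y|]; first by rewrite scaler0 addr0.
  exact: cst_continuous.
move=> /set_mem[lphi cphi] /set_mem[lpsi cpsi]; apply/mem_set.
split=> [b x y|x].
  rewrite -[LHS]/(a * phi (b *: x + y) + psi (b *: x + y)).
  rewrite -[RHS]/(b * (a * phi x + psi x) + (a * phi y + psi y)).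
  rewrite lphi lpsi -[b *: phi x]/(b * phi x) -[b *: psi x]/(b * psi x).
  by rewrite !mulrDr mulrCA -!addrA; congr (_ + _); rewrite addrCA.
apply: (@continuousD _ _ _ (a \*: phi) psi); last exact: cpsi.
by apply: continuousZl_tmp; exact: cphi.
Qed.

HB.instance Definition _ :=
  GRing.isSubmodClosed.Build _ _ dual_pred dual_submod_closed.
HB.instance Definition _ := [SubChoice_isSubLmodule of dual by <:].

Definition unit_ball : set X := [set x | `|x| <= 1].

Lemma unit_ball0 : unit_ball !=set0.
Proof. by exists 0; rewrite /unit_ball/= normr0. Qed.

Lemma dual_bounded (phi : dual) : bounded_on unit_ball phi.
Proof.
case: phi => phi /= /set_mem[lphi cphi].
pose L : {linear X -> R[i]} :=
  HB.pack phi (GRing.isLinear.Build R[i] X R[i] *:%R phi lphi).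
have /linear_boundedP : bounded_near L (nbhs (0 : X)).
  by apply/linear_bounded_continuous; exact: cphi.
move=> /pinfty_ex_gt0[r r0 Lr]; exists (complex.Re r) => x x1.
have: (normc (phi x))%:C <= r by rewrite -normcE_Re (le_trans (Lr x))// ler_piMr// ltW.
by rewrite lecE => /andP[].
Qed.

Definition dual_norm (phi : dual) : R[i] := (sup_norm unit_ball phi)%:C.

Lemma dual_normD (phi psi : dual) :
  dual_norm (phi + psi) <= dual_norm phi + dual_norm psi.
Proof.
rewrite /dual_norm -rmorphD lecR.
by apply: sup_norm_triangle; [exact: unit_ball0|exact: dual_bounded..].
Qed.

Lemma dual_normZ (a : R[i]) (phi : dual) :
  dual_norm (a *: phi) = `|a| * dual_norm phi.
Proof.
rewrite /dual_norm normcE_Re -rmorphM; congr (_%:C).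
by apply: sup_normZ; [exact: unit_ball0|exact: dual_bounded].
Qed.

Lemma dual_norm_eq0 (phi : dual) : dual_norm phi = 0 -> phi = 0.
Proof.
move=> /complexI/(sup_norm_eq0 (dual_bounded phi)) phi0.
have lphi : linear phi by case: (phi) => ? /= /set_mem[].
have Z a x : phi (a *: x) = a *: phi x.
  have e0 : phi 0 = 0 by apply: phi0; rewrite /unit_ball/= normr0.
  by rewrite -[a *: x]addr0 lphi e0 addr0.
apply: val_inj; apply/funext => x /=.
have [->|x0] := eqVneq x 0; first by rewrite phi0// /unit_ball/= normr0.
have nx0 : `|x| != 0 by rewrite normr_eq0.
rewrite -[x in LHS](scalerKV nx0) Z phi0 ?scaler0//.
by rewrite /unit_ball/= normrZ normfV normr_id mulVf.
Qed.

HB.instance Definition _ :=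
  Lmodule_isNormed.Build R[i] dual dual_normD dual_normZ dual_norm_eq0.

Definition annihilator (C : set X) : set dual :=
  [set phi | forall x, C x -> phi x = 0].

Definition M_ideal (C : set X) : Prop :=
  [/\ closed C, submod_closed (mem C) &
    exists P : {linear dual -> dual},
      [/\ continuous P,
          forall phi, P (P phi) = P phi,
          range P = annihilator C &
          forall phi, `|P phi| + `|phi - P phi| = `|phi| ]].

End Dual.
Arguments dual {R} X.

Section Hinf.
Context {R : realType}.

Definition disc : set R[i] := [set z | `|z| < 1].

Lemma disc0 : disc !=set0.
Proof. by exists 0; rewrite /disc/= normr0. Qed.

Definition analytic (f : R[i] -> R[i]) := forall z, disc z -> derivable f z 1.

(* A function on the disc is represented by its extension by 0, so that equality
   of elements of Hinf is equality on the disc. *)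
Definition off_disc0 (f : R[i] -> R[i]) := forall z, ~ disc z -> f z = 0.

Definition Hinf_pred : {pred R[i] -> R[i]} :=
  mem [set f | [/\ analytic f, off_disc0 f & bounded_on disc f]].

Record Hinf := MkHinf {
  Hinf_fun :> R[i] -> R[i]; _ : Hinf_fun \in Hinf_pred }.

HB.instance Definition _ := [isSub for Hinf_fun].
HB.instance Definition _ := [Choice of Hinf by <:].

Lemma Hinf_submod_closed : submod_closed Hinf_pred.
Proof.
split=> [|a f g].
  apply/mem_set; split=> [z _|//|]; [exact: derivable_cst|exact: bounded_on0].
move=> /set_mem[df f0 bf] /set_mem[dg g0 bg]; apply/mem_set; split.
- by move=> z Dz; apply: derivableD; [apply: derivableZ; exact: df|exact: dg].
- by move=> z Dz; rewrite -[LHS]/(a * f z + g z) f0// g0// mulr0 addr0.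
- by apply: bounded_onD => //; exact: bounded_onZ.
Qed.

HB.instance Definition _ :=
  GRing.isSubmodClosed.Build _ _ Hinf_pred Hinf_submod_closed.
HB.instance Definition _ := [SubChoice_isSubLmodule of Hinf by <:].

Lemma Hinf_bounded (f : Hinf) : bounded_on disc f.
Proof. by case: f => f /= /set_mem[]. Qed.

Definition Hinf_norm (f : Hinf) : R[i] := (sup_norm disc f)%:C.

Lemma Hinf_normD (f g : Hinf) : Hinf_norm (f + g) <= Hinf_norm f + Hinf_norm g.
Proof.
rewrite /Hinf_norm -rmorphD lecR.
by apply: sup_norm_triangle; [exact: disc0|exact: Hinf_bounded..].
Qed.

Lemma Hinf_normZ (a : R[i]) (f : Hinf) : Hinf_norm (a *: f) = `|a| * Hinf_norm f.
Proof.
rewrite /Hinf_norm normcE_Re -rmorphM; congr (_%:C).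
by apply: sup_normZ; [exact: disc0|exact: Hinf_bounded].
Qed.

Lemma Hinf_norm_eq0 (f : Hinf) : Hinf_norm f = 0 -> f = 0.
Proof.
move=> /complexI/(sup_norm_eq0 (Hinf_bounded f)) f0.
apply: val_inj; apply/funext => z /=.
have [Dz|Dz] := pselect (disc z); first exact: f0.
by case: (f) => ? /= /set_mem[_ h _]; exact: h.
Qed.

HB.instance Definition _ :=
  Lmodule_isNormed.Build R[i] Hinf Hinf_normD Hinf_normZ Hinf_norm_eq0.

End Hinf.
Arguments Hinf : clear implicits.

Section CircleMeasure.
Context {R : realType}.

Definition circle : set R[i] := [set z | `|z| = 1].

Definition expi (t : R) : R[i] := cos t +i* sin t.

Definition borelC := g_sigma_algebraType (@open R[i]).

Lemma continuous_expi : continuous expi.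
Proof.
move=> t; apply/cvgrPdist_lt => e e0.
have Re0 : 0 < complex.Re e by move: e0; rewrite ltcE => /andP[].
have eE : e = (complex.Re e)%:C.
  by move: e0; rewrite ltcE => /andP[/eqP]; case: (e) => a b /= -> _.
have e20 : 0 < complex.Re e / 2 by rewrite divr_gt0.
have /cvgrPdist_lt/(_ _ e20) hc := @continuous_cos R t.
have /cvgrPdist_lt/(_ _ e20) hs := @continuous_sin R t.
near=> s; rewrite eE normcE_Re ltcR.
have -> : expi t - expi s =
    (cos t - cos s)%:C + (0 +i* (sin t - sin s)) :> R[i].
  by rewrite /expi; simpc.
apply: le_lt_trans (le_normcD _ _) _; rewrite /= expr0n addr0 add0r !sqrtr_sqr.
by rewrite (splitr (complex.Re e)) ltrD//; near: s.
Unshelve. all: by end_near. Qed.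

Lemma measurable_expi :
  measurable_fun setT (expi : measurableTypeR R -> borelC).
Proof.
apply: (@measurability _ _ (measurableTypeR R) borelC setT expi (@open R[i])) => //.
move=> _ [U oU <-]; rewrite setTI; apply: open_measurable.
by apply: open_comp => // t _; exact: continuous_expi.
Qed.

Lemma inv2pi_ge0 : 0 <= (2 * pi)^-1 :> R.
Proof. by rewrite invr_ge0 mulr_ge0// pi_ge0. Qed.

(* normalized arc length of the unit circle, as a Borel measure on R[i] *)
Definition circle_measure : set borelC -> \bar R :=
  pushforward (mscale (NngNum inv2pi_ge0)
    (mrestr (@lebesgue_measure R) (measurable_itv `[0, 2 * pi[)))
    (expi : measurableTypeR R -> borelC).

Let circle_measure_ge0 A : (0 <= circle_measure A)%E.
Proof. by rewrite /circle_measure /pushforward measure_ge0. Qed.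

Let circle_measure0 : circle_measure set0 = 0%E.
Proof. by rewrite /circle_measure /pushforward preimage_set0 measure0. Qed.

Let circle_measure_sigma_additive : semi_sigma_additive circle_measure.
Proof.
by apply: measure_semi_sigma_additive; exact: measurable_expi.
Qed.

HB.instance Definition _ := isMeasure.Build _ _ _ circle_measure
  circle_measure0 circle_measure_ge0 circle_measure_sigma_additive.

End CircleMeasure.

Section Hardy.
Context {R : realType}.
Implicit Types (f : Hinf R) (h : R[i] -> R[i]).

(* lim returns a default value where the radial limit does not exist; for a
   bounded analytic function this happens only on a null set. *)
Definition radial_limit h (z : R[i]) : R[i] :=
  lim (h (r%:C * z) @[r --> (1 : R)^'-]).

Definition H2_norm h : \bar R :=
  ereal_sup [set Lnorm circle_measure 2%:E
                   (fun z : borelC => (normc (h (r%:C * z)))%:E)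
            | r in [set r : R | 0 <= r < 1]].

Definition H2 : set (R[i] -> R[i]) :=
  [set h | [/\ analytic h, off_disc0 h & (H2_norm h < +oo)%E]].

Definition H2_closure (A : set (R[i] -> R[i])) : set (R[i] -> R[i]) :=
  [set g | H2 g /\
    forall e : R, 0 < e -> exists2 h, A h & (H2_norm (g - h)%R < e%:E)%E].

Definition lin_span (A : set (R[i] -> R[i])) : set (R[i] -> R[i]) :=
  [set h | exists n (c : 'I_n -> R[i]) (u : 'I_n -> R[i] -> R[i]),
    (forall i, A (u i)) /\ h = \sum_(i < n) c i *: u i].

Definition outer f : Prop :=
  H2_closure (lin_span [set (fun z => z ^+ m * f z) | m in [set: nat]]) = H2.

Definition inner f : Prop :=
  \forall z \ae @circle_measure R, circle z -> normc (radial_limit f z) = 1.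

(* For outer f only; the open neighbourhoods of z in the circle are the traces
   U `&` circle of the open neighbourhoods U of z in R[i]. *)
Definition essential_zeros f : set R[i] :=
  [set z | circle z /\
    forall (e : R) (U : set R[i]), 0 < e -> open U -> U z ->
      circle_measure ([set w | 0 < normc (radial_limit f w) < e]
        `&` (U `&` circle)) != 0%E].

(* fO is unique up to a unimodular constant, on which essential_zeros fO does
   not depend. *)
Definition ZT f : set R[i] :=
  [set z | exists fI fO : Hinf R,
    [/\ inner fI, outer fO, (forall w, f w = fI w * fO w) &
        essential_zeros fO z]].

Definition Zinf : set (Hinf R) :=
  [set f | f != 0 /\
    exists F : R[i] -> R[i], {within disc `|` ZT f, continuous F} /\
      (forall z, disc z -> F z = f z)].

Definition Hinf_ideal f : set (Hinf R) :=
  closure [set h : Hinf R | exists g : Hinf R, forall z, h z = f z * g z].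

End Hardy.

(* Main.v *)
(* If the ideal C of f is an M-ideal, the constant 1, any y in C with |y| <= 1 and
   d > 0 admit e in C with |1 + y - e|, |1 - y - e| <= 1 + d (Hahn-Banach on X * X),
   so that |1 - e|^2 + |y|^2 <= (1 + d)^2 by the parallelogram law.  High iterated
   square roots of e, corrected by a constant, give E in C with |E| <= 1 + tau and
   E(z0) close to 1 at one point z0 where f does not vanish.  Then 1 - E is small in
   L^2 for the Poisson measure of z0, hence in H^2: 1 is in the H^2-closure of
   f H^oo, so f is outer.

   Conversely an outer f equals c exp(- Herg V), where Herg V is the Herglotz
   integral of V = - log |f / c| >= 0 on the circle: Szego's inequality (Jensen for
   |p exp(- Herg)|^2) turns 1 in the closure of f H^oo into convergence of the mean
   of - log |f(r .)|, and Scheffe's lemma gives L^1-convergence.  Put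
   A_K = Herg (V - K)^+.  Essential zeros of f are zeros of its continuous
   extension; by compactness of the circle, A_K tends to 0 uniformly on
   {|f| >= eta}.  Hence E = (1 + A_K)^(-2^-k) lies in C, |E| + |1 - E| is
   uniformly at most 1 + O(2^-k), and (1 - E) f is small.  For a sequence E_n of
   such functions, (P phi) x = lim phi ((1 - E_n) x) along an ultrafilter defines
   the M-projection onto the annihilator of C. *)

From HB Require Import structures.
Require Import Defs.
From mathcomp Require Import all_boot all_order all_algebra.
From mathcomp Require Import all_classical all_reals all_analysis.
From mathcomp Require Import measurable_realfun complex ring lra.

Set Implicit Arguments.
Unset Strict Implicit.
Unset Printing Implicit Defensive.

Import Order.TTheory GRing.Theory Num.Theory.
Import numFieldNormedType.Exports.
Import Normc.

Local Open Scope classical_set_scope.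
Local Open Scope ring_scope.
Local Open Scope complex_scope.

(** * Complex derivatives and the exponential *)

Section ComplexBasics.
Context {R : realType}.
Implicit Types (x y z w : R[i]) (f g : R[i] -> R[i]).

(** Both directions rest on roots. In the direct one the two-ball property gives only
    [|1 - e| <= 1 + d], and a bound below 1 at [z0]; high roots of [e + eta] bring the supremum down
    to nearly 1 and the value at [z0] close to 1 at once. Then [|1 - E|^2 = 1 - 2 Re E + |E|^2]
    turns the single value [E z0], a Poisson mean, into smallness in mean square. Conversely,
    additivity of the norm needs the values of [E] in a thin lens around [0, 1]: a square root at
    least halves the slope [|Im| / Re] of a point of the right half-plane, whereas a bounded
    approximate unit alone gives only a bounded projection. Outerness excludes a singular part of
    the measure: only an integrable density [V] has truncations whose mean tends to 0. The
    continuous extension makes [f] small near each essential zero, so that on [|f| >= eta] the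
    kernel in [A_K] stays away from its pole. Boundary values come from a primitive, which is
    Lipschitz up to the circle, so that Lebesgue's differentiation theorem applies to its boundary
    function. *)

Lemma normcB x y : normc (x - y) = normc (y - x).
Proof. by rewrite -normcN opprB. Qed.

Lemma normc_le_ReIm z : normc z <= `|complex.Re z| + `|complex.Im z|.
Proof.
rewrite [z in X in X <= _]complexE.
apply: le_trans (le_normcD _ _) _.
by rewrite normcM /= !expr0n /= !add0r !addr0 expr1n sqrtr1 mul1r !sqrtr_sqr.
Qed.

Lemma Re_le_normc z : `|complex.Re z| <= normc z.
Proof. by have := normc_ge_Re z; rewrite normcE_Re lecR. Qed.

Lemma Im_le_normc z : `|complex.Im z| <= normc z.
Proof. by case: z => a b /=; rewrite -sqrtr_sqr ler_wsqrtr // lerDr sqr_ge0. Qed.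

Lemma normcR (a : R) : normc a%:C = `|a|.
Proof. by rewrite /= expr0n addr0 sqrtr_sqr. Qed.

Lemma normcX z n : normc (z ^+ n) = normc z ^+ n.
Proof. by elim: n => [|n IH]; rewrite ?expr0 ?normc1// !exprS normcM IH. Qed.

Lemma normc_distB x y : normc x - normc y <= normc (x - y).
Proof. by rewrite lerBlDr; have := le_normcD (x - y) y; rewrite subrK. Qed.

(** The norm of [R[i]] has values in [R[i]], so the library's epsilons are complex; the order makes
    a positive one real, and from here on every estimate uses [normc] and a real epsilon. *)
Lemma cvgCP {T : Type} {F : set_system T} {FF : Filter F} (u : T -> R[i]) l :
  u @ F --> l <-> forall e : R, 0 < e -> \forall t \near F, normc (u t - l) < e.
Proof.
split=> [/cvgrPdist_lt h e e0|h].
  have := h e%:C; rewrite ltcR => /(_ e0); apply: filterS => t.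
  by rewrite normcE_Re ltcR normcB.
apply/cvgrPdist_lt => e e0.
have Re0 : 0 < complex.Re e by move: e0; rewrite ltcE => /andP[].
have eE : e = (complex.Re e)%:C.
  by move: e0; rewrite ltcE => /andP[/eqP]; case: (e) => a b /= -> _.
have := h _ Re0; apply: filterS => t.
by rewrite eE normcE_Re ltcR normcB.
Qed.

Lemma cvg_normc0 {T : Type} {F : set_system T} {FF : Filter F} (u : T -> R[i]) l :
  u @ F --> l <-> (fun t => normc (u t - l)) @ F --> (0 : R).
Proof.
split.
  move/cvgCP => h; apply/cvgr0Pnorm_lt => e e0; have := h e e0.
  by apply: filterS => t; rewrite ger0_norm ?normc_ge0.
move/cvgr0Pnorm_lt => h; apply/cvgCP => e e0; have := h e e0.
by apply: filterS => t; rewrite ger0_norm ?normc_ge0.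
Qed.

Lemma cvg_Re {T : Type} {F : set_system T} {FF : Filter F} (u : T -> R[i]) l :
  u @ F --> l -> (fun t => complex.Re (u t)) @ F --> complex.Re l.
Proof.
move/cvgCP => h; apply/cvgrPdist_lt => e e0; have := h e e0.
apply: filterS => t; rewrite normcB; apply: le_lt_trans.
by apply: le_trans (Re_le_normc _); rewrite raddfB.
Qed.

Lemma cvg_Im {T : Type} {F : set_system T} {FF : Filter F} (u : T -> R[i]) l :
  u @ F --> l -> (fun t => complex.Im (u t)) @ F --> complex.Im l.
Proof.
move/cvgCP => h; apply/cvgrPdist_lt => e e0; have := h e e0.
apply: filterS => t; rewrite normcB; apply: le_lt_trans.
by apply: le_trans (Im_le_normc _); rewrite raddfB.
Qed.

Lemma cvg_ReIm {T : Type} {F : set_system T} {FF : Filter F} (u : T -> R[i]) l :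
  (fun t => complex.Re (u t)) @ F --> complex.Re l ->
  (fun t => complex.Im (u t)) @ F --> complex.Im l -> u @ F --> l.
Proof.
move=> h1 h2; apply/cvg_normc0.
apply: (@squeeze_cvgr _ _ _ _ (cst 0)
  (fun t => `|complex.Re (u t - l)| + `|complex.Im (u t - l)|)).
- by apply: nearW => t; rewrite normc_ge0 normc_le_ReIm.
- exact: cvg_cst.
- rewrite -[X in _ --> X](addr0 0); apply: cvgD.
    apply/norm_cvg0P; under eq_fun do rewrite raddfB.
    by rewrite -(subrr (complex.Re l)); apply: cvgB => //; exact: cvg_cst.
  apply/norm_cvg0P; under eq_fun do rewrite raddfB.
  by rewrite -(subrr (complex.Im l)); apply: cvgB => //; exact: cvg_cst.
Qed.

Lemma cvg_normc {T : Type} {F : set_system T} {FF : Filter F} (u : T -> R[i]) l :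
  u @ F --> l -> (fun t => normc (u t)) @ F --> normc l.
Proof.
move/cvgCP => h; apply/cvgrPdist_lt => e e0; have := h e e0.
apply: filterS => t; apply: le_lt_trans.
have := normc_distB l (u t); have := normc_distB (u t) l.
by rewrite (normcB l) ler_norml; lra.
Qed.

Lemma cvgCM {T : Type} {F : set_system T} {FF : Filter F} (u v : T -> R[i]) (a b : R[i]) :
  u @ F --> a -> v @ F --> b -> (fun t => u t * v t) @ F --> a * b.
Proof. exact: cvgM. Qed.

Lemma cvgCV {T : Type} {F : set_system T} {FF : Filter F} (u : T -> R[i]) (a : R[i]) :
  a != 0 -> u @ F --> a -> (fun t => (u t)^-1) @ F --> a^-1.
Proof. exact: cvgV. Qed.

Lemma cvg_toC {T : Type} {F : set_system T} {FF : Filter F} (u : T -> R) (a : R) :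
  u @ F --> a -> (fun t => (u t)%:C) @ F --> a%:C.
Proof. by move=> h; apply: cvg_ReIm => //=; exact: cvg_cst. Qed.

(** Differentiability as a first-order expansion, without division: the chain rule then has no
    exceptional case where the inner function repeats its value. *)
Definition cder f z d := forall e : R, 0 < e -> exists2 r : R, 0 < r &
  forall w, normc (w - z) < r ->
    normc (f w - f z - d * (w - z)) <= e * normc (w - z).

Lemma derivable_cder f z : derivable f z 1 -> exists d, cder f z d.
Proof.
move=> /cvg_ex[d /cvgCP dP]; exists d => e e0.
have := dP e e0; rewrite near_withinE => /nbhs_ballP[r r0 rP].
have Re0 : 0 < complex.Re r by move: r0; rewrite /= ltcE => /andP[].
have rE : r = (complex.Re r)%:C.
  by move: r0; rewrite /= ltcE => /andP[/eqP]; case: (r) => a b /= -> _.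
exists (complex.Re r) => // w wz.
have [->|nwz] := eqVneq w z; first by rewrite !subrr mulr0 subrr normc0 mulr0.
have h0 : w - z != 0 by rewrite subr_eq0.
have := rP (w - z); rewrite /ball /= sub0r normrN {1}rE normcE_Re ltcR.
move=> /(_ wz h0); rewrite -[((w - z) *: 1)]/((w - z) * 1) mulr1 subrK.
rewrite -[_ *: _]/((w - z)^-1 * (f w - f z)) => h.
have -> : f w - f z - d * (w - z) = ((w - z)^-1 * (f w - f z) - d) * (w - z).
  by field.
by rewrite normcM ler_wpM2r ?normc_ge0 ?ltW.
Qed.

Lemma cder_derivable f z d : cder f z d -> derivable f z 1.
Proof.
move=> h; apply/cvg_ex; exists d; apply/cvgCP => e e0.
have e20 : 0 < e / 2 by rewrite divr_gt0.
have [r r0 rP] := h _ e20.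
rewrite near_withinE; apply/nbhs_ballP; exists r%:C => /=; first by rewrite ltcR.
move=> k; rewrite /ball /= sub0r normrN normcE_Re ltcR => kr k0.
have nk0 : 0 < normc k.
  by rewrite lt_neqAle normc_ge0 andbT eq_sym; apply: contra_neq k0 => /eq0_normc.
have := rP (k + z); rewrite addrK => /(_ kr).
rewrite -[(k *: 1)]/(k * 1) mulr1.
rewrite -[_ *: _]/(k^-1 * (f (k + z) - f z)).
have -> : k^-1 * (f (k + z) - f z) - d = (f (k + z) - f z - d * k) / k by field.
rewrite normcM normcV => hk.
by rewrite ltr_pdivrMr//; apply: le_lt_trans hk _; rewrite ltr_pM2r//; lra.
Qed.

Lemma cder_cont f z d : cder f z d -> f @ z --> f z.
Proof.
move=> h; apply/(@cvgCP _ (nbhs z) _) => e e0.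
have [r r0 rP] := h 1 ltr01.
set K := 1 + normc d; have K0 : 0 < K by rewrite /K; have := normc_ge0 d; lra.
have eK : 0 < e / K by rewrite divr_gt0.
apply/nbhs_ballP; exists (Num.min r (e / K))%:C => /=.
  by rewrite ltcR lt_min r0 eK.
move=> w; rewrite /ball /= normcE_Re ltcR lt_min => /andP[].
rewrite normcB => wr we; have := rP _ wr; rewrite mul1r => h1.
have -> : f w - f z = (f w - f z - d * (w - z)) + d * (w - z) by ring.
apply: le_lt_trans (le_normcD _ _) _.
rewrite normcM; apply: (@le_lt_trans _ _ (K * normc (w - z))).
  by rewrite /K mulrDl mul1r lerD2r.
by rewrite mulrC -ltr_pdivlMr.
Qed.

Lemma cvg_cnear (P : R[i] -> Prop) z : (\forall w \near z, P w) <->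
  exists2 r : R, 0 < r & forall w, normc (w - z) < r -> P w.
Proof.
split.
  move=> /nbhs_ballP[r /= r0 rP].
  have Re0 : 0 < complex.Re r by move: r0; rewrite /= ltcE => /andP[].
  have rE : r = (complex.Re r)%:C.
    by move: r0; rewrite /= ltcE => /andP[/eqP]; case: (r) => a b /= -> _.
  exists (complex.Re r) => // w wz; apply: rP.
  by rewrite /ball /= rE normcE_Re ltcR normcB.
move=> [r r0 rP]; apply/nbhs_ballP; exists r%:C; first by rewrite /= ltcR.
by move=> w; rewrite /ball /= normcE_Re ltcR normcB => /rP.
Qed.

Lemma cder_near f g z d : (\forall w \near z, f w = g w) -> cder f z d -> cder g z d.
Proof.
move=> /cvg_cnear[s s0 fg] h e /h[r r0 rP]; exists (Num.min r s).
  by rewrite lt_min r0.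
move=> w; rewrite lt_min => /andP[wr ws]; rewrite -!fg ?rP//.
by rewrite subrr normc0.
Qed.

Lemma cder_cst c z : cder (fun=> c) z 0.
Proof.
move=> e e0; exists 1 => // w _.
by rewrite subrr mul0r subr0 normc0 mulr_ge0 ?normc_ge0// ltW.
Qed.

Lemma cder_id z : cder (fun w => w) z 1.
Proof.
move=> e e0; exists 1 => // w _.
by rewrite mul1r subrr normc0 mulr_ge0 ?normc_ge0// ltW.
Qed.

Lemma cder_eq f z d d' : cder f z d -> d = d' -> cder f z d'.
Proof. by move=> h <-. Qed.

Lemma cderD f g z a b : cder f z a -> cder g z b ->
  cder (fun w => f w + g w) z (a + b).
Proof.
move=> hf hg e e0; have e20 : 0 < e / 2 by rewrite divr_gt0.
have [r r0 rP] := hf _ e20; have [s s0 sP] := hg _ e20.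
exists (Num.min r s); first by rewrite lt_min r0.
move=> w; rewrite lt_min => /andP[/rP wr /sP ws].
rewrite [X in normc X](_ : _ = (f w - f z - a * (w - z)) + (g w - g z - b * (w - z))).
  by apply: le_trans (le_normcD _ _) _; lra.
by ring.
Qed.

Lemma cderM f g z a b : cder f z a -> cder g z b ->
  cder (fun w => f w * g w) z (a * g z + f z * b).
Proof.
move=> hf hg e e0.
have [s1 s10 cg] : exists2 s1 : R, 0 < s1 &
    forall w, normc (w - z) < s1 -> normc (g w) <= normc (g z) + 1.
  have /cvgCP/(_ 1 ltr01)/cvg_cnear[s s0 sP] := cder_cont hg.
  exists s => // w /sP; have := le_normcD (g w - g z) (g z); rewrite subrK; lra.
have [s2 s20 ch] : exists2 s2 : R, 0 < s2 &
    forall w, normc (w - z) < s2 -> normc (a * (g w - g z)) <= e / 4.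
  have e1 : 0 < e / 4 / (normc a + 1).
    by rewrite !divr_gt0//; have := normc_ge0 a; lra.
  have /cvgCP/(_ _ e1)/cvg_cnear[s s0 sP] := cder_cont hg.
  exists s => // w /sP /ltW h; rewrite normcM.
  apply: (@le_trans _ _ ((normc a + 1) * normc (g w - g z))).
    by rewrite ler_wpM2r ?normc_ge0//; lra.
  by rewrite mulrC -ler_pdivlMr//; have := normc_ge0 a; lra.
set K := normc (g z) + 1; have K0 : 0 < K by rewrite /K; have := normc_ge0 (g z); lra.
set L := normc (f z) + 1; have L0 : 0 < L by rewrite /L; have := normc_ge0 (f z); lra.
have eK : 0 < e / 4 / K by rewrite !divr_gt0.
have eL : 0 < e / 4 / L by rewrite !divr_gt0.
have [r r0 rP] := hf _ eK; have [s s0 sP] := hg _ eL.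
exists (Num.min (Num.min r s) (Num.min s1 s2)); first by rewrite !lt_min r0 s0 s10.
move=> w; rewrite !lt_min => /andP[/andP[/rP wr /sP ws] /andP[/cg w1 /ch w2]].
rewrite [X in normc X](_ : _ = (f w - f z - a * (w - z)) * g w +
  (f z * (g w - g z - b * (w - z)) + (a * (g w - g z)) * (w - z))); last by ring.
apply: le_trans (le_normcD _ _) _.
have h1 : normc ((f w - f z - a * (w - z)) * g w) <= e / 4 * normc (w - z).
  rewrite normcM; apply: (@le_trans _ _ (e / 4 / K * normc (w - z) * K)).
    by apply: ler_pM; rewrite ?normc_ge0.
  by rewrite mulrAC divfK// gt_eqF.
have h2 : normc (f z * (g w - g z - b * (w - z))) <= e / 4 * normc (w - z).
  rewrite normcM; apply: (@le_trans _ _ (L * (e / 4 / L * normc (w - z)))).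
    by apply: ler_pM; rewrite ?normc_ge0// /L; lra.
  by rewrite mulrA mulrCA divff ?mulr1 ?gt_eqF.
have h3 : normc (a * (g w - g z) * (w - z)) <= e / 4 * normc (w - z).
  by rewrite normcM ler_wpM2r ?normc_ge0.
have := le_normcD (f z * (g w - g z - b * (w - z))) (a * (g w - g z) * (w - z)).
have : 0 <= e * normc (w - z) by rewrite mulr_ge0 ?normc_ge0 ?ltW.
lra.
Qed.

Lemma cderZ f z c a : cder f z a -> cder (fun w => c * f w) z (c * a).
Proof.
by move=> h; apply: (cder_eq (cderM (cder_cst c z) h)); rewrite mul0r add0r.
Qed.

Lemma cder_comp f g z a b : cder g z a -> cder f (g z) b ->
  cder (fun w => f (g w)) z (b * a).
Proof.
move=> hg hf e e0.
have B0 := normc_ge0 b; have A0 := normc_ge0 a.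
set K := normc a + 1; have K0 : 0 < K by rewrite /K; lra.
set L := normc b + 1; have L0 : 0 < L by rewrite /L; lra.
have eK : 0 < e / 2 / K by rewrite !divr_gt0.
have eL : 0 < e / 2 / L by rewrite !divr_gt0.
have [r r0 rP] := hf _ eK; have [s s0 sP] := hg _ eL.
have [t t0 tP] := hg _ ltr01.
have /cvgCP/(_ _ r0)/cvg_cnear[u u0 uP] := cder_cont hg.
exists (Num.min (Num.min s t) u); first by rewrite !lt_min s0 t0.
move=> w; rewrite !lt_min => /andP[/andP[/sP ws /tP wt] /uP/rP wr].
have hK : normc (g w - g z) <= K * normc (w - z).
  have := le_normcD (g w - g z - a * (w - z)) (a * (w - z)).
  by rewrite subrK normcM /K; lra.
rewrite [X in normc X](_ : _ = (f (g w) - f (g z) - b * (g w - g z)) +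
  b * (g w - g z - a * (w - z))); last by ring.
apply: le_trans (le_normcD _ _) _; rewrite normcM.
have h1 : e / 2 / K * normc (g w - g z) <= e / 2 * normc (w - z).
  apply: (@le_trans _ _ (e / 2 / K * (K * normc (w - z)))).
    by rewrite ler_wpM2l// ltW.
  by rewrite mulrA divfK// gt_eqF.
have h2 : normc b * normc (g w - g z - a * (w - z)) <= e / 2 * normc (w - z).
  apply: (@le_trans _ _ (L * (e / 2 / L * normc (w - z)))).
    by apply: ler_pM; rewrite ?normc_ge0// /L; lra.
  by rewrite mulrA mulrCA divff ?mulr1 ?gt_eqF.
lra.
Qed.

Lemma cder_inv z : z != 0 -> cder (fun w => w^-1) z (- z ^- 2).
Proof.
move=> z0 e e0.
have nz0 : 0 < normc z.
  by rewrite lt_neqAle normc_ge0 andbT eq_sym; apply: contra_neq z0 => /eq0_normc.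
set N := normc z; have N0 : 0 < N by [].
(* The first radius keeps [|w| >= N / 2]; the second bounds the remainder [(w - z)^2 / (w z^2)] by
   [e |w - z|]. *)
exists (Num.min (N / 2) (e * N ^+ 3 / 2)).
  by rewrite lt_min !divr_gt0// mulr_gt0// exprn_gt0.
move=> w; rewrite lt_min => /andP[w1 w2].
have wN : N / 2 <= normc w.
  by have := normc_distB z w; rewrite normcB -/N; lra.
have w0 : w != 0.
  by apply/eqP => w0; move: wN; rewrite w0 normc0; lra.
rewrite [X in normc X](_ : _ = (w - z) ^+ 2 / (w * z ^+ 2)); last first.
  by field; rewrite w0 z0.
rewrite normcM normcV [normc (w * _)]normcM !normcX -/N.
have wN0 : 0 < normc w * N ^+ 2 by rewrite mulr_gt0 ?exprn_gt0//; lra.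
rewrite ler_pdivrMr// expr2 mulrAC; apply: ler_wpM2r; first exact: normc_ge0.
apply: (le_trans (ltW w2)).
rewrite -!mulrA ler_pM2l// exprS.
have : N ^+ 2 * (N / 2) <= N ^+ 2 * normc w by rewrite ler_pM2l// exprn_gt0.
rewrite /=; lra.
Qed.

Lemma cderV f z a : f z != 0 -> cder f z a ->
  cder (fun w => (f w)^-1) z (- (f z) ^- 2 * a).
Proof. by move=> fz0 h; apply: (cder_comp h); exact: cder_inv. Qed.

Lemma cder_uniq f z a b : cder f z a -> cder f z b -> a = b.
Proof.
move=> ha hb; apply/eqP; rewrite -subr_eq0; apply/eqP/eq0_normc/eqP.
rewrite eq_le normc_ge0 andbT; apply/ler_addgt0Pr => e e0; rewrite add0r.
have e20 : 0 < e / 2 by rewrite divr_gt0.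
have [r r0 rP] := ha _ e20; have [s s0 sP] := hb _ e20.
set t := Num.min r s / 2.
have t0 : 0 < t by rewrite divr_gt0// lt_min r0.
have tm : t < Num.min r s by rewrite /t; rewrite ltr_pdivrMr// ltr_pMr// ?ltr1n// lt_min r0.
move: tm; rewrite lt_min => /andP[tr ts].
have nt : normc (z + t%:C - z) = t by rewrite addrC addKr normcR gtr0_norm.
have := rP (z + t%:C); have := sP (z + t%:C); rewrite nt => /(_ ts) h1 /(_ tr) h2.
rewrite -(ler_pM2r t0).
have -> : normc (a - b) * t = normc ((f (z + t%:C) - f z - b * (z + t%:C - z)) -
   (f (z + t%:C) - f z - a * (z + t%:C - z))).
  rewrite -[X in _ * X]nt -normcM; congr normc; ring.
apply: le_trans (le_normcD _ _) _; rewrite normcN; lra.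
Qed.

End ComplexBasics.

Section RealSmallO.
Context {R : realType}.

Lemma is_derive_small_o (f : R -> R) (x d : R) : is_derive x 1 f d ->
  forall e, 0 < e -> exists2 r : R, 0 < r &
    forall h, `|h| < r -> `|f (x + h) - f x - d * h| <= e * `|h|.
Proof.
move=> [/cvg_ex[l lP]] dE e e0; have ld : l = d by rewrite -dE; apply/esym/cvg_lim.
move: lP; rewrite ld => /cvgrPdist_le/(_ e e0).
rewrite near_withinE => /nbhs_ballP[r /= r0 rP]; exists r => // h hr.
have [->|h0] := eqVneq h 0; first by rewrite addr0 subrr mulr0 subrr normr0 mulr0.
have := rP h; rewrite /ball /= sub0r normrN => /(_ hr h0).
rewrite -[h *: 1]/(h * 1) mulr1 [h + x]addrC -[_ *: _]/(h^-1 * (f (x + h) - f x)) => H.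
have -> : f (x + h) - f x - d * h = - (d - h^-1 * (f (x + h) - f x)) * h by field.
by rewrite normrM normrN ler_wpM2r.
Qed.

End RealSmallO.

Section ComplexExp.
Context {R : realType}.
Implicit Types (z w : R[i]) (s t : R).

Definition cexp z : R[i] := (expR (complex.Re z))%:C * expi (complex.Im z).

Lemma expiD s t : expi (s + t) = expi s * expi t.
Proof. by rewrite /expi cosD sinD; simpc; congr (_ +i* _); rewrite addrC. Qed.

Lemma expi0 : expi 0 = 1 :> R[i].
Proof. by rewrite /expi cos0 sin0. Qed.

Lemma normc_expi t : normc (expi t) = 1.
Proof. by rewrite /= cos2Dsin2 sqrtr1. Qed.

Lemma expi_neq0 t : expi t != 0.
Proof.
apply/eqP => /(congr1 (fun z => normc z)); rewrite normc_expi normc0 => /eqP.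
by rewrite oner_eq0.
Qed.

Lemma expi2pi t : expi (t + 2 * pi) = expi t.
Proof.
have -> : 2 * pi = pi *+ 2 :> R by rewrite mulr_natl.
by rewrite /expi cosD2pi sinD2pi.
Qed.

Lemma conj_expi t : conjc (expi t) = expi (- t).
Proof. by rewrite /expi cosN sinN. Qed.

Lemma expiN t : expi (- t) = (expi t)^-1.
Proof. by apply: (mulfI (expi_neq0 t)); rewrite -expiD subrr expi0 divff// expi_neq0. Qed.

Lemma expiX t n : expi t ^+ n = expi (n%:R * t).
Proof.
elim: n => [|n IH]; first by rewrite expr0 mul0r expi0.
by rewrite exprS IH -expiD -[n.+1]add1n natrD mulrDl mul1r.
Qed.

Lemma cexpD z w : cexp (z + w) = cexp z * cexp w.
Proof.
by rewrite /cexp !raddfD/= expRD expiD rmorphM/= mulrACA.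
Qed.

Lemma cexp0 : cexp 0 = 1.
Proof. by rewrite /cexp /= expR0 expi0 mulr1. Qed.

Lemma normc_cexp z : normc (cexp z) = expR (complex.Re z).
Proof. by rewrite /cexp normcM normc_expi mulr1 normcR gtr0_norm ?expR_gt0. Qed.

Lemma cexp_neq0 z : cexp z != 0.
Proof.
apply/eqP => /(congr1 (fun z => normc z)); rewrite normc_cexp normc0 => /eqP.
by rewrite gt_eqF// expR_gt0.
Qed.

Lemma normc_expi_sub1 t e : 0 < e -> `|cos t - 1| <= e * `|t| ->
  `|sin t - t| <= e * `|t| -> normc (expi t - 1 - t *i) <= 2 * e * `|t|.
Proof.
move=> e0 hc hs; apply: le_trans (normc_le_ReIm _) _.
have -> : complex.Re (expi t - 1 - t *i) = cos t - 1 by rewrite /expi /= subr0.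
have -> : complex.Im (expi t - 1 - t *i) = sin t - t by rewrite /expi /= subr0.
lra.
Qed.

Lemma cder_cexp0 : cder cexp 0 (1 : R[i]).
Proof.
move=> e e0; set e1 := Num.min (e / 12) 1.
have e10 : 0 < e1 by rewrite lt_min divr_gt0 ?ltr01.
have [r1 r10 h1] := is_derive_small_o (is_derive_expR (0 : R)) e10.
have [r2 r20 h2] := is_derive_small_o (is_derive_cos (0 : R)) e10.
have [r3 r30 h3] := is_derive_small_o (is_derive_sin (0 : R)) e10.
exists (Num.min (Num.min r1 r2) (Num.min r3 (e / 12))).
  by rewrite !lt_min r10 r20 r30 divr_gt0.
move=> w; rewrite subr0 cexp0 mul1r !lt_min => /andP[/andP[w1 w2] /andP[w3 w4]].
set a := complex.Re w; set b := complex.Im w.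
have ha : `|a| <= normc w := Re_le_normc w.
have hb : `|b| <= normc w := Im_le_normc w.
have := h1 a (le_lt_trans ha w1); rewrite add0r expR0 mul1r => k1.
have := h2 b (le_lt_trans hb w2).
rewrite add0r cos0 sin0 oppr0 mul0r subr0 => k2.
have := h3 b (le_lt_trans hb w3).
rewrite add0r sin0 cos0 subr0 mul1r => k3.
have k4 := normc_expi_sub1 e10 k2 k3.
have e11 : e1 <= 1 by rewrite ge_min lexx orbT.
have e12 : e1 <= e / 12 by rewrite ge_min lexx.
have ea : `|expR a - 1| <= 2 * `|a|.
  have := ler_normD (expR a - 1 - a) a; rewrite subrK => /le_trans; apply.
  apply: (@le_trans _ _ (e1 * `|a| + `|a|)); first by rewrite lerD2r.
  by have := ler_wpM2r (normr_ge0 a) e11; lra.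
have eb : normc (expi b - 1) <= 3 * `|b|.
  have := le_normcD (expi b - 1 - b *i) (b *i); rewrite subrK => /le_trans; apply.
  have -> : normc (b *i) = `|b| by rewrite /= expr0n add0r sqrtr_sqr.
  have := ler_wpM2r (normr_ge0 b) e11; lra.
(* The last, mixed term is quadratic: at most [6 |w|^2], hence the requirement [|w| < e / 12]. The
   other two terms together take [3 e / 12]. *)
have -> : cexp w - 1 - w = (expR a - 1 - a)%:C + (expi b - 1 - b *i) +
    (expR a - 1)%:C * (expi b - 1).
  rewrite {2}(complexE w) -/a -/b /cexp -/a -/b.
  have -> : 'i * b%:C = b *i by simpc.
  rewrite !rmorphB /= !rmorph1; ring.
apply: le_trans (le_normcD _ _) _.
have t1 := le_normcD (expR a - 1 - a)%:C (expi b - 1 - b *i).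
rewrite normcR in t1.
have t2 : normc ((expR a - 1)%:C * (expi b - 1)) <= 6 * (e / 12) * normc w.
  rewrite normcM normcR; apply: (@le_trans _ _ ((2 * normc w) * (3 * (e / 12)))).
    apply: ler_pM; rewrite ?normc_ge0//; first by lra.
    by apply: le_trans eb _; rewrite ler_pM2l//; apply: le_trans hb _; exact: ltW.
  lra.
have t3 : e1 * `|a| <= e / 12 * normc w by apply: ler_pM => //; exact: ltW.
have t4 : 2 * e1 * `|b| <= 2 * (e / 12) * normc w by apply: ler_pM => //; [lra|lra].
have : 0 <= e * normc w by rewrite mulr_ge0 ?normc_ge0 ?ltW.
lra.
Qed.

Lemma cder_cexp z : cder cexp z (cexp z).
Proof.
move=> e e0; have ez : 0 < e / normc (cexp z) by rewrite divr_gt0// normc_cexp expR_gt0.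
have [r r0 rP] := cder_cexp0 ez; exists r => // w.
have := rP (w - z); rewrite subr0 => h /h; rewrite cexp0 mul1r => k.
have -> : cexp w - cexp z - cexp z * (w - z) = cexp z * (cexp (w - z) - 1 - (w - z)).
  have -> : cexp w = cexp z * cexp (w - z) by rewrite -cexpD addrC subrK.
  ring.
rewrite normcM; apply: le_trans (ler_wpM2l (normc_ge0 _) k) _.
by rewrite mulrA mulrCA divff ?mulr1// normc_cexp gt_eqF// expR_gt0.
Qed.

End ComplexExp.

(** * Iterated square roots in the right half-plane *)

Section ComplexSqrt.
Context {R : realType}.
Implicit Types (z w : R[i]).

Lemma Re_sqrtc_ge0 w : 0 <= complex.Re (sqrtc w).
Proof. by case: w => a b /=; exact: sqrtr_ge0. Qed.

Lemma Re_sqrtc_gt0 w : 0 < complex.Re w -> 0 < complex.Re (sqrtc w).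
Proof.
case: w => a b /= a0; rewrite sqrtr_gt0 divr_gt0// ltr_wpDl// sqrtr_ge0.
Qed.

Lemma normc_sqrtc w : normc (sqrtc w) ^+ 2 = normc w.
Proof. by rewrite -normcX sqr_sqrtc. Qed.

Lemma sqrtc_ReIm w : complex.Re w = complex.Re (sqrtc w) ^+ 2 - complex.Im (sqrtc w) ^+ 2
  /\ complex.Im w = 2 * complex.Re (sqrtc w) * complex.Im (sqrtc w).
Proof.
have := sqr_sqrtc w; case: (sqrtc w) => x y <- /=; rewrite expr2; simpc => /=.
by split; ring.
Qed.

Lemma Im_le_Re_sqrtc w : 0 <= complex.Re w ->
  `|complex.Im (sqrtc w)| <= complex.Re (sqrtc w).
Proof.
have [-> _] := sqrtc_ReIm w; rewrite subr_ge0 => h.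
by rewrite -(ler_pXn2r (ltn0Sn 1)) ?nnegrE ?Re_sqrtc_ge0// real_normK ?num_real.
Qed.

(** For a root [x + iy] the slope of [w] is [2 x y / (x^2 - y^2)], at least twice [y / x] in
    modulus: a square root at least halves the tangent of the argument. *)
Lemma Im_le_Re_sqrtc_half w (t : R) : 0 < complex.Re w ->
  `|complex.Im w| <= t * complex.Re w ->
  `|complex.Im (sqrtc w)| <= t / 2 * complex.Re (sqrtc w).
Proof.
move=> w0; have := Re_sqrtc_gt0 w0; have [-> ->] := sqrtc_ReIm w.
move: w0; have [-> _] := sqrtc_ReIm w.
set x := complex.Re _; set y := complex.Im _ => w0 x0.
rewrite !normrM (gtr0_norm x0) [`|2|]gtr0_norm// => h.
have t0 : 0 <= t.
  by rewrite -(pmulr_lge0 _ w0); apply: le_trans h; rewrite !mulr_ge0// ltW.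
rewrite -(ler_pM2l (_ : 0 < 2 * x)) ?mulr_gt0//; apply: le_trans h _.
have : t * (x ^+ 2 - y ^+ 2) <= t * x ^+ 2.
  by rewrite ler_wpM2l// gerBl sqr_ge0.
rewrite expr2; lra.
Qed.

Lemma sqrtc_sub1 w : 0 <= complex.Re w ->
  normc (1 - sqrtc w) * (1 + complex.Re (sqrtc w)) <= normc (1 - w).
Proof.
move=> w0; have -> : 1 - w = (1 - sqrtc w) * (1 + sqrtc w).
  by rewrite -{1}(sqr_sqrtc w); ring.
rewrite normcM ler_wpM2l ?normc_ge0//.
apply: le_trans (Re_le_normc _); rewrite raddfD/=; exact: ler_norm.
Qed.

(** In [w - z = (sqrtc w - sqrtc z) (sqrtc w + sqrtc z)] the second factor has real part at least
    [Re (sqrtc z)], because [Re (sqrtc w) >= 0] for every [w]. *)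
Lemma sqrtc_dist w z : 0 < complex.Re z ->
  normc (sqrtc w - sqrtc z) * complex.Re (sqrtc z) <= normc (w - z).
Proof.
move=> z0; have -> : w - z = (sqrtc w - sqrtc z) * (sqrtc w + sqrtc z).
  by rewrite -{1}(sqr_sqrtc w) -{1}(sqr_sqrtc z); ring.
rewrite normcM ler_wpM2l ?normc_ge0//.
apply: le_trans (le_trans (ler_norm _) (Re_le_normc _)).
by rewrite raddfD/= lerDr Re_sqrtc_ge0.
Qed.

Lemma cder_sqrtc z : 0 < complex.Re z -> cder (@sqrtc R) z ((2 * sqrtc z)^-1).
Proof.
move=> z0 e e0; have s0 := Re_sqrtc_gt0 z0; set c := complex.Re (sqrtc z) in s0 *.
have c3 : 0 < 2 * c ^+ 3 by rewrite mulr_gt0// exprn_gt0.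
(* The remainder is [(w - z) (sqrtc w - sqrtc z)] over [2 sqrtc z (sqrtc w + sqrtc z)] up to sign,
   at most [|w - z|^2 / (2 c^3)]. *)
exists (e * (2 * c ^+ 3)); first by rewrite mulr_gt0.
move=> w wz.
have sz0 : sqrtc z != 0.
  by apply/eqP => s; move: s0; rewrite /c s ltxx.
have sn : c <= normc (sqrtc w + sqrtc z).
  apply: le_trans (le_trans (ler_norm _) (Re_le_normc _)).
  by rewrite raddfD/= lerDr Re_sqrtc_ge0.
have sw0 : sqrtc w + sqrtc z != 0.
  by apply/eqP => s; move: sn; rewrite s normc0; lra.
have -> : sqrtc w - sqrtc z - (2 * sqrtc z)^-1 * (w - z) =
    - ((w - z) * (sqrtc w - sqrtc z)) / (2 * sqrtc z * (sqrtc w + sqrtc z)).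
  have -> : w - z = sqrtc w ^+ 2 - sqrtc z ^+ 2 by rewrite !sqr_sqrtc.
  move: sz0 sw0; move: (sqrtc w) (sqrtc z) => p q q0 pq0; field.
  by rewrite q0 pq0.
rewrite normcM normcN !normcM normcV !normcM.
have -> : normc (2 : R[i]) = 2 by rewrite (_ : 2 = 2%:C) ?normcR ?ger0_norm// rmorph_nat.
have n1 : c <= normc (sqrtc z) by exact: le_trans (ler_norm _) (Re_le_normc _).
have d1 : 0 < 2 * normc (sqrtc z) * normc (sqrtc w + sqrtc z).
  by rewrite !mulr_gt0//; lra.
rewrite ler_pdivrMr// [e * _]mulrC -[leRHS]mulrA ler_wpM2l ?normc_ge0//.
rewrite -(ler_pM2r s0); apply: le_trans (sqrtc_dist _ z0) _.
apply: le_trans (ltW wz) _; rewrite -!mulrA ler_pM2l// ler_pM2l//.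
rewrite exprS expr2; apply: ler_pM => //; rewrite ?mulr_ge0 ?(ltW s0)//.
by rewrite ler_pM2r.
Qed.

(** On the right half-plane this is the principal branch of [w^(2^-k)], obtained without a
    logarithm. *)
Definition root2 k w : R[i] := iter k (@sqrtc R) w.

Lemma root2S k w : root2 k.+1 w = sqrtc (root2 k w).
Proof. by []. Qed.

Lemma Re_root2_gt0 k w : 0 < complex.Re w -> 0 < complex.Re (root2 k w).
Proof. by move=> w0; elim: k => // k; exact: Re_sqrtc_gt0. Qed.

Lemma normc_root2 k w : normc (root2 k w) ^+ (2 ^ k) = normc w.
Proof. by elim: k => [|k IH]; rewrite ?expr1// expnS exprM normc_sqrtc. Qed.

Lemma cder_root2 k z : 0 < complex.Re z -> exists d, cder (root2 k) z d.
Proof.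
move=> z0; elim: k => [|k [d IH]]; first by exists 1; exact: cder_id.
by eexists; apply: (cder_comp IH); apply: cder_sqrtc; exact: Re_root2_gt0.
Qed.

(** The first root lies in the sector [|Im| <= Re]; each of the [k] further roots halves the
    slope. *)
Lemma Im_root2 k w : 0 < complex.Re w ->
  `|complex.Im (root2 k.+1 w)| <= 2 ^- k * complex.Re (root2 k.+1 w).
Proof.
move=> w0; elim: k => [|k IH]; first by rewrite expr0 invr1 mul1r; exact/Im_le_Re_sqrtc/ltW.
rewrite root2S; apply: le_trans (Im_le_Re_sqrtc_half _ IH) _; first exact: Re_root2_gt0.
by rewrite exprSr invfM.
Qed.

(** For a root [s] of modulus at most 1, [|s| <= Re s + |Im s|] and [|1 - s| <= 1 - Re s + |Im s|]:
    the real parts add up to 1, and [|Im s| <= 2^-k] by the slope bound. This is the source of the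
    norm additivity of the M-projection. *)
Lemma normc_root2_lens k w : 0 < complex.Re w -> normc w <= 1 ->
  normc (root2 k.+1 w) + normc (1 - root2 k.+1 w) <= 1 + 2 * 2 ^- k.
Proof.
move=> w0 w1; set s := root2 _ _.
have s1 : normc s <= 1.
  by rewrite -(@expr_le1 _ (2 ^ k.+1)) ?normc_ge0 ?normc_root2// expn_gt0.
have s0 : 0 < complex.Re s := Re_root2_gt0 _ w0.
have sR : complex.Re s <= 1.
  by apply: le_trans s1; exact: le_trans (ler_norm _) (Re_le_normc _).
have h1 := normc_le_ReIm s; have h2 := normc_le_ReIm (1 - s).
have h3 := Im_root2 k w0.
rewrite !raddfB/= sub0r normrN (ger0_norm (_ : 0 <= 1 - complex.Re s)) ?subr_ge0// in h2.
rewrite (gtr0_norm s0) in h1.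
have h4 : 2 ^- k * complex.Re s <= 2 ^- k by rewrite ler_piMr// invr_ge0 exprn_ge0.
rewrite -/s in h3; lra.
Qed.

Lemma root2_sub1_le k w : 0 < complex.Re w -> normc (1 - root2 k w) <= normc (1 - w).
Proof.
move=> w0; elim: k => // k; apply: le_trans; rewrite root2S.
apply: le_trans (sqrtc_sub1 (ltW (Re_root2_gt0 _ w0))).
by rewrite ler_peMr ?normc_ge0// lerDl Re_sqrtc_ge0.
Qed.

(* |1 - s_k| shrinks by a factor 1 + Re s_(k+1) at each step and
   Re s_(k+1) >= |s_(k+1)| / 2 is bounded below. *)
Lemma root2_cvg1 (c C e : R) : 0 < c -> 0 < e -> exists K, forall k w, (K <= k)%N ->
  0 < complex.Re w -> c <= normc w -> normc w <= C -> normc (1 - root2 k w) <= e.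
Proof.
move=> c0 e0; set q := Num.min c 1 / 2.
have q0 : 0 < q by rewrite divr_gt0 ?ltr0n// lt_min c0 ltr01.
have step k w : 0 < complex.Re w -> c <= normc w ->
    normc (1 - root2 k w) * (1 + q) ^+ k <= normc (1 - w).
  move=> w0 wc; elim: k => [|k]; first by rewrite expr0 mulr1.
  apply: le_trans; rewrite exprS mulrA ler_wpM2r ?exprn_ge0 ?addr_ge0 ?(ltW q0)//.
  apply: le_trans (sqrtc_sub1 (ltW (Re_root2_gt0 k w0))).
  rewrite root2S ler_wpM2l ?normc_ge0// lerD2l.
  set s := sqrtc _.
  (* Otherwise [|s| < 1] gives [|w| = |s|^(2^(k+1)) <= |s| < c]. *)
  have sc : Num.min c 1 <= normc s.
    have [//|h] := leP; exfalso.
    have n1 : normc s ^+ (2 ^ k.+1) = normc w := normc_root2 k.+1 w.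
    have := normc_ge0 s => n0.
    have s1 : normc s < 1 by apply: lt_le_trans h _; rewrite ge_min lexx orbT.
    have sc : normc s < c by apply: lt_le_trans h _; rewrite ge_min lexx.
    have : normc s ^+ (2 ^ k.+1) <= normc s.
      by rewrite -[X in _ <= X]expr1 ler_wiXn2l// ?ltW// expn_gt0.
    rewrite n1; lra.
  have := Im_le_Re_sqrtc (ltW (Re_root2_gt0 k w0)); rewrite -/s.
  have := normc_le_ReIm s; have := Re_sqrtc_ge0 (root2 k w); rewrite -/s => s0.
  rewrite (ger0_norm s0) /q ; lra.
have q1 : `|(1 + q)^-1| < 1.
  by rewrite gtr0_norm ?invr_gt0 ?addr_gt0// invf_lt1 ?addr_gt0// ltrDl.
have C0 : 0 < `|C| + 1 by rewrite ltr_wpDl.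
have eC : 0 < e / (`|C| + 1) by rewrite divr_gt0.
have /cvgr0Pnorm_lt/(_ _ eC)[K _ KP] := cvg_expr q1.
exists K => k w Kk w0 wc wC.
have := KP k Kk; rewrite /= ger0_norm ?exprn_ge0 ?invr_ge0 ?addr_ge0 ?(ltW q0)// => hk.
have h1 := step k w w0 wc.
have h2 : normc (1 - w) <= `|C| + 1.
  apply: le_trans (le_normcD _ _) _; rewrite normc1 normcN addrC lerD2r.
  exact: le_trans wC (ler_norm _).
have p0 : 0 < (1 + q) ^+ k by rewrite exprn_gt0// addr_gt0.
rewrite -(ler_pM2r p0); apply: le_trans h1 (le_trans h2 _).
by rewrite -ler_pdivrMr// mulrC; move: hk; rewrite exprVn ltr_pdivlMr// => /ltW.
Qed.

End ComplexSqrt.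

(** * Integrals and Goursat's lemma *)

Section RealIntegral.
Context d (T : measurableType d) {R : realType} (mu : {measure set T -> \bar R}).
Variable D : set T.
Hypotheses (mD : measurable D) (fD : (mu D < +oo)%E).
Implicit Types (f g h : T -> R).

Definition L1 h := mu.-integrable D (EFin \o h).
Definition bdd (h : T -> R) := exists M : R, forall t, D t -> `|h t| <= M.

Lemma bdd_bounded h : bdd h -> [bounded h x | x in D].
Proof.
move=> [M hM]; exists M; split; first exact: num_real.
by move=> N MN t Dt; apply: le_trans (ltW MN); exact: hM.
Qed.

Lemma L1_bdd h : measurable_fun D h -> bdd h -> L1 h.
Proof.
by move=> mh bh; apply: measurable_bounded_integrable => //; exact: bdd_bounded.
Qed.

Lemma L1_meas h : L1 h -> measurable_fun D h.
Proof. by move=> /integrableP[/measurable_EFinP]. Qed.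

Lemma L1D f g : L1 f -> L1 g -> L1 (fun t => f t + g t).
Proof.
move=> hf hg; have := integrableD mD hf hg.
by apply: eq_integrable => // t _ /=; rewrite EFinD.
Qed.

Lemma L1B f g : L1 f -> L1 g -> L1 (fun t => f t - g t).
Proof.
move=> hf hg; have := integrableB mD hf hg.
by apply: eq_integrable => // t _ /=; rewrite EFinB.
Qed.

Lemma L1Z (c : R) f : L1 f -> L1 (fun t => c * f t).
Proof.
move=> hf; have := integrableZl mD c hf.
by apply: eq_integrable => // t _ /=; rewrite EFinM.
Qed.

Lemma L1_cst (c : R) : L1 (fun=> c).
Proof. by apply: L1_bdd; [exact: measurable_cst | exists `|c|]. Qed.

Lemma L1_norm f : L1 f -> L1 (fun t => `|f t|).
Proof. by move=> h; have := integrable_norm h. Qed.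

Lemma L1_le f g : measurable_fun D f -> (forall t, D t -> `|f t| <= `|g t|) ->
  L1 g -> L1 f.
Proof.
move=> mf fg hg; apply: (le_integrable mD _ _ hg); first exact/measurable_EFinP.
by move=> t Dt /=; rewrite lee_fin fg.
Qed.

Lemma L1M f g : L1 f -> measurable_fun D g -> bdd g -> L1 (fun t => f t * g t).
Proof.
move=> hf mg bg; have := integrableMl mD hf mg (bdd_bounded bg).
by apply: eq_integrable => // t _ /=; rewrite EFinM.
Qed.

Lemma eq_L1 f g : (forall t, D t -> f t = g t) -> L1 f -> L1 g.
Proof.
by move=> fg; apply: eq_integrable => // t; rewrite inE => Dt /=; rewrite fg.
Qed.

Definition rI h : R := Rintegral mu D h.

Lemma eq_rI f g : (forall t, D t -> f t = g t) -> rI f = rI g.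
Proof. by move=> fg; apply: eq_Rintegral => t; rewrite inE => /fg. Qed.

Lemma rID f g : L1 f -> L1 g -> rI (fun t => f t + g t) = rI f + rI g.
Proof. exact: RintegralD. Qed.

Lemma rIB f g : L1 f -> L1 g -> rI (fun t => f t - g t) = rI f - rI g.
Proof. exact: RintegralB. Qed.

Lemma rIZ (c : R) f : L1 f -> rI (fun t => c * f t) = c * rI f.
Proof. exact: RintegralZl. Qed.

Lemma rI_cst (c : R) : rI (fun=> c) = c * fine (mu D).
Proof. exact: Rintegral_cst. Qed.

Lemma rI_ge0 f : (forall t, D t -> 0 <= f t) -> 0 <= rI f.
Proof. exact: Rintegral_ge0. Qed.

Lemma le_rI f g : L1 f -> L1 g -> (forall t, D t -> f t <= g t) -> rI f <= rI g.
Proof. exact: le_Rintegral. Qed.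

Lemma rI_dominated (f_ : nat -> T -> R) f g :
  (forall n, measurable_fun D (f_ n)) -> measurable_fun D f ->
  {ae mu, forall t, D t -> f_ ^~ t @ \oo --> f t} -> L1 g ->
  (forall n t, D t -> `|f_ n t| <= g t) ->
  L1 f /\ (fun n => rI (f_ n)) @ \oo --> rI f.
Proof.
move=> mf_ mf cf hg fg.
have [|||||i1 _ i3] := @dominated_convergence _ T R mu D mD
  (fun n t => (f_ n t)%:E) (EFin \o f) (EFin \o g).
- by move=> n; exact/measurable_EFinP.
- exact/measurable_EFinP.
- apply: filterS cf => t h /h{}h; apply/fine_cvgP; split; [exact: nearW|exact: h].
- exact: hg.
- by apply: aeW => t n Dt; rewrite lee_fin fg.
split=> //; move: i3; rewrite -(fineK (integrable_fin_num mD i1)).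
by move=> /fine_cvg.
Qed.

End RealIntegral.

Section ComplexIntegral.
Context d (T : measurableType d) {R : realType} (mu : {measure set T -> \bar R}).
Variable D : set T.
Hypotheses (mD : measurable D) (fD : (mu D < +oo)%E).
Implicit Types (f g h : T -> R[i]).
Local Notation L1 := (L1 mu D).
Local Notation rI := (rI mu D).
Local Notation Re := complex.Re.
Local Notation Im := complex.Im.

Definition cmeas f := measurable_fun D (fun t => Re (f t)) /\
                      measurable_fun D (fun t => Im (f t)).
Definition cL1 f := L1 (fun t => Re (f t)) /\ L1 (fun t => Im (f t)).
Definition cI f : R[i] := rI (fun t => Re (f t)) +i* rI (fun t => Im (f t)).
Definition cbdd f := exists M : R, forall t, D t -> normc (f t) <= M.

Lemma normc_ReIm (z : R[i]) : normc z = Num.sqrt (Re z ^+ 2 + Im z ^+ 2).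
Proof. by case: z. Qed.

Lemma Re_mul (z w : R[i]) : Re (z * w) = Re z * Re w - Im z * Im w.
Proof. by case: z w => [a b] [c e]. Qed.

Lemma Im_mul (z w : R[i]) : Im (z * w) = Re z * Im w + Im z * Re w.
Proof. by case: z w => [a b] [c e]. Qed.

Lemma cmeas_normc f : cmeas f -> measurable_fun D (fun t => normc (f t)).
Proof.
move=> [h1 h2]; under eq_fun do rewrite normc_ReIm.
have ms : measurable_fun setT (@Num.sqrt R).
  by apply: continuous_measurable_fun; exact: sqrt_continuous.
apply: (measurableT_comp ms).
by apply: measurable_funD; apply: measurable_funX.
Qed.

Lemma cmeasM f g : cmeas f -> cmeas g -> cmeas (fun t => f t * g t).
Proof.
move=> [f1 f2] [g1 g2]; split; [under eq_fun do rewrite Re_mul|under eq_fun do rewrite Im_mul].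
  by apply: measurable_funB; apply: measurable_funM.
by apply: measurable_funD; apply: measurable_funM.
Qed.

Lemma cmeas_cst c : cmeas (fun=> c).
Proof. by split; exact: measurable_cst. Qed.

Lemma cL1_meas f : cL1 f -> cmeas f.
Proof. by move=> [h1 h2]; split; apply: (@L1_meas _ _ _ mu). Qed.

Lemma cL1_normc f : cL1 f -> L1 (fun t => normc (f t)).
Proof.
move=> h; have [h1 h2] := h.
apply: (@L1_le _ _ _ _ _ mD _ (fun t => `|Re (f t)| + `|Im (f t)|)).
- exact/cmeas_normc/cL1_meas.
- move=> t _; rewrite ger0_norm ?normc_ge0//.
  exact: le_trans (normc_le_ReIm _) (ler_norm _).
- by apply: L1D => //; exact: L1_norm.
Qed.

Lemma cL1_le f (g : T -> R) : cmeas f -> (forall t, D t -> normc (f t) <= g t) ->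
  L1 g -> cL1 f.
Proof.
move=> [m1 m2] fg hg; split; apply: (L1_le mD _ _ hg) => // t Dt.
  by apply: le_trans (Re_le_normc _) (le_trans (fg t Dt) (ler_norm _)).
by apply: le_trans (Im_le_normc _) (le_trans (fg t Dt) (ler_norm _)).
Qed.

Lemma cL1_bdd f : cmeas f -> cbdd f -> cL1 f.
Proof. by move=> mf [M fM]; apply: (cL1_le mf fM); exact: L1_cst. Qed.

Lemma cL1_cst c : cL1 (fun=> c).
Proof. by apply: cL1_bdd; [exact: cmeas_cst|exists (normc c)]. Qed.

Lemma cL1D f g : cL1 f -> cL1 g -> cL1 (fun t => f t + g t).
Proof.
by move=> [f1 f2] [g1 g2]; split; (under eq_fun do rewrite raddfD); apply: L1D.
Qed.

Lemma cL1M f g : cL1 f -> cmeas g -> cbdd g -> cL1 (fun t => f t * g t).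
Proof.
move=> hf mg [M gM]; apply: (@cL1_le _ (fun t => M * normc (f t))).
- by apply: cmeasM => //; exact: cL1_meas.
- by move=> t Dt; rewrite normcM mulrC ler_wpM2r ?normc_ge0 ?gM.
- by apply: L1Z => //; exact: cL1_normc.
Qed.

Lemma cL1Z (c : R[i]) f : cL1 f -> cL1 (fun t => c * f t).
Proof.
move=> hf; under eq_fun do rewrite mulrC.
by apply: (cL1M hf (cmeas_cst c)); exists (normc c).
Qed.

Lemma cL1N f : cL1 f -> cL1 (fun t => - f t).
Proof. by move=> /(cL1Z (-1)); under eq_fun do rewrite mulN1r. Qed.

Lemma cL1B f g : cL1 f -> cL1 g -> cL1 (fun t => f t - g t).
Proof. by move=> hf /cL1N; exact: cL1D. Qed.

Lemma cL1_sum n (F : 'I_n -> T -> R[i]) : (forall i, cL1 (F i)) ->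
  cL1 (fun t => \sum_(i < n) F i t).
Proof.
elim: n F => [|n IH] F hF; first by under eq_fun do rewrite big_ord0; exact: cL1_cst.
by under eq_fun do rewrite big_ord_recr; apply: cL1D => //; exact: IH.
Qed.

Lemma eq_cL1 f g : (forall t, D t -> f t = g t) -> cL1 f -> cL1 g.
Proof.
by move=> fg [h1 h2]; split; [apply: eq_L1 h1|apply: eq_L1 h2] => // t /fg ->.
Qed.

Lemma eq_cI f g : (forall t, D t -> f t = g t) -> cI f = cI g.
Proof. by move=> fg; congr (_ +i* _); apply: eq_rI => t /fg ->. Qed.

Lemma cID f g : cL1 f -> cL1 g -> cI (fun t => f t + g t) = cI f + cI g.
Proof.
move=> [f1 f2] [g1 g2]; rewrite /cI; simpc; rewrite -!rID//.
by congr (_ +i* _); apply: eq_rI => t _; rewrite raddfD.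
Qed.

Lemma cIZ (c : R[i]) f : cL1 f -> cI (fun t => c * f t) = c * cI f.
Proof.
move=> [f1 f2]; case: c => a b; rewrite /cI; simpc.
rewrite -!rIZ// -rIB ?L1Z// -rID ?L1Z//.
by congr (_ +i* _); apply: eq_rI => t _; rewrite ?Re_mul ?Im_mul.
Qed.

Lemma cIN f : cL1 f -> cI (fun t => - f t) = - cI f.
Proof. by move=> /(cIZ (-1)); under eq_fun do rewrite mulN1r; rewrite mulN1r. Qed.

Lemma cIB f g : cL1 f -> cL1 g -> cI (fun t => f t - g t) = cI f - cI g.
Proof. by move=> hf hg; rewrite cID ?cIN//; exact: cL1N. Qed.

Lemma cI_cst (c : R[i]) : cI (fun=> c) = c * (fine (mu D))%:C.
Proof. by rewrite /cI !rI_cst//; case: c => a b /=; simpc. Qed.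

Lemma cI_sum n (F : 'I_n -> T -> R[i]) : (forall i, cL1 (F i)) ->
  cI (fun t => \sum_(i < n) F i t) = \sum_(i < n) cI (F i).
Proof.
elim: n F => [|n IH] F hF.
  by under eq_fun do rewrite big_ord0; rewrite big_ord0 cI_cst mul0r.
under eq_fun do rewrite big_ord_recr; rewrite big_ord_recr cID//= ?IH//.
exact: cL1_sum.
Qed.

Lemma cI_real (h : T -> R) : cI (fun t => (h t)%:C) = (rI h)%:C.
Proof. by rewrite /cI /= rI_cst// mul0r. Qed.

Lemma cL1_real (h : T -> R) : L1 h -> cL1 (fun t => (h t)%:C).
Proof. by move=> hh; split => //=; exact: L1_cst. Qed.

Lemma cI_conj f : cL1 f -> cI (fun t => conjc (f t)) = conjc (cI f).
Proof.
move=> [h1 h2]; rewrite /cI /=; congr (_ +i* _); first by apply: eq_rI => t _; case: (f t).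
have := rIZ mD (-1) h2; rewrite mulN1r => <-.
by apply: eq_rI => t _; case: (f t) => a b /=; rewrite mulN1r.
Qed.

Lemma normc_nat n : normc (n%:R : R[i]) = n%:R.
Proof. by rewrite (_ : n%:R = (n%:R : R)%:C) ?normcR ?ger0_norm// rmorph_nat. Qed.

Lemma normc_conj (z : R[i]) : normc (conjc z) = normc z.
Proof. by case: z => a b /=; rewrite sqrrN. Qed.

Lemma mul_conj (z : R[i]) : conjc z * z = (normc z ^+ 2)%:C.
Proof.
case: z => a b; rewrite normc_ReIm /= sqr_sqrtr ?addr_ge0 ?sqr_ge0//.
by simpc; rewrite -!expr2; congr (_ +i* _); ring.
Qed.

(** Rotation by the conjugate of the integral makes its square modulus the integral of a real part,
    to which monotonicity applies. *)
Lemma normc_cI_le f : cL1 f -> normc (cI f) <= rI (fun t => normc (f t)).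
Proof.
move=> hf; have [->|n0] := eqVneq (cI f) 0.
  by rewrite normc0; apply: rI_ge0 => t _; exact: normc_ge0.
have p0 : 0 < normc (cI f).
  by rewrite lt_neqAle normc_ge0 andbT eq_sym; apply: contra_neq n0 => /eq0_normc.
rewrite -(ler_pM2l p0) -expr2.
have -> : normc (cI f) ^+ 2 = Re (cI (fun t => conjc (cI f) * f t)).
  by rewrite cIZ// mul_conj.
rewrite -rIZ//; last exact: cL1_normc.
apply: le_rI => //.
- by have [] := cL1Z (conjc (cI f)) hf.
- by apply: L1Z => //; exact: cL1_normc.
- move=> t _; apply: le_trans (le_trans (ler_norm _) (Re_le_normc _)) _.
  by rewrite normcM normc_conj.
Qed.

Lemma normc_cI_bound f M : cL1 f -> (forall t, D t -> normc (f t) <= M) ->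
  normc (cI f) <= M * fine (mu D).
Proof.
move=> hf fM; apply: le_trans (normc_cI_le hf) _; rewrite -rI_cst//.
by apply: le_rI => //; [exact: cL1_normc|exact: L1_cst].
Qed.

Lemma cI_dominated (f_ : nat -> T -> R[i]) f (g : T -> R) :
  (forall n, cmeas (f_ n)) -> cmeas f ->
  {ae mu, forall t, D t -> f_ ^~ t @ \oo --> f t} -> L1 g ->
  (forall n t, D t -> normc (f_ n t) <= g t) ->
  cL1 f /\ (fun n => cI (f_ n)) @ \oo --> cI f.
Proof.
move=> mf_ [m1 m2] cf hg fg.
have [|||i1 c1] := @rI_dominated _ _ _ mu D mD (fun n t => Re (f_ n t)) _ g _ m1 _ hg.
- by move=> n; have [] := mf_ n.
- by apply: filterS cf => t h /h; exact: cvg_Re.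
- by move=> n t Dt; apply: le_trans (Re_le_normc _) (fg n t Dt).
have [|||i2 c2] := @rI_dominated _ _ _ mu D mD (fun n t => Im (f_ n t)) _ g _ m2 _ hg.
- by move=> n; have [] := mf_ n.
- by apply: filterS cf => t h /h; exact: cvg_Im.
- by move=> n t Dt; apply: le_trans (Im_le_normc _) (fg n t Dt).
by split=> //; exact: cvg_ReIm.
Qed.

End ComplexIntegral.

Section IntervalIntegral.
Context {R : realType}.
Implicit Types (a b c : R) (g h : R -> R[i]).
Local Notation Re := complex.Re.
Local Notation Im := complex.Im.

Definition lam : {measure set (measurableTypeR R) -> \bar R} := @lebesgue_measure R.
Definition itv a b : set (measurableTypeR R) := `[a, b]%classic.
Definition ci a b g : R[i] := cI lam (itv a b) g.
Definition contI a b g := forall x, a <= x <= b -> g @ x --> g x.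

Lemma mitv a b : measurable (itv a b).
Proof. exact: measurable_itv. Qed.

Lemma lam_itv a b : a <= b -> lam (itv a b) = (b - a)%:E.
Proof.
have e : lam (itv a b) = _ := lebesgue_measure_itv `[a, b].
move=> ab; rewrite e /= lte_fin; case: ltP => //.
by move=> ba; rewrite (_ : a = b) ?subrr//; apply/eqP; rewrite eq_le ab.
Qed.

Lemma lam_itv_fin a b : (lam (itv a b) < +oo)%E.
Proof.
have e : lam (itv a b) = _ := lebesgue_measure_itv `[a, b].
by rewrite e /=; case: ifP => _; rewrite ?ltry.
Qed.

Lemma contI_L1 a b (f : R -> R) : (forall x, a <= x <= b -> f @ x --> f x) ->
  L1 lam (itv a b) f.
Proof.
move=> cf; apply: continuous_compact_integrable; first exact: segment_compact.
apply: continuous_in_subspaceT => x; rewrite inE /itv /= in_itv /= => /cf; exact.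
Qed.

Lemma contI_cL1 a b g : contI a b g -> cL1 lam (itv a b) g.
Proof. by move=> cg; split; apply: contI_L1 => x /cg h; [exact: cvg_Re|exact: cvg_Im]. Qed.

Lemma rI_itv_split a b c (f : R -> R) : a <= b -> b <= c -> L1 lam (itv a c) f ->
  rI lam (itv a c) f = rI lam (itv a b) f + rI lam (itv b c) f.
Proof.
move=> ab bc hf; have := @Rintegral_itvB R f (BLeft a) (BRight c) b hf.
rewrite !bnd_simp => /(_ ab bc); rewrite Rintegral_itv_obnd_cbnd; last first.
  apply: (integrableS _ _ _ hf); [exact: mitv|exact: measurable_itv|].
  move=> x /=; rewrite /itv /= !in_itv/= => /andP[bx ->].
  by rewrite andbT; exact/ltW/(le_lt_trans ab).
by move/eqP; rewrite subr_eq addrC => /eqP.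
Qed.

Lemma ci_split a b c g : a <= b -> b <= c -> contI a c g ->
  ci a c g = ci a b g + ci b c g.
Proof.
move=> ab bc /contI_cL1[h1 h2]; rewrite /ci /cI; simpc.
by rewrite -!rI_itv_split.
Qed.

Lemma eq_ci a b g h : (forall x, a <= x <= b -> g x = h x) -> ci a b g = ci a b h.
Proof. by move=> gh; apply: eq_cI => x; rewrite /itv /= in_itv => /gh. Qed.

Lemma ciD a b g h : contI a b g -> contI a b h ->
  ci a b (fun x => g x + h x) = ci a b g + ci a b h.
Proof. by move=> /contI_cL1 ? /contI_cL1 ?; rewrite /ci cID//; exact: mitv. Qed.

Lemma ciB a b g h : contI a b g -> contI a b h ->
  ci a b (fun x => g x - h x) = ci a b g - ci a b h.
Proof. by move=> /contI_cL1 ? /contI_cL1 ?; rewrite /ci cIB//; exact: mitv. Qed.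

Lemma ciZ a b (c : R[i]) g : contI a b g -> ci a b (fun x => c * g x) = c * ci a b g.
Proof. by move=> /contI_cL1 ?; rewrite /ci cIZ//; exact: mitv. Qed.

Lemma ci_cst a b (c : R[i]) : a <= b -> ci a b (fun=> c) = c * (b - a)%:C.
Proof.
move=> ab; have := @cI_cst _ _ _ lam (itv a b) (mitv a b) c.
by rewrite lam_itv.
Qed.

Lemma contI_cst a b (c : R[i]) : contI a b (fun=> c).
Proof. by move=> x _; exact: cvg_cst. Qed.

Lemma contI_toC a b : contI a b (fun x => x%:C).
Proof. by move=> x _; apply: cvg_toC; exact: cvg_id. Qed.

Lemma ci_bound a b g M : a <= b -> contI a b g ->
  (forall x, a <= x <= b -> normc (g x) <= M) -> normc (ci a b g) <= M * (b - a).
Proof.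
move=> ab /contI_cL1 hg gM.
have := @normc_cI_bound _ _ _ lam _ (mitv a b) (lam_itv_fin a b) g M hg.
rewrite lam_itv//; apply=> x; rewrite /itv /= in_itv; exact: gM.
Qed.

Lemma rI_id a b : a <= b -> rI lam (itv a b) (fun x => x) = (b ^+ 2 - a ^+ 2) / 2.
Proof.
rewrite le_eqVlt => /predU1P[->|ab].
  by rewrite /itv set_itv1 /rI Rintegral_set1 subrr mul0r.
rewrite /rI /Rintegral.
rewrite (@continuous_FTC2 R (fun x => x) (fun x => x ^+ 2 / 2) a b ab).
- by rewrite /= mulrBl.
- by apply: continuous_subspaceT => x; exact: cvg_id.
- have c2 : continuous (fun x : R => x ^+ 2 / 2).
    by move=> x; apply: cvgM; [exact: exprn_continuous|exact: cvg_cst].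
  split.
  + by move=> x _; apply: derivableM; [exact: exprn_derivable|exact: derivable_cst].
  + by apply: cvg_at_right_filter; exact: c2.
  + by apply: cvg_at_left_filter; exact: c2.
- move=> x _; rewrite derive1E.
  have -> : (fun x : R => x ^+ 2 / 2) = 2^-1 \*o (@GRing.exp R ^~ 2).
    by apply/funext => y; rewrite /= mulrC.
  rewrite deriveMl ?exp_derive//.
  by rewrite -[_ *: _]/(_ * _) /= expr1 mulr1 mulrA mulVf ?mul1r.
Qed.

Lemma ci_lin a b (c d : R[i]) : a <= b ->
  ci a b (fun x => c + d * x%:C) =
  c * (b - a)%:C + d * ((b ^+ 2 - a ^+ 2) / 2)%:C.
Proof.
move=> ab; have c1 := @contI_toC a b.
have c2 : contI a b (fun x => d * x%:C).
  by move=> x ax; apply: cvgCM; [exact: cvg_cst|exact: c1].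
transitivity (ci a b (fun=> c) + ci a b (fun x => d * x%:C)).
  by apply: (@ciD a b (fun=> c) (fun x => d * x%:C)); [exact: contI_cst|exact: c2].
rewrite (@ciZ a b d (fun x => x%:C))// ci_cst//; congr (_ + _ * _).
by rewrite /ci cI_real ?rI_id//; exact: mitv.
Qed.

End IntervalIntegral.

(** * Goursat's lemma by bisection of rectangles *)

Section Goursat.
Context {R : realType}.
Implicit Types (a b c d x y : R) (g : R[i] -> R[i]).
Local Notation Re := complex.Re.
Local Notation Im := complex.Im.

Definition rect_int g a b c d : R[i] :=
  ci a b (fun x => g (x +i* c)) - ci a b (fun x => g (x +i* d))
  + 'i * (ci c d (fun y => g (b +i* y)) - ci c d (fun y => g (a +i* y))).

Definition cont_rect g a b c d := forall x y, a <= x <= b -> c <= y <= d ->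
  g @ (x +i* y) --> g (x +i* y).

Lemma cvg_line_re x y : (fun t : R => t +i* y) @ x --> x +i* y.
Proof. by apply: cvg_ReIm => /=; [exact: cvg_id|exact: cvg_cst]. Qed.

Lemma cvg_line_im x y : (fun t : R => x +i* t) @ y --> x +i* y.
Proof. by apply: cvg_ReIm => /=; [exact: cvg_cst|exact: cvg_id]. Qed.

Lemma cont_rect_h g a b c d y : cont_rect g a b c d -> c <= y <= d ->
  contI a b (fun x => g (x +i* y)).
Proof.
move=> h cy x ax; apply: (@continuous_comp R R[i] R[i] (fun t => t +i* y) g x); first exact: cvg_line_re.
exact: h.
Qed.

Lemma cont_rect_v g a b c d x : cont_rect g a b c d -> a <= x <= b ->
  contI c d (fun y => g (x +i* y)).
Proof.
move=> h ax y cy; apply: (@continuous_comp R R[i] R[i] (fun t => x +i* t) g y); first exact: cvg_line_im.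
exact: h.
Qed.

Lemma rect_int_split g a m b c n d : a <= m -> m <= b -> c <= n -> n <= d ->
  cont_rect g a b c d ->
  rect_int g a b c d = rect_int g a m c n + rect_int g m b c n
                     + (rect_int g a m n d + rect_int g m b n d).
Proof.
move=> am mb cn nd h.
have ab := le_trans am mb; have cd := le_trans cn nd.
have hh y : c <= y <= d -> ci a b (fun x => g (x +i* y)) =
    ci a m (fun x => g (x +i* y)) + ci m b (fun x => g (x +i* y)).
  by move=> cy; apply: ci_split => //; exact: cont_rect_h h cy.
have hv x : a <= x <= b -> ci c d (fun y => g (x +i* y)) =
    ci c n (fun y => g (x +i* y)) + ci n d (fun y => g (x +i* y)).
  by move=> cx; apply: ci_split => //; exact: cont_rect_v h cx.
rewrite /rect_int !hh ?hv ?lexx ?ab ?cd ?cn ?nd//; ring.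
Qed.

Lemma complex_split x y : x +i* y = x%:C + 'i * y%:C.
Proof. exact: complexE. Qed.

Lemma rect_int_lin (z0 al be : R[i]) a b c d : a <= b -> c <= d ->
  rect_int (fun w => al + be * (w - z0)) a b c d = 0.
Proof.
move=> ab cd; rewrite /rect_int.
have hh y : ci a b (fun x => al + be * (x +i* y - z0)) =
    (al + be * ('i * y%:C - z0)) * (b - a)%:C + be * ((b ^+ 2 - a ^+ 2) / 2)%:C.
  rewrite -ci_lin//; apply: eq_ci => x _.
  by rewrite complex_split; ring.
have hv x : ci c d (fun y => al + be * (x +i* y - z0)) =
    (al + be * (x%:C - z0)) * (d - c)%:C + (be * 'i) * ((d ^+ 2 - c ^+ 2) / 2)%:C.
  rewrite -ci_lin//; apply: eq_ci => y _.
  by rewrite complex_split; ring.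
by rewrite !hh !hv !rmorphB /=; ring.
Qed.

Lemma rect_intB g h a b c d : a <= b -> c <= d -> cont_rect g a b c d ->
  cont_rect h a b c d ->
  rect_int (fun w => g w - h w) a b c d = rect_int g a b c d - rect_int h a b c d.
Proof.
move=> ab cd cg ch; rewrite /rect_int.
have hh y : c <= y <= d -> ci a b (fun x => g (x +i* y) - h (x +i* y)) =
    ci a b (fun x => g (x +i* y)) - ci a b (fun x => h (x +i* y)).
  by move=> cy; apply: ciB; [exact: cont_rect_h cg cy|exact: cont_rect_h ch cy].
have hv x : a <= x <= b -> ci c d (fun y => g (x +i* y) - h (x +i* y)) =
    ci c d (fun y => g (x +i* y)) - ci c d (fun y => h (x +i* y)).
  by move=> ax; apply: ciB; [exact: cont_rect_v cg ax|exact: cont_rect_v ch ax].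
by rewrite !hh ?hv ?lexx ?ab ?cd//; ring.
Qed.

Lemma rect_int_bound g a b c d M : a <= b -> c <= d -> cont_rect g a b c d ->
  (forall x y, a <= x <= b -> c <= y <= d -> normc (g (x +i* y)) <= M) ->
  normc (rect_int g a b c d) <= 2 * M * ((b - a) + (d - c)).
Proof.
move=> ab cd cg gM.
have hh y : c <= y <= d -> normc (ci a b (fun x => g (x +i* y))) <= M * (b - a).
  by move=> cy; apply: ci_bound => // [|x ax]; [exact: cont_rect_h cg cy|exact: gM].
have hv x : a <= x <= b -> normc (ci c d (fun y => g (x +i* y))) <= M * (d - c).
  by move=> ax; apply: ci_bound => // [|y cy]; [exact: cont_rect_v cg ax|exact: gM].
rewrite /rect_int.
set A1 := ci _ _ _; set A2 := ci _ _ _; set A3 := ci _ _ _; set A4 := ci _ _ _.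
have t1 : normc A1 <= M * (b - a) by apply: hh; rewrite lexx.
have t2 : normc A2 <= M * (b - a) by apply: hh; rewrite lexx cd.
have t3 : normc A3 <= M * (d - c) by apply: hv; rewrite lexx ab.
have t4 : normc A4 <= M * (d - c) by apply: hv; rewrite lexx ab.
have := le_normcD (A1 - A2) ('i * (A3 - A4)).
have := le_normcD A1 (- A2); have := le_normcD A3 (- A4); rewrite !normcN.
have -> : normc ('i * (A3 - A4)) = normc (A3 - A4).
  by rewrite normcM /= expr0n expr1n add0r sqrtr1 mul1r.
lra.
Qed.

Section Bisection.
Variables (g : R[i] -> R[i]) (a0 c0 l h : R).
Hypotheses (l0 : 0 <= l) (h0 : 0 <= h).
Hypothesis dg : forall z, a0 <= Re z <= a0 + l -> c0 <= Im z <= c0 + h ->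
  exists d : R[i], cder g z d.

Let ln k := l / 2 ^+ k.
Let hn k := h / 2 ^+ k.
Let G k (p : R * R) := rect_int g p.1 (p.1 + ln k) p.2 (p.2 + hn k).
(** A rectangle is recorded by its lower left corner and its level. The first quarter carrying a
    quarter of the integral is taken; if three tests fail, the triangle inequality in [normG] shows
    that the remaining quarter qualifies. *)
Let next k (p : R * R) : R * R :=
  let N := normc (G k p) / 4 in
  if N <= normc (G k.+1 p) then p
  else if N <= normc (G k.+1 (p.1 + ln k.+1, p.2)) then (p.1 + ln k.+1, p.2)
  else if N <= normc (G k.+1 (p.1, p.2 + hn k.+1)) then (p.1, p.2 + hn k.+1)
  else (p.1 + ln k.+1, p.2 + hn k.+1).
Let pos := fix pos k := if k is k'.+1 then next k' (pos k') else (a0, c0).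

Let ln0 k : 0 <= ln k. Proof. by rewrite /ln divr_ge0// exprn_ge0. Qed.
Let hn0 k : 0 <= hn k. Proof. by rewrite /hn divr_ge0// exprn_ge0. Qed.
Let lnS k : ln k = ln k.+1 + ln k.+1.
Proof. by rewrite /ln exprS; field; rewrite expf_neq0. Qed.
Let hnS k : hn k = hn k.+1 + hn k.+1.
Proof. by rewrite /hn exprS; field; rewrite expf_neq0. Qed.

Let next1 k p : p.1 <= (next k p).1 /\ (next k p).1 + ln k.+1 <= p.1 + ln k.
Proof.
rewrite (lnS k) addrA; have := ln0 k.+1.
by rewrite /next; case: ifP => _ /=; [lra|case: ifP => _ /=; [lra|case: ifP => _ /=; lra]].
Qed.

Let next2 k p : p.2 <= (next k p).2 /\ (next k p).2 + hn k.+1 <= p.2 + hn k.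
Proof.
rewrite (hnS k) addrA; have := hn0 k.+1.
by rewrite /next; case: ifP => _ /=; [lra|case: ifP => _ /=; [lra|case: ifP => _ /=; lra]].
Qed.

Let posD k m : (pos k).1 <= (pos (k + m)).1 /\ (pos (k + m)).1 + ln (k + m) <= (pos k).1 + ln k
  /\ (pos k).2 <= (pos (k + m)).2 /\ (pos (k + m)).2 + hn (k + m) <= (pos k).2 + hn k.
Proof.
elim: m => [|m]; first by rewrite addn0 !lexx.
rewrite addnS /=; have := next1 (k + m) (pos (k + m)).
have := next2 (k + m) (pos (k + m)); lra.
Qed.

Let cont_sub k : cont_rect g (pos k).1 ((pos k).1 + ln k) (pos k).2 ((pos k).2 + hn k).
Proof.
move=> x y xa yc; have := posD 0 k; rewrite add0n /= /ln /hn expr0 !divr1 => H.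
have [||d /cder_cont//] := @dg (x +i* y); rewrite /=.
  by move: xa; rewrite /ln; lra.
by move: yc; rewrite /hn; lra.
Qed.

Let normG k : normc (G 0 (a0, c0)) / 4 ^+ k <= normc (G k (pos k)).
Proof.
elim: k => [|k IH]; first by rewrite expr0 divr1.
rewrite exprSr invfM mulrA.
apply: (@le_trans _ _ (normc (G k (pos k)) / 4)); first by rewrite ler_wpM2r// invr_ge0.
rewrite [pos k.+1]/= /next; move: (pos k) (@cont_sub k) => p cs.
set N := normc (G k p) / 4.
have [//|n1] := leP N (normc (G k.+1 p)).
have [//|n2] := leP N (normc (G k.+1 (p.1 + ln k.+1, p.2))).
have [//|n3] := leP N (normc (G k.+1 (p.1, p.2 + hn k.+1))).
have := ln0 k.+1; have := hn0 k.+1 => hk lk.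
have S : G k p = G k.+1 p + G k.+1 (p.1 + ln k.+1, p.2) +
  (G k.+1 (p.1, p.2 + hn k.+1) +
   G k.+1 (p.1 + ln k.+1, p.2 + hn k.+1)).
  have E1 : p.1 + ln k = p.1 + ln k.+1 + ln k.+1 by rewrite (lnS k) addrA.
  have E2 : p.2 + hn k = p.2 + hn k.+1 + hn k.+1 by rewrite (hnS k) addrA.
  rewrite /G /= E1 E2; rewrite E1 E2 in cs.
  by apply: rect_int_split => //; rewrite lerDl.
have := le_normcD (G k.+1 p + G k.+1 (p.1 + ln k.+1, p.2))
  (G k.+1 (p.1, p.2 + hn k.+1) +
   G k.+1 (p.1 + ln k.+1, p.2 + hn k.+1)).
rewrite -S.
have := le_normcD (G k.+1 p) (G k.+1 (p.1 + ln k.+1, p.2)).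
have := le_normcD (G k.+1 (p.1, p.2 + hn k.+1))
   (G k.+1 (p.1 + ln k.+1, p.2 + hn k.+1)).
move: n1 n2 n3; rewrite /N; lra.
Qed.

Lemma goursat : rect_int g a0 (a0 + l) c0 (c0 + h) = 0.
Proof.
have -> : rect_int g a0 (a0 + l) c0 (c0 + h) = G 0 (a0, c0).
  by rewrite /G /ln /hn !expr0 !divr1.
have [p pP] : exists p, forall k, (pos k).1 <= p <= (pos k).1 + ln k.
  pose S := [set (pos k).1 | k in [set: nat]].
  have ubS k m : (pos m).1 <= (pos k).1 + ln k.
    have [/subnKC km|/ltnW/subnKC mk] := leqP k m.
      by have := posD k (m - k); rewrite km; have := ln0 m; lra.
    by have := posD m (k - m); rewrite mk; have := ln0 k; lra.
  exists (sup S) => k; apply/andP; split.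
    by apply: ub_le_sup; [exists ((pos 0).1 + ln 0) => _ [m _ <-]; exact: ubS|exists k].
  by apply: ge_sup; [exists (pos 0).1, 0%N|move=> _ [m _ <-]; exact: ubS].
have [q qP] : exists q, forall k, (pos k).2 <= q <= (pos k).2 + hn k.
  pose S := [set (pos k).2 | k in [set: nat]].
  have ubS k m : (pos m).2 <= (pos k).2 + hn k.
    have [/subnKC km|/ltnW/subnKC mk] := leqP k m.
      by have := posD k (m - k); rewrite km; have := hn0 m; lra.
    by have := posD m (k - m); rewrite mk; have := hn0 k; lra.
  exists (sup S) => k; apply/andP; split.
    by apply: ub_le_sup; [exists ((pos 0).2 + hn 0) => _ [m _ <-]; exact: ubS|exists k].
  by apply: ge_sup; [exists (pos 0).2, 0%N|move=> _ [m _ <-]; exact: ubS].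
have [d dP] : exists d : R[i], cder g (p +i* q) d.
  apply: dg => /=; [have := pP 0%N|have := qP 0%N]; rewrite /ln /hn expr0 divr1//.
apply: eq0_normc; apply/eqP; rewrite eq_le normc_ge0 andbT.
apply/ler_addgt0Pr => e e0; rewrite add0r.
set L := l + h + 1; have L0 : 0 < L by rewrite ltr_wpDl ?addr_ge0.
(* At level [K] the sides are [l t] and [h t] with [t = 2^-K]. A remainder of at most
   [e / (2 L^2) * (L t)] integrates to at most [e t^2], which matches the factor [4^-K] lost in the
   bisection. *)
have e10 : 0 < e / (2 * L ^+ 2) by rewrite divr_gt0// mulr_gt0// exprn_gt0.
have [r r0 rP] := dP _ e10.
have rL : 0 < r / L by rewrite divr_gt0.
have : `|2^-1 : R| < 1 by rewrite gtr0_norm ?invr_gt0// invf_lt1// ltr1n.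
move=> /cvg_expr/cvgr0Pnorm_lt/(_ _ rL)[K _ KP].
have rK : (2^-1 : R) ^+ K < r / L.
  by have := KP K (leqnn K); rewrite /= ger0_norm ?exprn_ge0.
have K4 : (0 : R) < 4 ^+ K by rewrite exprn_gt0.
rewrite -(ler_pM2r (_ : 0 < (4 ^+ K)^-1)) ?invr_gt0//.
apply: le_trans (normG K) _.
(* [E] is [g] minus its affine approximation at the common point; the affine part has zero boundary
   integral. *)
pose E := fun w => g w - (g (p +i* q) + d * (w - p +i* q)).
have clin : cont_rect (fun w => g (p +i* q) + d * (w - p +i* q)) (pos K).1
   ((pos K).1 + ln K) (pos K).2 ((pos K).2 + hn K).
  move=> x y _ _; apply: cder_cont; apply: cderD; first exact: cder_cst.
  by apply: cderZ; apply: cderD; [exact: cder_id|exact: cder_cst].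
have -> : G K (pos K) = rect_int E (pos K).1 ((pos K).1 + ln K) (pos K).2 ((pos K).2 + hn K).
  have l1 : (pos K).1 <= (pos K).1 + ln K by rewrite lerDl.
  have l2 : (pos K).2 <= (pos K).2 + hn K by rewrite lerDl.
  by rewrite /E (rect_intB l1 l2 (@cont_sub K) clin) (rect_int_lin _ _ _ l1 l2) subr0.
set t := (2^-1 : R) ^+ K in rK.
have t0 : 0 < t by rewrite exprn_gt0// invr_gt0.
have lK : ln K = l * t by rewrite /ln /t exprVn.
have hK : hn K = h * t by rewrite /hn /t exprVn.
have tt : (4 ^+ K)^-1 = t ^+ 2.
  by rewrite /t -exprM mulnC exprM -exprVn; congr (_ ^+ K); field.
have := @rect_int_bound E (pos K).1 ((pos K).1 + ln K) (pos K).2 ((pos K).2 + hn K)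
  (e / (2 * L ^+ 2) * (L * t)).
rewrite !lerDl (ln0 K) (hn0 K) => /(_ isT isT) H.
apply: le_trans (H _ _) _.
- move=> x y hx hy; have := cvgB (@cont_sub K x y hx hy) (clin x y hx hy); exact.
- move=> x y hx hy.
  have d1 : normc (x +i* y - p +i* q) <= L * t.
    apply: le_trans (normc_le_ReIm _) _ => /=.
    have := pP K; have := qP K; rewrite lK hK in hx hy * => q1 p1.
    have s1 : `|x - p| <= l * t by rewrite ler_norml; lra.
    have s2 : `|y - q| <= h * t by rewrite ler_norml; lra.
    rewrite /L; lra.
  have := rP (x +i* y); rewrite /E.
  have -> : g (x +i* y) - (g (p +i* q) + d * (x +i* y - p +i* q)) =
    g (x +i* y) - g (p +i* q) - d * (x +i* y - p +i* q) by ring.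
  move=> R1; apply: le_trans (R1 _) _.
    apply: le_lt_trans d1 _; rewrite mulrC -ltr_pdivlMr//.
  by rewrite ler_wpM2l// ltW.
- have dA (u v : R) : u + v - u = v by ring.
  rewrite !dA lK hK tt.
  apply: (@le_trans _ _ (2 * (e / (2 * L ^+ 2) * (L * t)) * (L * t))).
    apply: ler_wpM2l; last by rewrite -mulrDl ler_wpM2r ?(ltW t0)// /L lerDl.
    have Lt0 : 0 < L * t by rewrite mulr_gt0.
    by rewrite mulr_ge0// mulr_ge0 ?(ltW e10) ?(ltW Lt0).
  by rewrite le_eqVlt; apply/orP; left; apply/eqP; field; rewrite gt_eqF.
Qed.

End Bisection.

End Goursat.

Section ToC.
Context {R : realType}.
Implicit Types (a b : R) (z w : R[i]).

Lemma toCM a b : (a * b)%:C = a%:C * b%:C :> R[i].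
Proof. exact: rmorphM. Qed.

Lemma toCD a b : (a + b)%:C = a%:C + b%:C :> R[i].
Proof. exact: rmorphD. Qed.

Lemma toCB a b : (a - b)%:C = a%:C - b%:C :> R[i].
Proof. exact: rmorphB. Qed.

Lemma toCX a n : (a ^+ n)%:C = a%:C ^+ n :> R[i].
Proof. exact: rmorphXn. Qed.

Lemma toCV a : (a^-1)%:C = (a%:C)^-1 :> R[i].
Proof. exact: fmorphV. Qed.

Lemma toC_neq0 a : a != 0 -> a%:C != 0 :> R[i].
Proof. by apply: contra_neq => /complexI. Qed.

Lemma conjM z w : conjc (z * w) = conjc z * conjc w.
Proof. exact: rmorphM. Qed.

End ToC.

(** * Means over the circle and Fourier coefficients *)

Section Averages.
Context {R : realType}.
Implicit Types (g h : R -> R[i]) (u v : R -> R).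
Local Notation Re := complex.Re.
Local Notation Im := complex.Im.

(** Closed at both ends, so that compactness makes continuous functions integrable; it differs from
    the interval in [circle_measure] by one null point. *)
Definition D2 : set (measurableTypeR R) := itv 0 (2 * pi).
Definition avg g : R[i] := ((2 * pi)^-1)%:C * cI lam D2 g.
Definition ravg u : R := (2 * pi)^-1 * rI lam D2 u.
Definition aL1 g := cL1 lam D2 g.
Definition rL1 u := L1 lam D2 u.
Definition ameas g := cmeas D2 g.

Lemma pi2_gt0 : 0 < 2 * pi :> R.
Proof. by rewrite mulr_gt0 ?pi_gt0. Qed.

Lemma pi2_ge0 : 0 <= 2 * pi :> R.
Proof. exact/ltW/pi2_gt0. Qed.

Lemma mD2 : measurable D2. Proof. exact: mitv. Qed.
Lemma fD2 : (lam D2 < +oo)%E. Proof. exact: lam_itv_fin. Qed.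
#[local] Hint Resolve mD2 fD2 : core.

Lemma lamD2 : fine (lam D2) = 2 * pi.
Proof. by rewrite lam_itv ?subr0 ?pi2_ge0. Qed.

Lemma eq_avg g h : (forall t, g t = h t) -> avg g = avg h.
Proof. by move=> gh; congr (_ * _); apply: eq_cI => t _; exact: gh. Qed.

Lemma eq_ravg u v : (forall t, u t = v t) -> ravg u = ravg v.
Proof. by move=> gh; congr (_ * _); apply: eq_rI => t _; exact: gh. Qed.

Lemma eq_aL1 g h : (forall t, g t = h t) -> aL1 g -> aL1 h.
Proof. by move=> gh; apply: eq_cL1 => // t _; exact: gh. Qed.

Lemma eq_rL1 u v : (forall t, u t = v t) -> rL1 u -> rL1 v.
Proof. by move=> gh; apply: eq_L1 => // t _; exact: gh. Qed.

Lemma avgD g h : aL1 g -> aL1 h -> avg (fun t => g t + h t) = avg g + avg h.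
Proof. by move=> ? ?; rewrite /avg cID// mulrDr. Qed.

Lemma avgB g h : aL1 g -> aL1 h -> avg (fun t => g t - h t) = avg g - avg h.
Proof. by move=> ? ?; rewrite /avg cIB// mulrBr. Qed.

Lemma avgZ c g : aL1 g -> avg (fun t => c * g t) = c * avg g.
Proof. by move=> ?; rewrite /avg cIZ// mulrCA. Qed.

Lemma avg_cst c : avg (fun=> c) = c.
Proof.
by rewrite /avg cI_cst// lamD2 mulrCA -rmorphM/= mulVf ?rmorph1 ?mulr1// gt_eqF// pi2_gt0.
Qed.

Lemma avg_sum n (F : 'I_n -> R -> R[i]) : (forall i, aL1 (F i)) ->
  avg (fun t => \sum_(i < n) F i t) = \sum_(i < n) avg (F i).
Proof. by move=> hF; rewrite /avg cI_sum// mulr_sumr. Qed.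

Lemma avg_real u : avg (fun t => (u t)%:C) = (ravg u)%:C.
Proof. by rewrite /avg cI_real// -rmorphM. Qed.

Lemma avg_conj g : aL1 g -> avg (fun t => conjc (g t)) = conjc (avg g).
Proof.
by move=> hg; rewrite /avg cI_conj// conjM; congr (_ * _); exact/esym/conjc_real.
Qed.

Lemma Re_avg g : Re (avg g) = ravg (fun t => Re (g t)).
Proof. by rewrite /avg Re_mul /= mul0r subr0. Qed.

Lemma aL1D g h : aL1 g -> aL1 h -> aL1 (fun t => g t + h t).
Proof. by move=> *; exact: cL1D. Qed.

Lemma aL1B g h : aL1 g -> aL1 h -> aL1 (fun t => g t - h t).
Proof. by move=> *; exact: cL1B. Qed.

Lemma aL1Z c g : aL1 g -> aL1 (fun t => c * g t).
Proof. by move=> *; exact: cL1Z. Qed.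

Lemma aL1_cst c : aL1 (fun=> c).
Proof. exact: cL1_cst. Qed.

Lemma aL1M g h M : aL1 g -> ameas h -> (forall t, normc (h t) <= M) ->
  aL1 (fun t => g t * h t).
Proof. by move=> hg mh hM; apply: cL1M => //; exists M => t _; exact: hM. Qed.

Lemma aL1_bdd g M : ameas g -> (forall t, normc (g t) <= M) -> aL1 g.
Proof. by move=> mg gM; apply: cL1_bdd => //; exists M => t _; exact: gM. Qed.

Lemma aL1_meas g : aL1 g -> ameas g.
Proof. exact: cL1_meas. Qed.

Lemma aL1_normc g : aL1 g -> rL1 (fun t => normc (g t)).
Proof. by move=> hg; exact: cL1_normc. Qed.

Lemma aL1_real u : rL1 u -> aL1 (fun t => (u t)%:C).
Proof. by move=> hu; exact: cL1_real. Qed.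

Lemma aL1_Re g : aL1 g -> rL1 (fun t => Re (g t)).
Proof. by case. Qed.

Lemma continuous_ameas g : continuous g -> ameas g.
Proof.
move=> cg; split; apply: measurable_funTS; apply: continuous_measurable_fun => t.
  by apply: cvg_Re; exact: cg.
by apply: cvg_Im; exact: cg.
Qed.

Lemma continuous_aL1 g : continuous g -> aL1 g.
Proof. by move=> cg; apply: contI_cL1 => t _; exact: cg. Qed.

Lemma continuous_rL1 u : continuous u -> rL1 u.
Proof. by move=> cu; apply: contI_L1 => t _; exact: cu. Qed.

Lemma rL1D u v : rL1 u -> rL1 v -> rL1 (fun t => u t + v t).
Proof. by move=> *; exact: L1D. Qed.

Lemma rL1B u v : rL1 u -> rL1 v -> rL1 (fun t => u t - v t).
Proof. by move=> *; exact: L1B. Qed.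

Lemma rL1Z c u : rL1 u -> rL1 (fun t => c * u t).
Proof. by move=> *; exact: L1Z. Qed.

Lemma rL1_cst c : rL1 (fun=> c).
Proof. exact: L1_cst. Qed.

Lemma rL1_norm u : rL1 u -> rL1 (fun t => `|u t|).
Proof. exact: L1_norm. Qed.

Lemma rL1_meas u : rL1 u -> measurable_fun D2 u.
Proof. exact: L1_meas. Qed.

Lemma rL1_le u v : measurable_fun D2 u -> (forall t, `|u t| <= v t) -> rL1 v -> rL1 u.
Proof. by move=> mu uv; apply: L1_le => // t _; exact: le_trans (uv t) (ler_norm _). Qed.

Lemma rL1_bdd u M : measurable_fun D2 u -> (forall t, `|u t| <= M) -> rL1 u.
Proof. by move=> mu uM; apply: (rL1_le mu uM); exact: rL1_cst. Qed.

Lemma rL1M u v M : rL1 u -> measurable_fun D2 v -> (forall t, `|v t| <= M) ->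
  rL1 (fun t => u t * v t).
Proof. by move=> hu mv vM; apply: L1M => //; exists M => t _; exact: vM. Qed.

Lemma ravgD u v : rL1 u -> rL1 v -> ravg (fun t => u t + v t) = ravg u + ravg v.
Proof. by move=> ? ?; rewrite /ravg rID// mulrDr. Qed.

Lemma ravgB u v : rL1 u -> rL1 v -> ravg (fun t => u t - v t) = ravg u - ravg v.
Proof. by move=> ? ?; rewrite /ravg rIB// mulrBr. Qed.

Lemma ravgZ c u : rL1 u -> ravg (fun t => c * u t) = c * ravg u.
Proof. by move=> ?; rewrite /ravg rIZ// mulrCA. Qed.

Lemma ravg_cst c : ravg (fun=> c) = c.
Proof. by rewrite /ravg rI_cst// lamD2 mulrCA mulVf ?mulr1// gt_eqF// pi2_gt0. Qed.

Lemma ravg_ge0 u : (forall t, 0 <= u t) -> 0 <= ravg u.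
Proof.
move=> u0; rewrite mulr_ge0 ?invr_ge0 ?pi2_ge0//.
by apply: rI_ge0 => t _; exact: u0.
Qed.

Lemma le_ravg u v : rL1 u -> rL1 v -> (forall t, u t <= v t) -> ravg u <= ravg v.
Proof.
move=> hu hv uv; rewrite ler_wpM2l ?invr_ge0 ?pi2_ge0//.
by apply: le_rI => // t _; exact: uv.
Qed.

Lemma normc_avg_le g : aL1 g -> normc (avg g) <= ravg (fun t => normc (g t)).
Proof.
move=> hg; rewrite /avg normcM normcR ger0_norm ?invr_ge0 ?pi2_ge0//.
by rewrite ler_wpM2l ?invr_ge0 ?pi2_ge0//; exact: normc_cI_le.
Qed.

Lemma avg_bound g M : aL1 g -> (forall t, normc (g t) <= M) -> normc (avg g) <= M.
Proof.
move=> hg gM; apply: le_trans (normc_avg_le hg) _; rewrite -[leRHS]ravg_cst.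
by apply: le_ravg => //; [exact: aL1_normc|exact: rL1_cst].
Qed.

Lemma ravg_dominated (f_ : nat -> R -> R) (f v : R -> R) :
  (forall n, measurable_fun D2 (f_ n)) -> measurable_fun D2 f ->
  {ae lam, forall t, D2 t -> f_ ^~ t @ \oo --> f t} -> rL1 v ->
  (forall n t, `|f_ n t| <= v t) ->
  rL1 f /\ (fun n => ravg (f_ n)) @ \oo --> ravg f.
Proof.
move=> mf_ mf cf hv fv.
have [|i c] := @rI_dominated _ _ _ lam D2 mD2 f_ f v mf_ mf cf hv.
  by move=> n t _; exact: fv.
by split; [exact: i|apply: cvgM; [exact: cvg_cst|exact: c]].
Qed.

End Averages.
#[export] Hint Resolve mD2 fD2 : core.

Section FourierCoefficients.
Context {R : realType}.
Local Notation Re := complex.Re.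
Local Notation Im := complex.Im.

Definition holo (f : R[i] -> R[i]) := forall z, normc z < 1 -> exists d, cder f z d.

Lemma normc_circ (r t : R) : 0 <= r -> normc (r%:C * expi t) = r.
Proof. by move=> r0; rewrite normcM normc_expi mulr1 normcR ger0_norm. Qed.

Lemma continuous_expiM (m : R) : continuous (fun t : R => expi (m * t)).
Proof.
move=> t; apply: (@continuous_comp R R R[i] (fun t => m * t) expi).
  by apply: cvgM; [exact: cvg_cst|exact: cvg_id].
exact: continuous_expi.
Qed.

Lemma continuous_circ (r : R) : continuous (fun t : R => r%:C * expi t).
Proof. by move=> t; apply: cvgCM; [exact: cvg_cst|exact: continuous_expi]. Qed.

Lemma continuousCM (g h : R -> R[i]) : continuous g -> continuous h ->
  continuous (fun t => g t * h t).
Proof. by move=> cg ch t; apply: cvgCM; [exact: cg|exact: ch]. Qed.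

Lemma holo_circ f (r : R) : holo f -> 0 <= r < 1 -> continuous (fun t : R => f (r%:C * expi t)).
Proof.
move=> hf /andP[r0 r1] t.
have [|d /cder_cont fc] := hf (r%:C * expi t); first by rewrite normc_circ.
apply: (@continuous_comp R R[i] R[i] (fun t => r%:C * expi t) f); last exact: fc.
exact: continuous_circ.
Qed.

(** In the coordinate [w = ln r + i t] the function [f(e^w) e^(m w)] is holomorphic for [Re w < 0].
    Goursat's lemma applies on [[x1, x2] * [0, 2 pi]]; the horizontal sides cancel by periodicity
    and the vertical ones are the two means. *)
Lemma polar_const f (m x1 x2 : R) : holo f -> expi (m * (2 * pi)) = 1 :> R[i] ->
  x1 <= x2 -> x2 < 0 ->
  (expR (m * x1))%:C * avg (fun t => f ((expR x1)%:C * expi t) * expi (m * t)) =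
  (expR (m * x2))%:C * avg (fun t => f ((expR x2)%:C * expi t) * expi (m * t)).
Proof.
move=> hf mp x12 x20.
pose g w := f (cexp w) * cexp (m%:C * w).
have ex (x : R) : x < 0 -> 0 <= expR x < 1 by move=> x0; rewrite expR_ge0 expR_lt1.
have dg z : x1 <= Re z <= x1 + (x2 - x1) -> 0 <= Im z <= 0 + 2 * pi ->
    exists d, cder g z d.
  move=> h _; have Rz : Re z < 0 by lra.
  have [|d fd] := hf (cexp z); first by rewrite normc_cexp; case/andP: (ex _ Rz).
  eexists; apply: cderM; first exact: (cder_comp (cder_cexp z) fd).
  by apply: (cder_comp (cderZ _ (cder_id z))); exact: cder_cexp.
have := @goursat R g x1 0 (x2 - x1) (2 * pi) _ pi2_ge0 dg.
rewrite subr_ge0 add0r => /(_ x12); rewrite addrC subrK /rect_int.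
have -> : ci x1 x2 (fun x => g (x +i* 0)) = ci x1 x2 (fun x => g (x +i* (2 * pi))).
  apply: eq_ci => x _; rewrite /g /cexp !Re_mul !Im_mul /= !mulr0 !mul0r !subr0 !addr0.
  rewrite mp; have -> : expi (2 * pi) = 1 :> R[i] by rewrite -[2 * pi]add0r expi2pi expi0.
  by rewrite expi0.
rewrite subrr add0r => /eqP; rewrite mulf_eq0.
have -> : ('i == 0 :> R[i]) = false.
  by apply/negbTE/eqP => /(congr1 (@complex.Im R))/= /eqP; rewrite oner_eq0.
rewrite /= subr_eq0 => /eqP E.
have H x : x < 0 -> ((2 * pi)^-1)%:C * ci 0 (2 * pi) (fun y => g (x +i* y)) =
  (expR (m * x))%:C * avg (fun t => f ((expR x)%:C * expi t) * expi (m * t)).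
  move=> x0; rewrite -avgZ; last first.
    apply: continuous_aL1; apply: continuousCM; last exact: continuous_expiM.
    exact/holo_circ/ex.
  congr (_ * _); apply: eq_ci => y _.
  rewrite /g /cexp !Re_mul !Im_mul /= !mul0r !subr0 !addr0; ring.
by rewrite -!H ?E//; exact: le_lt_trans x12 x20.
Qed.

(* locked, since otherwise rewriting with ring laws unfolds it *)
Definition coef (f : R[i] -> R[i]) : nat -> R[i] := locked (fun n =>
  avg (fun t => f ((2^-1)%:C * expi t) * expi (- n%:R * t)) * 2%:C ^+ n).

Lemma expi_nat n : expi (n%:R * (2 * pi)) = 1 :> R[i].
Proof.
elim: n => [|n IH]; first by rewrite mul0r expi0.
by rewrite -[n.+1]addn1 natrD mulrDl mul1r expi2pi.
Qed.

Lemma polar_const_r f (m r s : R) : holo f -> expi (m * (2 * pi)) = 1 :> R[i] ->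
  0 < r < 1 -> 0 < s < 1 ->
  (r `^ m)%:C * avg (fun t => f (r%:C * expi t) * expi (m * t)) =
  (s `^ m)%:C * avg (fun t => f (s%:C * expi t) * expi (m * t)).
Proof.
move=> hf mp /andP[r0 r1] /andP[s0 s1].
have E (x : R) : 0 < x -> x = expR (ln x) by move=> x0; rewrite lnK.
wlog rs : r s r0 r1 s0 s1 / r <= s.
  move=> W; have [/W|/ltW/W W2] := leP r s; first exact.
  by apply/esym/W2.
rewrite /powR !gt_eqF//.
have lrs : ln r <= ln s by rewrite ler_ln.
have ls : ln s < 0 by rewrite ln_lt0// s0.
by have := polar_const hf mp lrs ls; rewrite !lnK.
Qed.

Lemma coefP f n (r : R) : holo f -> 0 < r < 1 ->
  avg (fun t => f (r%:C * expi t) * expi (- n%:R * t)) = coef f n * r%:C ^+ n.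
Proof.
move=> hf r01; have /andP[r0 r1] := r01.
have h01 : 0 < (2^-1 : R) < 1 by rewrite invr_gt0 ltr0n invf_lt1 ?ltr1n.
have := polar_const_r hf (_ : expi (- n%:R * (2 * pi)) = 1) r01 h01.
rewrite mulNr expiN expi_nat invr1 => /(_ erefl).
rewrite !powRN !powR_mulrn ?ltW// ?invr_ge0// /coef -lock exprVn invrK.
set A := avg _; set B := avg _ => E.
have r0n : r ^+ n != 0 by rewrite expf_neq0// gt_eqF.
have -> : A = (r ^+ n)%:C * ((r ^- n)%:C * A) by rewrite mulrA -toCM divff// mul1r.
by rewrite E !toCX; ring.
Qed.

(** [r^(n+1)] times the mean does not depend on [r], and it is at most [s M] on a small circle of
    radius [s], since [f] is bounded near 0. *)
Lemma coefN f n (r : R) : holo f -> 0 < r < 1 ->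
  avg (fun t => f (r%:C * expi t) * expi (n.+1%:R * t)) = 0.
Proof.
move=> hf r01; have /andP[r0 r1] := r01.
have [|d /cder_cont] := hf 0; first by rewrite normc0 ltr01.
move=> /cvgCP/(_ 1 ltr01)/cvg_cnear[s0 s00 sP].
set M := normc (f 0) + 1.
have M0 : 0 < M by rewrite ltr_wpDl ?normc_ge0.
set A := avg _.
have H s : 0 < s -> s < s0 -> s < 1 -> normc ((r `^ n.+1%:R)%:C * A) <= s * M.
  move=> s_0 s_s s1.
  have s01 : 0 < s < 1 by rewrite s_0.
  rewrite (polar_const_r hf (expi_nat n.+1) r01 s01) normcM normcR.
  rewrite ger0_norm ?powR_ge0// powR_mulrn ?(ltW s_0)//.
  apply: ler_pM; rewrite ?normc_ge0 ?exprn_ge0 ?(ltW s_0)//.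
    by rewrite -[leRHS]expr1 ler_wiXn2l// ?ltW.
  apply: avg_bound.
    apply: continuous_aL1; apply: continuousCM; last exact: continuous_expiM.
    by apply: holo_circ => //; rewrite ltW.
  move=> t; rewrite normcM normc_expi mulr1.
  have := sP (s%:C * expi t); rewrite subr0 normc_circ ?(ltW s_0)// => /(_ s_s).
  have := le_normcD (f (s%:C * expi t) - f 0) (f 0); rewrite subrK /M; lra.
have : normc ((r `^ n.+1%:R)%:C * A) = 0.
  apply/eqP; rewrite eq_le normc_ge0 andbT; apply/ler_addgt0Pr => e e0; rewrite add0r.
  set s := Num.min (Num.min (s0 / 2) (1 / 2)) (e / M).
  have s_0 : 0 < s by rewrite !lt_min !divr_gt0.
  have s_1 : s <= s0 / 2 by rewrite !ge_min lexx.
  have s_2 : s <= 1 / 2 by rewrite !ge_min lexx orbT.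
  have s_3 : s <= e / M by rewrite ge_min lexx orbT.
  apply: le_trans (H s s_0 _ _) _; [lra|lra|].
  by rewrite -ler_pdivlMr.
move/eq0_normc/eqP; rewrite mulf_eq0 => /orP[/eqP/complexI/eqP|/eqP//].
by rewrite gt_eqF// powR_gt0.
Qed.

End FourierCoefficients.

Section ComplexLimits.
Context {R : realType}.
Implicit Types (z w : R[i]).

(** The centre [l] in the hypothesis may depend on [e]: this is Cauchy's criterion, reduced to the
    two real components. *)
Lemma complex_cauchy {T : Type} {F : set_system T} {FF : ProperFilter F} (u : T -> R[i]) :
  (forall e : R, 0 < e -> exists l, \forall t \near F, normc (u t - l) < e) ->
  exists l : R[i], u @ F --> l.
Proof.
move=> h.
have hr (p : R[i] -> R) : (forall z w, `|p z - p w| <= normc (z - w)) ->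
    exists l : R, (fun t => p (u t)) @ F --> l.
  move=> hp; apply/cvg_ex/cauchy_cvgP/cauchy_exP => e e0.
  have [l hl] := h e e0; exists (p l); rewrite /= nbhs_simpl /=.
  by apply: filterS hl => t ht; rewrite /ball /= distrC; exact: le_lt_trans (hp _ _) ht.
have [a ha] : exists l : R, (fun t => complex.Re (u t)) @ F --> l.
  by apply: hr => z w; rewrite -raddfB; exact: Re_le_normc.
have [b hb] : exists l : R, (fun t => complex.Im (u t)) @ F --> l.
  by apply: hr => z w; rewrite -raddfB; exact: Im_le_normc.
by exists (a +i* b); apply: cvg_ReIm.
Qed.

Lemma normc_lim_le {T : Type} {F : set_system T} {FF : ProperFilter F} (u : T -> R[i]) l (M : R) :
  u @ F --> l -> (\forall t \near F, normc (u t) <= M) -> normc l <= M.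
Proof.
move=> /cvg_normc ul uM; apply: (@closed_cvg _ _ F FF _ (fun t => t <= M) _ uM _ ul).
exact: closed_le.
Qed.

Lemma cvgC_uniq {T : Type} {F : set_system T} {FF : ProperFilter F} (u : T -> R[i]) (a b : R[i]) :
  u @ F --> a -> u @ F --> b -> a = b.
Proof. by move=> ha hb; apply: (cvg_unique _ ha hb). Qed.

Lemma geo_sum (q : R) n : (\sum_(i < n) q ^+ i) * (1 - q) = 1 - q ^+ n.
Proof.
elim: n => [|n IH]; first by rewrite big_ord0 mul0r expr0 subrr.
by rewrite big_ord_recr /= mulrDl IH exprSr; ring.
Qed.

Lemma geo_le (q : R) n : 0 <= q < 1 -> \sum_(i < n) q ^+ i <= (1 - q)^-1.
Proof.
move=> /andP[q0 q1]; rewrite -[leRHS]mul1r ler_pdivlMr ?subr_gt0//.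
by rewrite geo_sum gerBl exprn_ge0.
Qed.

End ComplexLimits.

(** * Power series in the unit disc *)

Section PowerSeries.
Context {R : realType}.
Implicit Types (a b : nat -> R[i]) (z w : R[i]).

Definition psum a N z : R[i] := \sum_(n < N) a n * z ^+ n.
(** Radius of convergence at least 1, in the form of Abel's lemma: boundedness at every smaller
    radius, from which geometric tails follow. *)
Definition radius1 a := forall r : R, 0 < r < 1 -> exists C : R, forall n, normc (a n) * r ^+ n <= C.
Definition pser a z : R[i] := get [set l | psum a ^~ z @ \oo --> l].

Lemma normc_sum n (F : 'I_n -> R[i]) : normc (\sum_(i < n) F i) <= \sum_(i < n) normc (F i).
Proof.
elim: n F => [|n IH] F; first by rewrite !big_ord0 normc0.
rewrite !big_ord_recr /=; apply: le_trans (le_normcD _ _) _.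
by rewrite lerD2r.
Qed.

Lemma psumS a N z : psum a N.+1 z = psum a N z + a N * z ^+ N.
Proof. by rewrite /psum big_ord_recr. Qed.

Lemma psum_abs_le a z (s r C : R) N : 0 < s -> (forall n, normc (a n) * s ^+ n <= C) ->
  0 <= r < s -> \sum_(n < N) normc (a n) * r ^+ n <= C / (1 - r / s).
Proof.
move=> s0 aC /andP[r0 rs].
have q01 : 0 <= r / s < 1 by rewrite divr_ge0 ?(ltW s0)//= ltr_pdivrMr// mul1r.
have C0 : 0 <= C by apply: le_trans (aC 0%N); rewrite mulr_ge0 ?normc_ge0.
apply: (@le_trans _ _ (C * \sum_(n < N) (r / s) ^+ n)).
  rewrite mulr_sumr; apply: ler_sum => n _.
  have -> : normc (a n) * r ^+ n = normc (a n) * s ^+ n * (r / s) ^+ n.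
    by rewrite -mulrA -exprMn mulrCA divff ?mulr1// gt_eqF.
  by apply: ler_wpM2r => //; rewrite exprn_ge0//; case/andP: q01.
by rewrite ler_wpM2l// geo_le.
Qed.

Lemma psum_tail a z (s C : R) N k : 0 < s -> (forall n, normc (a n) * s ^+ n <= C) ->
  normc z < s ->
  normc (psum a (N + k) z - psum a N z) <= C / (1 - normc z / s) * (normc z / s) ^+ N.
Proof.
move=> s0 aC zs; set q := normc z / s.
have q01 : 0 <= q < 1 by rewrite divr_ge0 ?normc_ge0 ?(ltW s0)//= ltr_pdivrMr// mul1r.
have q0 : 0 <= q by case/andP: q01.
have C0 : 0 <= C by apply: le_trans (aC 0%N); rewrite mulr_ge0 ?normc_ge0.
have H : normc (psum a (N + k) z - psum a N z) <= C * q ^+ N * \sum_(i < k) q ^+ i.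
  elim: k => [|k IH]; first by rewrite addn0 subrr normc0 big_ord0 mulr0.
  rewrite addnS psumS addrAC big_ord_recr /= mulrDr; apply: le_trans (le_normcD _ _) _.
  apply: lerD => //; rewrite -mulrA -exprD normcM normcX.
  have -> : normc z ^+ (N + k) = s ^+ (N + k) * q ^+ (N + k).
    by rewrite -exprMn mulrC divfK// gt_eqF.
  by rewrite mulrA ler_wpM2r// exprn_ge0.
apply: le_trans H _; rewrite mulrAC; apply: ler_wpM2r; first by rewrite exprn_ge0.
by rewrite ler_wpM2l// geo_le.
Qed.

Lemma mid_lt (r : R) : 0 <= r < 1 -> [/\ r < (1 + r) / 2, 0 < (1 + r) / 2 & (1 + r) / 2 < 1].
Proof. by move=> /andP[]; split; lra. Qed.

Lemma pserP a z : radius1 a -> normc z < 1 -> psum a ^~ z @ \oo --> pser a z.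
Proof.
move=> ra z1; have [|zs s0 s1] := @mid_lt (normc z); first by rewrite normc_ge0.
set s := (1 + _) / 2 in zs s0 s1.
have [|C aC] := ra s; first by rewrite s0.
have q0 : 0 <= normc z / s by rewrite divr_ge0 ?normc_ge0 ?(ltW s0).
have q01 : `|normc z / s| < 1 by rewrite (ger0_norm q0) ltr_pdivrMr// mul1r.
have [l lP] : exists l : R[i], psum a ^~ z @ \oo --> l.
  apply: complex_cauchy => e e0.
  have : (fun N => C / (1 - normc z / s) * (normc z / s) ^+ N) @ \oo --> (0 : R).
    by rewrite -[X in _ --> X](mulr0 (C / (1 - normc z / s))); apply: cvgMl_tmp; exact: cvg_expr.
  move=> /cvgr0Pnorm_lt/(_ e e0)[N _ NP].
  exists (psum a N z); exists N => // m /= Nm.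
  rewrite -(subnKC Nm); apply: le_lt_trans (psum_tail _ _ s0 aC zs) _.
  by apply: le_lt_trans (ler_norm _) _; exact: (NP N (leqnn N)).
by have := @getPex _ [set l : R[i] | psum a ^~ z @ \oo --> l] (ex_intro _ l lP); exact.
Qed.

Lemma pser_tail a z (s C : R) N : radius1 a -> 0 < s < 1 ->
  (forall n, normc (a n) * s ^+ n <= C) -> normc z < s ->
  normc (pser a z - psum a N z) <= C / (1 - normc z / s) * (normc z / s) ^+ N.
Proof.
move=> ra /andP[s0 s1] aC zs; have z1 := lt_trans zs s1.
apply: (@normc_lim_le _ _ \oo _ (fun M => psum a M z - psum a N z)).
  by apply: cvgB; [exact: pserP|exact: cvg_cst].
exists N => // m /= Nm; rewrite -(subnKC Nm); exact: psum_tail.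
Qed.

(** The remainder is a polynomial in [z] and [h] with nonnegative coefficients and of order at least
    2 in [h]; hence it is dominated by its value at [normc z] and [eta], scaled by
    [(|h| / eta)^2]. *)
Lemma pow_remainder z h (eta : R) n : 0 < eta -> normc h <= eta ->
  normc ((z + h) ^+ n - z ^+ n - n%:R * z ^+ n.-1 * h) <=
  (normc h / eta) ^+ 2 * ((normc z + eta) ^+ n - normc z ^+ n - n%:R * normc z ^+ n.-1 * eta).
Proof.
move=> e0 he; set A := normc z; set t := normc h / eta.
have A0 : 0 <= A by exact: normc_ge0.
elim: n => [|n IH]; first by rewrite !expr0 !mul0r subrr !subr0 normc0 subrr mulr0.
have -> : (z + h) ^+ n.+1 - z ^+ n.+1 - n.+1%:R * z ^+ n.+1.-1 * h =
  (z + h) * ((z + h) ^+ n - z ^+ n - n%:R * z ^+ n.-1 * h) + n%:R * z ^+ n.-1 * h ^+ 2.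
  case: n {IH} => [|n]; first by rewrite !expr0 !mul0r !expr1 /=; ring.
  by rewrite /= !exprS -[n.+2]addn1 natrD; ring.
have -> : (A + eta) ^+ n.+1 - A ^+ n.+1 - n.+1%:R * A ^+ n.+1.-1 * eta =
  (A + eta) * ((A + eta) ^+ n - A ^+ n - n%:R * A ^+ n.-1 * eta) + n%:R * A ^+ n.-1 * eta ^+ 2.
  case: n {IH} => [|n]; first by rewrite !expr0 !mul0r !expr1 /=; ring.
  by rewrite /= !exprS -[n.+2]addn1 natrD; ring.
apply: le_trans (le_normcD _ _) _; rewrite [leRHS]mulrDr; apply: lerD.
  rewrite normcM [leRHS]mulrCA; apply: ler_pM; rewrite ?normc_ge0//.
  by apply: le_trans (le_normcD _ _) _; rewrite lerD2l.
rewrite !normcM !normcX -/A.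
have -> : normc (n%:R : R[i]) = n%:R.
  by rewrite (_ : n%:R = (n%:R : R)%:C) ?normcR ?ger0_norm// rmorph_nat.
by rewrite le_eqVlt; apply/orP; left; apply/eqP; rewrite /t; field; rewrite gt_eqF.
Qed.

Lemma pow_remainder_le z h (eta : R) n : 0 < eta -> normc h <= eta ->
  normc ((z + h) ^+ n - z ^+ n - n%:R * z ^+ n.-1 * h) <=
  (normc h / eta) ^+ 2 * (normc z + eta) ^+ n.
Proof.
move=> e0 he; apply: le_trans (pow_remainder z n e0 he) _.
apply: ler_wpM2l; first exact: sqr_ge0.
by rewrite -addrA gerDl -opprD oppr_le0 addr_ge0 ?mulr_ge0 ?exprn_ge0 ?normc_ge0// ltW.
Qed.

Lemma npow_le (x eta : R) n : 0 <= x -> 0 < eta -> n%:R * x ^+ n.-1 * eta <= (x + eta) ^+ n.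
Proof.
move=> x0 e0; elim: n => [|n IH]; first by rewrite !mul0r expr0 ler01.
rewrite exprS mulrDl /=.
have h1 : x ^+ n * eta <= eta * (x + eta) ^+ n.
  by rewrite mulrC ler_wpM2l ?(ltW e0)// lerXn2r ?nnegrE ?addr_ge0 ?(ltW e0)// lerDl ltW.
have h2 : n%:R * x ^+ n * eta <= x * (x + eta) ^+ n.
  case: n IH {h1} => [|n] IH; first by rewrite !mul0r expr0 mulr1.
  apply: le_trans (ler_wpM2l x0 IH); rewrite exprS /=; by rewrite !mulrA [x * _]mulrC.
by rewrite -[n.+1]addn1 natrD; lra.
Qed.

Definition pder a n : R[i] := n.+1%:R * a n.+1.

Lemma radius1_pder a : radius1 a -> radius1 (pder a).
Proof.
move=> ra r /andP[r0 r1]; have [|rs s0 s1] := @mid_lt r; first by rewrite ltW.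
set s := (1 + r) / 2 in rs s0 s1.
have [|C aC] := ra s; first by rewrite s0.
exists (C / (s - r)) => n; rewrite /pder normcM.
have -> : normc (n.+1%:R : R[i]) = n.+1%:R.
  by rewrite (_ : n.+1%:R = (n.+1%:R : R)%:C) ?normcR ?ger0_norm// rmorph_nat.
rewrite ler_pdivlMr ?subr_gt0//.
have := @npow_le r (s - r) n.+1 (ltW r0); rewrite subr_gt0 => /(_ rs).
have -> : r + (s - r) = s by ring.
move=> /= h; apply: le_trans (aC n.+1).
by have := ler_wpM2l (normc_ge0 (a n.+1)) h; lra.
Qed.

Lemma psum_pder a N z w (eta : R) : 0 < eta -> normc (w - z) <= eta ->
  normc (psum a N.+1 w - psum a N.+1 z - psum (pder a) N z * (w - z)) <=
  (normc (w - z) / eta) ^+ 2 * \sum_(n < N.+1) normc (a n) * (normc z + eta) ^+ n.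
Proof.
move=> e0 he.
have -> : psum (pder a) N z = \sum_(n < N.+1) a n * (n%:R * z ^+ n.-1).
  rewrite big_ord_recl /= mul0r mulr0 add0r; apply: eq_bigr => n _.
  by rewrite /pder /bump /= add1n; ring.
rewrite /psum mulr_suml -!sumrB mulr_sumr.
apply: le_trans (normc_sum _) _; apply: ler_sum => n _.
have -> : a n * w ^+ n - a n * z ^+ n - a n * (n%:R * z ^+ n.-1) * (w - z) =
    a n * ((z + (w - z)) ^+ n - z ^+ n - n%:R * z ^+ n.-1 * (w - z)).
  by rewrite (addrC z) subrK; ring.
by rewrite normcM mulrCA ler_wpM2l ?normc_ge0// pow_remainder_le.
Qed.

(** The quadratic bound of [psum_pder] is uniform in the length of the sum and so survives the
    limit; no uniform convergence of the derivatives enters. *)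
Lemma cder_pser a z : radius1 a -> normc z < 1 -> cder (pser a) z (pser (pder a) z).
Proof.
move=> ra z1 e e0.
(* Two intermediate radii: [r] leaves room [eta] for the increment around [z], and the larger [s]
   bounds the coefficients so that the series converges geometrically at [r]. *)
have [|zs s0 s1] := @mid_lt (normc z); first by rewrite normc_ge0.
set r := (1 + _) / 2 in zs s0 s1.
have [|rs t0 t1] := @mid_lt r; first by rewrite (ltW s0).
set s := (1 + r) / 2 in rs t0 t1.
have [|C aC] := ra s; first by rewrite t0.
set eta := r - normc z; have eta0 : 0 < eta by rewrite subr_gt0.
have C0 : 0 <= C by apply: le_trans (aC 0%N); rewrite mulr_ge0 ?normc_ge0.
set K := C / (1 - r / s) + 1.
have K0 : 0 < K.
  by rewrite ltr_wpDl// divr_ge0// subr_ge0 ler_pdivrMr// mul1r ltW.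
exists (Num.min eta (e * eta ^+ 2 / K)).
  by rewrite lt_min eta0 divr_gt0// mulr_gt0// exprn_gt0.
move=> w; rewrite lt_min => /andP[we wK].
have w1 : normc w < 1.
  have := le_normcD (w - z) z; rewrite subrK; move: we; rewrite /eta /r; lra.
have H : normc (pser a w - pser a z - pser (pder a) z * (w - z)) <=
    (normc (w - z) / eta) ^+ 2 * K.
  apply: (@normc_lim_le _ _ \oo _ (fun N => psum a N.+1 w - psum a N.+1 z -
     psum (pder a) N z * (w - z))).
    have cS b x : radius1 b -> normc x < 1 -> (fun N => psum b N.+1 x) @ \oo --> pser b x.
      by move=> rb x1; have := pserP rb x1; rewrite -(cvg_shiftS (psum b ^~ x)).
    apply: cvgB; first by apply: cvgB; exact: cS.
    by apply: cvgCM; [exact/pserP/z1/radius1_pder|exact: cvg_cst].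
  apply: nearW => N; apply: le_trans (psum_pder a N eta0 (ltW we)) _.
  rewrite ler_wpM2l ?sqr_ge0//.
  have -> : normc z + eta = r by rewrite /eta addrC subrK.
  apply: (@le_trans _ _ (C / (1 - r / s))); last by rewrite lerDl.
  by apply: psum_abs_le => //; rewrite (ltW s0).
apply: le_trans H _; set n := normc _.
have -> : (n / eta) ^+ 2 * K = n * K / eta ^+ 2 * n by field; rewrite gt_eqF.
rewrite ler_wpM2r ?normc_ge0// ler_pdivrMr ?exprn_gt0//.
by rewrite -ler_pdivlMr// ltW.
Qed.

Lemma holo_pser a : radius1 a -> holo (pser a).
Proof. by move=> ra z z1; exists (pser (pder a) z); exact: cder_pser. Qed.

Lemma eq_pser a b z : a =1 b -> pser a z = pser b z.
Proof. by move=> /funext ->. Qed.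

End PowerSeries.

(** * Herglotz and Poisson integrals *)

Section Herglotz.
Context {R : realType}.
Implicit Types (z w : R[i]) (t : R) (g : R -> R[i]).
Local Notation Re := complex.Re.
Local Notation Im := complex.Im.

Definition hker z t : R[i] := (expi t + z) / (expi t - z).
Definition herg g z : R[i] := avg (fun t => g t * hker z t).
Definition fc g n : R[i] := avg (fun t => g t * expi (- n%:R * t)).

Lemma continuousCX g n : continuous g -> continuous (fun t => g t ^+ n).
Proof.
move=> cg; elim: n => [|n IH] t; first exact: cvg_cst.
have -> : (fun t => g t ^+ n.+1) = (fun t => g t * g t ^+ n).
  by apply/funext => u; rewrite exprS.
exact: (cvgCM (cg t) (IH t)).
Qed.

Lemma continuousCV g : continuous g -> (forall t, g t != 0) ->
  continuous (fun t => (g t)^-1).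
Proof. by move=> cg g0 t; exact: (cvgCV (g0 t) (cg t)). Qed.

Lemma continuousCB g h : continuous g -> continuous h -> continuous (fun t => g t - h t).
Proof. by move=> cg ch t; exact: (cvgB (cg t) (ch t)). Qed.

Lemma continuousC_cst (c : R[i]) : continuous (fun _ : R => c).
Proof. by move=> t; exact: cvg_cst. Qed.

Lemma Re_mulR (z : R[i]) (a : R) : Re (z * a%:C) = Re z * a.
Proof. by case: z => x y /=; rewrite mulr0 subr0. Qed.

Lemma expi_sub_ge z t : 1 - normc z <= normc (expi t - z).
Proof. by have := normc_distB (expi t) z; rewrite normc_expi. Qed.

Lemma expi_sub_neq0 z t : normc z < 1 -> expi t - z != 0.
Proof.
move=> z1; apply/eqP => h; have := expi_sub_ge z t; rewrite h normc0; lra.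
Qed.

Lemma normc_div (a b : R[i]) : normc (a / b) = normc a / normc b.
Proof. by rewrite normcM normcV. Qed.

Lemma hker_le z t : normc z < 1 -> normc (hker z t) <= 2 / (1 - normc z).
Proof.
move=> z1; rewrite normc_div; have := expi_sub_ge z t => h.
have h1 : normc (expi t + z) <= 2.
  by apply: le_trans (le_normcD _ _) _; rewrite normc_expi; lra.
have z0 : 0 < 1 - normc z by lra.
apply: ler_pM => //; rewrite ?normc_ge0 ?invr_ge0 ?normc_ge0//.
by rewrite lef_pV2// posrE; lra.
Qed.

Lemma continuous_hker z : normc z < 1 -> continuous (hker z).
Proof.
move=> z1 t; apply: cvgCM.
  by apply: cvgD; [exact: continuous_expi|exact: cvg_cst].
apply: cvgCV; first exact: expi_sub_neq0.
by apply: cvgB; [exact: continuous_expi|exact: cvg_cst].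
Qed.

Lemma ameas_hker z : normc z < 1 -> ameas (hker z).
Proof. by move=> z1; apply: continuous_ameas; exact: continuous_hker. Qed.

Lemma aL1_hker z g : normc z < 1 -> aL1 g -> aL1 (fun t => g t * hker z t).
Proof.
move=> z1 hg; apply: (aL1M hg (ameas_hker z1) (fun t => hker_le t z1)).
Qed.

Lemma aL1_expi g (m : R) : aL1 g -> aL1 (fun t => g t * expi (m * t)).
Proof.
move=> hg; apply: (@aL1M _ _ _ 1 hg).
  by apply: continuous_ameas; exact: continuous_expiM.
by move=> t; rewrite normc_expi.
Qed.

Lemma expi_pow z t n : z ^+ n * expi (- n%:R * t) = (z * expi (- t)) ^+ n.
Proof. by rewrite exprMn expiX mulrN mulNr. Qed.

(** With [x = z e^(-it)] the kernel is [(1 + x) / (1 - x)], a geometric series with an explicit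
    remainder. *)
Lemma hker_expand z t N : normc z < 1 ->
  hker z t = 2 * (\sum_(n < N) z ^+ n * expi (- n%:R * t)) - 1
             + 2 * (z * expi (- t)) ^+ N / (1 - z * expi (- t)).
Proof.
move=> z1; under eq_bigr => n _ do rewrite expi_pow.
set x := z * expi (- t).
have zx : z = x * expi t by rewrite /x -mulrA expiN mulVf ?mulr1// expi_neq0.
have e0 := @expi_neq0 R t.
have x1 : 1 - x != 0.
  have := @expi_sub_neq0 z t z1; rewrite zx.
  have -> : expi t - x * expi t = (1 - x) * expi t by ring.
  by rewrite mulf_eq0 negb_or => /andP[].
have -> : hker z t = (1 + x) / (1 - x).
  rewrite /hker zx.
  have -> : expi t + x * expi t = (1 + x) * expi t by ring.
  have -> : expi t - x * expi t = (1 - x) * expi t by ring.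
  by rewrite invfM mulrACA divff ?mulr1.
have S : (\sum_(n < N) x ^+ n) * (1 - x) = 1 - x ^+ N.
  elim: N => [|n IH]; first by rewrite big_ord0 mul0r expr0 subrr.
  by rewrite big_ord_recr /= mulrDl IH exprSr; ring.
apply: (mulIf x1); rewrite mulfVK// !mulrDl mulfVK// -mulrA S; ring.
Qed.

Lemma herg_psum g z N : normc z < 1 -> aL1 g ->
  normc (psum (fc g) N z - (herg g z + avg g) / 2) <=
  ravg (fun t => normc (g t)) / (1 - normc z) * normc z ^+ N.
Proof.
move=> z1 hg; have z0 : 0 < 1 - normc z by lra.
pose rem t : R[i] := (z * expi (- t)) ^+ N / (1 - z * expi (- t)).
have cx : continuous (fun t : R => z * expi (- t)).
  move=> t; apply: cvgCM; first exact: cvg_cst.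
  have := @continuous_expiM R (-1) t; rewrite /continuous_at mulN1r.
  by under eq_fun do rewrite mulN1r.
have nx t : normc (z * expi (- t)) = normc z by rewrite normcM normc_expi mulr1.
have d0 t : 1 - normc z <= normc (1 - z * expi (- t)).
  by have := normc_distB 1 (z * expi (- t)); rewrite normc1 nx.
have remle t : normc (rem t) <= normc z ^+ N / (1 - normc z).
  rewrite /rem normc_div normcX nx ler_wpM2l ?exprn_ge0 ?normc_ge0//.
  by rewrite lef_pV2 ?posrE//; have := d0 t; lra.
have mrem : ameas rem.
  have n0 t : 1 - z * expi (- t) != 0.
    by apply/eqP => h; have := d0 t; rewrite h normc0; lra.
  have c1 := @continuousCX _ N cx.
  have c2 := @continuousCB (fun=> 1) _ (@continuousC_cst 1) cx.
  have c3 := @continuousCV _ c2 n0.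
  exact: (continuous_ameas (continuousCM c1 c3)).
have hrem : aL1 (fun t => g t * rem t) := aL1M hg mrem remle.
have hn (n : nat) : aL1 (fun t => z ^+ n * (g t * expi (- n%:R * t))).
  by apply: aL1Z; exact: aL1_expi.
have E : psum (fc g) N z = (herg g z + avg g) / 2 - avg (fun t => g t * rem t).
  have -> : psum (fc g) N z = avg (fun t => \sum_(n < N) z ^+ n * (g t * expi (- n%:R * t))).
    rewrite (@avg_sum _ N (fun n t => z ^+ n * (g t * expi (- n%:R * t)))); last first.
      by move=> n; exact: hn.
    apply: eq_bigr => n _; rewrite avgZ; last exact: aL1_expi.
    by rewrite mulrC.
  have -> : (herg g z + avg g) / 2 = avg (fun t => 2^-1 * (g t * hker z t + g t)).
    rewrite avgZ; last by apply: aL1D; [exact: aL1_hker|exact: hg].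
    by rewrite avgD; [rewrite mulrC|exact: aL1_hker|exact: hg].
  rewrite -avgB; last 2 first.
    by apply: aL1Z; apply: aL1D; [exact: aL1_hker|exact: hg].
    exact: hrem.
  apply: eq_avg => t; rewrite (hker_expand t N z1) /rem.
  have -> : \sum_(n < N) z ^+ n * (g t * expi (- n%:R * t)) =
      g t * \sum_(n < N) z ^+ n * expi (- n%:R * t).
    by rewrite mulr_sumr; apply: eq_bigr => n _; rewrite mulrCA.
  field; apply/eqP => h; have := d0 t; rewrite h normc0; lra.
rewrite E addrAC subrr sub0r normcN; apply: le_trans (normc_avg_le hrem) _.
have -> : ravg (fun t => normc (g t)) / (1 - normc z) * normc z ^+ N =
   ravg (fun t => normc z ^+ N / (1 - normc z) * normc (g t)).
  by rewrite ravgZ; [ring|exact: aL1_normc].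
apply: le_ravg; [exact: aL1_normc|by apply: rL1Z; exact: aL1_normc|].
by move=> t; rewrite normcM mulrC ler_wpM2r ?normc_ge0.
Qed.

Lemma herg_cvg g z : normc z < 1 -> aL1 g ->
  psum (fc g) ^~ z @ \oo --> (herg g z + avg g) / 2.
Proof.
move=> z1 hg; apply/cvg_normc0.
apply: (@squeeze_cvgr _ _ _ _ (cst 0)
  (fun N => ravg (fun t => normc (g t)) / (1 - normc z) * normc z ^+ N)).
- by apply: nearW => N; rewrite normc_ge0 herg_psum.
- exact: cvg_cst.
- rewrite -[X in _ --> X](mulr0 (ravg (fun t => normc (g t)) / (1 - normc z))).
  apply: cvgM; first exact: cvg_cst.
  by apply: cvg_expr; rewrite ger0_norm ?normc_ge0.
Qed.

Lemma fc_le g n : aL1 g -> normc (fc g n) <= ravg (fun t => normc (g t)).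
Proof.
move=> hg; apply: le_trans (normc_avg_le (aL1_expi _ hg)) _.
apply: le_ravg; [exact/aL1_normc/aL1_expi|exact: aL1_normc|].
by move=> t; rewrite normcM normc_expi mulr1.
Qed.

Lemma radius1_fc g : aL1 g -> radius1 (fc g).
Proof.
move=> hg r /andP[r0 r1]; exists (ravg (fun t => normc (g t))) => n.
apply: le_trans (fc_le n hg); rewrite ler_piMr ?normc_ge0//.
by rewrite exprn_ile1// ltW.
Qed.

Lemma hergE g z : normc z < 1 -> aL1 g -> herg g z = 2 * pser (fc g) z - avg g.
Proof.
move=> z1 hg; have := cvgC_uniq (pserP (radius1_fc hg) z1) (herg_cvg z1 hg) => ->.
by field.
Qed.

(** Analyticity is read off the power series of the Fourier coefficients, without differentiation
    under the integral. *)
Lemma holo_herg g : aL1 g -> holo (herg g).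
Proof.
move=> hg z z1; have [d dP] := holo_pser (radius1_fc hg) z1.
exists (2 * d + 0); apply: (@cder_near _ (fun w => 2 * pser (fc g) w + (- avg g))).
  apply/cvg_cnear; exists (1 - normc z); first by lra.
  move=> w wz; rewrite hergE//.
  by have := le_normcD (w - z) z; rewrite subrK; lra.
by apply: cderD; [exact: cderZ|exact: cder_cst].
Qed.

Lemma herg0 g : herg g 0 = avg g.
Proof.
by apply: eq_avg => t; rewrite /hker addr0 subr0 divff ?mulr1// expi_neq0.
Qed.

Definition pker z t : R := Re (hker z t).
Definition pois g z : R[i] := avg (fun t => g t * (pker z t)%:C).

Lemma Re_div (a b : R[i]) : Re (a / b) * normc b ^+ 2 = Re (a * conjc b).
Proof.
have [->|b0] := eqVneq b 0; first by rewrite invr0 mulr0 /= mul0r; case: a => x y /=; rewrite oppr0 !mulr0 subr0.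
have -> : a * conjc b = (a / b) * (normc b ^+ 2)%:C.
  by rewrite -mul_conj [conjc b * b]mulrC mulrA divfK.
by rewrite Re_mulR.
Qed.

Lemma pkerE z t : normc z < 1 -> pker z t = (1 - normc z ^+ 2) / normc (expi t - z) ^+ 2.
Proof.
move=> z1; have n0 : normc (expi t - z) ^+ 2 != 0.
  rewrite expf_neq0//; apply/eqP => h; have := expi_sub_ge z t; rewrite h; lra.
apply: (mulIf n0); rewrite mulfVK// /pker Re_div.
have : normc (expi t) ^+ 2 = 1 by rewrite normc_expi expr1n.
rewrite !normc_ReIm; case: (expi t) z {z1 n0} => [a b] [c d] /=.
rewrite !sqr_sqrtr ?addr_ge0 ?sqr_ge0// => <-.
by ring.
Qed.

Lemma pker_ge0 z t : normc z < 1 -> 0 <= pker z t.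
Proof.
move=> z1; rewrite pkerE// divr_ge0 ?sqr_ge0// subr_ge0 exprn_ile1 ?normc_ge0//.
exact: ltW.
Qed.

Lemma pker_le z t : normc z < 1 -> pker z t <= 2 / (1 - normc z).
Proof.
move=> z1; apply: le_trans (hker_le t z1).
exact: le_trans (ler_norm _) (Re_le_normc _).
Qed.

(** A convenient weakening of the true minimum [(1 - |z|) / (1 + |z|)]. *)
Lemma pker_lb z t : normc z < 1 -> (1 - normc z) / 2 <= pker z t.
Proof.
move=> z1; have z0 := normc_ge0 z.
have n1 : normc (expi t - z) <= 1 + normc z.
  by apply: le_trans (le_normcD _ _) _; rewrite normcN normc_expi.
have n2 := expi_sub_ge z t.
rewrite pkerE// ler_pdivlMr; last by rewrite exprn_gt0//; lra.
have : normc (expi t - z) ^+ 2 <= (1 + normc z) ^+ 2.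
  by rewrite lerXn2r// nnegrE; lra.
move=> h; apply: (@le_trans _ _ ((1 - normc z) / 2 * (1 + normc z) ^+ 2)).
  by rewrite ler_wpM2l// divr_ge0//; lra.
have -> : 1 - normc z ^+ 2 = (1 - normc z) * (1 + normc z) by ring.
rewrite -mulrA ler_wpM2l//; first by lra.
rewrite expr2 mulrA ler_piMl//; first by lra.
lra.
Qed.

Lemma ameas_pker z : normc z < 1 -> measurable_fun D2 (pker z).
Proof. by move=> z1; have [] := ameas_hker z1. Qed.

Lemma rL1_pker z : normc z < 1 -> rL1 (pker z).
Proof.
move=> z1; apply: (rL1_bdd (ameas_pker z1) (M := 2 / (1 - normc z))) => t.
by rewrite ger0_norm ?pker_ge0// pker_le.
Qed.

Lemma aL1_pker z g : normc z < 1 -> aL1 g -> aL1 (fun t => g t * (pker z t)%:C).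
Proof.
move=> z1 hg; apply: (@aL1M _ _ _ (2 / (1 - normc z)) hg).
  exact/aL1_meas/aL1_real/rL1_pker.
by move=> t; rewrite normcR ger0_norm ?pker_ge0// pker_le.
Qed.

Lemma pker_conj z t : (pker z t)%:C = (hker z t + conjc (hker z t)) / 2.
Proof. by rewrite /pker; exact: ReJ_add. Qed.

Lemma aL1_conj g : aL1 g -> aL1 (fun t => conjc (g t)).
Proof.
move=> [h1 h2]; split; first by apply: eq_rL1 h1 => t; case: (g t).
by apply: eq_rL1 (rL1Z (-1) h2) => t; case: (g t) => a b /=; rewrite mulN1r.
Qed.

Lemma pois_herg g z : normc z < 1 -> aL1 g ->
  pois g z = (herg g z + conjc (herg (fun t => conjc (g t)) z)) / 2.
Proof.
move=> z1 hg; have hc := aL1_conj hg.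
rewrite /herg -avg_conj; last exact: aL1_hker.
rewrite -avgD; [|exact: aL1_hker|exact/aL1_conj/aL1_hker].
rewrite mulrC -avgZ; last by apply: aL1D; [exact: aL1_hker|exact/aL1_conj/aL1_hker].
by apply: eq_avg => t; rewrite pker_conj [conjc (_ * hker _ _)]conjM conjcK; field.
Qed.

Lemma herg_cst (c : R[i]) z : normc z < 1 -> herg (fun=> c) z = c.
Proof.
move=> z1; have hc := aL1_cst c; rewrite hergE// avg_cst.
suff -> : pser (fc (fun=> c)) z = c by ring.
have f0 n : fc (fun=> c) n.+1 = 0.
  rewrite /fc; have h := @coefP R (fun=> c) n.+1 (2^-1) _ _.
  have hh : holo (fun=> c) by move=> w _; exists 0; exact: cder_cst.
  have h01 : 0 < (2^-1 : R) < 1 by rewrite invr_gt0 ltr0n invf_lt1 ?ltr1n.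
  (* The coefficient of [c] at frequency [- n.+1] is the conjugate of that of [conjc c] at [n.+1],
     which vanishes as for every holomorphic function. *)
  have := @coefN R (fun=> conjc c) n 2^-1 _ h01.
  move=> /(_ (fun w _ => ex_intro _ 0 (cder_cst _ w))) E.
  have := congr1 (fun z => conjc z) E; rewrite conjc0 -avg_conj.
    by move=> <-; apply: eq_avg => t; rewrite conjM conjcK conj_expi mulNr.
  by apply: aL1_expi; exact: aL1_cst.
apply: (cvgC_uniq (pserP (radius1_fc hc) z1)).
apply/cvgCP => e e0; exists 1%N => // N /= N1.
case: N N1 => // N _; rewrite /psum big_ord_recl big1 => [|i _]; last by rewrite f0 mul0r.
rewrite expr0 mulr1 addr0 /fc.
under eq_avg do rewrite mulr0n oppr0 mul0r expi0 mulr1.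
by rewrite avg_cst subrr normc0.
Qed.

Lemma ravg_pker z : normc z < 1 -> ravg (pker z) = 1.
Proof.
move=> z1; apply: complexI; rewrite -avg_real.
have := pois_herg z1 (aL1_cst 1); rewrite /pois.
under eq_avg do rewrite mul1r.
move=> ->; rewrite herg_cst//.
have -> : (fun _ : R => conjc (1 : R[i])) = (fun=> 1) by apply/funext => t; rewrite conjc1.
by rewrite herg_cst// conjc1 rmorph1; field.
Qed.

End Herglotz.

(** * Poisson's and Schwarz's formulas, Taylor expansion *)

Section PoissonFormula.
Context {R : realType}.
Implicit Types (z w : R[i]) (r t : R) (g : R -> R[i]) (f : R[i] -> R[i]).
Local Notation Re := complex.Re.
Local Notation Im := complex.Im.

(** The kernel has mean 1, so the arc near [t0] contributes at most [e]. Off that arc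
    [|expi t - z| >= d / 2], and the kernel is at most the coefficient of the second term. *)
Lemma pois_dist g (g0 : R[i]) z (e d : R) t0 : aL1 g -> normc z < 1 -> 0 < d -> 0 <= e ->
  normc (expi t0 - z) <= d / 2 ->
  (forall t, normc (expi t - expi t0) < d -> normc (g t - g0) <= e) ->
  normc (pois g z - g0) <=
  e + (1 - normc z ^+ 2) / (d / 2) ^+ 2 * ravg (fun t => normc (g t - g0)).
Proof.
move=> hg z1 d0 e0 zd gd; have d20 : 0 < d / 2 by rewrite divr_gt0.
have hgg : aL1 (fun t => g t - g0) := aL1B hg (aL1_cst g0).
set Q := (1 - normc z ^+ 2) / (d / 2) ^+ 2.
have E : pois g z - g0 = pois (fun t => g t - g0) z.
  rewrite /pois; under [RHS]eq_avg do rewrite mulrBl.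
  rewrite avgB; [|exact: aL1_pker|exact: (aL1_pker z1 (aL1_cst g0))].
  congr (_ - _); rewrite avgZ; last exact/aL1_real/rL1_pker.
  by rewrite avg_real ravg_pker// mulr1.
have n1 := aL1_normc hgg; have n2 := rL1_pker z1.
rewrite E; apply: le_trans (normc_avg_le (aL1_pker z1 hgg)) _.
have -> : e + Q * ravg (fun t => normc (g t - g0)) =
    ravg (fun t => e * pker z t + Q * normc (g t - g0)).
  by rewrite ravgD ?ravgZ ?ravg_pker ?mulr1//; apply: rL1Z.
apply: le_ravg; [exact/aL1_normc/aL1_pker|by apply: rL1D; apply: rL1Z|].
move=> t; rewrite normcM normcR ger0_norm ?pker_ge0//.
have Q0 : 0 <= Q by rewrite divr_ge0 ?sqr_ge0// subr_ge0 exprn_ile1 ?normc_ge0// ltW.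
have [h|h] := ltP (normc (expi t - expi t0)) d.
  have := ler_wpM2r (pker_ge0 t z1) (gd t h).
  have : 0 <= Q * normc (g t - g0) by rewrite mulr_ge0 ?normc_ge0.
  lra.
have nd : d / 2 <= normc (expi t - z).
  have := le_normcD (expi t - z) (z - expi t0).
  have -> : expi t - z + (z - expi t0) = expi t - expi t0 by ring.
  rewrite (normcB z); lra.
have : pker z t <= Q.
  rewrite pkerE// ler_wpM2l//; first by rewrite subr_ge0 exprn_ile1 ?normc_ge0// ltW.
  rewrite lef_pV2 ?posrE ?exprn_gt0//; last exact: lt_le_trans d20 nd.
  by rewrite lerXn2r// nnegrE ltW// (lt_le_trans d20).
move=> /(ler_wpM2l (normc_ge0 (g t - g0))).
have : 0 <= e * pker z t by rewrite mulr_ge0 ?pker_ge0.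
lra.
Qed.

Lemma pois_cvg g (g0 : R[i]) t0 : aL1 g ->
  (forall e : R, 0 < e -> exists2 d : R, 0 < d &
     forall t, normc (expi t - expi t0) < d -> normc (g t - g0) <= e) ->
  (fun r : R => pois g (r%:C * expi t0)) @ 1^'- --> g0.
Proof.
move=> hg gd; apply/cvgCP => e e0.
have e40 : 0 < e / 4 by rewrite divr_gt0.
have [d d0 dP] := gd _ e40.
set A := ravg (fun t => normc (g t - g0)).
have A0 : 0 <= A by apply: ravg_ge0 => t; exact: normc_ge0.
have d20 : 0 < d / 2 by rewrite divr_gt0.
(* With [1 - r^2 <= c] the far part in [pois_dist] is at most [e / 4]; the shift [A + 1] avoids
   division by zero. *)
set c := (d / 2) ^+ 2 / (A + 1) * (e / 4).
have c0 : 0 < c by rewrite mulr_gt0 ?divr_gt0 ?exprn_gt0// ltr_wpDl.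
near=> r.
have r0 : 0 < r by near: r; apply: nbhs_left_gt.
have r1 : r < 1 by near: r; apply: nbhs_left_lt.
have rd : 1 - d / 2 < r by near: r; apply: nbhs_left_gt; lra.
have rc : 1 - c / 2 < r by near: r; apply: nbhs_left_gt; lra.
have n1 : normc (r%:C * expi t0) = r by rewrite normc_circ ?ltW.
have n2 : normc (expi t0 - r%:C * expi t0) <= d / 2.
  have -> : expi t0 - r%:C * expi t0 = (1 - r)%:C * expi t0.
    by rewrite toCB; ring.
  by rewrite normc_circ; lra.
have z1 : normc (r%:C * expi t0) < 1 by rewrite n1.
have := pois_dist hg z1 d0 (ltW e40) n2 dP; rewrite n1 -/A.
move=> h; apply: le_lt_trans h _.
have : (1 - r ^+ 2) / (d / 2) ^+ 2 * A <= e / 4.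
  rewrite mulrAC ler_pdivrMr ?exprn_gt0//.
  have r2 : 1 - r ^+ 2 <= c.
    have -> : 1 - r ^+ 2 = (1 - r) * (1 + r) by ring.
    apply: (@le_trans _ _ (c / 2 * 2)); last by rewrite divfK.
    by apply: ler_pM; lra.
  apply: (@le_trans _ _ (c * A)); first by rewrite ler_wpM2r.
  rewrite /c; have A1 : A / (A + 1) <= 1 by rewrite ler_pdivrMr ?mul1r ?lerDl// ltr_wpDl.
  have -> : (d / 2) ^+ 2 / (A + 1) * (e / 4) * A = A / (A + 1) * (e / 4 * (d / 2) ^+ 2) by ring.
  by rewrite ler_piMl// mulr_ge0 ?exprn_ge0// ltW.
lra.
Unshelve. all: by end_near. Qed.

Definition circf f r t : R[i] := f (r%:C * expi t).

Lemma aL1_circf f r : holo f -> 0 <= r < 1 -> aL1 (circf f r).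
Proof. by move=> hf r01; apply: continuous_aL1; exact: holo_circ. Qed.

Lemma fc_circf f r n : holo f -> 0 < r < 1 -> fc (circf f r) n = coef f n * r%:C ^+ n.
Proof. exact: coefP. Qed.

Lemma fc_conj g n : aL1 g -> fc (fun t => conjc (g t)) n = conjc (avg (fun t => g t * expi (n%:R * t))).
Proof.
move=> hg; rewrite -avg_conj; last exact: aL1_expi.
by apply: eq_avg => t; rewrite conjM conj_expi mulNr.
Qed.

Lemma fc_conj_circf f r n : holo f -> 0 < r < 1 -> fc (fun t => conjc (circf f r t)) n.+1 = 0.
Proof.
move=> hf r01; rewrite fc_conj; last by apply: aL1_circf => //; case/andP: r01 => /ltW ->.
by rewrite [avg _]coefN// conjc0.
Qed.

Lemma coef_radius1 f : holo f -> radius1 (coef f).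
Proof.
move=> hf r r01; have r01' : 0 <= r < 1 by case/andP: r01 => /ltW ->.
exists (ravg (fun t => normc (circf f r t))) => n.
apply: le_trans (fc_le n (aL1_circf hf r01')).
rewrite fc_circf// (normcM (coef f n)) normcX normcR ger0_norm ?lexx//.
by case/andP: r01'.
Qed.

Lemma fc0 g : fc g 0 = avg g.
Proof. by apply: eq_avg => t; rewrite mulr0n oppr0 mul0r expi0 mulr1. Qed.

Lemma coef0_avg f r : holo f -> 0 < r < 1 -> avg (circf f r) = coef f 0.
Proof. by move=> hf r01; rewrite -fc0 fc_circf// expr0 mulr1. Qed.

Lemma normc_scale r z : 0 <= r < 1 -> normc z <= 1 -> normc (r%:C * z) < 1.
Proof.
move=> /andP[r0 r1] z1; rewrite normcM normcR ger0_norm//.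
by apply: le_lt_trans r1; rewrite ler_piMr.
Qed.

Lemma herg_circf f r z : holo f -> 0 < r < 1 -> normc z < 1 ->
  herg (circf f r) z = 2 * pser (coef f) (r%:C * z) - coef f 0.
Proof.
move=> hf r01 z1; have r01' : 0 <= r < 1 by case/andP: r01 => /ltW ->.
have hg := aL1_circf hf r01'.
rewrite (hergE z1 hg) (coef0_avg hf r01).
suff -> : pser (fc (circf f r)) z = pser (coef f) (r%:C * z) by [].
apply: (cvgC_uniq (pserP (radius1_fc hg) z1)).
have := pserP (coef_radius1 hf) (normc_scale r01' (ltW z1)).
suff -> : psum (coef f) ^~ (r%:C * z) = psum (fc (circf f r)) ^~ z by [].
by apply/funext => N; apply: eq_bigr => n _; rewrite fc_circf// exprMn mulrA.
Qed.

Lemma pser_c0 (a : nat -> R[i]) z : (forall n, a n.+1 = 0) -> pser a z = a 0%N.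
Proof.
move=> a0; have h : psum a ^~ z @ \oo --> a 0%N.
  apply/cvgCP => e e0; exists 1%N => // N /= N1.
  case: N N1 => // N _; rewrite /psum big_ord_recl big1 => [|i _]; last by rewrite a0 mul0r.
  by rewrite expr0 mulr1 addr0 subrr normc0.
have := @getPex _ [set l : R[i] | psum a ^~ z @ \oo --> l] (ex_intro (fun x : R[i] => psum a ^~ z @ \oo --> x) _ h).
by move=> h2; exact: (cvgC_uniq h2 h).
Qed.

Lemma herg_conj_circf f r z : holo f -> 0 < r < 1 -> normc z < 1 ->
  herg (fun t => conjc (circf f r t)) z = conjc (coef f 0).
Proof.
move=> hf r01 z1; have r01' : 0 <= r < 1 by case/andP: r01 => /ltW ->.
have hg := aL1_circf hf r01'; have hc := aL1_conj hg.
rewrite hergE// pser_c0; last by move=> n; exact: fc_conj_circf.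
by rewrite fc0 avg_conj// coef0_avg//; ring.
Qed.

Lemma pois_circf_pser f r z : holo f -> 0 < r < 1 -> normc z < 1 ->
  pois (circf f r) z = pser (coef f) (r%:C * z).
Proof.
move=> hf r01 z1; have r01' : 0 <= r < 1 by case/andP: r01 => /ltW ->.
rewrite pois_herg//; last exact: aL1_circf.
by rewrite herg_circf// herg_conj_circf// conjcK; field.
Qed.

Lemma polarE z : exists2 t, 0 <= t <= 2 * pi & z = (normc z)%:C * expi t.
Proof.
have [->|z0] := eqVneq z 0.
  by exists 0; [rewrite lexx mulr_ge0 ?pi_ge0|rewrite normc0 mul0r].
have n0 : 0 < normc z.
  by rewrite lt_neqAle normc_ge0 andbT eq_sym; apply: contra_neq z0 => /eq0_normc.
set N := normc z in n0 *; set c := Re z / N; set s := Im z / N.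
have cs : c ^+ 2 + s ^+ 2 = 1.
  have e : N ^+ 2 = Re z ^+ 2 + Im z ^+ 2.
    by rewrite /N normc_ReIm sqr_sqrtr// addr_ge0 ?sqr_ge0.
  by rewrite /c /s !expr_div_n -mulrDl -e divff// expf_neq0// gt_eqF.
have c1 : -1 <= c <= 1.
  by rewrite -ler_norml -(@expr_le1 _ 2)// real_normK ?num_real// -cs lerDl sqr_ge0.
have zE : z = N%:C * (c +i* s).
  have NN : N != 0 by rewrite gt_eqF.
  rewrite [LHS]complexE [c +i* s]complexE /= /c /s mulrDr -toCM mulrCA divff// mulr1.
  by rewrite mulrCA -toCM mulrCA divff// mulr1.
have cosA : cos (acos c) = c by rewrite acosK// in_itv.
have sinA : sin (acos c) = `|s|.
  by rewrite sin_acos// -cs addrAC subrr add0r sqrtr_sqr.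
have a1 := acos_ge0 c1; have a2 := acos_lepi c1.
have [s0|s0] := leP 0 s.
  exists (acos c); first by rewrite a1 /=; have := pi_ge0 R; lra.
  by rewrite {1}zE /expi cosA sinA ger0_norm.
exists (- acos c + 2 * pi); first by have := pi_ge0 R; lra.
by rewrite {1}zE expi2pi /expi cosN sinN cosA sinA ltr0_norm// opprK.
Qed.

(* Poisson's kernel reproduces the value at r e^{i t0} from the circle of radius
   r, which the power series of the Fourier coefficients also does. *)
Lemma holo_pser_coef f z : holo f -> normc z < 1 -> f z = pser (coef f) z.
Proof.
move=> hf z1.
have [t _ zE] := polarE z.
(* At the centre the circle through [z] degenerates; there the value is the limit of the means over
   small circles. *)
have [n0|/eqP n0] := eqVneq (normc z) 0.
  have -> : z = 0 by rewrite zE n0 mul0r.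
  have [d /cder_cont/cvgCP f0] := hf 0 ltac:(by rewrite normc0 ltr01).
  have -> : pser (coef f) 0 = coef f 0.
    have h := pserP (coef_radius1 hf) (_ : normc 0 < 1).
    apply: (cvgC_uniq (h _)); first by rewrite normc0 ltr01.
    apply/cvgCP => e e0; exists 1%N => // N /= N1; case: N N1 => // N _.
    rewrite /psum big_ord_recl big1 => [|i _]; last by rewrite expr0n mulr0.
    by rewrite expr0 mulr1 addr0 subrr normc0.
  apply/eqP; rewrite -subr_eq0; apply/eqP/eq0_normc/eqP.
  rewrite eq_le normc_ge0 andbT; apply/ler_addgt0Pr => e e0; rewrite add0r.
  have /cvg_cnear[s s0 sP] := f0 e e0.
  set r := Num.min (s / 2) (1 / 2).
  have r0 : 0 < r by rewrite lt_min !divr_gt0.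
  have rs : r <= s / 2 by rewrite ge_min lexx.
  have r2 : r <= 1 / 2 by rewrite ge_min lexx orbT.
  have r01 : 0 < r < 1 by rewrite r0 /=; lra.
  have r01' : 0 <= r < 1 by case/andP: r01 => /ltW ->.
  rewrite -(coef0_avg hf r01) -[X in X - _](avg_cst (f 0)) -avgB; [|exact: aL1_cst|exact: aL1_circf].
  apply: avg_bound; first by apply: aL1B; [exact: aL1_cst|exact: aL1_circf].
  move=> u; rewrite normcB; apply/ltW/sP; rewrite subr0 normc_circ ?ltW//; lra.
set r := normc z in zE z1 n0.
have r0 : 0 < r by rewrite lt_neqAle eq_sym normc_ge0 andbT; apply/eqP.
have r01 : 0 < r < 1 by rewrite r0.
have r01' : 0 <= r < 1 by rewrite ltW.
have [d /cder_cont/cvgCP fc] := hf z z1.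
have h1 : (fun s : R => pois (circf f r) (s%:C * expi t)) @ 1^'- --> f z.
  apply: pois_cvg; first exact: aL1_circf.
  move=> e e0; have /cvg_cnear[s s0 sP] := fc e e0.
  exists s => // u us; rewrite /circf; apply/ltW/sP.
  have -> : r%:C * expi u - z = r%:C * (expi u - expi t) by rewrite {1}zE; ring.
  rewrite normcM normcR gtr0_norm//; apply: le_lt_trans us.
  by rewrite ler_piMl ?normc_ge0// ltW.
have h2 : (fun s : R => pois (circf f r) (s%:C * expi t)) @ 1^'- --> pser (coef f) z.
  have [d2 /cder_cont/cvgCP pc] := holo_pser (coef_radius1 hf) z1.
  apply/cvgCP => e e0; have /cvg_cnear[s s0 sP] := pc e e0.
  near=> u.
  have u0 : 0 < u by near: u; apply: nbhs_left_gt.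
  have u1 : u < 1 by near: u; apply: nbhs_left_lt.
  have us : 1 - s < u by near: u; apply: nbhs_left_gt; lra.
  rewrite pois_circf_pser// ?normc_circ ?(ltW u0)//.
  apply: sP; have -> : r%:C * (u%:C * expi t) = u%:C * z.
    by rewrite [X in _ = u%:C * X]zE; ring.
  have -> : u%:C * z - z = - ((1 - u)%:C * z) by rewrite toCB; ring.
  rewrite normcN normcM normcR gtr0_norm ?subr_gt0//.
  apply: (@le_lt_trans _ _ (1 - u)); last by lra.
  by rewrite ler_piMr ?subr_ge0 ?ltW// -/r ltW.
exact: (cvgC_uniq h1 h2).
Unshelve. all: by end_near. Qed.

Lemma poisson_formula f r z : holo f -> 0 < r < 1 -> normc z < 1 ->
  pois (circf f r) z = f (r%:C * z).
Proof.
move=> hf r01 z1; rewrite pois_circf_pser// -holo_pser_coef//.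
by apply: normc_scale; [case/andP: r01 => /ltW ->|exact: ltW].
Qed.

Lemma coef0 f : holo f -> coef f 0 = f 0.
Proof.
move=> hf; have h01 : 0 < (2^-1 : R) < 1 by rewrite invr_gt0 ltr0n invf_lt1 ?ltr1n.
have := @poisson_formula f _ 0 hf h01; rewrite normc0 mulr0 => <-//.
rewrite -(coef0_avg hf h01) /pois; apply: eq_avg => t.
rewrite pkerE ?normc0// expr0n subr0 subr0 normc_expi expr1n divr1.
by rewrite mulr1.
Qed.

Lemma mean_value f r : holo f -> 0 < r < 1 -> avg (circf f r) = f 0.
Proof. by move=> hf r01; rewrite coef0_avg// coef0. Qed.

(** The Herglotz integral of the conjugate of [f] is constant, so that of [Re f] determines [f] up
    to an imaginary constant. It later carries convergence of real parts over to the function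
    itself. *)
Lemma schwarz_formula f r z : holo f -> 0 < r < 1 -> normc z < 1 ->
  f (r%:C * z) = herg (fun t => (Re (circf f r t))%:C) z + (Im (f 0)) *i.
Proof.
move=> hf r01 z1; have r01' : 0 <= r < 1 by case/andP: r01 => /ltW ->.
have hg := aL1_circf hf r01'; have hc := aL1_conj hg.
have -> : herg (fun t => (Re (circf f r t))%:C) z =
    (herg (circf f r) z + herg (fun t => conjc (circf f r t)) z) / 2.
  rewrite -avgD; [|exact: aL1_hker|exact: aL1_hker].
  rewrite mulrC -avgZ; last by apply: aL1D; exact: aL1_hker.
  by apply: eq_avg => t; rewrite ReJ_add; field.
rewrite herg_circf// herg_conj_circf// coef0//.
rewrite -holo_pser_coef//; last by apply: normc_scale; [exact: r01'|exact: ltW].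
have -> : conjc (f 0) = f 0 - 2 * (Im (f 0)) *i.
  by case: (f 0) => a b; rewrite -[2]/(2%:R) mulr_natl mulr2n /=; simpc; congr (_ +i* _); ring.
by field.
Qed.

End PoissonFormula.

(** * Mean value inequality, primitives and logarithms *)

Section Primitives.
Context {R : realType}.
Implicit Types (z w : R[i]) (r t : R) (f : R[i] -> R[i]).
Local Notation Re := complex.Re.
Local Notation Im := complex.Im.

Lemma small_o_is_derive (f : R -> R) (x d : R) :
  (forall e, 0 < e -> exists2 r : R, 0 < r &
    forall h, `|h| < r -> `|f (x + h) - f x - d * h| <= e * `|h|) ->
  is_derive x 1 f d.
Proof.
move=> H; have c : (fun h => h^-1 *: ((f \o shift x) (h *: 1) - f x)) @ 0^' --> d.
  apply/cvgrPdist_le => e e0; have [r r0 rP] := H e e0.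
  rewrite near_withinE; apply/nbhs_ballP; exists r => //= h.
  rewrite /ball /= sub0r normrN => hr h0.
  rewrite -[h *: 1]/(h * 1) mulr1 [h + x]addrC -[_ *: _]/(h^-1 * (f (x + h) - f x)).
  have -> : d - h^-1 * (f (x + h) - f x) = - (f (x + h) - f x - d * h) / h by field.
  by rewrite normrM normrN normfV ler_pdivrMr ?normr_gt0// rP.
apply: DeriveDef; first by apply/cvg_ex; exists d.
exact/cvg_lim.
Qed.

Lemma cder_is_derive_Re (F : R[i] -> R[i]) t d : cder F t%:C d ->
  is_derive t 1 (fun s : R => Re (F s%:C)) (Re d).
Proof.
move=> H; apply: small_o_is_derive => e e0; have [r r0 rP] := H e e0.
exists r => // h hr; have := rP (t + h)%:C; rewrite toCD addrAC subrr add0r normcR.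
move=> /(_ hr); apply: le_trans; apply: le_trans (Re_le_normc _).
by rewrite !raddfB /= Re_mulR.
Qed.

Lemma cder_is_derive_Im (F : R[i] -> R[i]) t d : cder F t%:C d ->
  is_derive t 1 (fun s : R => Im (F s%:C)) (Im d).
Proof.
move=> H; apply: small_o_is_derive => e e0; have [r r0 rP] := H e e0.
exists r => // h hr; have := rP (t + h)%:C; rewrite toCD addrAC subrr add0r normcR.
move=> /(_ hr); apply: le_trans; apply: le_trans (Im_le_normc _).
rewrite !raddfB /=; have -> : Im (d * h%:C) = Im d * h; last by [].
by case: (d) => a b /=; rewrite mulr0 add0r.
Qed.

Lemma is_derive_continuous_itv (h dh : R -> R) (a b : R) :
  (forall x : R, a <= x <= b -> is_derive x 1 h (dh x)) -> {within `[a, b], continuous h}.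
Proof.
move=> H; apply: derivable_within_continuous => x; rewrite in_itv /= => /H[].
by [].
Qed.

(** With [c = f z - f w], the real mean value theorem is applied along the segment to the real part
    of [conjc c * f], whose increment is exactly [|c|^2]. *)
Lemma mean_value_ineq f (d : R[i] -> R[i]) (M : R) z w :
  (forall x, normc x < 1 -> cder f x (d x)) ->
  (forall x, normc x < 1 -> normc (d x) <= M) ->
  normc z < 1 -> normc w < 1 -> normc (f z - f w) <= M * normc (z - w).
Proof.
move=> fd dM z1 w1; set c := f z - f w.
have [->|c0] := eqVneq c 0.
  have := le_trans (normc_ge0 _) (dM z z1) => M0.
  by rewrite normc0 mulr_ge0 ?normc_ge0.
have n0 : 0 < normc c.
  by rewrite lt_neqAle normc_ge0 andbT eq_sym; apply: contra_neq c0 => /eq0_normc.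
pose F x := conjc c * f (w + x * (z - w)).
have seg (s : R) : 0 <= s <= 1 -> normc (w + s%:C * (z - w)) < 1.
  move=> /andP[s0 s1].
  have -> : w + s%:C * (z - w) = (1 - s)%:C * w + s%:C * z by rewrite toCB; ring.
  apply: le_lt_trans (le_normcD _ _) _; rewrite !normcM !normcR !ger0_norm ?subr_ge0//.
  set m := Num.max (normc z) (normc w).
  apply: (@le_lt_trans _ _ m); last by rewrite gt_max z1.
  have h1 : normc z <= m by rewrite le_max lexx.
  have h2 : normc w <= m by rewrite le_max lexx orbT.
  have s2 : 0 <= 1 - s by rewrite subr_ge0.
  have := ler_wpM2l s0 h1; have := ler_wpM2l s2 h2; lra.
have dF (s : R) : 0 <= s <= 1 ->
    is_derive s 1 (fun s : R => Re (F s%:C)) (Re (conjc c * (d (w + s%:C * (z - w)) * (z - w)))).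
  move=> s01; apply: cder_is_derive_Re; apply: cderZ.
  apply: (@cder_comp _ f (fun x => w + x * (z - w))); last exact/fd/seg.
  apply: cder_eq; first by apply: cderD; [exact: cder_cst|apply: cderM; [exact: cder_id|exact: cder_cst]].
  by rewrite mulr0 addr0 add0r mul1r.
have [||s] := @MVT R (fun s : R => Re (F s%:C))
  (fun s => Re (conjc c * (d (w + s%:C * (z - w)) * (z - w)))) 0 1 ltr01.
- by move=> s; rewrite in_itv /= => /andP[s0 s1]; apply: dF; rewrite !ltW.
- exact: is_derive_continuous_itv dF.
rewrite in_itv /= subr0 mulr1 => /andP[s0 s1] E.
have E2 : Re (F 1%:C) - Re (F 0%:C) = normc c ^+ 2.
  rewrite -raddfB /=.
  have -> : F 1%:C - F 0%:C = conjc c * c.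
    rewrite /F; have -> : w + 1%:C * (z - w) = z by rewrite mul1r addrC subrK.
    have -> : w + 0%:C * (z - w) = w by rewrite mul0r addr0.
    by rewrite -mulrBr.
  by rewrite mul_conj.
rewrite -(ler_pM2l n0) -expr2 -E2 E.
apply: le_trans (le_trans (ler_norm _) (Re_le_normc _)) _.
rewrite !normcM normc_conj ler_wpM2l ?normc_ge0// ler_wpM2r ?normc_ge0// dM//.
by apply: seg; rewrite !ltW.
Qed.

Lemma holo_cst f z w : (forall x, normc x < 1 -> cder f x 0) ->
  normc z < 1 -> normc w < 1 -> f z = f w.
Proof.
move=> fd z1 w1; apply/eqP; rewrite -subr_eq0; apply/eqP/eq0_normc/eqP.
rewrite eq_le normc_ge0 andbT.
have := mean_value_ineq fd (M := 0) _ z1 w1; rewrite mul0r; apply.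
by move=> x _; rewrite normc0.
Qed.

Definition holo_der f z : R[i] := pser (pder (coef f)) z.

Lemma disc_near (P : R[i] -> Prop) z : normc z < 1 ->
  (forall w, normc w < 1 -> P w) -> \forall w \near z, P w.
Proof.
move=> z1 H; apply/cvg_cnear; exists (1 - normc z); first by rewrite subr_gt0.
move=> w wz; apply: H; have := le_normcD (w - z) z; rewrite subrK; lra.
Qed.

Lemma cder_holo f z : holo f -> normc z < 1 -> cder f z (holo_der f z).
Proof.
move=> hf z1; apply: (@cder_near _ (pser (coef f))).
  by apply: disc_near => // w w1; rewrite -holo_pser_coef.
exact/cder_pser/z1/coef_radius1.
Qed.

Lemma holo_holo_der f : holo f -> holo (holo_der f).
Proof. by move=> hf; exact/holo_pser/radius1_pder/coef_radius1. Qed.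

Definition prim f : R[i] -> R[i] :=
  pser (fun n => if n is m.+1 then coef f m / m.+1%:R else 0).

Lemma cder_prim f z : holo f -> normc z < 1 -> cder (prim f) z (f z).
Proof.
move=> hf z1; rewrite [f z]holo_pser_coef//; apply: cder_eq.
  apply: cder_pser => // r r01; have [C CP] := coef_radius1 hf r01.
  have C0 : 0 <= C by apply: le_trans (CP 0%N); rewrite mulr_ge0 ?normc_ge0.
  case/andP: r01 => r0 r1; exists C => -[|n]; first by rewrite normc0 mul0r.
  apply: le_trans (CP n); rewrite (normcM (coef f n)) normcV normc_nat -mulrA.
  rewrite ler_wpM2l ?normc_ge0// exprSr mulrCA ler_piMr ?exprn_ge0 ?ltW//.
  by rewrite ltr_pdivrMl// mulr1; apply: lt_le_trans r1 _; rewrite ler1n.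
by apply: eq_pser => n; rewrite /pder /= mulrC divfK// pnatr_eq0.
Qed.

Lemma holo_prim f : holo f -> holo (prim f).
Proof. by move=> hf z z1; exists (f z); exact: cder_prim. Qed.

(** With [u] a primitive of [f' / f], the product [f exp(- u)] has zero derivative. *)
Lemma holo_log f : holo f -> (forall z, normc z < 1 -> f z != 0) ->
  exists c, exists2 u, holo u & c != 0 /\ forall z, normc z < 1 -> f z = c * cexp (u z).
Proof.
move=> hf f0; pose g z := holo_der f z * (f z)^-1.
have hg : holo g.
  move=> z z1; have [d1 h1] := holo_holo_der hf z1.
  by eexists; apply: cderM h1 _; apply: cderV (f0 z z1) (cder_holo hf z1).
pose q z := f z * cexp (- prim g z).
have dq z : normc z < 1 -> cder q z 0.
  move=> z1; apply: cder_eq.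
    apply: cderM (cder_holo hf z1) _.
    apply: (@cder_comp _ cexp (fun z => - prim g z)); last exact: cder_cexp.
    by under [X in cder X]funext do rewrite -mulN1r; exact: cderZ (cder_prim hg z1).
  by rewrite /g; field; exact: f0.
have c01 : normc (0 : R[i]) < 1 by rewrite normc0 ltr01.
exists (q 0), (prim g); first exact: holo_prim.
split; first by rewrite mulf_neq0 ?cexp_neq0 ?f0.
move=> z z1; rewrite -(holo_cst dq z1 c01) /q -mulrA -cexpD addNr cexp0 mulr1 //.
Qed.

End Primitives.

(** * Parseval's identity and mean squares over circles *)

Section Parseval.
Context {R : realType}.
Implicit Types (z w : R[i]) (r s t : R) (f : R[i] -> R[i]).
Local Notation Re := complex.Re.
Local Notation Im := complex.Im.

(** The square of the L^2 mean over the circle of radius [r]. For holomorphic [f] it increases with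
    [r], and its supremum is the squared Hardy norm. *)
Definition en f r : R := ravg (fun t => normc (circf f r t) ^+ 2).
Definition esum (a : nat -> R[i]) N r : R := \sum_(n < N) normc (a n) ^+ 2 * r ^+ n ^+ 2.
Definition taylor_rest f N z : R[i] := f z - psum (coef f) N z.

Lemma cder_psum (a : nat -> R[i]) N z : exists d, cder (psum a N) z d.
Proof.
elim: N => [|N [d IH]].
  exists 0; have -> : psum a 0 = fun=> 0 by apply/funext => w; rewrite /psum big_ord0.
  exact: cder_cst.
have hX n : exists d, cder (fun w : R[i] => w ^+ n) z d.
  elim: n => [|n [e hn]]; first by exists 0; exact: cder_cst.
  have -> : (fun w : R[i] => w ^+ n.+1) = fun w => w * w ^+ n.
    by apply/funext => w; rewrite exprS.
  by eexists; apply: cderM hn; exact: cder_id.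
have [e he] := hX N.
have -> : psum a N.+1 = fun w => psum a N w + a N * w ^+ N.
  by apply/funext => w; rewrite psumS.
by eexists; apply: cderD IH _; exact: cderZ he.
Qed.

Lemma holo_psum (a : nat -> R[i]) N : holo (psum a N).
Proof. by move=> z _; exact: cder_psum. Qed.

Lemma holoB f g : holo f -> holo g -> holo (fun z => f z - g z).
Proof.
move=> hf hg z z1; have [a ha] := hf z z1; have [b hb] := hg z z1.
have -> : (fun z => f z - g z) = (fun z => f z + -1 * g z).
  by apply/funext => w; rewrite mulN1r.
exists (a + -1 * b); by apply: cderD ha _; exact: cderZ.
Qed.

Lemma holoM f g : holo f -> holo g -> holo (fun z => f z * g z).
Proof.
move=> hf hg z z1; have [a ha] := hf z z1; have [b hb] := hg z z1.
by eexists; exact: cderM ha hb.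
Qed.

Lemma holo_taylor_rest f N : holo f -> holo (taylor_rest f N).
Proof. by move=> hf; apply: holoB => //; exact: holo_psum. Qed.

Lemma avg_expi_neg n : avg (fun t => expi (- n.+1%:R * t)) = 0 :> R[i].
Proof.
have h1 : holo (fun _ : R[i] => 1) by move=> z _; exists 0; exact: cder_cst.
have h01 : 0 < (2^-1 : R) < 1 by rewrite invr_gt0 ltr0n invf_lt1 ?ltr1n.
rewrite -(fc_conj_circf n h1 h01); apply: eq_avg => t.
by rewrite /circf conjc1 mul1r.
Qed.

Lemma fc_taylor_rest f N r : holo f -> 0 < r < 1 ->
  fc (circf (taylor_rest f N) r) N = coef f N * r%:C ^+ N.
Proof.
move=> hf r01; have r01' : 0 <= r < 1 by case/andP: r01 => /ltW ->.
rewrite -(fc_circf N hf r01) /fc.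
have hp := aL1_circf (holo_psum (coef f) N) r01'.
under eq_avg => t do rewrite /circf /taylor_rest mulrBl.
rewrite avgB; [|exact/aL1_expi/aL1_circf|exact: aL1_expi hp].
rewrite -[RHS]subr0; congr (_ - _).
under eq_avg => t do rewrite /psum mulr_suml.
rewrite (@avg_sum _ N (fun n t => coef f n * (r%:C * expi t) ^+ n * expi (- N%:R * t))); last first.
  move=> n; apply: aL1_expi; apply: aL1Z; apply: continuous_aL1.
  exact: (@continuousCX _ _ n (continuous_circ (r := r))).
apply: big1 => n _; have nN := ltn_ord n.
transitivity (avg (fun t => coef f n * r%:C ^+ n * expi (- (N - n)%:R * t))).
  apply: eq_avg => t; rewrite exprMn expiX.
  have -> : expi (- (N - n)%:R * t) = expi (n%:R * t) * expi (- N%:R * t).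
    by rewrite -expiD natrB ?(ltnW nN)//; congr (expi _); ring.
  by ring.
rewrite avgZ; last first.
  by apply: continuous_aL1; exact: continuous_expiM.
by rewrite -(subnSK nN) avg_expi_neg mulr0.
Qed.

Lemma normc_sub_sqr (x y : R[i]) :
  normc (x - y) ^+ 2 = normc x ^+ 2 - 2 * Re (conjc y * x) + normc y ^+ 2.
Proof.
case: x y => [a b] [c d]; rewrite !normc_ReIm /= !sqr_sqrtr ?addr_ge0 ?sqr_ge0//.
by ring.
Qed.

Lemma continuous_normc_sqr (g : R -> R[i]) : continuous g ->
  continuous (fun t => normc (g t) ^+ 2).
Proof.
move=> cg t; rewrite /continuous_at expr2; under eq_fun do rewrite expr2.
by apply: cvgM; apply: cvg_normc; exact: cg.
Qed.

Lemma rL1_en f r : holo f -> 0 <= r < 1 -> rL1 (fun t => normc (circf f r t) ^+ 2).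
Proof. by move=> hf r01; apply: continuous_rL1; exact/continuous_normc_sqr/holo_circ. Qed.

(** Induction by Pythagoras: the [N]-th term is the orthogonal projection of the rest onto
    [expi (N t)], by [fc_taylor_rest]. *)
Lemma bessel f N r : holo f -> 0 < r < 1 ->
  en (taylor_rest f N) r = en f r - esum (coef f) N r.
Proof.
move=> hf r01; have r01' : 0 <= r < 1 by case/andP: r01 => /ltW ->.
elim: N => [|N IH].
  rewrite /esum big_ord0 subr0; apply: eq_ravg => t.
  by rewrite /circf /taylor_rest /psum big_ord0 subr0.
have hD := aL1_circf (holo_taylor_rest N hf) r01'.
rewrite /esum big_ord_recr /= opprD addrA -/(esum _ _ _) -IH.
set c := coef f N * r%:C ^+ N.
have nc : normc c ^+ 2 = normc (coef f N) ^+ 2 * r ^+ N ^+ 2.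
  rewrite /c (normcM (coef f N)) normcX normcR ger0_norm ?exprMn//.
  by case/andP: r01'.
have E t : normc (circf (taylor_rest f N.+1) r t) ^+ 2 =
    normc (circf (taylor_rest f N) r t) ^+ 2 -
    2 * Re (conjc c * (circf (taylor_rest f N) r t * expi (- N%:R * t))) + normc c ^+ 2.
  have -> : circf (taylor_rest f N.+1) r t = circf (taylor_rest f N) r t - c * expi (N%:R * t).
    by rewrite /circf /taylor_rest psumS /c exprMn expiX; ring.
  rewrite normc_sub_sqr (normcM c) normc_expi mulr1 conjM conj_expi.
  by rewrite mulNr; congr (_ - 2 * Re _ + _); ring.
rewrite /en (eq_ravg E).
have L1 : rL1 (fun t => Re (conjc c * (circf (taylor_rest f N) r t * expi (- N%:R * t)))).
  by apply: aL1_Re; apply: aL1Z; exact: aL1_expi.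
rewrite ravgD; last exact: rL1_cst; last first.
  by apply: rL1B; [exact/rL1_en/r01'/holo_taylor_rest|exact: rL1Z].
rewrite ravgB; [|exact/rL1_en/r01'/holo_taylor_rest|exact: rL1Z].
rewrite ravgZ// -Re_avg avgZ; last exact: aL1_expi.
rewrite -/(fc _ _) fc_taylor_rest// -/c mul_conj /= ravg_cst -nc; lra.
Qed.

Lemma en_ge0 f r : 0 <= en f r.
Proof. by apply: ravg_ge0 => t; exact: sqr_ge0. Qed.

Lemma esum_le_en f N r : holo f -> 0 < r < 1 -> esum (coef f) N r <= en f r.
Proof. by move=> hf r01; rewrite -subr_ge0 -bessel//; exact: en_ge0. Qed.

Lemma parseval f r : holo f -> 0 < r < 1 -> esum (coef f) ^~ r @ \oo --> en f r.
Proof.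
move=> hf r01; have /andP[r0 r1] := r01.
have [|rs s0 s1] := @mid_lt _ r; first by rewrite ltW.
set s := (1 + r) / 2 in rs s0 s1.
have s01 : 0 < s < 1 by rewrite s0.
have [C CP] := coef_radius1 hf s01.
set K := C / (1 - r / s); set q := r / s.
have q0 : 0 <= q by rewrite divr_ge0 ?(ltW r0) ?(ltW s0).
have q1 : q < 1 by rewrite ltr_pdivrMr// mul1r.
have K0 : 0 <= K.
  have C0 : 0 <= C by apply: le_trans (CP 0%N); rewrite mulr_ge0 ?normc_ge0.
  by rewrite divr_ge0// subr_ge0 ltW.
have tail N t : normc (circf (taylor_rest f N) r t) <= K * q ^+ N.
  have nr : normc (r%:C * expi t) = r by rewrite normc_circ// ltW.
  rewrite /circf /taylor_rest (holo_pser_coef hf) ?nr//.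
  have := @pser_tail _ (coef f) (r%:C * expi t) s C N (coef_radius1 hf) s01 CP.
  by rewrite nr => /(_ rs).
have h N : `|en f r - esum (coef f) N r| <= K ^+ 2 * (q ^+ 2) ^+ N.
  rewrite -bessel// ger0_norm ?en_ge0// -[leRHS]ravg_cst.
  apply: le_ravg; [by apply: rL1_en; [exact: holo_taylor_rest|rewrite ltW]|exact: rL1_cst|].
  move=> t; rewrite exprAC -exprMn lerXn2r ?nnegrE ?normc_ge0//.
  by rewrite mulr_ge0 ?exprn_ge0.
have : (fun N => K ^+ 2 * (q ^+ 2) ^+ N) @ \oo --> (0 : R).
  rewrite -[X in _ --> X](mulr0 (K ^+ 2)); apply: cvgM; first exact: cvg_cst.
  by apply: cvg_expr; rewrite ger0_norm ?exprn_ge0// exprn_ilt1.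
move=> /cvgr0Pnorm_lt H; apply/cvgrPdist_lt => e /H[N _ NP].
exists N => // n Nn; apply: le_lt_trans (h n) _.
exact: le_lt_trans (ler_norm _) (NP n Nn).
Qed.

Lemma esum_mono (a : nat -> R[i]) N r s : 0 <= r <= s -> esum a N r <= esum a N s.
Proof.
move=> /andP[r0 rs]; apply: ler_sum => n _; rewrite ler_wpM2l ?sqr_ge0//.
have s0 := le_trans r0 rs.
by rewrite !lerXn2r ?nnegrE ?exprn_ge0.
Qed.

Lemma en_mono f r s : holo f -> 0 < r -> r <= s -> s < 1 -> en f r <= en f s.
Proof.
move=> hf r0 rs s1.
have r01 : 0 < r < 1 by rewrite r0 (le_lt_trans rs).
have s01 : 0 < s < 1 by rewrite s1 (lt_le_trans r0).
apply: (ler_cvg_to (parseval hf r01) (parseval hf s01)).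
by apply: nearW => N; apply: esum_mono; rewrite ltW.
Qed.

(** The difference has Taylor coefficients [a_n (s^n - r^n)], and
    [(s^n - r^n)^2 <= s^(2n) - r^(2n)]. Monotone convergence of [en] thus becomes a Cauchy estimate
    in L^2. *)
Lemma en_diff f r s : holo f -> 0 < r -> r <= s -> s < 1 ->
  ravg (fun t => normc (circf f s t - circf f r t) ^+ 2) <= en f s - en f r.
Proof.
move=> hf r0 rs s1; have s0 := lt_le_trans r0 rs.
have r01 : 0 < r < 1 by rewrite r0 (le_lt_trans rs).
have s01 : 0 < s < 1 by rewrite s1 s0.
pose g z := f z - f ((r / s)%:C * z).
have q1 : 0 <= r / s <= 1 by rewrite divr_ge0 ?(ltW r0) ?(ltW s0)//= ler_pdivrMr// mul1r.
have hg : holo g.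
  apply: holoB => // z z1.
  have z1' : normc ((r / s)%:C * z) < 1.
    rewrite normcM normcR ger0_norm; last by case/andP: q1.
    by apply: le_lt_trans z1; rewrite ler_piMl ?normc_ge0//; case/andP: q1.
  have [d dP] := hf _ z1'.
  by eexists; apply: (@cder_comp _ f (fun z => (r / s)%:C * z)); [exact: cderZ (cder_id z)|exact: dP].
have gE t : circf g s t = circf f s t - circf f r t.
  by rewrite /circf /g mulrA -toCM divfK// gt_eqF.
have -> : ravg (fun t => normc (circf f s t - circf f r t) ^+ 2) = en g s.
  by apply: eq_ravg => t; rewrite gE.
have cg n : normc (coef g n) * s ^+ n = normc (coef f n) * (s ^+ n - r ^+ n).
  have -> : normc (coef g n) * s ^+ n = normc (fc (circf g s) n).
    by rewrite fc_circf// (normcM (coef g n)) normcX normcR ger0_norm// ltW.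
  have -> : fc (circf g s) n = coef f n * (s ^+ n - r ^+ n)%:C.
    rewrite toCB mulrBr !toCX -!fc_circf// /fc -avgB.
    - by apply: eq_avg => t; rewrite gE mulrBl.
    - by apply: aL1_expi; apply: aL1_circf => //; rewrite ltW.
    - by apply: aL1_expi; apply: aL1_circf => //; rewrite ltW//=; case/andP: r01.
  rewrite (normcM (coef f n)) normcR ger0_norm// subr_ge0 lerXn2r ?nnegrE ?(ltW r0) ?(ltW s0)//.
apply: (@ler_cvg_to _ _ _ _ (esum (coef g) ^~ s)
  (fun N => esum (coef f) N s - esum (coef f) N r) _ _ (parseval hg s01)
  (cvgB (parseval hf s01) (parseval hf r01))).
apply: nearW => N; rewrite /esum -sumrB; apply: ler_sum => n _.
rewrite -exprMn cg exprMn -mulrBr ler_wpM2l ?sqr_ge0//.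
have h1 : 0 <= r ^+ n by rewrite exprn_ge0 ?ltW.
have h2 : r ^+ n <= s ^+ n by rewrite lerXn2r ?nnegrE ?(ltW r0) ?(ltW s0).
rewrite -subr_ge0.
have -> : s ^+ n ^+ 2 - r ^+ n ^+ 2 - (s ^+ n - r ^+ n) ^+ 2 = 2 * r ^+ n * (s ^+ n - r ^+ n) by ring.
by rewrite !mulr_ge0// subr_ge0.
Qed.

(** The tail of Parseval's series at any [r < 1] is at most its tail at 1, where the partial sums
    stay below [S]; hence one [N] serves all radii. *)
Lemma taylor_small f (S e : R) : holo f -> (forall r, 0 < r < 1 -> en f r <= S) -> 0 < e ->
  exists N, forall r, 0 < r < 1 -> en (taylor_rest f N) r <= e.
Proof.
move=> hf fS e0; pose e1 N := esum (coef f) N 1.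
have e1mono : nondecreasing_seq e1.
  apply/nondecreasing_seqP => n; rewrite /e1 /esum big_ord_recr /= lerDl.
  by rewrite mulr_ge0 ?sqr_ge0.
have e1S N : e1 N <= S.
  have c : esum (coef f) N @ (1 : R)^'- --> e1 N.
    apply: cvg_at_left_filter; rewrite /e1 /esum.
    elim: N => [|N IH]; first by rewrite big_ord0; under eq_fun do rewrite big_ord0; exact: cvg_cst.
    rewrite big_ord_recr /=; under eq_fun do rewrite big_ord_recr /=.
    apply: cvgD; first exact: IH.
    apply: cvgM; first exact: cvg_cst.
    have h : (fun r : R => r ^+ N) @ (1 : R) --> (1 : R) ^+ N by exact: exprn_continuous.
    rewrite expr2; under eq_fun do rewrite expr2.
    by apply: cvgM.
  apply: (@closed_cvg _ _ _ _ _ (fun x => x <= S) _ _ _ c); first exact: closed_le.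
  near=> r; apply: le_trans (esum_le_en N hf _) (fS _ _);
    by apply/andP; split; near: r; [exact: nbhs_left_gt|exact: nbhs_left_lt].
have ub : has_ubound (range e1) by exists S => _ [N _ <-].
have cv := nondecreasing_cvgn e1mono ub; set sg := sup _ in cv.
have /cvgrPdist_lt/(_ e e0)[N _ NP] := cv.
exists N => r r01; rewrite bessel//.
apply: (@closed_cvg _ _ \oo _ _ (fun x => x <= e) _ _ _ (cvgB (parseval hf r01) (cvg_cst _))).
  exact: closed_le.
exists N => // M /= NM.
have h1 : esum (coef f) M r - esum (coef f) N r <= e1 M - e1 N.
  rewrite /e1 -(subnKC NM); elim: (M - N)%N => [|k IH]; first by rewrite addn0 !subrr.
  rewrite addnS {1 3}/esum !big_ord_recr /= -!/(esum _ _ _).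
  have : normc (coef f (N + k)) ^+ 2 * r ^+ (N + k) ^+ 2 <= normc (coef f (N + k)) ^+ 2 * 1 ^+ (N + k) ^+ 2.
    by rewrite ler_wpM2l ?sqr_ge0// !expr1n !exprn_ile1 ?exprn_ge0 ?exprn_ile1//; case/andP: r01 => /ltW// _ /ltW.
  lra.
have h2 : e1 M <= sg by apply: ub_le_sup => //; exists M.
have := NP N (leqnn N); rewrite /= ger0_norm; last by rewrite subr_ge0; apply: ub_le_sup => //; exists N.
move=> h3; change (esum (coef f) M r - esum (coef f) N r <= e); lra.
Unshelve. all: by end_near. Qed.

End Parseval.

(** * Fatou's theorem *)

Section BoundaryFunctions.
Context {R : realType}.
Implicit Types (z w : R[i]) (r s t : R) (f F : R[i] -> R[i]) (g : R -> R[i]).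
Local Notation Re := complex.Re.
Local Notation Im := complex.Im.

Lemma le_ravg_in (u v : R -> R) : rL1 u -> rL1 v ->
  (forall t, 0 <= t <= 2 * pi -> u t <= v t) -> ravg u <= ravg v.
Proof.
move=> hu hv uv; rewrite ler_wpM2l ?invr_ge0 ?pi2_ge0//.
by apply: le_rI => // t; rewrite /D2 /itv /= in_itv; exact: uv.
Qed.

(** Approach to the boundary values at a rate linear in [1 - r] and uniform in [t], which is what a
    primitive of a bounded function satisfies. *)
Definition bdry_of g F := aL1 g /\ exists M : R,
  forall r t, 0 <= r < 1 -> normc (g t - F (r%:C * expi t)) <= M * (1 - r).

Lemma bdry_ofB g1 g2 F1 F2 : bdry_of g1 F1 -> bdry_of g2 F2 ->
  bdry_of (fun t => g1 t - g2 t) (fun z => F1 z - F2 z).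
Proof.
move=> [a1 [M1 h1]] [a2 [M2 h2]]; split; first exact: aL1B.
exists (M1 + M2) => r t r01.
rewrite [X in normc X](_ : _ = (g1 t - F1 (r%:C * expi t)) - (g2 t - F2 (r%:C * expi t))); last by ring.
apply: le_trans (le_normcD _ _) _; rewrite normcN mulrDl.
by apply: lerD; [exact: h1|exact: h2].
Qed.

Lemma bdry_ofZ c g F : bdry_of g F -> bdry_of (fun t => c * g t) (fun z => c * F z).
Proof.
move=> [a1 [M1 h1]]; split; first exact: aL1Z.
exists (normc c * M1) => r t r01; rewrite -mulrBr normcM -mulrA.
by rewrite ler_wpM2l ?normc_ge0// h1.
Qed.

Lemma bdry_of_cst c : bdry_of (fun=> c) (fun=> c).
Proof. by split; [exact: aL1_cst|exists 0 => r t _; rewrite subrr normc0 mul0r]. Qed.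

Lemma bdry_of_id : bdry_of expi (fun z => z).
Proof.
split; first exact/continuous_aL1/continuous_expi.
exists 1 => r t /andP[r0 r1]; rewrite mul1r.
have -> : expi t - r%:C * expi t = (1 - r)%:C * expi t by rewrite toCB; ring.
by rewrite normc_circ // subr_ge0 ltW.
Qed.

(** Uniform approach to [g] lets [r] tend to 1 in [herg_circf] and [herg_conj_circf]. *)
Lemma herg_bdry g F z : holo F -> bdry_of g F -> normc z < 1 ->
  herg g z = 2 * F z - F 0 /\ herg (fun t => conjc (g t)) z = conjc (F 0).
Proof.
move=> hF [hg [M gM]] z1; have hc := aL1_conj hg.
have z0 : 0 < 1 - normc z by lra.
have M0 : 0 <= M.
  have := gM 0 0; rewrite lexx ltr01 => /(_ isT); rewrite subr0 mulr1.
  exact: le_trans (normc_ge0 _).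
have key (g' : R -> R[i]) (G : R -> R -> R[i]) : aL1 g' ->
    (forall r, 0 < r < 1 -> aL1 (G r)) ->
    (forall r t, 0 < r < 1 -> normc (g' t - G r t) <= M * (1 - r)) ->
    (fun r => herg (G r) z) @ 1^'- --> herg g' z.
  move=> hg' hG gG; apply/cvgCP => e e0.
  set K := M * (2 / (1 - normc z)) + 1.
  have K0 : 0 < K by rewrite ltr_wpDl// mulr_ge0// divr_ge0// ltW.
  have eK : 0 < e / K by rewrite divr_gt0.
  near=> r.
  have r0 : 0 < r by near: r; exact: nbhs_left_gt.
  have r1 : r < 1 by near: r; exact: nbhs_left_lt.
  have re : 1 - e / K < r by near: r; apply: nbhs_left_gt; lra.
  have r01 : 0 < r < 1 by rewrite r0.
  rewrite normcB -avgB; [|exact: aL1_hker|by apply: aL1_hker => //; exact: hG].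
  apply: (@le_lt_trans _ _ (M * (1 - r) * (2 / (1 - normc z)))).
    apply: avg_bound; first by apply: aL1B; apply: aL1_hker => //; exact: hG.
    move=> t; rewrite -mulrBl normcM; apply: ler_pM; rewrite ?normc_ge0//.
      exact: gG.
    exact: hker_le.
  apply: (@le_lt_trans _ _ (K * (1 - r))).
    by rewrite mulrAC ler_wpM2r ?subr_ge0 ?(ltW r1)// lerDl.
  by rewrite mulrC -ltr_pdivlMr//; lra.
have n0 : normc (0 : R[i]) < 1 by rewrite normc0 ltr01.
split.
  have h1 : (fun r => herg (circf F r) z) @ 1^'- --> herg g z.
    apply: key => // [r /andP[r0 r1]|r t /andP[r0 r1]].
      by apply: aL1_circf => //; rewrite ltW.
    by apply: gM; rewrite ltW.
  have h2 : (fun r => herg (circf F r) z) @ 1^'- --> 2 * F z - F 0.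
    have [d /cder_cont/cvgCP Fc] := hF z z1.
    apply/cvgCP => e e0; have e20 : 0 < e / 2 by rewrite divr_gt0.
    have /cvg_cnear[s s0 sP] := Fc _ e20.
    near=> r.
    have r0 : 0 < r by near: r; exact: nbhs_left_gt.
    have r1 : r < 1 by near: r; exact: nbhs_left_lt.
    have rs : 1 - s < r by near: r; apply: nbhs_left_gt; lra.
    have r01 : 0 < r < 1 by rewrite r0.
    rewrite herg_circf// coef0// -holo_pser_coef//; last first.
      by apply: normc_scale; [rewrite ltW|exact: ltW].
    have -> : 2 * F (r%:C * z) - F 0 - (2 * F z - F 0) = 2 * (F (r%:C * z) - F z) by ring.
    rewrite normcM normc_nat.
    have : normc (F (r%:C * z) - F z) < e / 2.
      apply: sP; have -> : r%:C * z - z = - ((1 - r)%:C * z) by rewrite toCB; ring.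
      rewrite normcN normcM normcR gtr0_norm ?subr_gt0//.
      apply: (@le_lt_trans _ _ (1 - r)); last by lra.
      by rewrite ler_piMr ?subr_ge0 ?ltW.
    lra.
  exact: (cvgC_uniq h1 h2).
have h1 : (fun r => herg (fun t => conjc (circf F r t)) z) @ 1^'- --> herg (fun t => conjc (g t)) z.
  apply: (key _ (fun r t => conjc (circf F r t))) => // [r /andP[r0 r1]|r t /andP[r0 r1]].
    by apply/aL1_conj/aL1_circf => //; rewrite ltW.
  by rewrite -rmorphB normc_conj; apply: gM; rewrite ltW.
have h2 : (fun r => herg (fun t => conjc (circf F r t)) z) @ 1^'- --> conjc (F 0).
  apply/cvgCP => e e0; near=> r.
  have r0 : 0 < r by near: r; exact: nbhs_left_gt.
  have r1 : r < 1 by near: r; exact: nbhs_left_lt.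
  by rewrite herg_conj_circf ?r0// coef0// subrr normc0.
exact: (cvgC_uniq h1 h2).
Unshelve. all: by end_near. Qed.

(** Half the derivative of [hker z t] with respect to [z]. *)
Definition dker z t : R[i] := expi t / (expi t - z) ^+ 2.

Lemma continuous_dker z : normc z < 1 -> continuous (dker z).
Proof.
move=> z1; have c1 := @continuousCB R expi _ continuous_expi (@continuousC_cst R z).
have c2 := @continuousCX R _ 2 c1.
have c3 := @continuousCV R _ c2 (fun t => expf_neq0 2 (expi_sub_neq0 t z1)).
exact: (continuousCM continuous_expi c3).
Qed.

Lemma dker_le z t : normc z < 1 -> normc (dker z t) <= (1 - normc z) ^- 2.
Proof.
move=> z1; rewrite normc_div normc_expi mul1r normcX.
have h := expi_sub_ge z t; have z0 : 0 < 1 - normc z by lra.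
rewrite lef_pV2 ?posrE ?exprn_gt0//; last exact: lt_le_trans z0 h.
by rewrite lerXn2r ?nnegrE ?normc_ge0// ltW.
Qed.

Lemma aL1_dker g z : normc z < 1 -> aL1 g -> aL1 (fun t => g t * dker z t).
Proof.
move=> z1 hg; apply: (aL1M hg _ (fun t => dker_le t z1)).
exact/continuous_ameas/continuous_dker.
Qed.

Lemma cder_herg g z : aL1 g -> normc z < 1 ->
  cder (herg g) z (2 * avg (fun t => g t * dker z t)).
Proof.
move=> hg z1 e e0; set d := (1 - normc z) / 2.
have d0 : 0 < d by rewrite /d; lra.
set A := ravg (fun t => normc (g t)).
have A0 : 0 <= A by apply: ravg_ge0 => t; exact: normc_ge0.
set K := 2 / (d * (2 * d) ^+ 2) * A + 1.
have K0 : 0 < K by rewrite ltr_wpDl// mulr_ge0// divr_ge0// mulr_ge0 ?sqr_ge0// ltW.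
exists (Num.min d (e / K)); first by rewrite lt_min d0 divr_gt0.
move=> w; rewrite lt_min => /andP[wd wK].
have w1 : normc w < 1 by have := le_normcD (w - z) z; rewrite subrK; move: wd; rewrite /d; lra.
have wn : d <= 1 - normc w by have := le_normcD (w - z) z; rewrite subrK; move: wd; rewrite /d; lra.
have hd := aL1_dker z1 hg.
have -> : herg g w - herg g z - 2 * avg (fun t => g t * dker z t) * (w - z) =
    avg (fun t => g t * (hker w t - hker z t - 2 * dker z t * (w - z))).
  rewrite -!avgB; [|exact: aL1_hker..].
  have -> : 2 * avg (fun t => g t * dker z t) * (w - z) =
     avg (fun t => 2 * (w - z) * (g t * dker z t)) by rewrite avgZ//; ring.
  rewrite -avgB; [|by apply: aL1B; exact: aL1_hker|exact: aL1Z].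
  by apply: eq_avg => t; ring.
(* The remainder of the kernel is exactly quadratic in [w - z], with a denominator kept away from 0
   by [d], uniformly in [t]. *)
have E t : hker w t - hker z t - 2 * dker z t * (w - z) =
    2 * expi t * (w - z) ^+ 2 / ((expi t - w) * (expi t - z) ^+ 2).
  by rewrite /hker /dker; field; rewrite !expi_sub_neq0.
set B := 2 / (d * (2 * d) ^+ 2) * normc (w - z) ^+ 2.
have Eb t : normc (hker w t - hker z t - 2 * dker z t * (w - z)) <= B.
  rewrite E normc_div [normc (_ * _ ^+ 2)]normcM [normc (2 * _)]normcM normc_nat normc_expi mulr1.
  rewrite [normc (_ * (_ ^+ 2))]normcM !normcX.
  rewrite [leLHS](_ : _ = 2 * (normc (expi t - w) * normc (expi t - z) ^+ 2)^-1 * normc (w - z) ^+ 2); last by ring.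
  rewrite /B ler_wpM2r ?sqr_ge0// ler_wpM2l//.
  have k1 := expi_sub_ge w t; have k2 := expi_sub_ge z t.
  have k3 : 2 * d = 1 - normc z by rewrite /d mulrC divfK.
  have k4 : 0 < 2 * d by rewrite mulr_gt0.
  rewrite lef_pV2 ?posrE ?mulr_gt0 ?exprn_gt0//; try lra.
  apply: ler_pM; rewrite ?sqr_ge0 ?(ltW d0)//; first exact: le_trans k1.
  by rewrite lerXn2r ?nnegrE ?normc_ge0 ?(ltW k4)// k3.
have hE : aL1 (fun t => g t * (hker w t - hker z t - 2 * dker z t * (w - z))).
  apply: (aL1M hg _ Eb); apply: aL1_meas; apply: aL1B.
    by apply: aL1B; apply: continuous_aL1; exact: continuous_hker.
  under [X in aL1 X]funext do rewrite -mulrA mulrCA.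
  apply: (@eq_aL1 _ (fun t => 2 * (w - z) * dker z t)) => [t|]; first by ring.
  by apply: aL1Z; apply: continuous_aL1; exact: continuous_dker.
apply: le_trans (normc_avg_le hE) _.
apply: (@le_trans _ _ (ravg (fun t => B * normc (g t)))).
  apply: le_ravg; [exact: aL1_normc|by apply: rL1Z; exact: aL1_normc|].
  by move=> t; rewrite normcM mulrC ler_wpM2r ?normc_ge0.
rewrite ravgZ; last exact: aL1_normc.
rewrite -/A [leLHS](_ : _ = 2 / (d * (2 * d) ^+ 2) * A * normc (w - z) * normc (w - z)); last by rewrite /B; ring.
rewrite ler_wpM2r ?normc_ge0//.
apply: (@le_trans _ _ (K * normc (w - z))).
  by rewrite ler_wpM2r ?normc_ge0// lerDl.
by rewrite mulrC -ler_pdivlMr// ltW.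
Qed.

Lemma bdry_der g F f z : holo F -> bdry_of g F -> (forall w, normc w < 1 -> cder F w (f w)) ->
  normc z < 1 -> avg (fun t => g t * dker z t) = f z /\
  avg (fun t => conjc (g t) * dker z t) = 0.
Proof.
move=> hF gF Ff z1; have hg := gF.1; have hc := aL1_conj hg.
have i2 : (2 : R[i]) != 0 by rewrite pnatr_eq0.
split; apply: (mulfI i2).
  apply: (cder_uniq (cder_herg hg z1)).
  apply: (@cder_near _ (fun w => 2 * F w + - F 0)).
    by apply: disc_near => // w w1; have [-> _] := herg_bdry hF gF w1.
  by apply: cder_eq; [apply: cderD; [exact: cderZ (Ff z z1)|exact: cder_cst]|rewrite addr0].
rewrite mulr0; apply: (cder_uniq (cder_herg hc z1)).
apply: (@cder_near _ (fun=> conjc (F 0))); last exact: cder_cst.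
by apply: disc_near => // w w1; have [_ ->] := herg_bdry hF gF w1.
Qed.

(** Up to the factor -2, the derivative of the Poisson kernel in the argument of [z]. *)
Definition qker z t : R := Im (z * dker z t).

(** The conjugate kernel integrates [g] to 0, so subtracting it changes nothing and leaves [2i]
    times an imaginary part. This kernel is odd about the argument of [z], which gains a factor in
    [qker_le] that [dker] does not have. *)
Lemma bdry_qker g F f z : holo F -> bdry_of g F -> (forall w, normc w < 1 -> cder F w (f w)) ->
  normc z < 1 -> z * f z = 2 * 'i * avg (fun t => g t * (qker z t)%:C).
Proof.
move=> hF gF Ff z1; have hg := gF.1; have hc := aL1_conj hg.
have [E1 E2] := bdry_der hF gF Ff z1.
have E3 : avg (fun t => g t * conjc (z * dker z t)) = 0.
  have h : aL1 (fun t => conjc (g t) * dker z t) by exact: aL1_dker.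
  have : conjc (avg (fun t => z * (conjc (g t) * dker z t))) = 0.
    by rewrite (avgZ z h) E2 mulr0 conjc0.
  rewrite -(avg_conj (aL1Z z h)) => <-.
  by apply: eq_avg => t; rewrite [z * (_ * _)]mulrCA [in RHS]conjM conjcK.
have hd : aL1 (fun t => z * (g t * dker z t)) by apply: aL1Z; exact: aL1_dker.
have hd2 : aL1 (fun t => g t * conjc (z * dker z t)).
  apply: (@eq_aL1 _ (fun t => conjc (z * (conjc (g t) * dker z t)))).
    by move=> t; rewrite [z * (_ * _)]mulrCA [LHS]conjM conjcK.
  by apply: aL1_conj; apply: aL1Z; exact: aL1_dker.
have Q t : (2 * 'i : R[i]) * (qker z t)%:C = z * dker z t - conjc (z * dker z t).
  rewrite /qker; case: (z * dker z t) => a b /=.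
  by rewrite -[2]/(2%:R) mulr_natl mulr2n; simpc; congr (_ +i* _); ring.
have hq : aL1 (fun t => g t * (qker z t)%:C).
  apply: (@eq_aL1 _ (fun t => (2 * 'i)^-1 * (z * (g t * dker z t) - g t * conjc (z * dker z t)))).
    move=> t; have -> : z * (g t * dker z t) - g t * conjc (z * dker z t) =
       g t * (z * dker z t - conjc (z * dker z t)) by ring.
    rewrite -Q mulrCA mulKf// mulf_neq0 ?pnatr_eq0//.
    by apply/eqP => /(congr1 (@complex.Im R))/= /eqP; rewrite oner_eq0.
  by apply: aL1Z; exact: aL1B.
rewrite -(avgZ _ hq) -E1 -(avgZ z (aL1_dker z1 hg)) -[LHS]subr0 -E3 -(avgB hd hd2).
by apply: eq_avg => t; rewrite [RHS]mulrCA Q; ring.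
Qed.

(** Expanding with [|w| = |z0| = 1], the imaginary part of the numerator is
    [(1 - r^2) r Im (z0 conj w)]. It vanishes at [w = z0] and is controlled by [|w - z0|]. *)
Lemma qker_le r t0 t : 0 <= r < 1 -> `|qker (r%:C * expi t0) t| <=
  (1 - r ^+ 2) * normc (expi t - expi t0) / normc (expi t - r%:C * expi t0) ^+ 4.
Proof.
move=> /andP[r0 r1]; set z := r%:C * expi t0.
have z1 : normc z < 1 by rewrite normc_circ.
set w := expi t; set z0 := expi t0.
have w1 : conjc w * w = 1 by rewrite mul_conj normc_expi expr1n.
have z01 : conjc z0 * z0 = 1 by rewrite mul_conj normc_expi expr1n.
have d0 : w - z != 0 := expi_sub_neq0 t z1.
set n := normc (w - z); have n0 : 0 < n.
  by rewrite lt_neqAle normc_ge0 andbT eq_sym; apply: contra_neq d0 => /eq0_normc.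
have nn : conjc (w - z) * (w - z) = (n ^+ 2)%:C by rewrite mul_conj.
have zd : z * dker z t = (z * conjc w + r%:C ^+ 2 * (w * conjc z0 * r%:C) - 2 * r%:C ^+ 2) * ((n ^+ 4)^-1)%:C.
  have n4 : ((n ^+ 4)%:C : R[i]) != 0 by rewrite toC_neq0// expf_neq0// gt_eqF.
  rewrite toCV; apply: (mulIf n4); rewrite mulfVK//.
  have -> : (n ^+ 4)%:C = (conjc (w - z) * (w - z)) ^+ 2 by rewrite nn -toCX -exprM.
  have cz : conjc z = r%:C * conjc z0.
    by rewrite /z conjM; congr (_ * _); exact: conjc_real.
  have cwz : conjc (w - z) = conjc w - r%:C * conjc z0 by rewrite -cz; exact: rmorphB.
  rewrite /dker -/w cwz.
  have -> : z * (w / (w - z) ^+ 2) * ((conjc w - r%:C * conjc z0) * (w - z)) ^+ 2 =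
     z * w * (conjc w - r%:C * conjc z0) ^+ 2 by field.
  have -> : z * w * (conjc w - r%:C * conjc z0) ^+ 2 =
    z * conjc w * (conjc w * w) - 2 * r%:C ^+ 2 * (conjc w * w) * (conjc z0 * z0) +
    r%:C ^+ 2 * (w * conjc z0 * r%:C) * (conjc z0 * z0) by rewrite /z -/z0; ring.
  by rewrite w1 z01; ring.
rewrite /qker zd.
have ImR (x : R[i]) (a : R) : Im (x * a%:C) = Im x * a.
  by case: x => p q /=; rewrite mulr0 add0r.
rewrite ImR normrM [`|_^-1|]ger0_norm ?invr_ge0 ?exprn_ge0 ?(ltW n0)//.
rewrite ler_wpM2r ?invr_ge0 ?exprn_ge0 ?(ltW n0)//.
have -> : Im (z * conjc w + r%:C ^+ 2 * (w * conjc z0 * r%:C) - 2 * r%:C ^+ 2) =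
    (1 - r ^+ 2) * (r * Im (z0 * (conjc w - conjc z0))).
  rewrite /z -/z0 -toCX mulrBr [z0 * conjc z0]mulrC z01.
  case: (z0) (w) => [a b] [c d]; rewrite [2 * _](_ : _ = (2 * r ^+ 2)%:C); last first.
    by rewrite toCM; congr (_ * _); rewrite rmorph_nat.
  by simpc => /=; ring.
have r2 : 0 <= 1 - r ^+ 2 by rewrite subr_ge0 expr_le1 ?(ltW r1).
rewrite normrM [`|1 - _|]ger0_norm// ler_wpM2l// normrM ger0_norm//.
have := Im_le_normc (z0 * (conjc w - conjc z0)).
rewrite normcM normc_expi mul1r -rmorphB normc_conj => h.
apply: le_trans (ler_wpM2l r0 h) _.
by rewrite ler_piMl ?normc_ge0 ?ltW.
Qed.

End BoundaryFunctions.

Section FatouPoint.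
Context {R : realType}.
Implicit Types (z w : R[i]) (r s t : R) (f F : R[i] -> R[i]) (g : R -> R[i]).
Local Notation Re := complex.Re.
Local Notation Im := complex.Im.

Lemma expi_small_o t0 (e : R) : 0 < e -> exists2 d : R, 0 < d &
  forall t, `|t - t0| < d ->
    normc (expi t - expi t0 - 'i * expi t0 * (t - t0)%:C) <= e * `|t - t0|.
Proof.
move=> e0; have [d d0 dP] := cder_cexp0 e0; exists d => // t td.
have iE : 'i * (t - t0)%:C = 0 +i* (t - t0) :> R[i] by simpc.
have n1 : normc (0 +i* (t - t0) : R[i]) = `|t - t0|.
  by rewrite normc_ReIm /= expr0n add0r sqrtr_sqr.
have := dP (0 +i* (t - t0)); rewrite subr0 n1 => /(_ td).
have -> : cexp (0 +i* (t - t0)) = expi (t - t0) by rewrite /cexp expR0 mul1r.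
rewrite cexp0 mul1r => h; apply: le_trans h.
have -> : expi t - expi t0 - 'i * expi t0 * (t - t0)%:C =
    expi t0 * (expi (t - t0) - 1 - (0 +i* (t - t0))).
  rewrite -iE; have -> : expi t = expi t0 * expi (t - t0) by rewrite -expiD addrC subrK.
  by ring.
by rewrite normcM normc_expi mul1r.
Qed.

Lemma normc_expiB s t : normc (expi s - expi t) ^+ 2 = 2 - 2 * cos (s - t).
Proof.
rewrite normc_ReIm sqr_sqrtr ?addr_ge0 ?sqr_ge0//= cosB.
have := cos2Dsin2 s; have := cos2Dsin2 t.
move: (cos s) (cos t) (sin s) (sin t) => a b c d h1 h2.
rewrite (_ : (a - b) ^+ 2 + (c - d) ^+ 2 =
  (a ^+ 2 + c ^+ 2) + (b ^+ 2 + d ^+ 2) - 2 * (a * b + c * d)); last by ring.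
by rewrite h1 h2; lra.
Qed.

Lemma normc_expiB_le2 s t : normc (expi s - expi t : R[i]) <= 2.
Proof. by have := le_normcD (expi s : R[i]) (- expi t); rewrite normcN !normc_expi. Qed.

Lemma expi_far t0 (d : R) : 0 < t0 < 2 * pi -> 0 < d -> exists2 x : R, 0 < x &
  forall t, 0 <= t <= 2 * pi -> d <= `|t - t0| -> x <= normc (expi t - expi t0).
Proof.
move=> /andP[t1 t2] d0; have p0 := @pi_gt0 R.
(* The terms [t0] and [2 pi - t0] exclude points that are far on the line but close on the circle:
   they give [|t - t0| <= 2 pi - m]. *)
set m := Num.min (Num.min d pi) (Num.min t0 (2 * pi - t0)).
have m0 : 0 < m by rewrite !lt_min d0 p0 t1 subr_gt0 t2.
have [md mp m1 m2] : [/\ m <= d, m <= pi, m <= t0 & m <= 2 * pi - t0].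
  by rewrite /m; split; rewrite !ge_min lexx ?orbT.
have cm : cos m < 1 by rewrite -cos0 ltr_cos// in_itv/= ?lexx ?(ltW m0) ?(ltW p0).
exists (1 - cos m); first by rewrite subr_gt0.
move=> t /andP[h1 h2] dt; set h := `|t - t0|.
have ch : cos (t - t0) = cos h.
  rewrite /h; have [p|p] := lerP 0 (t - t0); first by rewrite ger0_norm.
  by rewrite ltr0_norm// cosN.
have hm1 : m <= h by exact: le_trans md dt.
have hm2 : h <= 2 * pi - m by rewrite /h ler_norml; apply/andP; split; lra.
have lc x y : 0 <= x -> x <= y -> y <= pi -> cos y <= cos x :> R.
  move=> x0 xy yp; rewrite leNgt ltr_cos ?in_itv/= -?leNgt// ?x0 ?yp ?andbT/=.
    exact: le_trans x0 xy.
  exact: le_trans xy yp.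
have cc : cos h <= cos m.
  have [hp|hp] := lerP h pi.
    exact: lc (ltW m0) hm1 hp.
  have -> : cos h = cos (2 * pi - h).
    by rewrite cosB mulr_natl cos2pi sin2pi mul1r mul0r addr0.
  by apply: lc; lra.
(* The chord [x] satisfies [x^2 >= 2 (1 - cos m)] and [x <= 2], whence [x >= 1 - cos m]. *)
have := normc_expiB t t0; rewrite ch => E.
have n2 := normc_expiB_le2 t t0; have n0 := normc_ge0 (expi t - expi t0 : R[i]).
nra.
Qed.

(** Subtracting the affine function with the same derivative at [t0] leaves boundary values of order
    [o(|expi s - z0|)]. With the extra factor of [qker_le], the near part of the integral is a small
    multiple of the Poisson kernel, while the far part is [O(1 - r^2)]. *)
Lemma fatou_point g F f t0 D : holo F -> bdry_of g F ->
  (forall w, normc w < 1 -> cder F w (f w)) -> 0 < t0 < 2 * pi ->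
  (forall e : R, 0 < e -> exists2 d : R, 0 < d & forall s, `|s - t0| < d ->
     normc (g s - g t0 - D * (s - t0)%:C) <= e * `|s - t0|) ->
  (fun r => f (r%:C * expi t0)) @ 1^'- --> D / ('i * expi t0).
Proof.
move=> hF gF Ff t0I gD; set z0 := expi t0; set L := D / ('i * z0).
have i0 : ('i : R[i]) != 0.
  by apply/eqP => /(congr1 (@complex.Im R))/= /eqP; rewrite oner_eq0.
have ni : normc ('i : R[i]) = 1 by rewrite normc_ReIm /= expr0n expr1n add0r sqrtr1.
have z00 : z0 != 0 := expi_neq0 t0.
have LD : L * ('i * z0) = D by rewrite /L divfK// mulf_neq0.
pose psi s := g s - g t0 - L * (expi s - z0).
pose Psi w := F w - g t0 - L * (w - z0).
have bpsi : bdry_of psi Psi.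
  apply: bdry_ofB; first by apply: bdry_ofB => //; exact: bdry_of_cst.
  by apply: bdry_ofZ; apply: bdry_ofB; [exact: bdry_of_id|exact: bdry_of_cst].
have cPsi w : normc w < 1 -> cder Psi w (f w - L).
  move=> w1.
  have c1 := cderD (Ff w w1) (cder_cst (- g t0) w).
  have c2 := cderZ (- L) (cderD (cder_id w) (cder_cst (- z0) w)).
  have c3 := cderD c1 c2.
  apply: (cder_eq (d := (f w + 0) + - L * (1 + 0))); last by rewrite !addr0 mulr1.
  by apply: (cder_near _ c3); apply: (disc_near w1) => x _; rewrite /Psi mulNr.
have hPsi : holo Psi by move=> w w1; exists (f w - L); exact: cPsi.
have psiL : rL1 (fun s => normc (psi s)) := aL1_normc bpsi.1.
set A := ravg (fun s => normc (psi s)).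
have A0 : 0 <= A by apply: ravg_ge0 => s; exact: normc_ge0.
apply/cvgCP => e e0.
pose nL := normc L + 1; have nL0 : 0 < nL by rewrite ltr_wpDl ?normc_ge0.
(* Finally [r N <= 2 (16 e1 + e / 8)] with [r > 1 / 2], so that [N <= e / 4 + e / 2]. *)
set e1 := e / 256; have e10 : 0 < e1 by rewrite divr_gt0.
have [d1 d10 P1] := gD _ e10.
have [d2 d20 P2] := expi_small_o t0 (divr_gt0 e10 nL0).
have [d3 d30 P3] := @expi_small_o t0 (1 / 2) (divr_gt0 (ltr01) (ltr0Sn _ 1)).
pose d := Num.min d1 (Num.min d2 d3).
have d0 : 0 < d by rewrite !lt_min d10 d20.
have [x0 x00 far] := expi_far t0I d0.
set K := 32 / x0 ^+ 4 * A; have K0 : 0 <= K.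
  by rewrite mulr_ge0 ?divr_ge0// exprn_ge0 ?ltW.
have near_psi s : `|s - t0| < d -> normc (psi s) <= 4 * e1 * normc (expi s - z0).
  rewrite !lt_min => /and3P[s1 s2 s3].
  have xs : `|s - t0| <= 2 * normc (expi s - z0).
    have a1 := P3 s s3.
    have := normc_distB ('i * expi t0 * (s - t0)%:C) (- (expi s - expi t0 - 'i * expi t0 * (s - t0)%:C)).
    rewrite [normc ('i * _ * _)]normcM [normc ('i * _)]normcM ni normc_expi normcR !mul1r normcN.
    by rewrite opprK addrCA subrr addr0 -/z0; rewrite -/z0 in a1; lra.
  have a1 := P1 s s1; have a2 := P2 s s2; rewrite -/z0 in a2.
  have -> : psi s = (g s - g t0 - D * (s - t0)%:C) - L * (expi s - z0 - 'i * z0 * (s - t0)%:C).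
    by rewrite /psi -LD; ring.
  apply: le_trans (le_normcD _ _) _; rewrite normcN normcM.
  have a3 : normc L * normc (expi s - z0 - 'i * z0 * (s - t0)%:C) <= e1 * `|s - t0|.
    apply: (@le_trans _ _ (nL * (e1 / nL * `|s - t0|))).
      by apply: ler_pM; rewrite ?normc_ge0// lerDl.
    by rewrite mulrA [nL * _]mulrC divfK// gt_eqF.
  apply: (@le_trans _ _ (e1 * `|s - t0| + e1 * `|s - t0|)); first exact: lerD.
  have a4 : e1 * `|s - t0| <= e1 * (2 * normc (expi s - z0)) by rewrite ler_pM2l.
  by lra.
near=> r.
have r2 : 2^-1 < r by near: r; apply: nbhs_left_gt; rewrite invf_lt1// ltr1n.
have r1 : r < 1 by near: r; exact: nbhs_left_lt.
have rK : 1 - e / 16 / (K + 1) < r.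
  by near: r; apply: nbhs_left_gt; rewrite ltrBlDr ltrDl !divr_gt0// ltr_wpDl.
have r0 : 0 < r by apply: lt_trans r2; rewrite invr_gt0.
have r01 : 0 <= r < 1 by rewrite (ltW r0).
set z := r%:C * z0.
have z1 : normc z < 1 by rewrite /z normc_circ ?(ltW r0).
have nz : normc z = r by rewrite /z normc_circ ?(ltW r0).
have := bdry_qker hPsi bpsi cPsi z1.
move=> /(congr1 (@normc R)); rewrite normcM [in RHS]normcM nz [normc (2 * 'i)]normcM normc_nat.
rewrite ni mulr1 => E.
have mq : ameas (fun t => (qker z t)%:C).
  split; last exact: measurable_cst.
  have c1 := continuousCM (@continuousC_cst R z) (continuous_dker z1).
  by have [_ h] := continuous_ameas c1.
have qb t : normc (qker z t)%:C <= (1 - normc z) ^- 2.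
  rewrite normcR; apply: le_trans (Im_le_normc _) _; rewrite normcM.
  apply: le_trans (dker_le t z1); rewrite ler_piMl ?normc_ge0//; exact: ltW.
have hq : aL1 (fun t => psi t * (qker z t)%:C) := aL1M bpsi.1 mq qb.
have r21 : 0 <= 1 - r ^+ 2 by rewrite subr_ge0 expr_le1 ?(ltW r0) ?(ltW r1).
(* Both constants come from [x <= 2 n]. Near [t0], [4 e1 x * x / n^4 <= 16 e1 / n^2]; far from it,
   [x <= 2] and [n >= x0 / 2] give [2 / (x0 / 2)^4]. *)
have pt s : 0 <= s <= 2 * pi -> normc (psi s * (qker z s)%:C) <=
   16 * e1 * pker z s + (1 - r ^+ 2) * (32 / x0 ^+ 4) * normc (psi s).
  move=> sI; rewrite normcM normcR.
  set x := normc (expi s - z0); set n := normc (expi s - z).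
  have x_ge0 : 0 <= x := normc_ge0 _.
  have n0 : 0 < n.
    by apply: lt_le_trans (expi_sub_ge z s); rewrite nz subr_gt0.
  have xn : x <= 2 * n.
    have a1 : x <= n + (1 - r).
      have := le_normcD (expi s - z) (z - z0); rewrite addrA subrK -/x -/n.
      have -> : z - z0 = - ((1 - r)%:C * z0) by rewrite /z toCB; ring.
      by rewrite normcN normc_circ// subr_ge0 ltW.
    by have := expi_sub_ge z s; rewrite nz -/n; lra.
  have qs := qker_le t0 s r01; rewrite -/z0 -/z -/x -/n in qs.
  have T1 : 0 <= 16 * e1 * pker z s by rewrite !mulr_ge0 ?pker_ge0// ltW.
  have T2 : 0 <= (1 - r ^+ 2) * (32 / x0 ^+ 4) * normc (psi s).
    by rewrite !mulr_ge0 ?normc_ge0 ?invr_ge0 ?exprn_ge0 ?(ltW x00).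
  have [sd|sd] := ltrP `|s - t0| d.
    apply: le_trans (ler_wpDr T2 (lexx _)); have a1 := near_psi s sd; rewrite -/x in a1.
    apply: (@le_trans _ _ (4 * e1 * x * ((1 - r ^+ 2) * x / n ^+ 4))).
      by apply: ler_pM => //; rewrite ?normc_ge0.
    rewrite pkerE// nz -/n.
    have -> : 4 * e1 * x * ((1 - r ^+ 2) * x / n ^+ 4) = 4 * e1 * (1 - r ^+ 2) / n ^+ 4 * x ^+ 2 by ring.
    have -> : 16 * e1 * ((1 - r ^+ 2) / n ^+ 2) = 4 * e1 * (1 - r ^+ 2) / n ^+ 4 * (2 * n) ^+ 2.
      by field; rewrite gt_eqF.
    rewrite ler_wpM2l ?divr_ge0 ?exprn_ge0 ?(ltW n0) ?mulr_ge0 ?(ltW e10) ?(ltW e0)//.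
    by rewrite lerXn2r ?nnegrE ?mulr_ge0 ?(ltW n0).
  apply: le_trans (ler_wpDl T1 (lexx _)).
  rewrite mulrC ler_wpM2r ?normc_ge0//; apply: le_trans qs _; rewrite -mulrA ler_wpM2l//.
  have xx0 : x0 <= x := far s sI sd.
  have x2 : x <= 2 := normc_expiB_le2 s t0.
  apply: (@le_trans _ _ (2 * (n ^+ 4)^-1)).
    by rewrite ler_wpM2r ?invr_ge0 ?exprn_ge0 ?(ltW n0).
  have -> : 32 / x0 ^+ 4 = 2 * ((x0 / 2) ^+ 4)^-1 by field; rewrite gt_eqF.
  rewrite ler_wpM2l// lef_pV2 ?posrE ?exprn_gt0 ?divr_gt0//.
  by rewrite lerXn2r ?nnegrE ?divr_ge0 ?(ltW x00) ?(ltW n0)//; lra.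
have hp : rL1 (fun s => 16 * e1 * pker z s) := rL1Z (16 * e1) (rL1_pker z1).
have hps : rL1 (fun s => (1 - r ^+ 2) * (32 / x0 ^+ 4) * normc (psi s)).
  exact: rL1Z psiL.
have B : normc (avg (fun t => psi t * (qker z t)%:C)) <= 16 * e1 + (1 - r ^+ 2) * K.
  apply: le_trans (normc_avg_le hq) _.
  apply: (@le_trans _ _ (ravg (fun s => 16 * e1 * pker z s + (1 - r ^+ 2) * (32 / x0 ^+ 4) * normc (psi s)))).
    by apply: le_ravg_in => //; [exact: aL1_normc|exact: rL1D].
  rewrite (ravgD hp hps) (ravgZ _ (rL1_pker z1)) ravg_pker// mulr1 (ravgZ _ psiL).
  by rewrite -/A le_eqVlt; apply/orP; left; apply/eqP; rewrite /K; ring.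
have B2 : (1 - r ^+ 2) * K <= e / 8.
  have a1 : (1 - r) * (K + 1) < e / 16.
    by rewrite -ltr_pdivlMr ?ltr_wpDl//; lra.
  have a2 : 0 <= (1 - r) * K by rewrite mulr_ge0// subr_ge0 ltW.
  have -> : (1 - r ^+ 2) * K = (1 + r) * ((1 - r) * K) by ring.
  apply: (@le_trans _ _ (2 * ((1 - r) * K))); first by rewrite ler_wpM2r//; lra.
  by move: a1; rewrite mulrDr mulr1; lra.
rewrite -/z -/L; set N := normc _ in E *; have N0 : 0 <= N := normc_ge0 _.
have : 2^-1 * N <= r * N by rewrite ler_wpM2r// ltW.
by move: E B B2; rewrite /e1; lra.
Unshelve. all: by end_near. Qed.

End FatouPoint.

Section Fatou.
Context {R : realType}.
Implicit Types (z w : R[i]) (r s t : R) (f F : R[i] -> R[i]).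
Local Notation Re := complex.Re.
Local Notation Im := complex.Im.

Lemma ae_imp (P Q : measurableTypeR R -> Prop) : (forall t, P t -> Q t) ->
  {ae lam, forall t, P t} -> {ae lam, forall t, Q t}.
Proof.
move=> PQ.
exact: (@filterS _ (almost_everywhere lam) (ae_filter_ringOfSetsType lam) P Q PQ).
Qed.

Lemma ae_and (P Q : measurableTypeR R -> Prop) :
  {ae lam, forall t, P t} -> {ae lam, forall t, Q t} -> {ae lam, forall t, P t /\ Q t}.
Proof.
move=> hP hQ.
exact: (@filterI _ (almost_everywhere lam) (ae_filter_ringOfSetsType lam) P Q hP hQ).
Qed.

Lemma rI_ftc (h H : R -> R) t : 0 < t -> continuous h ->
  (forall x : R, is_derive x 1 H (h x)) -> rI lam (itv 0 t) h = H t - H 0.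
Proof.
move=> t0 ch dH.
have dd x : derivable H x 1 by exact: (@ex_derive _ _ _ _ _ _ _ (dH x)).
have cH : continuous H.
  by move=> x; apply: differentiable_continuous; apply/derivable1_diffP.
have := @continuous_FTC2 R h H 0 t t0.
rewrite /rI /Rintegral => ->//.
- by apply: continuous_subspaceT.
- split; [by move=> x _; exact: dd|apply: cvg_at_right_filter; exact: cH|].
  by apply: cvg_at_left_filter; exact: cH.
- by move=> x _; rewrite derive1E; exact: (@derive_val _ _ _ _ _ _ _ (dH x)).
Qed.

Lemma circ_ftc F f r t : (forall w, normc w < 1 -> cder F w (f w)) -> holo f ->
  0 <= r < 1 -> 0 < t ->
  F (r%:C * expi t) - F (r%:C * expi 0) = ci 0 t (fun s => 'i * (r%:C * expi s) * f (r%:C * expi s)).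
Proof.
move=> Ff hf /andP[r0 r1] t0.
have E s : cexp ('i * s%:C) = expi s 
  by have -> : 'i * s%:C = 0 +i* s :> R[i] by [simpc]; rewrite /cexp expR0 mul1r.
have D s : cder (fun z => F (r%:C * cexp ('i * z))) s%:C ('i * (r%:C * expi s) * f (r%:C * expi s)).
  have c1 := cderZ 'i (cder_id s%:C).
  have c2 := cderZ r%:C (cder_comp c1 (cder_cexp ('i * s%:C))).
  have c3 : cder F (r%:C * cexp ('i * s%:C)) (f (r%:C * cexp ('i * s%:C))).
    by apply: Ff; rewrite E normc_circ.
  by apply: (cder_eq (cder_comp c2 c3)); rewrite E; ring.
have c : continuous (fun s => 'i * (r%:C * expi s) * f (r%:C * expi s)).
  have c1 := @continuousCM R _ _ (@continuousC_cst R 'i) (@continuous_circ R r).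
  apply: (@continuousCM R _ (fun s => f (r%:C * expi s)) c1).
  by apply: holo_circ => //; rewrite r0.
have H1 := rI_ftc t0 (fun x => cvg_Re (c x)) (fun s => cder_is_derive_Re (D s)).
have H2 := rI_ftc t0 (fun x => cvg_Im (c x)) (fun s => cder_is_derive_Im (D s)).
rewrite /ci /cI H1 H2 !E; by case: (F _) (F _) => [a b] [c' d]; simpc.
Qed.

(** The sum of the successive differences has finite integral, so it is finite almost everywhere,
    and there the sequence is Cauchy. *)
Lemma ae_cvg_fast (g : nat -> R -> R[i]) : (forall k, aL1 (g k)) ->
  (forall k, ravg (fun t => normc (g k.+1 t - g k t)) <= 2^-1 ^+ k) ->
  {ae lam, forall t, D2 t -> exists l : R[i], g ^~ t @ \oo --> l}.
Proof.
move=> hg gk; have mD := @mD2 R.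
pose u k t := normc (g k.+1 t - g k t).
have hu k : rL1 (u k) by apply: aL1_normc; exact: aL1B.
have u0 k t : 0 <= u k t by exact: normc_ge0.
have mu k : measurable_fun (@D2 R) (EFin \o u k).
  by apply/measurable_EFinP; exact: rL1_meas (hu k).
pose S t := (\sum_(k <oo) (u k t)%:E)%E.
have iS : (\int[lam]_(t in @D2 R) S t < +oo)%E.
  rewrite /S integral_nneseries//; last by move=> k t _; rewrite lee_fin.
  (* The bound [2 pi 2^-k] is written over [2^(k+1)] to match the series summed by
     [epsilon_trick0]. *)
  have b k : (\int[lam]_(t in @D2 R) (u k t)%:E <= ((2 * (2 * pi)) / (2 ^ k.+1)%:R)%:E)%E.
    have hk := integral_fune_fin_num mD (hu k).
    rewrite -(fineK hk) lee_fin.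
    have := gk k; rewrite /ravg mulrC -[_^-1]div1r -ler_pdivlMr ?divr_gt0 ?pi2_gt0//.
    rewrite invf_div divr1 => h; apply: le_trans h _.
    by rewrite natrX exprS invfM mulrACA mulfV ?pnatr_eq0// mul1r exprVn mulrC.
  apply: (@le_lt_trans _ _ (\sum_(k <oo) ((2 * (2 * pi)) / (2 ^ k.+1)%:R)%:E)%E).
    by apply: lee_nneseries => [k *|k *]; [by apply: integral_ge0 => t _; rewrite lee_fin|exact: b].
  apply: le_lt_trans (epsilon_trick0 xpredT _) _; first by rewrite mulr_ge0 ?pi2_ge0.
  exact: ltry.
have S0 t : (0 <= S t)%E by apply: nneseries_ge0 => k _ _; rewrite lee_fin.
have mS : measurable_fun (@D2 R) S by apply: ge0_emeasurable_sum => [k t _ _|k _]; [by rewrite lee_fin|exact: mu].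
have : lam.-integrable (@D2 R) S.
  by apply/integrableP; split => //; under eq_integral do rewrite gee0_abs//.
move=> /(integrable_ae mD); apply: ae_imp => t St Dt.
have {St} St := St Dt.
pose U n := \sum_(0 <= k < n) u k t.
have Ub n : U n <= fine (S t).
  rewrite -lee_fin fineK// /U -sumEFin.
  by apply: (@nneseries_lim_ge _ (fun k => (u k t)%:E) xpredT) => k _ _; rewrite lee_fin.
have Um m n : (m <= n)%N -> normc (g n t - g m t) <= U n - U m.
  move=> mn; rewrite /U (big_cat_nat (n := m))//= addrAC subrr add0r.
  elim: n mn => [|n IH]; first by rewrite leqn0 => /eqP->; rewrite subrr normc0 big_geq.
  rewrite leq_eqVlt => /predU1P[->|mn]; first by rewrite subrr normc0 big_geq.
  rewrite big_nat_recr//=; apply: le_trans (lerD (IH mn) (lexx _)).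
  have -> : g n.+1 t - g m t = (g n t - g m t) + (g n.+1 t - g n t) by ring.
  exact: le_normcD.
have Un : nondecreasing_seq U.
  by apply/nondecreasing_seqP => n; rewrite /U big_nat_recr//= lerDl.
have cU : cvgn U.
  by apply: nondecreasing_is_cvgn => //; exists (fine (S t)) => _ [n _ <-].
apply: complex_cauchy => e e0.
have /cvgrPdist_lt/(_ e e0)[N _ NP] := cU.
exists (g N t); exists N => // n /= Nn.
apply: le_lt_trans (Um N n Nn) _.
have := NP N (leqnn N) => /=; have := nondecreasing_cvgn_le Un cU n => h1.
by move=> h2; have := ler_norm (limn U - U N); lra.
Qed.

Lemma en_bdd f (M : R) r : holo f -> (forall z, normc z < 1 -> normc (f z) <= M) ->
  0 <= r < 1 -> en f r <= M ^+ 2.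
Proof.
move=> hf fM r01; rewrite -(ravg_cst (M ^+ 2)); apply: le_ravg; [exact: rL1_en|exact: rL1_cst|].
move=> t; rewrite lerXn2r ?nnegrE ?normc_ge0//.
  by apply: le_trans (fM 0 _); rewrite ?normc_ge0// normc0.
by apply: fM; case/andP: r01 => *; rewrite normc_circ.
Qed.

(** [en f] increases to a finite supremum; radii at which it is nearly attained make the L^2
    differences small by [en_diff]. *)
Lemma fast_radii f (M : R) : holo f -> (forall z, normc z < 1 -> normc (f z) <= M) ->
  exists2 r : nat -> R, (forall k, 0 < r k < 1) /\ r @ \oo --> 1^'- &
  forall k, ravg (fun t => normc (circf f (r k.+1) t - circf f (r k) t)) <= 2^-1 ^+ k.
Proof.
move=> hf fM; pose A := [set en f r | r in [set r : R | 0 < r < 1]].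
have hA : has_sup A.
  split; first by exists (en f 2^-1), 2^-1 => //=; rewrite invr_gt0 ltr0n invf_lt1 ?ltr1n.
  exists (M ^+ 2) => _ [r /andP[r0 r1] <-]; apply: en_bdd => //; by rewrite (ltW r0).
set S := sup A.
have H k : exists r : R, 1 - 2^-1 ^+ k.+1 < r < 1 /\ S - 2^-1 ^+ k ^+ 2 < en f r.
  have e0 : 0 < 2^-1 ^+ k ^+ 2 :> R by rewrite !exprn_gt0 ?invr_gt0.
  have [_ [s /andP[s0 s1] <-] h] := sup_adherent e0 hA.
  have q1 : 1 - 2^-1 ^+ k.+1 < (1 : R) by rewrite ltrBlDr ltrDl exprn_gt0 ?invr_gt0.
  set m := Num.max s ((1 - 2^-1 ^+ k.+1 + 1) / 2).
  have m1 : m < 1 by rewrite /m gt_max s1/=; lra.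
  exists m; rewrite m1 andbT; split; first by rewrite /m lt_max; apply/orP; right; lra.
  by apply: lt_le_trans h _; apply: en_mono => //; rewrite /m le_max lexx.
have [rho rhoP] := boolp.choice H.
have rho0 k : 0 < rho k.
  have [/andP[h _] _] := rhoP k; apply: le_lt_trans h; rewrite subr_ge0.
  by rewrite exprn_ile1 ?invr_ge0// invf_le1 ?ler1n.
(* [en_diff] compares ordered radii, so the running maximum of the chosen ones is used; monotonicity
   of [en] keeps it near the supremum. *)
pose fix r k := if k is k'.+1 then Num.max (r k') (rho k) else rho 0%N.
have rr k : rho k <= r k by case: k => [|k] //=; rewrite le_max lexx orbT.
have r1 k : r k < 1.
  elim: k => [|k IH] /=; first by have [/andP[]] := rhoP 0%N.
  by rewrite gt_max IH; have [/andP[]] := rhoP k.+1.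
have r0 k : 0 < r k by exact: lt_le_trans (rho0 k) (rr k).
have rm k : r k <= r k.+1 by rewrite /= le_max lexx.
exists r; first split.
- by move=> k; rewrite r0 r1.
- have r_1 : r @ \oo --> (1 : R).
    have c : (fun k => 1 - 2^-1 ^+ k.+1) @ \oo --> (1 : R).
      rewrite -[X in _ --> X]subr0; apply: cvgB; first exact: cvg_cst.
      have := @cvg_expr R 2^-1; rewrite ger0_norm ?invr_ge0// invf_lt1 ?ltr1n// => /(_ isT).
      by rewrite -(cvg_shiftS (fun k => 2^-1 ^+ k : R)).
    apply: (squeeze_cvgr _ c (cvg_cst _)); apply: nearW => k.
    rewrite (ltW (r1 k)) andbT; apply: le_trans (rr k).
    by have [/andP[/ltW]] := rhoP k.
  move=> P [d d0 dP]; have /cvgrPdist_lt/(_ d d0)[N _ NP] := r_1.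
  by exists N => // k Nk; apply: dP => //=; exact: NP.
move=> k; set q := 2^-1 ^+ k; have q0 : 0 < q by rewrite exprn_gt0 ?invr_gt0.
have c k' : continuous (circf f (r k')).
  by apply: holo_circ => //; rewrite (ltW (r0 k')) r1.
have cB := @continuousCB R _ _ (c k.+1) (c k).
have i2 := continuous_rL1 (@continuous_normc_sqr R _ cB).
have i1 := aL1_normc (continuous_aL1 cB).
have h2 : ravg (fun t => normc (circf f (r k.+1) t - circf f (r k) t) ^+ 2) <= q ^+ 2.
  apply: le_trans (en_diff hf (r0 k) (rm k) (r1 k.+1)) _.
  have a1 : en f (r k.+1) <= S by apply: ub_le_sup; [exact: hA.2|exists (r k.+1); [apply/andP; split; [exact: r0|exact: r1]|]].
  have a2 : en f (rho k) <= en f (r k) by apply: en_mono.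
  by have [_] := rhoP k; rewrite -/q; lra.
(* The arithmetic-geometric inequality with weight [q] replaces Cauchy-Schwarz: a mean square of at
   most [q^2] gives a mean of at most [q]. *)
have p t : normc (circf f (r k.+1) t - circf f (r k) t) <=
   q / 2 + (2 * q)^-1 * normc (circf f (r k.+1) t - circf f (r k) t) ^+ 2.
  set x := normc _; rewrite -subr_ge0.
  have -> : q / 2 + (2 * q)^-1 * x ^+ 2 - x = (2 * q)^-1 * (q - x) ^+ 2 by field; rewrite gt_eqF.
  by rewrite mulr_ge0 ?sqr_ge0// invr_ge0 mulr_ge0 ?ltW.
have i3 := rL1Z (2 * q)^-1 i2.
apply: le_trans (le_ravg i1 (rL1D (rL1_cst (q / 2)) i3) p) _.
rewrite (ravgD (rL1_cst (q / 2)) i3) ravg_cst (ravgZ _ i2).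
have : (2 * q)^-1 * ravg (fun t => normc (circf f (r k.+1) t - circf f (r k) t) ^+ 2) <= (2 * q)^-1 * q ^+ 2.
  by apply: ler_wpM2l h2; rewrite invr_ge0 mulr_ge0 ?(ltW q0).
have -> : (2 * q)^-1 * q ^+ 2 = q / 2 by field; rewrite gt_eqF.
by lra.
Qed.

Lemma limn_supP (u : nat -> R) l : u @ \oo --> l -> limn_sup u = l.
Proof. by move=> ul; rewrite cvg_limn_supE; [exact/cvg_lim|apply/cvg_ex; exists l]. Qed.

(* the componentwise limsup is a measurable version of the limit *)
Lemma ae_lim_measurable (g : nat -> R -> R[i]) (M : R) : (forall k, ameas (g k)) ->
  (forall k t, normc (g k t) <= M) ->
  {ae lam, forall t, D2 t -> exists l : R[i], g ^~ t @ \oo --> l} ->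
  exists2 h, ameas h & (forall t, normc (h t) <= 2 * M) /\
    {ae lam, forall t, D2 t -> g ^~ t @ \oo --> h t}.
Proof.
move=> mg gM cg.
have gR k t : `|Re (g k t)| <= M by exact: le_trans (Re_le_normc _) (gM k t).
have gI k t : `|Im (g k t)| <= M by exact: le_trans (Im_le_normc _) (gM k t).
have bl (u : nat -> R -> R) t : (forall k t, `|u k t| <= M) -> has_lbound (range (u ^~ t)).
  by move=> uM; exists (- M) => _ [k _ <-]; have := uM k t; rewrite ler_norml => /andP[].
have bu (u : nat -> R -> R) t : (forall k t, `|u k t| <= M) -> has_ubound (range (u ^~ t)).
  by move=> uM; exists M => _ [k _ <-]; have := uM k t; rewrite ler_norml => /andP[].
pose h t : R[i] := limn_sup (fun k => Re (g k t)) +i* limn_sup (fun k => Im (g k t)).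
have hb (u : nat -> R) : (forall k, `|u k| <= M) -> `|limn_sup u| <= M.
  move=> uM; have hu : has_ubound (range u).
    by exists M => _ [k _ <-]; have := uM k; rewrite ler_norml => /andP[].
  have hl : has_lbound (range u).
    by exists (- M) => _ [k _ <-]; have := uM k; rewrite ler_norml => /andP[].
  have hs k : - M <= sups u k <= M.
    have hh : has_ubound (sdrop u k) by case: hu => B Bu; exists B => _ [n _ <-]; exact: Bu.
    apply/andP; split.
      apply: le_trans (ub_le_sup hh (x := u k) _); last by exists k => //=.
      by have := uM k; rewrite ler_norml => /andP[].
    apply: ge_sup; first by exists (u k), k => /=.
    by move=> _ [n _ <-]; have := uM n; rewrite ler_norml => /andP[].
  have cs : cvgn (sups u).
    apply: nonincreasing_is_cvgn; first exact: nonincreasing_sups.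
    by exists (- M) => _ [k _ <-]; case/andP: (hs k).
  rewrite /limn_sup ler_norml; apply/andP; split.
    by apply: limr_ge => //; apply: nearW => k; case/andP: (hs k).
  by apply: limr_le => //; apply: nearW => k; case/andP: (hs k).
exists h.
  split.
    apply: (@measurable_fun_limn_sup _ _ _ (@D2 R) (fun n t => Re (g n t))) => [t _|t _|n].
    - exact: (bu (fun n t => Re (g n t)) t (fun k s => gR k s)).
    - exact: (bl (fun n t => Re (g n t)) t (fun k s => gR k s)).
    - by case: (mg n).
  apply: (@measurable_fun_limn_sup _ _ _ (@D2 R) (fun n t => Im (g n t))) => [t _|t _|n].
  - exact: (bu (fun n t => Im (g n t)) t (fun k s => gI k s)).
  - exact: (bl (fun n t => Im (g n t)) t (fun k s => gI k s)).
  - by case: (mg n).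
split.
  move=> t; apply: le_trans (normc_le_ReIm _) _ => /=.
  have h1 := hb _ (gR ^~ t); have h2 := hb _ (gI ^~ t).
  by have := lerD h1 h2; lra.
apply: ae_imp cg => t gt Dt; have [l gl] := gt Dt.
by apply: cvg_ReIm => /=; rewrite (limn_supP (cvg_Re gl), limn_supP (cvg_Im gl)); [exact: cvg_Re|exact: cvg_Im].
Qed.

(** The primitive [F] is Lipschitz and extends to [phi] on the circle. Along fast radii [f]
    converges almost everywhere to some [g], and [phi] is an indefinite integral of [i e^(it) g].
    Lebesgue differentiation and [fatou_point] then upgrade the sequence to the full radial
    limit. *)
Theorem fatou_radial f (M : R) : holo f -> (forall z, normc z < 1 -> normc (f z) <= M) ->
  {ae lam, forall t, D2 t -> exists l : R[i], (fun r : R => f (r%:C * expi t)) @ 1^'- --> l}.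
Proof.
move=> hf fM; set F := prim f.
have M0 : 0 <= M by apply: le_trans (fM 0 _); rewrite ?normc_ge0// normc0.
have Ff w : normc w < 1 -> cder F w (f w) by exact: cder_prim.
have hF : holo F := holo_prim hf.
have FL z w : normc z < 1 -> normc w < 1 -> normc (F z - F w) <= M * normc (z - w).
  by move=> z1 w1; exact: (mean_value_ineq Ff fM z1 w1).
have nc r t : 0 <= r < 1 -> normc (r%:C * expi t) < 1 by move=> /andP[r0 r1]; rewrite normc_circ.
have Fr r s t : 0 <= r < 1 -> 0 <= s < 1 -> normc (F (r%:C * expi t) - F (s%:C * expi t)) <= M * `|r - s|.
  move=> r01 s01; apply: le_trans (FL _ _ (nc r t r01) (nc s t s01)) _.
  by rewrite -mulrBl -toCB normcM normc_expi mulr1 normcR.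
have cphi t : exists l : R[i], (fun r : R => F (r%:C * expi t)) @ 1^'- --> l.
  apply: complex_cauchy => e e0.
  have M1 : 0 < M + 1 by rewrite ltr_wpDl.
  set r0 := Num.max 0 (1 - e / (M + 1) / 2).
  have r01 : 0 <= r0 < 1.
    by rewrite /r0 le_max lexx gt_max ltr01/= ltrBlDr ltrDl !divr_gt0.
  have r0e : 1 - r0 < e / (M + 1).
    have : 1 - e / (M + 1) / 2 <= r0 by rewrite /r0 le_max lexx orbT.
    by have := divr_gt0 e0 M1; lra.
  exists (F (r0%:C * expi t)); near=> r.
  have rr : r0 < r by near: r; apply: nbhs_left_gt; have [] := andP r01.
  have r1 : r < 1 by near: r; exact: nbhs_left_lt.
  have r01' : 0 <= r < 1 by rewrite r1 andbT; have [a _] := andP r01; exact: le_trans a (ltW rr).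
  apply: le_lt_trans (Fr r r0 t r01' r01) _; rewrite gtr0_norm ?subr_gt0//.
  apply: (@le_lt_trans _ _ ((M + 1) * (r - r0))).
    by rewrite ler_wpM2r ?subr_ge0 ?(ltW rr)// lerDl.
  by rewrite mulrC -ltr_pdivlMr//; lra.
have [phi phiP] := boolp.choice cphi.
have near01 : \forall r \near (1 : R)^'-, 0 <= r < 1.
  near=> r; apply/andP; split; [apply: ltW; near: r; exact: nbhs_left_gt|near: r; exact: nbhs_left_lt].
have phir r t : 0 <= r < 1 -> normc (phi t - F (r%:C * expi t)) <= M * (1 - r).
  move=> r01; apply: (@normc_lim_le _ _ (1^'-) _ (fun s : R => F (s%:C * expi t) - F (r%:C * expi t))).
    by apply: cvgB; [exact: phiP|exact: cvg_cst].
  near=> s; have s01 : 0 <= s < 1 by near: s.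
  have rs : r < s by near: s; apply: nbhs_left_gt; have [] := andP r01.
  apply: le_trans (Fr s r t s01 r01) _; rewrite gtr0_norm ?subr_gt0// ler_wpM2l//.
  by have [_ ?] := andP s01; lra.
have phit s t : normc (phi s - phi t) <= M * normc (expi s - expi t).
  apply: (@normc_lim_le _ _ (1^'-) _ (fun r : R => F (r%:C * expi s) - F (r%:C * expi t))).
    by apply: cvgB; exact: phiP.
  near=> r; have r01 : 0 <= r < 1 by near: r.
  apply: le_trans (FL _ _ (nc r s r01) (nc r t r01)) _; rewrite ler_wpM2l//.
  rewrite -mulrBr normcM normcR ger0_norm; last by have [] := andP r01.
  by rewrite ler_piMl ?normc_ge0//; have [_ /ltW] := andP r01.
have cont_phi : continuous phi.
  move=> t; apply/cvgCP => e e0; have /cvgCP := @continuous_expi R t.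
  have M1 : 0 < M + 1 by rewrite ltr_wpDl.
  move=> /(_ _ (divr_gt0 e0 M1)); apply: filterS => s h.
  apply: le_lt_trans (phit s t) _; apply: (@le_lt_trans _ _ ((M + 1) * normc (expi s - expi t))).
    by rewrite ler_wpM2r ?normc_ge0// lerDl.
  by rewrite mulrC -ltr_pdivlMr.
have bphi : bdry_of phi F by split; [exact: continuous_aL1|exists M => r t; exact: phir].
have [r [r01 r_1] rfast] := fast_radii hf fM.
have r01' k : 0 <= r k < 1 by case/andP: (r01 k) => a b; rewrite (ltW a).
have cf k : continuous (circf f (r k)) by exact: holo_circ.
have fb k t : normc (circf f (r k) t) <= M by apply/fM/nc.
have [g mg [gM gP]] := ae_lim_measurable (fun k => continuous_ameas (cf k)) fb
  (ae_cvg_fast (fun k => continuous_aL1 (cf k)) rfast).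
pose h t := 'i * expi t * g t.
have mh : ameas h.
  apply: (cmeasM (D := @D2 R) _ mg).
  exact: (continuous_ameas (@continuousCM R _ _ (@continuousC_cst R 'i) (@continuous_expi R))).
have hb t : normc (h t) <= 2 * M.
  rewrite /h normcM [normc ('i * _)]normcM normc_expi [normc 'i]normc_ReIm /= expr0n expr1n add0r sqrtr1 !mul1r.
  exact: gM.
have hL : aL1 h := aL1_bdd mh hb.
(* [circ_ftc] on the circles of radius [r k], passed to the limit under the bound [M]. *)
have phiE t : 0 < t <= 2 * pi -> phi t - phi 0 = ci 0 t h.
  move=> /andP[t0 t2].
  have sub : itv 0 t `<=` @D2 R.
    by move=> x; rewrite /itv /D2 /itv /= !in_itv /= => /andP[-> /le_trans]; exact.
  have c1 : (fun k => F ((r k)%:C * expi t) - F ((r k)%:C * expi 0)) @ \oo --> phi t - phi 0.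
    apply: cvgB.
      exact: (cvg_comp r (fun x : R => F (x%:C * expi t)) r_1 (phiP t)).
    exact: (cvg_comp r (fun x : R => F (x%:C * expi 0)) r_1 (phiP 0)).
  pose hk k s := 'i * ((r k)%:C * expi s) * f ((r k)%:C * expi s).
  have chk k : continuous (hk k).
    have c := @continuousCM R _ _ (@continuousC_cst R 'i) (@continuous_circ R (r k)).
    exact: (@continuousCM R _ (fun s => f ((r k)%:C * expi s)) c (cf k)).
  have mk k : cmeas (itv 0 t) (hk k).
    have [m1 m2] := continuous_ameas (chk k).
    by split; apply: measurable_funS sub _ => //; exact: mD2.
  have mt : cmeas (itv 0 t) h.
    have [m1 m2] := mh.
    by split; apply: measurable_funS sub _ => //; exact: mD2.
  have hc : {ae lam, forall s, itv 0 t s -> hk ^~ s @ \oo --> h s}.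
    apply: ae_imp gP => s gs Ds; have {gs} gs := gs (sub _ Ds).
    have rC : (fun k => (r k)%:C) @ \oo --> (1 : R[i]).
      apply: cvg_toC; apply: (cvg_comp r (fun x : R => x) r_1).
      exact: cvg_within.
    have e1 : (fun k => (r k)%:C * expi s) @ \oo --> expi s.
      by rewrite -[X in _ --> X]mul1r; apply: cvgCM; [exact: rC|exact: cvg_cst].
    have e2 : (fun k => 'i * ((r k)%:C * expi s)) @ \oo --> 'i * expi s.
      by apply: cvgCM; [exact: cvg_cst|exact: e1].
    exact: (@cvgCM R _ _ _ _ (fun k => circf f (r k) s) _ _ e2 gs).
  have hkb k s : itv 0 t s -> normc (hk k s) <= M.
    move=> _; rewrite /hk [normc (_ * f _)]normcM [normc ('i * _)]normcM.
    have /andP[a b] := r01' k.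
    rewrite normc_circ// [normc 'i]normc_ReIm /= expr0n expr1n add0r sqrtr1 !mul1r.
    apply: le_trans (fb k s); rewrite ler_piMl ?normc_ge0//; exact: ltW.
  have [_ c2] := @cI_dominated _ _ _ lam (itv 0 t) (@mitv R 0 t) hk h (fun=> M) mk mt hc
     (@L1_cst _ _ _ lam _ (@mitv R 0 t) (@lam_itv_fin R 0 t) M) hkb.
  apply: (cvgC_uniq c1).
  have -> : (fun k => F ((r k)%:C * expi t) - F ((r k)%:C * expi 0)) = (fun k => cI lam (itv 0 t) (hk k)).
    by apply/funext => k; exact: (circ_ftc Ff hf (r01' k) t0).
  exact: c2.
(* Lebesgue's differentiation theorem for the indefinite integral of [u] extended by 0; the radius
   is cut by [t] and [2 pi - t] so that [s] stays in the interval, where the extension is [u]. *)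
have ftc u : L1 lam (@D2 R) u -> {ae lam, forall t, D2 t -> 0 < t < 2 * pi ->
    forall e, 0 < e -> exists2 d : R, 0 < d & forall s, `|s - t| < d ->
     0 < s < 2 * pi /\ `|rI lam (itv 0 s) u - rI lam (itv 0 t) u - u t * (s - t)| <= e * `|s - t|}.
  move=> hu; set v := u \_ (@D2 R).
  have iv : lam.-integrable setT (EFin \o v).
    by move: hu; rewrite /L1 (integrable_mkcond _ (@mD2 R)) restrict_EFin.
  have iy y : lam.-integrable [set` Interval (BLeft 0) (BRight y)] (EFin \o v).
    by apply: integrableS iv => //; exact: measurable_itv.
  have lv : locally_integrable setT v by exact: integrable_locally (@mD2 R) hu.
  have := FTC1 iy lv; apply: ae_imp => t tP _ /andP[t0 t2] e e0.
  have [|dv dE] := tP; first by rewrite /= lte_fin.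
  set H := (fun x => _) in dv dE.
  have HE s : 0 <= s <= 2 * pi -> H s = rI lam (itv 0 s) u.
    move=> /andP[s0 s2]; apply: eq_Rintegral => x; rewrite inE /itv /= in_itv /= => /andP[x0 xs].
    rewrite /v patchE mem_set//; rewrite /D2 /itv /= in_itv /= x0 /=; exact: le_trans xs s2.
  have vt : v t = u t by rewrite /v patchE mem_set// /D2 /itv /= in_itv /= !ltW.
  have dH : is_derive t 1 H (v t).
    by apply: DeriveDef; [exact: dv|rewrite -derive1E].
  have [d d0 dP] := is_derive_small_o dH e0.
  exists (Num.min d (Num.min t (2 * pi - t))).
    by rewrite !lt_min d0 t0 subr_gt0.
  move=> s; rewrite !lt_min => /and3P[sd st s2].
  have st' : - t < s - t by rewrite ltrNl; apply: le_lt_trans st; rewrite -normrN ler_norm.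
  have s2' : s - t < 2 * pi - t by apply: le_lt_trans s2; exact: ler_norm.
  have s0 : 0 < s by lra.
  have ss : s < 2 * pi by lra.
  split; first by rewrite s0.
  by have := dP (s - t) sd; rewrite [t + _]addrC subrK !HE ?vt ?(ltW t0) ?(ltW t2) ?(ltW s0) ?(ltW ss).
have ends : {ae lam, forall t, D2 t -> 0 < t < 2 * pi}.
  exists [set 0; 2 * pi]; split => //=.
  - by rewrite setUC; apply: measurableU; exact: measurable_set1.
  - by apply: countable_lebesgue_measure0; apply/finite_set_countable/finite_set2.
  move=> t /= /not_implyP[]; rewrite /D2 /itv /= in_itv /= => /andP[t0 t2] tn.
  case: (eqVneq t 0) => [->|n0]; [by left|]; case: (eqVneq t (2 * pi)) => [->|n2]; [by right|].
  by case: tn; rewrite !lt_neqAle t0 t2 n2 eq_sym n0.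
have hRe := ftc _ hL.1; have hIm := ftc _ hL.2.
apply: ae_imp (ae_and (ae_and hRe hIm) ends) => t [[tR tI] t02] Dt.
have t0 := t02 Dt; exists (h t / ('i * expi t)).
apply: (fatou_point hF bphi Ff t0) => e e0.
have e2 : 0 < e / 2 by rewrite divr_gt0.
have [d1 d10 P1] := tR Dt t0 _ e2; have [d2 d20 P2] := tI Dt t0 _ e2.
exists (Num.min d1 d2); first by rewrite lt_min d10.
move=> s; rewrite lt_min => /andP[s1 s2].
have [sI Q1] := P1 s s1; have [_ Q2] := P2 s s2.
have -> : phi s - phi t - h t * (s - t)%:C = (phi s - phi 0) - (phi t - phi 0) - h t * (s - t)%:C by ring.
have [a b] := andP t0; have [c d] := andP sI.
rewrite !phiE ?a ?c ?(ltW b) ?(ltW d)//.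
apply: le_trans (normc_le_ReIm _) _; apply: (@le_trans _ _ (e / 2 * `|s - t| + e / 2 * `|s - t|)); last lra.
have RM (x y : R[i]) (k : R) : Re (x - y - h t * k%:C) = Re x - Re y - Re (h t) * k.
  by case: x y (h t) => [x1 x2] [y1 y2] [z1 z2] /=; rewrite mulr0 subr0.
have IM (x y : R[i]) (k : R) : Im (x - y - h t * k%:C) = Im x - Im y - Im (h t) * k.
  by case: x y (h t) => [x1 x2] [y1 y2] [z1 z2] /=; rewrite mulr0 add0r.
by rewrite RM IM; apply: lerD; [exact: Q1|exact: Q2].
Unshelve. all: by end_near. Qed.

End Fatou.

(** * Hardy norms and outer functions *)

Section HardyNorm.
Context {R : realType}.
Implicit Types (z w : R[i]) (r s t : R) (f g h : R[i] -> R[i]).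
Local Notation Re := complex.Re.
Local Notation Im := complex.Im.

Lemma discE z : disc z <-> normc z < 1.
Proof. by rewrite /disc /= normcE_Re ltcR. Qed.

Lemma circleE z : circle z <-> normc z = 1.
Proof.
rewrite /circle /= normcE_Re; split=> [/(congr1 (@complex.Re R))//|->//].
Qed.

Lemma analytic_holo f : analytic f <-> holo f.
Proof.
split=> hf z.
  by move=> /discE/hf/derivable_cder.
by move=> /discE/hf[d /cder_derivable].
Qed.

Lemma eq_en f g r : 0 <= r < 1 -> (forall z, normc z < 1 -> f z = g z) -> en f r = en g r.
Proof.
by move=> /andP[r0 r1] fg; apply: eq_ravg => t; rewrite /circf fg// normc_circ.
Qed.

Lemma en0 f : en f 0 = normc (f 0) ^+ 2.
Proof. by rewrite /en -[RHS]ravg_cst; apply: eq_ravg => t; rewrite /circf mul0r. Qed.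

Lemma en_ge_center f r : holo f -> 0 < r < 1 -> normc (f 0) ^+ 2 <= en f r.
Proof.
move=> hf r01; have := esum_le_en 1 hf r01.
by rewrite /esum big_ord1 coef0// expr0 expr1n mulr1.
Qed.

Lemma en_mul_le f g (M : R) r : holo f -> holo g -> 0 <= r < 1 ->
  (forall z, normc z < 1 -> normc (f z) <= M) ->
  en (fun z => f z * g z) r <= M ^+ 2 * en g r.
Proof.
move=> hf hg r01 fM; have [r0 r1] := andP r01.
rewrite /en -ravgZ; last exact: rL1_en.
apply: le_ravg; [exact: (rL1_en (holoM hf hg))|apply: rL1Z; exact: rL1_en|].
move=> t; rewrite /circf [normc (_ * g _)]normcM exprMn ler_wpM2r ?sqr_ge0//.
by rewrite lerXn2r ?nnegrE ?normc_ge0 ?fM ?normc_circ// (le_trans _ (fM 0 _)) ?normc_ge0// normc0.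
Qed.

Lemma holoD f g : holo f -> holo g -> holo (fun z => f z + g z).
Proof.
by move=> hf hg z z1; have [a fa] := hf z z1; have [b gb] := hg z z1; exists (a + b); exact: cderD.
Qed.

Lemma holo_csts (c : R[i]) : holo (fun=> c).
Proof. by move=> z _; exists 0; exact: cder_cst. Qed.

Lemma en_add_le f g r : holo f -> holo g -> 0 <= r < 1 ->
  en (fun z => f z + g z) r <= 2 * en f r + 2 * en g r.
Proof.
move=> hf hg r01; have i1 := rL1_en hf r01; have i2 := rL1_en hg r01.
rewrite /en -(ravgZ _ i1) -(ravgZ _ i2) -(ravgD (rL1Z 2 i1) (rL1Z 2 i2)).
apply: le_ravg; [exact: (rL1_en (holoD hf hg))|by apply: rL1D; exact: rL1Z|].
move=> t; rewrite /circf; have := le_normcD (f (r%:C * expi t)) (g (r%:C * expi t)).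
set x := normc (f _ + _); set a := normc _; set b := normc _ => h.
have [x0 a0 b0] : [/\ 0 <= x, 0 <= a & 0 <= b] by rewrite !normc_ge0.
have h2 : x ^+ 2 <= (a + b) ^+ 2 by rewrite lerXn2r ?nnegrE ?addr_ge0.
by have := sqr_ge0 (a - b); lra.
Qed.

(** Besides the change of variable, this restores the endpoint [2 pi] that [circle_measure] leaves
    out, so that Hardy norms can be expressed by [ravg]. *)
Lemma circle_integral (G : R[i] -> \bar R) : measurable_fun setT (G : borelC -> \bar R) ->
  (forall z, 0 <= G z)%E ->
  (\int[@circle_measure R]_z G z = ((2 * pi)^-1)%:E * \int[lam]_(t in @D2 R) G (expi t))%E.
Proof.
move=> mG G0.
have mGe : measurable_fun setT (G \o (expi : measurableTypeR R -> borelC)).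
  exact: (measurableT_comp mG (@measurable_expi R)).
rewrite /circle_measure ge0_integral_pushforward//; last exact: measurable_expi.
rewrite preimage_setT ge0_integral_mscale//; last by move=> x _; exact: G0.
congr (_ * _)%E.
set D : set (measurableTypeR R) := `[0, 2 * pi[%classic.
have mD : measurable D by exact: measurable_itv.
rewrite -(setUv D) ge0_integral_setU//=;
  [|exact: measurableC|by rewrite setUv|by rewrite disj_set_sym; apply/disj_setPS; rewrite setICl].
rewrite [X in (_ + X)%E](_ : _ = 0%E) ?adde0; last first.
  apply: null_set_integral => //; first exact: measurableC.
    exact: measurable_funS mGe.
  by rewrite /= /mrestr setICl measure0.
rewrite (@eq_measure_integral _ _ _ D lam)//; last first.
  by move=> A mA AD; rewrite /= /mrestr setIidl.
rewrite /D integral_itv_bndo_bndc//; exact: measurable_funS mGe.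
Qed.

(** Extension by 0 may destroy continuity, but [h] is continuous wherever it is nonzero: superlevel
    sets at levels [a >= 0] are open, those below 0 are everything. *)
Lemma measurable_circ h r : holo h -> off_disc0 h -> 0 <= r < 1 ->
  measurable_fun setT ((fun z => normc (h (r%:C * z))) : borelC -> R).
Proof.
move=> hh h0 /andP[r0 r1].
apply: (measurability _ (RGenOInfty.measurableE R)) => //.
move=> _ [_ [a ->] <-]; rewrite setTI.
have [a0|a0] := ltrP a 0.
  rewrite (_ : _ @^-1` _ = setT); first exact: measurableT.
  by apply/seteqP; split => // z _ /=; rewrite in_itv /= andbT (lt_le_trans a0)// normc_ge0.
apply: sub_sigma_algebra => /=.
rewrite openE => z /=; rewrite in_itv /= andbT => az.
have zr : normc (r%:C * z) < 1.
  apply/discE; apply: contrapT => /h0 h1; move: az; rewrite h1 normc0; lra.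
have [d /cder_cont/cvg_normc hc] := hh _ zr.
have c1 : (fun w => r%:C * w) @ z --> r%:C * z.
  exact: (cder_cont (cderZ r%:C (cder_id z))).
have := cvg_comp _ _ c1 hc => /cvgrPdist_lt/(_ (normc (h (r%:C * z)) - a)).
rewrite subr_gt0 => /(_ az); apply: filterS => w /= hw.
rewrite in_itv /= andbT; have := ler_norm (normc (h (r%:C * z)) - normc (h (r%:C * w))).
lra.
Qed.

Lemma Lnorm_circ h r : holo h -> off_disc0 h -> 0 <= r < 1 ->
  Lnorm (@circle_measure R) 2%:E (fun z : borelC => (normc (h (r%:C * z)))%:E) =
  (Num.sqrt (en h r))%:E.
Proof.
move=> hh h0 r01; have mh := measurable_circ hh h0 r01.
rewrite unlock /=.
have E z : ((`|normc (h (r%:C * z))| `^ 2)%:E = (normc (h (r%:C * z)) ^+ 2)%:E)%E.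
  by rewrite ger0_norm ?normc_ge0// -powR_mulrn ?normc_ge0.
under eq_integral do rewrite E.
rewrite circle_integral; [|apply/measurable_EFinP; exact: measurable_funX|by move=> z; rewrite lee_fin sqr_ge0].
have i := rL1_en hh r01.
rewrite -(fineK (integral_fune_fin_num (@mD2 R) i)) -EFinM poweR_EFin powR12_sqrt//.
exact: en_ge0.
Qed.

Lemma H2_norm_le h (B : R) : holo h -> off_disc0 h -> 0 <= B ->
  (forall r, 0 < r < 1 -> en h r <= B ^+ 2) -> (H2_norm h <= B%:E)%E.
Proof.
move=> hh h0 B0 hB; apply: ge_ereal_sup => _ [r r01 <-].
rewrite Lnorm_circ// lee_fin -[B]ger0_norm// -sqrtr_sqr; apply: ler_wsqrtr.
(* The supremum includes the radius 0, where the mean square is [|h 0|^2], below that of any other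
   circle. *)
have [r0 r1] := andP r01; have [r00|rn0] := eqVneq r 0; last first.
  by apply: hB; rewrite r1 lt_neqAle eq_sym rn0 r0.
have h01 : 0 < (2^-1 : R) < 1 by rewrite invr_gt0 ltr0n/= invf_lt1// ltr1n.
by rewrite r00 en0; apply: le_trans (hB _ h01); exact: en_ge_center.
Qed.

Lemma en_le_H2_norm h (B : R) r : holo h -> off_disc0 h ->
  (H2_norm h <= B%:E)%E -> 0 <= r < 1 -> en h r <= B ^+ 2.
Proof.
move=> hh h0 hB r01.
have : (Lnorm (@circle_measure R) 2%:E (fun z : borelC => (normc (h (r%:C * z)))%:E) <= B%:E)%E.
  by apply: le_trans hB; apply: ereal_sup_ubound; exists r.
rewrite Lnorm_circ// lee_fin => h1.
rewrite -[leLHS]sqr_sqrtr ?en_ge0// lerXn2r ?nnegrE ?sqrtr_ge0//.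
exact: le_trans (sqrtr_ge0 _) h1.
Qed.

Lemma H2_en_bdd h : H2 h -> exists2 B : R, 0 <= B & forall r, 0 < r < 1 -> en h r <= B.
Proof.
move=> [/analytic_holo hh h0 hB].
have n0 : (0 <= H2_norm h)%E.
  apply: (@le_trans _ _ (Lnorm (@circle_measure R) 2%:E (fun z : borelC => (normc (h (0%:C * z)))%:E))).
    exact: Lnorm_ge0.
  by apply: ereal_sup_ubound; exists 0 => //=; rewrite lexx ltr01.
exists (fine (H2_norm h) ^+ 2); first exact: sqr_ge0.
move=> r /andP[r0 r1]; apply: en_le_H2_norm => //; last by rewrite (ltW r0).
by rewrite fineK// ge0_fin_numE.
Qed.

Lemma H2P h (B : R) : holo h -> off_disc0 h -> 0 <= B ->
  (forall r, 0 < r < 1 -> en h r <= B) -> H2 h.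
Proof.
move=> hh h0 B0 hB; split => //; first exact/analytic_holo.
apply: le_lt_trans (H2_norm_le (B := Num.sqrt B) hh h0 (sqrtr_ge0 _) _) _; last exact: ltry.
by move=> r /hB; rewrite sqr_sqrtr.
Qed.

(** Point evaluation is bounded in mean square: Poisson's formula, [pker z t <= 2 / (1 - |z|)] and
    [2 x <= a + x^2 / a], where the free [a] stands in for Cauchy-Schwarz. *)
Lemma normc_le_en h r z (a : R) : holo h -> 0 < r < 1 -> normc z < 1 -> 0 < a ->
  normc (h (r%:C * z)) <= (a + en h r / a) / (1 - normc z).
Proof.
move=> hh r01 z1 a0; have r01' : 0 <= r < 1 by have [x y] := andP r01; rewrite (ltW x).
rewrite -poisson_formula//.
have hc := aL1_circf hh r01'; have hp := aL1_pker z1 hc.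
apply: le_trans (normc_avg_le hp) _.
have i2 := rL1_en hh r01'.
have i3 : rL1 (fun t => (1 - normc z)^-1 * (a + a^-1 * normc (circf h r t) ^+ 2)).
  by apply: rL1Z; apply: rL1D; [exact: rL1_cst|exact: rL1Z].
apply: (@le_trans _ _ (ravg (fun t => (1 - normc z)^-1 * (a + a^-1 * normc (circf h r t) ^+ 2)))).
  apply: le_ravg; [exact: aL1_normc|exact: i3|].
  move=> t; rewrite normcM normcR ger0_norm ?pker_ge0//; set x := normc (circf h r t).
  have x0 : 0 <= x := normc_ge0 _.
  apply: (@le_trans _ _ (x * (2 / (1 - normc z)))); first by rewrite ler_wpM2l ?pker_le.
  rewrite mulrA mulrC ler_wpM2l ?invr_ge0 ?subr_ge0 ?(ltW z1)//.
  rewrite -subr_ge0 (_ : _ - _ = a^-1 * (x - a) ^+ 2); last by field; rewrite gt_eqF.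
  by rewrite mulr_ge0 ?sqr_ge0// invr_ge0 ltW.
have i4 := rL1Z a^-1 i2.
rewrite (ravgZ _ (rL1D (rL1_cst a) i4)) (ravgD (rL1_cst a) i4) ravg_cst (ravgZ _ i2).
by rewrite mulrC [a^-1 * _]mulrC.
Qed.

End HardyNorm.

Section HinfElements.
Context {R : realType}.
Implicit Types (z w : R[i]) (r s t : R) (F G : Hinf R) (f g h p : R[i] -> R[i]).
Local Notation Re := complex.Re.
Local Notation Im := complex.Im.

Lemma HinfP F : [/\ holo F, off_disc0 F & exists M : R, forall z, normc z < 1 -> normc (F z) <= M].
Proof.
case: F => f /= /set_mem[/analytic_holo hf f0 [M fM]]; split => //.
by exists M => z /discE; exact: fM.
Qed.

Lemma Hinf_holo F : holo F. Proof. by case: (HinfP F). Qed.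

Definition hnorm F : R := sup_norm disc F.

Lemma Hinf_normE F : `|F| = (hnorm F)%:C.
Proof. by []. Qed.

Lemma normc_le_hnorm F z : normc z < 1 -> normc (F z) <= hnorm F.
Proof. by move=> /discE z1; apply: sup_norm_ub => //; exact: Hinf_bounded. Qed.

Lemma hnorm_le F (M : R) : (forall z, normc z < 1 -> normc (F z) <= M) -> hnorm F <= M.
Proof. by move=> FM; apply: sup_norm_le; [exact: disc0|move=> z /discE; exact: FM]. Qed.

Lemma hnorm_ge0 F : 0 <= hnorm F.
Proof.
by apply: le_trans (normc_le_hnorm F (z := 0) _); rewrite ?normc_ge0// normc0 ltr01.
Qed.

Lemma HinfD F G z : (F + G) z = F z + G z. Proof. by []. Qed.
Lemma HinfB F G z : (F - G) z = F z - G z. Proof. by []. Qed.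
Lemma HinfZ (c : R[i]) F z : (c *: F) z = c * F z. Proof. by []. Qed.

Lemma Hinf_ext F G : (forall z, normc z < 1 -> F z = G z) -> F = G.
Proof.
move=> FG; apply: val_inj; apply/funext => z /=.
have [z1|z1] := boolP (normc z < 1); first exact: FG.
have nz : ~ disc z by move/discE; exact/negP.
by have [_ F0 _] := HinfP F; have [_ G0 _] := HinfP G; rewrite F0// G0.
Qed.

Lemma Hinf_ex f (M : R) : holo f -> (forall z, normc z < 1 -> normc (f z) <= M) ->
  exists F : Hinf R, forall z, normc z < 1 -> F z = f z.
Proof.
move=> hf fM; pose f1 z := if normc z < 1 then f z else 0.
have f1E z : normc z < 1 -> f1 z = f z by rewrite /f1 => ->.
have f1P : f1 \in Hinf_pred.
  apply/mem_set; split.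
  - apply/analytic_holo => z z1; have [d fd] := hf z z1; exists d.
    by apply: (cder_near _ fd); apply: (disc_near z1) => w w1; rewrite f1E.
  - by move=> z nz; rewrite /f1; case: ifP => // z1; case: nz; exact/discE.
  - by exists M => z /discE z1; rewrite f1E//; exact: fM.
by exists (MkHinf f1P).
Qed.

Lemma HinfM_ex F G : exists FG : Hinf R, forall z, FG z = F z * G z.
Proof.
have FGb z : normc z < 1 -> normc (F z * G z) <= hnorm F * hnorm G.
  by move=> z1; rewrite normcM; apply: ler_pM; rewrite ?normc_ge0 ?normc_le_hnorm.
have [FG FGE] := Hinf_ex (holoM (@Hinf_holo F) (@Hinf_holo G)) FGb.
exists FG => z; have [z1|z1] := boolP (normc z < 1); first exact: FGE.
have nz : ~ disc z by move/discE; exact/negP.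
by have [_ F0 _] := HinfP FG; have [_ G0 _] := HinfP G; rewrite F0// G0// mulr0.
Qed.

Lemma closure_HinfP (A : set (Hinf R)) F : closure A F <->
  forall e : R, 0 < e -> exists2 G, A G & forall z, normc z < 1 -> normc (F z - G z) <= e.
Proof.
split=> [cF e e0|h B /nbhs_ballP[e /= e0 eB]].
  have eC : 0 < e%:C :> R[i] by rewrite ltcR.
  have [G [AG]] := cF _ (nbhsx_ballx F e%:C eC).
  rewrite -ball_normE /= Hinf_normE ltcR => FG; exists G => // z z1.
  by rewrite -HinfB; apply: le_trans (normc_le_hnorm _ z1) (ltW FG).
have [e1 e10 eE] : exists2 e1 : R, 0 < e1 & e = e1%:C.
  by move: e0; rewrite ltcE /= => /andP[/eqP ei er]; exists (Re e) => //; case: (e) ei => a b /= ->.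
have [G AG FG] := h _ (divr_gt0 e10 (ltr0Sn _ 1)).
exists G; split => //; apply: eB; rewrite -ball_normE /= Hinf_normE eE ltcR.
apply: (@le_lt_trans _ _ (e1 / 2)); last lra.
by apply: hnorm_le => z z1; rewrite HinfB FG.
Qed.

Lemma ideal_HinfP F G : Hinf_ideal F G <->
  forall e : R, 0 < e -> exists K : Hinf R, forall z, normc z < 1 -> normc (G z - F z * K z) <= e.
Proof.
rewrite /Hinf_ideal closure_HinfP; split=> h e e0.
  by have [H [K HK] HG] := h e e0; exists K => z z1; rewrite -HK HG.
have [K KP] := h e e0; have [H HE] := HinfM_ex F K.
by exists H; [exists K|move=> z z1; rewrite HE KP].
Qed.

Lemma lin_span_monomialsP F h :
  lin_span [set (fun z => z ^+ m * F z) | m in [set: nat]] h <->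
  exists (a : nat -> R[i]) N, h = fun z => psum a N z * F z.
Proof.
split=> [[n [c [u [uA ->]]]]|[a [N ->]]]; last first.
  exists N, (fun i => a i), (fun i z => z ^+ i * F z); split.
    by move=> i; exists (nat_of_ord i).
  apply/funext => z; rewrite /psum mulr_suml fct_sumE; apply: eq_bigr => i _.
  by rewrite -[RHS]/(a i * (z ^+ i * F z)) mulrA.
elim: n c u uA => [|n IH] c u uA.
  by exists (fun=> 0), 0%N; rewrite big_ord0; apply/funext => z; rewrite /psum big_ord0 mul0r.
have [a [N E]] := IH (c \o lift ord0) (u \o lift ord0) (fun i => uA (lift ord0 i)).
have [m _ um] := uA ord0.
(* Exponents may repeat in a linear combination, so the new term is added to the old coefficient
   instead of being appended. *)
exists (fun k => (if (k < N)%N then a k else 0) + (if k == m then c ord0 else 0)), (maxn N m.+1).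
apply/funext => z; rewrite big_ord_recl /= E -um /psum.
under [X in _ = X * _]eq_bigr do rewrite mulrDl.
rewrite big_split mulrDl; transitivity (psum a N z * F z + c ord0 * (z ^+ m * F z)); first exact: addrC.
congr (_ + _); first (congr (_ * _); rewrite /psum).
  rewrite (big_ord_widen (maxn N m.+1) (fun k => a k * z ^+ k)) ?leq_maxl// big_mkcond /=.
  by apply: eq_bigr => i _; case: ifP => // _; rewrite mul0r.
have mN : (m < maxn N m.+1)%N by rewrite leq_max leqnn orbT.
rewrite (bigD1 (Ordinal mN)) //= eqxx big1 ?addr0 ?mulrA// => i im.
by rewrite ifN ?mul0r//; apply: contra im => /eqP im; apply/eqP/val_inj.
Qed.

Lemma psum_bdd (a : nat -> R[i]) N : exists M : R, forall z, normc z < 1 -> normc (psum a N z) <= M.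
Proof.
exists (\sum_(n < N) normc (a n)) => z z1; apply: le_trans (normc_sum _) _.
apply: ler_sum => i _; rewrite normcM normcX ler_piMr ?normc_ge0//.
by rewrite exprn_ile1 ?normc_ge0// ltW.
Qed.

(** The span allows only polynomial multiples of [F]. So [h] is replaced by a Taylor polynomial [q],
    then [q] by [q F G], which is close as [q] is bounded, and at last the bounded function [q G] by
    a polynomial [p]. *)
Lemma outer_of_approx F :
  (forall e : R, 0 < e -> exists G : Hinf R, forall r, 0 < r < 1 ->
     en (fun z => 1 - F z * G z) r <= e) -> outer F.
Proof.
move=> hF; apply/seteqP; split=> [h []//|h Hh]; split => // e e0.
have [/analytic_holo hh h0 _] := Hh; have [S S0 hS] := H2_en_bdd Hh.
have [holoF F0 [M FM]] := HinfP F.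
have M0 : 0 <= M by apply: le_trans (FM 0 _); rewrite ?normc_ge0// normc0 ltr01.
(* Two uses of [en_add_le] lead to [10 d = 10/16 e^2], below [(7/8 e)^2]; the factor 7/8 makes the
   final inequality strict. *)
set d := e ^+ 2 / 16; have d0 : 0 < d by rewrite divr_gt0 ?exprn_gt0.
have [N1 hN1] := taylor_small hh hS d0.
pose q := psum (coef h) N1; have [Q qQ] := psum_bdd (coef h) N1.
have hq : holo q := holo_psum _ _.
have Q1 : 0 < Q ^+ 2 + 1 by rewrite ltr_wpDl ?sqr_ge0.
have M1 : 0 < M ^+ 2 + 1 by rewrite ltr_wpDl ?sqr_ge0.
have [G GP] := hF _ (divr_gt0 d0 Q1).
pose k z := q z * G z.
have hk : holo k := holoM hq (@Hinf_holo G).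
have kb r : 0 < r < 1 -> en k r <= (Q * hnorm G) ^+ 2.
  move=> /andP[r0 r1]; apply: en_bdd => //; last by rewrite (ltW r0).
  by move=> z z1; rewrite /k normcM; apply: ler_pM; rewrite ?normc_ge0 ?normc_le_hnorm ?qQ.
have [N2 hN2] := taylor_small hk kb (divr_gt0 d0 M1).
pose p := psum (coef k) N2; have hp : holo p := holo_psum _ _.
exists (fun z => p z * F z); first by apply/lin_span_monomialsP; exists (coef k), N2.
have hFp : holo (fun z => p z * F z) := holoM hp holoF.
apply: (@le_lt_trans _ _ (e * (7 / 8))%:E); last first.
  by rewrite lte_fin; lra.
apply: H2_norm_le.
- exact: holoB.
- by move=> z nz; rewrite -[LHS]/(h z - p z * F z) h0// F0// mulr0 subr0.
- by rewrite mulr_ge0 ?ltW//; lra.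
move=> r r01; have r01' : 0 <= r < 1 by have [x y] := andP r01; rewrite (ltW x).
have E z : normc z < 1 -> h z - p z * F z =
    (taylor_rest h N1 z + q z * (1 - F z * G z)) + F z * taylor_rest k N2 z.
  by move=> _; rewrite /taylor_rest -/q -/p /k; ring.
have h1 := holo_taylor_rest N1 hh; have h3 := holo_taylor_rest N2 hk.
have hFG : holo (fun z => 1 - F z * G z).
  by apply: holoB; [exact: holo_csts|apply: holoM => //; exact: Hinf_holo].
have h2 : holo (fun z => q z * (1 - F z * G z)) := holoM hq hFG.
have h4 : holo (fun z => F z * taylor_rest k N2 z) := holoM holoF h3.
rewrite (eq_en r01' E).
have a1 := en_add_le (holoD h1 h2) h4 r01'.
have a2 := en_add_le h1 h2 r01'.
have b1 := hN1 r r01.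
have b2 := en_mul_le hq hFG r01' qQ.
have b3 := en_mul_le holoF h3 r01' FM.
have c2 : Q ^+ 2 * en (fun z => 1 - F z * G z) r <= d.
  apply: (@le_trans _ _ ((Q ^+ 2 + 1) * (d / (Q ^+ 2 + 1)))); last by rewrite mulrC divfK ?gt_eqF.
  by apply: ler_pM; rewrite ?sqr_ge0 ?en_ge0 ?GP// lerDl.
have c3 : M ^+ 2 * en (taylor_rest k N2) r <= d.
  apply: (@le_trans _ _ ((M ^+ 2 + 1) * (d / (M ^+ 2 + 1)))); last by rewrite mulrC divfK ?gt_eqF.
  by apply: ler_pM; rewrite ?sqr_ge0 ?en_ge0 ?hN2// lerDl.
have d2 : d <= e ^+ 2 / 16 by [].
have e2 : 0 < e ^+ 2 by rewrite exprn_gt0.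
rewrite exprMn; lra.
Qed.

Lemma Hinf_one_ex : exists one : Hinf R, forall z, normc z < 1 -> one z = 1.
Proof.
by apply: (@Hinf_ex (fun=> 1) 1 (@holo_csts R 1)) => z _; rewrite normc1.
Qed.

Lemma outer_approx F : outer F -> forall e : R, 0 < e -> exists a N,
  forall r, 0 < r < 1 -> en (fun z => 1 - psum a N z * F z) r <= e.
Proof.
move=> oF e e0; have [one oneE] := Hinf_one_ex; have [h1 one0 _] := HinfP one.
have H1 : H2 one.
  apply: (H2P h1 one0 (B := 1)) => // r /andP[r0 r1].
  rewrite -[leRHS](expr1n _ 2); apply: en_bdd => //; last by rewrite (ltW r0).
  by move=> z z1; rewrite oneE// normc1.
move: H1; rewrite -oF => -[_ /(_ (Num.sqrt e))]; rewrite sqrtr_gt0 => /(_ e0)[h].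
move=> /lin_span_monomialsP[a [N ->]] hN; exists a, N => r r01.
have [holoF F0 _] := HinfP F.
have r01' : 0 <= r < 1 by have [x y] := andP r01; rewrite (ltW x).
have hh : holo (fun z => one z - psum a N z * F z).
  by apply: holoB => //; apply: holoM => //; exact: holo_psum.
have hd : off_disc0 (fun z => one z - psum a N z * F z).
  by move=> z nz; rewrite one0// F0// mulr0 subr0.
have := en_le_H2_norm hh hd (ltW hN) r01'; rewrite sqr_sqrtr ?(ltW e0)//.
by rewrite (eq_en (g := fun z => 1 - psum a N z * F z) r01')// => z z1; rewrite oneE.
Qed.

(** At a zero of [F] every [1 - p F] has the value 1, while point evaluation is bounded by
    [normc_le_en]. With [d = (1 - |w|) / 4] this reads [1 - |w| <= 2 d]. *)
Lemma outer_neq0 F z : outer F -> normc z < 1 -> F z != 0.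
Proof.
move=> oF z1; apply/eqP => Fz.
set r := (1 + normc z) / 2; have z0 := normc_ge0 z.
have r01 : 0 < r < 1 by rewrite /r; apply/andP; split; lra.
have rz : normc z < r by rewrite /r; lra.
have r0 : 0 < r by have [] := andP r01.
set w := (r^-1)%:C * z.
have wz : r%:C * w = z by rewrite /w mulrA -toCM mulfV ?gt_eqF// mul1r.
have w1 : normc w < 1.
  by rewrite /w normcM normcR ger0_norm ?invr_ge0 ?(ltW r0)// mulrC ltr_pdivrMr// mul1r.
set d := (1 - normc w) / 4; have d0 : 0 < d by rewrite /d; lra.
have [a [N hN]] := outer_approx oF (exprn_gt0 2 d0).
have hh : holo (fun z => 1 - psum a N z * F z).
  by apply: holoB; [exact: holo_csts|apply: holoM; [exact: holo_psum|exact: Hinf_holo]].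
have := normc_le_en hh r01 w1 d0; rewrite wz Fz mulr0 subr0 normc1.
rewrite ler_pdivlMr ?subr_gt0// mul1r.
have : en (fun z => 1 - psum a N z * F z) r / d <= d by rewrite ler_pdivrMr// -expr2 hN.
by rewrite /d; lra.
Qed.

End HinfElements.

(** * Hahn-Banach and the two-ball property of M-ideals *)

Section HahnBanach.
Context {R : realType} {V : lmodType R[i]}.
Implicit Types (p q : V -> R) (x y : V).

Definition sublinear q := (forall x y, q (x + y) <= q x + q y) /\
  (forall (a : R) x, 0 <= a -> q (a%:C *: x) = a * q x).

Lemma sublinear0 q : sublinear q -> q 0 = 0.
Proof. by move=> [_ /(_ 0 0 (lexx _))]; rewrite scaler0 mul0r. Qed.

Lemma sublinear_lb q x : sublinear q -> - q (- x) <= q x.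
Proof. by move=> sq; have := sq.1 x (- x); rewrite subrr sublinear0// => h; lra. Qed.

(* a sublinear minorant of p that is linear in the direction of x0 *)
Definition slide p x0 x := inf [set p (x + t%:C *: x0) - t * p x0 | t in [set t : R | 0 <= t]].

Section Slide.
Variables (p : V -> R) (x0 : V).
Hypothesis sp : sublinear p.

Let slide_lb x : has_lbound [set p (x + t%:C *: x0) - t * p x0 | t in [set t : R | 0 <= t]].
Proof.
exists (- p (- x)) => _ [t /= t0 <-].
have := sp.1 (x + t%:C *: x0) (- x); rewrite addrAC subrr add0r sp.2// => h; lra.
Qed.

Lemma slide_ub x (t : R) : 0 <= t -> slide p x0 x <= p (x + t%:C *: x0) - t * p x0.
Proof. by move=> t0; apply: ge_inf; [exact: slide_lb|exists t]. Qed.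

Lemma slide_ge x (c : R) : (forall t : R, 0 <= t -> c <= p (x + t%:C *: x0) - t * p x0) ->
  c <= slide p x0 x.
Proof.
move=> h; apply: lb_le_inf; first by exists (p (x + 0%:C *: x0) - 0 * p x0), 0 => /=.
by move=> _ [t /= t0 <-]; exact: h.
Qed.

Lemma slide_le x : slide p x0 x <= p x.
Proof. by have := slide_ub x (lexx 0); rewrite scale0r addr0 mul0r subr0. Qed.

Lemma slideN : slide p x0 (- x0) <= - p x0.
Proof. by have := slide_ub (- x0) ler01; rewrite scale1r addNr sublinear0// mul1r sub0r. Qed.

Lemma sublinear_slide : sublinear (slide p x0).
Proof.
split=> [x y|a x a0].
  rewrite -lerBlDr; apply: slide_ge => t t0; rewrite lerBlDr -lerBlDl.
  apply: slide_ge => s s0; rewrite lerBlDl.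
  have := slide_ub (x + y) (addr_ge0 t0 s0).
  have := sp.1 (x + t%:C *: x0) (y + s%:C *: x0).
  rewrite addrACA -scalerDl -toCD mulrDl => h1 h2; lra.
have h (b : R) (z : V) : 0 < b -> slide p x0 (b%:C *: z) <= b * slide p x0 z.
  move=> b0; rewrite mulrC -ler_pdivrMr//; apply: slide_ge => t t0.
  rewrite ler_pdivrMr//; apply: le_trans (slide_ub _ (mulr_ge0 (ltW b0) t0)) _.
  by rewrite toCM -scalerA -scalerDr sp.2 ?(ltW b0)// mulrBl -mulrA; lra.
have [->|an0] := eqVneq a 0.
  rewrite scale0r mul0r; apply/eqP; rewrite eq_le; apply/andP; split.
    by apply: le_trans (slide_le 0) _; rewrite sublinear0.
  by apply: slide_ge => t t0; rewrite add0r sp.2// subrr.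
have a1 : 0 < a by rewrite lt_neqAle eq_sym an0.
apply/eqP; rewrite eq_le h//=.
have := h a^-1 (a%:C *: x); rewrite invr_gt0 => /(_ a1).
by rewrite scalerA -toCM mulVf// scale1r mulrC ler_pdivlMr// mulrC.
Qed.

End Slide.

(** Zorn's lemma for the reversed order. The pointwise infimum of a chain is subadditive because of
    two members the smaller one serves at both points; it stays finite since each member is at least
    [- p (- x)]. *)
Lemma minimal_sublinear p : sublinear p -> exists q, [/\ sublinear q, forall x, q x <= p x &
  forall q', sublinear q' -> (forall x, q' x <= q x) -> forall x, q' x = q x].
Proof.
move=> sp; pose T := {q | sublinear q /\ forall x, q x <= p x}.
pose ord (q1 q2 : T) := `[< forall x, sval q2 x <= sval q1 x >].
have sp' : sublinear p /\ forall x, p x <= p x by [].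
have [| | |[q [sq qp]] qmin] := @ZL_preorder T (exist _ p sp') ord.
- by move=> q; apply/asboolP.
- by move=> a b c /asboolP ba /asboolP cb; apply/asboolP => x; exact: le_trans (cb x) (ba x).
- move=> A totA; have [[a0 Aa0]|A0] := pselect (exists a : T, A a); last first.
    by exists (exist _ p sp') => s As; case: A0; exists s.
  pose S x := [set sval a x | a in A].
  have lbS x : has_lbound (S x).
    exists (- p (- x)) => _ [[a [sa ap]] Aa <-] /=.
    by apply: le_trans (sublinear_lb x sa); rewrite lerN2.
  have ubS x a : A a -> inf (S x) <= sval a x by move=> Aa; apply: ge_inf => //; exists a.
  have geS x c : (forall a, A a -> c <= sval a x) -> c <= inf (S x).
    by move=> h; apply: lb_le_inf; [exists (sval a0 x), a0|move=> _ [a Aa <-]; exact: h].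
  have sS : sublinear (fun x => inf (S x)).
    split=> [x y|c x c0].
      rewrite -lerBlDr; apply: (geS _) => a Aa; rewrite lerBlDr -lerBlDl.
      apply: (geS _) => b Ab; rewrite lerBlDl.
      have [/asboolP ab|/asboolP ab] := totA a b Aa Ab.
        apply: le_trans (ubS _ b Ab) _; apply: le_trans ((svalP b).1.1 x y) _.
        by rewrite lerD2r ab.
      apply: le_trans (ubS _ a Aa) _; apply: le_trans ((svalP a).1.1 x y) _.
      by rewrite lerD2l ab.
    have [->|cn0] := eqVneq c 0.
      rewrite scale0r mul0r; apply/eqP; rewrite eq_le; apply/andP; split.
        by apply: le_trans (ubS _ a0 Aa0) _; rewrite sublinear0//; exact: (svalP a0).1.
      by apply: (geS _) => a Aa; rewrite sublinear0//; exact: (svalP a).1.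
    have c1 : 0 < c by rewrite lt_neqAle eq_sym cn0.
    apply/eqP; rewrite eq_le; apply/andP; split.
      rewrite mulrC -ler_pdivrMr//; apply: (geS _) => a Aa; rewrite ler_pdivrMr//.
      by apply: le_trans (ubS _ a Aa) _; rewrite (svalP a).1.2// mulrC.
    apply: (geS _) => a Aa; rewrite (svalP a).1.2// ler_pM2l//; exact: ubS.
  have Sp : forall x, inf (S x) <= p x.
    by move=> x; apply: le_trans (ubS x a0 Aa0) _; exact: (svalP a0).2.
  exists (exist _ (fun x => inf (S x)) (conj sS Sp)) => a Aa.
  by apply/asboolP => x; exact: ubS.
exists q; split=> // q' sq' q'q x.
have h : sublinear q' /\ forall x, q' x <= p x.
  by split => // y; exact: le_trans (q'q y) (qp y).
have /asboolP qq' := qmin (exist _ q' h) (asboolT q'q).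
by apply/eqP; rewrite eq_le q'q; exact: qq'.
Qed.

(** A minimal sublinear functional equals its own slide in every direction, so [q (- x) <= - q x]
    and [q] is linear. Taking it below the slide of [p] along [x0] forces [q x0 = p x0]; no
    extension from a subspace is involved. *)
Lemma hahn_banach p x0 : sublinear p -> exists l : V -> R,
  [/\ forall x y, l (x + y) = l x + l y, forall (a : R) x, l (a%:C *: x) = a * l x,
      forall x, l x <= p x & l x0 = p x0].
Proof.
move=> sp; have [q [sq qs qmin]] := minimal_sublinear (sublinear_slide x0 sp).
have qN x : q (- x) = - q x.
  have h := qmin _ (sublinear_slide x sq) (slide_le x sq).
  apply/eqP; rewrite eq_le; apply/andP; split.
    by rewrite -h; exact: slideN.
  by have := sublinear_lb (- x) sq; rewrite opprK.
have qD x y : q (x + y) = q x + q y.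
  apply/eqP; rewrite eq_le sq.1/=.
  have := sq.1 (x + y) (- y); rewrite addrK qN; lra.
exists q; split=> //.
- move=> a x; have [a0|a0] := lerP 0 a; first exact: sq.2.
  have -> : a%:C *: x = - ((- a)%:C *: x) by rewrite rmorphN/= scaleNr opprK.
  by rewrite qN sq.2 ?oppr_ge0 ?(ltW a0)// mulNr opprK.
- by move=> x; apply: le_trans (qs x) _; exact: slide_le.
apply/eqP; rewrite eq_le; apply/andP; split.
  by apply: le_trans (qs x0) _; exact: slide_le.
have := le_trans (qs (- x0)) (slideN x0 sp).
by rewrite qN lerN2.
Qed.

(** The complexification [l x - i l (i x)]; a rotation that makes its value at [x] real and
    nonnegative carries the real bound over to the modulus. *)
Lemma hahn_banach_complex p x0 : (forall x y, p (x + y) <= p x + p y) ->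
  (forall c x, p (c *: x) = normc c * p x) -> exists l : V -> R[i],
  [/\ linear l, forall x, normc (l x) <= p x & complex.Re (l x0) = p x0].
Proof.
move=> pD pZ; have sp : sublinear p.
  by split=> // a x a0; rewrite pZ normcR ger0_norm.
have [l [lD lZ lp l0]] := hahn_banach x0 sp.
pose L x : R[i] := l x +i* - l ('i *: x).
have LD x y : L (x + y) = L x + L y.
  by rewrite /L scalerDr !lD opprD; simpc.
have LZ c x : L (c *: x) = c * L x.
  case: c => a b.
  have E : (a +i* b) = a%:C + b%:C * 'i :> R[i] by simpc.
  have E2 : 'i * (a +i* b) = (- b)%:C + a%:C * 'i :> R[i] by simpc.
  by rewrite /L scalerA E2 E !scalerDl !lD -!scalerA !lZ; simpc; congr (_ +i* _); ring.
exists L; split=> //; first by move=> c x y; rewrite LD LZ.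
move=> x; have [L0|L0] := eqVneq (L x) 0.
  rewrite L0 normc0; have := pZ 0 x; have := pD x (- x).
  have := pZ (- 1) x; rewrite scaleN1r normcN normc1 mul1r => ->.
  by rewrite subrr scale0r normc0 mul0r => h h0; move: h; rewrite h0; lra.
set n := normc (L x); have n0 : 0 < n.
  by rewrite lt_neqAle normc_ge0 andbT eq_sym; apply: contra_neq L0 => /eq0_normc.
pose c := conjc (L x) / n%:C.
have nc : normc c = 1 by rewrite normc_div normc_conj normcR -/n gtr0_norm// divff// gt_eqF.
have cL : L (c *: x) = n%:C.
  rewrite LZ /c mulrAC mul_conj -/n toCX expr2 mulfK// toC_neq0// gt_eqF//.
have := lp (c *: x); rewrite pZ nc mul1r; congr (_ <= _).
by have := congr1 (@complex.Re R) cL.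
Qed.

End HahnBanach.

Lemma phase (R : realType) (c : R[i]) : exists2 b : R[i], normc b = 1 & b * c = (normc c)%:C.
Proof.
have [->|c0] := eqVneq c 0; first by exists 1; rewrite ?normc1// normc0 mulr0.
have n0 : normc c != 0 by apply: contra_neq c0 => /eq0_normc.
exists (conjc c / (normc c)%:C).
  by rewrite normc_div normc_conj normcR ger0_norm ?normc_ge0// divff.
by rewrite mulrAC mul_conj toCX expr2 mulfK// toC_neq0.
Qed.

Section TwoBall.
Context {R : realType} (X : normedModType R[i]).
Implicit Types (x y e u : X) (phi : dual X).
Local Notation Re := complex.Re.

Definition nrm x : R := Re `|x|.

Lemma nrmE x : `|x| = (nrm x)%:C.
Proof.
have := normr_ge0 x; rewrite lecE /= /nrm => /andP[/eqP h _].
by case: `|x| h => a b /= ->.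
Qed.

Lemma nrm_ge0 x : 0 <= nrm x.
Proof. by have := normr_ge0 x; rewrite nrmE lecR. Qed.

Lemma nrmD x y : nrm (x + y) <= nrm x + nrm y.
Proof. by have := ler_normD x y; rewrite !nrmE -toCD lecR. Qed.

Lemma nrmZ (c : R[i]) x : nrm (c *: x) = normc c * nrm x.
Proof. by have := normrZ c x; rewrite !nrmE normcE_Re -toCM => /complexI. Qed.

Definition dnorm phi : R := sup_norm (@unit_ball R X) phi.

Lemma dual_le phi x : nrm x <= 1 -> normc (phi x) <= dnorm phi.
Proof.
move=> x1; apply: sup_norm_ub; first exact: dual_bounded.
by rewrite /unit_ball /= nrmE lecR.
Qed.

Lemma dual_linear phi : linear phi.
Proof. by case: phi => ? /= /set_mem[]. Qed.

Lemma dualD phi x y : phi (x + y) = phi x + phi y.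
Proof. by have := dual_linear phi 1 x y; rewrite !scale1r. Qed.

Lemma dualN phi x : phi (- x) = - phi x.
Proof.
have p0 : phi 0 = 0 by apply: (addrI (phi 0)); rewrite -dualD !addr0.
by apply/eqP; rewrite -addr_eq0 -dualD addNr p0.
Qed.

Lemma dual_ex (l : X -> R[i]) (M : R) : linear l -> (forall x, normc (l x) <= M * nrm x) ->
  exists phi : dual X, forall x, phi x = l x.
Proof.
move=> ll lM; suff h : l \in @dual_pred R X by exists (Dual h).
apply/mem_set; split => // x; apply/cvgCP => e e0.
have M1 : 0 < `|M| + 1 by rewrite ltr_wpDl.
have d0 : 0 < (e / (`|M| + 1))%:C :> R[i] by rewrite ltcR divr_gt0.
apply: filterS (nbhsx_ballx x _ d0) => y; rewrite -ball_normE /= nrmE ltcR => xy.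
have -> : l y - l x = l (y - x).
  have := ll (- 1) x y; rewrite !scaleN1r [- x + y]addrC => ->.
  by rewrite addrC; congr (_ + _); rewrite -mulN1r.
apply: le_lt_trans (lM _) _.
have -> : nrm (y - x) = nrm (x - y).
  by have := nrmZ (- 1) (x - y); rewrite scaleN1r opprB normcN normc1 mul1r.
apply: (@le_lt_trans _ _ ((`|M| + 1) * nrm (x - y))).
  by rewrite ler_wpM2r ?nrm_ge0//; have := ler_norm M; lra.
by rewrite mulrC -ltr_pdivlMr.
Qed.

(** [p] is the distance, in the maximum norm of [X * X], to the diagonal copy of [C], and the claim
    is [p (u + y, u - y) <= 1]. A functional attaining this value has components [f1], [f2] with
    norms adding up to at most 1, and [f1 + f2] annihilates [C]. Hence [P] fixes the sum, and the
    parts outside its range are opposite. *)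
Lemma M_ideal_two_ball (C : set X) u y (d : R) : M_ideal C -> nrm u <= 1 -> C y -> nrm y <= 1 ->
  0 < d -> exists e, [/\ C e, nrm (u + y - e) <= 1 + d & nrm (u - y - e) <= 1 + d].
Proof.
move=> [_ [C0 CD] [P [_ PP rP nP]]] u1 Cy y1 d0.
have {}C0 : C 0 by exact: set_mem.
have {}CD (a : R[i]) x z : C x -> C z -> C (a *: x + z).
  by move=> Cx Cz; apply: set_mem; apply: CD; exact: mem_set.
pose mx (x : X * X) e := Num.max (nrm (x.1 - e)) (nrm (x.2 - e)).
pose S (x : X * X) := [set mx x e | e in C]; pose p (x : X * X) := inf (S x).
have mx0 (x : X * X) e : 0 <= mx x e by rewrite /mx le_max nrm_ge0.
have lbS (x : X * X) : has_lbound (S x) by exists 0 => _ [e _ <-].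
have p_ub (x : X * X) e : C e -> p x <= mx x e by move=> Ce; apply: ge_inf => //; exists e.
have p_ge (x : X * X) (c : R) : (forall e, C e -> c <= mx x e) -> c <= p x.
  by move=> h; apply: lb_le_inf; [exists (mx x 0), 0|move=> _ [e Ce <-]; exact: h].
have pD (x z : X * X) : p (x + z) <= p x + p z.
  rewrite -lerBlDr; apply: (p_ge _) => a Ca; rewrite lerBlDr -lerBlDl.
  apply: (p_ge _) => b Cb; rewrite lerBlDl.
  have Cab : C (a + b) by have := CD 1 a b Ca Cb; rewrite scale1r.
  apply: le_trans (p_ub _ _ Cab) _; rewrite /mx ge_max; apply/andP; split.
    apply: (@le_trans _ _ (nrm (x.1 - a) + nrm (z.1 - b))).
      by apply: le_trans (nrmD _ _); rewrite opprD addrACA.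
    by apply: lerD; rewrite le_max lexx.
  apply: (@le_trans _ _ (nrm (x.2 - a) + nrm (z.2 - b))).
    by apply: le_trans (nrmD _ _); rewrite opprD addrACA.
  by apply: lerD; rewrite le_max lexx orbT.
have p_ge0 (x : X * X) : 0 <= p x by apply: (p_ge _) => e _.
have pZ_le (c : R[i]) (x : X * X) : p (c *: x) <= normc c * p x.
  have [->|cn0] := eqVneq c 0.
    rewrite scale0r normc0 mul0r; apply: le_trans (p_ub _ 0 C0) _.
    by rewrite /mx !subr0 maxxx /nrm normr0.
  have c1 : 0 < normc c.
    by rewrite lt_neqAle normc_ge0 andbT eq_sym; apply: contra_neq cn0 => /eq0_normc.
  rewrite mulrC -ler_pdivrMr//; apply: (p_ge _) => e Ce; rewrite ler_pdivrMr//.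
  have Cce : C (c *: e) by have := CD c e 0 Ce C0; rewrite addr0.
  apply: le_trans (p_ub _ _ Cce) _.
  by rewrite /mx -!scalerBr !nrmZ [leRHS]mulrC maxr_pMr ?lexx// ltW.
have pZ (c : R[i]) (x : X * X) : p (c *: x) = normc c * p x.
  have [->|cn0] := eqVneq c 0.
    apply/eqP; rewrite eq_le pZ_le; by rewrite normc0 mul0r p_ge0.
  have c1 : 0 < normc c.
    by rewrite lt_neqAle normc_ge0 andbT eq_sym; apply: contra_neq cn0 => /eq0_normc.
  apply/eqP; rewrite eq_le pZ_le /=.
  have := pZ_le c^-1 (c *: x); rewrite scalerA mulVf// scale1r normcV => h.
  by rewrite mulrC -ler_pdivlMr// mulrC.
set x0 : X * X := (u + y, u - y).
have [L [Ll Lp L0]] := hahn_banach_complex x0 pD pZ.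
have LD (x z : X * X) : L (x + z) = L x + L z by have := Ll 1 x z; rewrite !scale1r.
have LZ (c : R[i]) (x : X * X) : L (c *: x) = c * L x.
  have L00 : L 0 = 0 by apply: (addrI (L 0)); rewrite -LD !addr0.
  by have := Ll c x 0; rewrite !addr0 L00 addr0.
have p_max (x : X * X) : p x <= Num.max (nrm x.1) (nrm x.2).
  by apply: le_trans (p_ub _ _ C0) _; rewrite /mx !subr0.
have l1 : linear (fun x : X => L (x, 0)).
  move=> a x z; rewrite -Ll; congr L; by congr pair; rewrite /= ?scaler0 ?addr0.
have l2 : linear (fun x : X => L (0, x)).
  move=> a x z; rewrite -Ll; congr L; by congr pair; rewrite /= ?scaler0 ?addr0.
have [f1 f1E] : exists phi : dual X, forall x, phi x = L (x, 0).
  apply: (dual_ex (M := 1) l1) => x; rewrite mul1r; apply: le_trans (Lp _) _.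
  by apply: le_trans (p_max _) _; rewrite ge_max lexx /nrm normr0 /= nrm_ge0.
have [f2 f2E] : exists phi : dual X, forall x, phi x = L (0, x).
  apply: (dual_ex (M := 1) l2) => x; rewrite mul1r; apply: le_trans (Lp _) _.
  by apply: le_trans (p_max _) _; rewrite ge_max lexx /nrm normr0 /= nrm_ge0.
have LE x z : L (x, z) = f1 x + f2 z.
  by rewrite f1E f2E -LD; congr L; congr pair; rewrite /= ?addr0 ?add0r.
have f12 : dnorm f1 + dnorm f2 <= 1.
  (* Independent phases in the two coordinates align the values without leaving the unit ball of the
     maximum norm. *)
  have h x z : nrm x <= 1 -> nrm z <= 1 -> normc (f1 x) + normc (f2 z) <= 1.
    move=> x1 z1; have [b b1 bE] := phase (f1 x); have [c c1 cE] := phase (f2 z).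
    have := Lp (b *: x, c *: z); rewrite LE.
    have -> : f1 (b *: x) = b * f1 x.
      rewrite !f1E -LZ; congr L; by congr pair; rewrite /= ?scaler0.
    have -> : f2 (c *: z) = c * f2 z.
      rewrite !f2E -LZ; congr L; by congr pair; rewrite /= ?scaler0.
    rewrite bE cE -toCD normcR ger0_norm ?addr_ge0 ?normc_ge0// => h.
    apply: le_trans h _; apply: le_trans (p_max _) _.
    by rewrite ge_max /= !nrmZ b1 c1 !mul1r x1.
  have ub (x : X) : @unit_ball R X x -> nrm x <= 1 by rewrite /unit_ball /= nrmE lecR.
  rewrite -lerBrDr; apply: sup_norm_le; first exact: unit_ball0.
  move=> x /ub x1; rewrite lerBrDr -lerBrDl; apply: sup_norm_le; first exact: unit_ball0.
  by move=> z /ub z1; rewrite lerBrDl; exact: h.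
have ann : annihilator C (f1 + f2).
  move=> e Ce; rewrite -[LHS]/(f1 e + f2 e) -LE; apply: eq0_normc.
  apply/eqP; rewrite eq_le normc_ge0 andbT; apply: le_trans (Lp _) _.
  by apply: le_trans (p_ub _ _ Ce) _; rewrite /mx /= subrr maxxx /nrm normr0.
have PE : P (f1 + f2) = f1 + f2.
  by move: ann; rewrite -rP => -[g _ <-]; exact: PP.
set a1 := P f1; set a2 := P f2; set b1 := f1 - P f1; set b2 := f2 - P f2.
have b12 x : b1 x + b2 x = 0.
  rewrite -[LHS]/(f1 x - P f1 x + (f2 x - P f2 x)).
  have := congr1 (fun g : dual X => g x) PE; rewrite /= raddfD.
  rewrite -[LHS]/(P f1 x + P f2 x) -[RHS]/(f1 x + f2 x) => h.
  by rewrite addrACA -opprD -h subrr.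
have aC g e : C e -> P g e = 0.
  move=> Ce; have : annihilator C (P g) by rewrite -rP; exists g.
  exact.
have nE g : dnorm (P g) + dnorm (g - P g) = dnorm g.
  by have := nP g; rewrite -[LHS]/((dnorm (P g))%:C + (dnorm (g - P g))%:C) -toCD => /complexI.
have pd : p x0 <= 1.
  rewrite -L0 LE; apply: le_trans f12; rewrite -(nE f1) -(nE f2).
  (* At [u] the parts [b1], [b2] cancel, and [a1], [a2] vanish at [y]. What remains evaluates each
     [P f] at [u] and each [f - P f] at [y] up to sign, so norm additivity gives the bound
     [dnorm f1 + dnorm f2]. *)
  have -> : f1 (u + y) + f2 (u - y) = a1 u + b1 y + (a2 u - b2 y) + (b1 u + b2 u) + (a1 y - a2 y).
    have s (g : dual X) x : g x = P g x + (g - P g) x.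
      by rewrite -[(g - P g) x]/(g x - P g x) addrC subrK.
    by rewrite dualD dualD dualN (s f1 u) (s f1 y) (s f2 u) (s f2 y) -/a1 -/a2 -/b1 -/b2; ring.
  rewrite b12 (aC _ _ Cy) (aC _ _ Cy) subrr !addr0.
  apply: le_trans (ler_norm _) _; apply: le_trans (Re_le_normc _) _.
  apply: le_trans (le_normcD _ _) _; apply: lerD.
    by apply: le_trans (le_normcD _ _) _; apply: lerD; exact: dual_le.
  by apply: le_trans (le_normcD _ _) _; rewrite normcN; apply: lerD; exact: dual_le.
have hS : has_inf (S x0) by split; [exists (mx x0 0), 0|exact: lbS].
have [_ [e Ce <-] he] := inf_adherent d0 hS.
exists e; rewrite -/(p x0) in he; split => //.
  by apply: le_trans (_ : mx x0 e <= _); [rewrite /mx le_max lexx|lra].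
by apply: le_trans (_ : mx x0 e <= _); [rewrite /mx le_max lexx orbT|lra].
Qed.

End TwoBall.

(** * Generators of M-ideals are outer *)

Section MIdealOuter.
Context {R : realType}.
Implicit Types (z w : R[i]) (r s t : R) (F G : Hinf R) (f g h : R[i] -> R[i]).
Local Notation Re := complex.Re.
Local Notation Im := complex.Im.

Lemma ideal_mul F G (H : Hinf R) g (M : R) : Hinf_ideal F G -> holo g ->
  (forall z, normc z < 1 -> normc (g z) <= M) -> (forall z, normc z < 1 -> H z = G z * g z) ->
  Hinf_ideal F H.
Proof.
move=> /ideal_HinfP hG hg gM HE; apply/ideal_HinfP => e e0.
have M0 : 0 <= M by apply: le_trans (gM 0 _); rewrite ?normc_ge0// normc0 ltr01.
have M1 : 0 < M + 1 by rewrite ltr_wpDl.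
have [K KP] := hG _ (divr_gt0 e0 M1).
have [g' g'E] := Hinf_ex hg gM; have [Kg KgE] := HinfM_ex K g'.
exists Kg => z z1; rewrite HE// KgE g'E// mulrA -mulrBl normcM.
apply: (@le_trans _ _ (e / (M + 1) * (M + 1))); last by rewrite divfK// gt_eqF.
by apply: ler_pM; rewrite ?normc_ge0 ?KP//; apply: le_trans (gM z z1) _; rewrite lerDl.
Qed.

Lemma holo_root2 k f : holo f -> (forall z, normc z < 1 -> 0 < Re (f z)) ->
  holo (fun z => root2 k (f z)).
Proof.
move=> hf f0 z z1; have [a fa] := hf z z1; have [b rb] := cder_root2 k (f0 z z1).
by exists (b * a); exact: cder_comp fa rb.
Qed.

Lemma holoV f : holo f -> (forall z, normc z < 1 -> f z != 0) -> holo (fun z => (f z)^-1).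
Proof.
move=> hf f0 z z1; have [a fa] := hf z z1.
by exists (- (f z) ^- 2 * a); exact: cderV (f0 z z1) fa.
Qed.

(* sqrt a - sqrt b = (a - b) / (sqrt a + sqrt b) *)
Lemma root2_quotient k f (b : R[i]) : holo f -> 0 < Re b ->
  (forall z, normc z < 1 -> 0 < Re (f z + b)) ->
  exists g (M : R), [/\ holo g, forall z, normc z < 1 -> normc (g z) <= M &
    forall z, normc z < 1 -> root2 k (f z + b) - root2 k b = f z * g z].
Proof.
move=> hf b0 fb; have hfb : holo (fun z => f z + b) by apply: holoD => //; exact: holo_csts.
elim: k => [|k [g [M [hg gM gE]]]].
  exists (fun=> 1), 1; split; [exact: holo_csts|by move=> z _; rewrite normc1|].
  by move=> z _; rewrite /root2 /= addrK mulr1.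
set c := Re (root2 k.+1 b); have c0 : 0 < c := Re_root2_gt0 k.+1 b0.
pose D z := root2 k.+1 (f z + b) + root2 k.+1 b.
have Dc z : normc z < 1 -> c <= normc (D z).
  move=> z1; apply: le_trans (Re_le_normc _); apply: le_trans (ler_norm _).
  have := Re_root2_gt0 k.+1 (fb z z1); rewrite /D /c.
  by case: (root2 _ _) (root2 _ b) => [x y] [x' y'] /= h; rewrite lerDr ltW.
have D0 z : normc z < 1 -> D z != 0.
  move=> z1; apply/eqP => Dz; have := Dc z z1; rewrite Dz normc0; lra.
have hD : holo D by apply: holoD; [exact: holo_root2|exact: holo_csts].
have M0 : 0 <= M by apply: le_trans (gM 0 _); rewrite ?normc_ge0// normc0 ltr01.
exists (fun z => g z * (D z)^-1), (M / c); split.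
- by apply: holoM => //; exact: holoV.
- move=> z z1; rewrite normcM normcV; apply: ler_pM; rewrite ?invr_ge0 ?normc_ge0 ?gM//.
  by rewrite lef_pV2 ?posrE ?Dc//; exact: lt_le_trans (Dc z z1).
move=> z z1; apply: (mulIf (D0 z z1)); rewrite mulrA mulfVK ?D0// -gE//.
rewrite /D -subr_sqr !root2S !sqr_sqrtc//.
Qed.

(** One exponent has to serve three estimates: closeness to 1 by [root2_cvg1], the bound [1 + tau]
    because Bernoulli's inequality gives [(1 + tau)^(2^n) >= 6], and a small root of [eta], chosen
    after [n]. The constant 6 leaves room for [|E + eta|] in the application. *)
Lemma root2_parameters (c b tau : R) : 0 < c -> 0 < b -> 0 < tau -> exists n (eta : R),
  [/\ 0 < eta <= b, normc (root2 n eta%:C) <= tau,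
      forall w, normc w <= 6 -> normc (root2 n w) <= 1 + tau &
      forall w, 0 < Re w -> c <= normc w -> normc w <= 6 -> normc (1 - root2 n w) <= tau].
Proof.
move=> c0 b0 tau0; have [k kP] := @root2_cvg1 R c 6 tau c0 tau0.
have [K0] : exists K0 : nat, 6 / tau < K0%:R.
  by exists (Num.truncn (6 / tau)).+1; rewrite truncnS_gt.
rewrite ltr_pdivrMr// => hK0.
set n := maxn k K0; have kn : (k <= n)%N := leq_maxl _ _; have K0n : (K0 <= n)%N := leq_maxr _ _.
have e2 : (0 < 2 ^ n)%N by rewrite expn_gt0.
have bern m : 1 + m%:R * tau <= (1 + tau) ^+ m.
  elim: m => [|m IH]; first by rewrite mul0r addr0 expr0.
  rewrite exprS -natr1 mulrDl mul1r.
  have := ler_wpM2l (addr_ge0 ler01 (ltW tau0)) IH.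
  have : 0 <= m%:R * tau * tau by rewrite !mulr_ge0// ltW.
  lra.
have six : 6 <= (1 + tau) ^+ (2 ^ n).
  apply: (@le_trans _ _ (1 + n%:R * tau)).
    apply: ltW; apply: (lt_le_trans hK0); apply: (@le_trans _ _ (n%:R * tau)); last by rewrite lerDr.
    by rewrite ler_wpM2r ?(ltW tau0)// ler_nat.
  apply: le_trans (bern n) _.
  by rewrite ler_weXn2l ?lerDl ?(ltW tau0)// ltnW// ltn_expl.
set eta := Num.min b (tau ^+ (2 ^ n)).
have eta0 : 0 < eta by rewrite lt_min exprn_gt0// b0.
exists n, eta; split.
- by rewrite eta0 /eta ge_min lexx.
- have h := normc_root2 n eta%:C; rewrite normcR gtr0_norm// in h.
  rewrite -(ler_pXn2r e2) ?nnegrE ?normc_ge0 ?(ltW tau0)// h.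
  by rewrite /eta ge_min lexx orbT.
- move=> w w6; have h := normc_root2 n w.
  rewrite -(ler_pXn2r e2) ?nnegrE ?normc_ge0 ?addr_ge0 ?(ltW tau0)// h.
  exact: le_trans w6 six.
by move=> w w0 cw w6; exact: kP.
Qed.

Lemma M_ideal_near_one F Y (d : R) : M_ideal (Hinf_ideal F) -> Hinf_ideal F Y -> hnorm Y <= 1 ->
  0 < d -> exists E : Hinf R, Hinf_ideal F E /\
    forall z, normc z < 1 -> normc (1 - E z) ^+ 2 + normc (Y z) ^+ 2 <= (1 + d) ^+ 2.
Proof.
move=> MI CY Y1 d0; have [one oneE] := @Hinf_one_ex R.
have one1 : nrm one <= 1.
  by apply: hnorm_le => z z1; rewrite oneE// normc1.
have [E [CE Ep Em]] := M_ideal_two_ball MI one1 CY Y1 d0.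
exists E; split=> // z z1.
have p : normc ((1 - E z) + Y z) <= 1 + d.
  apply: le_trans Ep; have := normc_le_hnorm (one + Y - E) z1.
  by rewrite HinfB HinfD oneE//; apply: le_trans; rewrite addrAC.
have m : normc ((1 - E z) - Y z) <= 1 + d.
  apply: le_trans Em; have := normc_le_hnorm (one - Y - E) z1.
  by rewrite !HinfB oneE//; apply: le_trans; rewrite addrAC.
have par (x y : R[i]) : normc (x + y) ^+ 2 + normc (x - y) ^+ 2 = 2 * (normc x ^+ 2 + normc y ^+ 2).
  rewrite !normc_ReIm !sqr_sqrtr ?addr_ge0 ?sqr_ge0//.
  by case: x y => [a b] [a' b'] /=; ring.
have := par (1 - E z) (Y z).
clear one1 Y1 Ep Em.
have p2 : normc ((1 - E z) + Y z) ^+ 2 <= (1 + d) ^+ 2.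
  by rewrite lerXn2r ?nnegrE ?normc_ge0 ?addr_ge0 ?(ltW d0).
have m2 : normc ((1 - E z) - Y z) ^+ 2 <= (1 + d) ^+ 2.
  by rewrite lerXn2r ?nnegrE ?normc_ge0 ?addr_ge0 ?(ltW d0).
lra.
Qed.

(** [|1 - E| <= 1 + d] still allows real parts down to [- d]; adding [eta = 2 d] puts [E + eta] in
    the right half-plane, where roots are holomorphic. Subtracting the root of [eta] leaves a
    multiple of [E], hence an element of the ideal. *)
Lemma M_ideal_almost_unit F z0 (tau : R) : M_ideal (Hinf_ideal F) -> normc z0 < 1 -> F z0 != 0 ->
  0 < tau -> exists E : Hinf R, [/\ Hinf_ideal F E,
    forall z, normc z < 1 -> normc (E z) <= 1 + 2 * tau & normc (1 - E z0) <= 2 * tau].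
Proof.
move=> MI z01 Fz0 tau0.
have n0 : 0 < hnorm F.
  apply: lt_le_trans (normc_le_hnorm F z01).
  by rewrite lt_neqAle normc_ge0 andbT eq_sym; apply: contra_neq Fz0 => /eq0_normc.
pose Y : Hinf R := ((hnorm F)^-1)%:C *: F.
have YE z : Y z = ((hnorm F)^-1)%:C * F z by rewrite /Y HinfZ.
have Y1 : hnorm Y <= 1.
  apply: hnorm_le => z z1; rewrite YE normcM normcR ger0_norm ?invr_ge0 ?(ltW n0)//.
  by rewrite mulrC ler_pdivrMr// mul1r normc_le_hnorm.
have CY : Hinf_ideal F Y.
  apply/ideal_HinfP => e e0.
  have [K KE] := @Hinf_ex R (fun=> ((hnorm F)^-1)%:C) _ (@holo_csts R _) (fun z _ => lexx _).
  by exists K => z z1; rewrite KE// YE mulrC subrr normc0 ltW.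
set al := normc (Y z0).
have al0 : 0 < al.
  rewrite lt_neqAle normc_ge0 andbT eq_sym; apply: contra_neq Fz0 => /eq0_normc.
  by rewrite YE => /eqP; rewrite mulf_eq0 => /orP[/eqP/complexI/eqP|/eqP//]; rewrite invr_eq0 gt_eqF.
have al1 : al <= 1 by apply: le_trans (normc_le_hnorm Y z01) Y1.
(* At [z0] the term [|Y z0|^2 = al^2] is available: with [d <= al^2 / 16], [(1 + d)^2 - al^2 <= 1 -
   2 c0 <= (1 - c0)^2], hence [Re (E z0) >= c0]. *)
set c0 := al ^+ 2 / 4; have c00 : 0 < c0 by rewrite divr_gt0 ?exprn_gt0.
have a21 : al ^+ 2 <= 1 by rewrite expr_le1 ?(ltW al0).
have al2 : 0 < al ^+ 2 / 8 by rewrite divr_gt0 ?exprn_gt0.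
have [n [eta [/andP[eta0 eta1] eta_n rn1 rn2]]] := root2_parameters c00 al2 tau0.
set d := eta / 2; have d0 : 0 < d by rewrite divr_gt0.
have [E [CE PL]] := M_ideal_near_one MI CY Y1 d0.
clear Y1.
have d1 : d <= 1 / 16 by rewrite /d; lra.
have E1 z : normc z < 1 -> normc (1 - E z) <= 1 + d.
  move=> z1; rewrite -(@ler_pXn2r _ 2) ?nnegrE ?normc_ge0//; last by lra.
  by apply: le_trans (PL z z1); rewrite lerDl sqr_ge0.
have E1z0 : normc (1 - E z0) <= 1 - c0.
  rewrite -(@ler_pXn2r _ 2) ?nnegrE ?normc_ge0//; last by rewrite /c0; lra.
  have := PL z0 z01; rewrite -/al.
  have : (1 + d) ^+ 2 <= 1 + 3 * d by have : d * d <= d * 1 by [rewrite ler_wpM2l ?(ltW d0)//; lra]; lra.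
  have : 1 - 2 * c0 <= (1 - c0) ^+ 2 by have := sqr_ge0 c0; lra.
  rewrite /c0 /d in eta1 *; lra.
have ReE z (x : R) : normc (1 - E z) <= x -> 1 - x <= Re (E z).
  move=> h; have := le_trans (ler_norm _) (Re_le_normc (1 - E z)).
  by case: (E z) h => a b /= h h2; lra.
have b0 : 0 < Re eta%:C by [].
have fb z : normc z < 1 -> 0 < Re (E z + eta%:C).
  move=> z1; have := ReE z _ (E1 z z1); case: (E z) => a b /=; rewrite /d; lra.
have [g [M [hg gM gE]]] := root2_quotient n (@Hinf_holo R E) b0 fb.
have Eb : forall z, normc z < 1 -> normc (E z * g z) <= hnorm E * M.
  by move=> z z1; rewrite normcM; apply: ler_pM; rewrite ?normc_ge0 ?normc_le_hnorm ?gM.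
have [E' E'E] := Hinf_ex (holoM (@Hinf_holo R E) hg) Eb.
have En z : normc z < 1 -> normc (E z + eta%:C) <= 6.
  move=> z1; have h := E1 z z1.
  have -> : E z + eta%:C = (1 + eta%:C) - (1 - E z) by ring.
  apply: le_trans (le_normcD _ _) _; rewrite normcN.
  have : normc (1 + eta%:C) <= 1 + eta.
    by apply: le_trans (le_normcD _ _) _; rewrite normc1 normcR gtr0_norm.
  lra.
exists E'; split.
- by apply: (ideal_mul CE hg gM) => z z1; exact: E'E.
- move=> z z1; rewrite E'E// -gE//.
  apply: le_trans (le_normcD _ _) _; rewrite normcN.
  have : normc (root2 n (E z + eta%:C)) <= 1 + tau by apply/rn1/En.
  lra.
rewrite E'E// -gE//.
have := rn2 (E z0 + eta%:C) (fb z0 z01).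
have h := ReE z0 _ E1z0.
have c1 : c0 <= normc (E z0 + eta%:C).
  apply: le_trans (Re_le_normc _); apply: le_trans (ler_norm _).
  by move: h; case: (E z0) => a b /= h; lra.
move=> /(_ c1 (En z0 z01)) h2.
rewrite opprB addrCA addrC; apply: le_trans (le_normcD _ _) _; lra.
Qed.

Lemma M_ideal_outer F : F != 0 -> M_ideal (Hinf_ideal F) -> outer F.
Proof.
move=> Fn0 MI.
have [z0 z01 Fz0] : exists2 z0, normc z0 < 1 & F z0 != 0.
  apply: contrapT => h; case/negP: Fn0; apply/eqP/Hinf_ext => z z1.
  by apply/eqP; apply: contrapT => /negP Fz; apply: h; exists z.
apply: outer_of_approx => e e0.
have zz := normc_ge0 z0.
set rho := (1 + normc z0) / 2.
have rho1 : rho < 1 by rewrite /rho; lra.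
have rhoz : normc z0 < rho by rewrite /rho; lra.
have rho0 : 0 < rho by apply: le_lt_trans rhoz.
(* A lower bound, uniform in [r >= rho], for the Poisson kernel at [z0 / r]; it compares the plain
   mean with the Poisson mean at [z0]. *)
set q := (1 - normc z0 / rho) / 2.
have q0 : 0 < q by rewrite divr_gt0// subr_gt0 ltr_pdivrMr// mul1r.
(* The Poisson mean of [|1 - E|^2] will be at most [16 tau], which has to be at most [q e / 4]. *)
set tau := Num.min (1 / 4) (e * q / 64).
have tau0 : 0 < tau by rewrite lt_min !divr_gt0// mulr_gt0.
have tau1 : tau <= 1 / 4 by rewrite /tau ge_min lexx.
have tau2 : tau <= e * q / 64 by rewrite /tau ge_min lexx orbT.
have [E [CE Eb Ez0]] := M_ideal_almost_unit MI z01 Fz0 tau0.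
have hE := @Hinf_holo R E.
have h1E : holo (fun z => 1 - E z) by apply: holoB => //; exact: holo_csts.
have enb r : rho <= r < 1 -> en (fun z => 1 - E z) r <= e / 4.
  move=> /andP[rr r1]; have r0 : 0 < r := lt_le_trans rho0 rr.
  have r01 : 0 < r < 1 by rewrite r0.
  have r01' : 0 <= r < 1 by rewrite ltW.
  set w := (r^-1)%:C * z0.
  have rw : r%:C * w = z0 by rewrite /w mulrA -toCM mulfV ?gt_eqF// mul1r.
  have nw : normc w = normc z0 / r by rewrite /w normcM normcR ger0_norm ?invr_ge0 ?(ltW r0)// mulrC.
  have w1 : normc w < 1 by rewrite nw ltr_pdivrMr// mul1r; exact: lt_le_trans rr.
  have qw : q <= (1 - normc w) / 2.
    by rewrite ler_wpM2r// lerB// nw ler_wpM2l// lef_pV2.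
  have i2 := rL1_en h1E r01'.
  have hc := aL1_circf hE r01'.
  have ip : rL1 (fun t => normc (circf (fun z => 1 - E z) r t) ^+ 2 * pker w t).
    apply: (rL1M i2 (rL1_meas (rL1_pker w1)) (M := 2 / (1 - normc w))) => t.
    by rewrite ger0_norm ?pker_ge0 ?pker_le.
  have l1 : q * en (fun z => 1 - E z) r <= ravg (fun t => normc (circf (fun z => 1 - E z) r t) ^+ 2 * pker w t).
    rewrite /en -(ravgZ _ i2); apply: le_ravg; [exact: rL1Z|exact: ip|].
    move=> t; rewrite mulrC ler_wpM2l ?sqr_ge0//; apply: le_trans qw _; exact: pker_lb.
  have cE : aL1 (fun t => circf E r t * (pker w t)%:C) := aL1_pker w1 hc.
  have iE := aL1_Re cE.
  (* The Poisson mean of [Re E] is [Re (E z0) >= 1 - 2 tau]. So the mean of [1 - 2 Re E + |E|^2] is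
     at most [1 - 2 (1 - 2 tau) + (1 + 2 tau)^2 = 8 tau + 4 tau^2]. *)
  have l2 : ravg (fun t => normc (circf (fun z => 1 - E z) r t) ^+ 2 * pker w t) <= 16 * tau.
    have i3 : rL1 (fun t => (1 + (1 + 2 * tau) ^+ 2) * pker w t) := rL1Z _ (rL1_pker w1).
    apply: (@le_trans _ _ (ravg (fun t => (1 + (1 + 2 * tau) ^+ 2) * pker w t - 2 * Re (circf E r t * (pker w t)%:C)))).
      apply: le_ravg; [exact: ip|by apply: rL1B => //; exact: rL1Z|].
      move=> t; rewrite Re_mulR mulrA -mulrBl ler_wpM2r ?pker_ge0//.
      have b : normc (circf E r t) <= 1 + 2 * tau by apply: Eb; rewrite normc_circ// ltW.
      have b2 : normc (circf E r t) ^+ 2 <= (1 + 2 * tau) ^+ 2.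
        by rewrite lerXn2r ?nnegrE ?normc_ge0//; lra.
      rewrite [circf (fun z => _) r t]/(1 - circf E r t) normc_sub_sqr normc1 expr1n.
      rewrite mulr1 (_ : Re (conjc _) = Re (circf E r t)); last by case: (circf E r t).
      lra.
    rewrite (ravgB i3 (rL1Z 2 iE)) (ravgZ _ (rL1_pker w1)) ravg_pker// mulr1 (ravgZ _ iE).
    rewrite -Re_avg -/(pois (circf E r) w) poisson_formula// rw.
    have := le_trans (ler_norm _) (Re_le_normc (1 - E z0)).
    have t2 : tau * tau <= tau * (1 / 4) by rewrite ler_wpM2l ?(ltW tau0).
    case: (E z0) Ez0 => a b /= h h2; lra.
  have : q * en (fun z => 1 - E z) r <= q * (e / 4) by lra.
  by rewrite ler_pM2l.
have [K KP] : exists K : Hinf R, forall z, normc z < 1 -> normc (E z - F z * K z) <= Num.min 1 (e / 4).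
  by move/ideal_HinfP: CE => /(_ (Num.min 1 (e / 4))); apply; rewrite lt_min ltr01 divr_gt0.
exists K => r r01; have [r0 r1] := andP r01.
have r01' : 0 <= r < 1 by rewrite (ltW r0).
have hFK : holo (fun z => E z - F z * K z) by apply: holoB => //; apply: holoM; exact: Hinf_holo.
rewrite (@eq_en _ _ (fun z => (1 - E z) + (E z - F z * K z)) r r01'); last first.
  by move=> z _; rewrite addrA subrK.
apply: le_trans (en_add_le h1E hFK r01') _.
have a1 : en (fun z => 1 - E z) r <= e / 4.
  have [rr|rr] := lerP rho r; first by apply: enb; rewrite rr.
  apply: le_trans (en_mono h1E r0 (ltW rr) rho1) _.
  by apply: enb; rewrite lexx.
have a2 : en (fun z => E z - F z * K z) r <= Num.min 1 (e / 4) ^+ 2 by exact: en_bdd.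
have a3 : Num.min 1 (e / 4) ^+ 2 <= e / 4.
  set m := Num.min _ _; have m0 : 0 <= m by rewrite le_min ler01 divr_ge0// ltW.
  have m1 : m <= 1 by rewrite ge_min lexx.
  have m2 : m <= e / 4 by rewrite ge_min lexx orbT.
  by apply: le_trans m2; rewrite expr2 ler_piMr.
lra.
Qed.

End MIdealOuter.

(** * Representation of outer functions *)

Section RealHerglotz.
Context {R : realType}.
Implicit Types (z w : R[i]) (r s t : R) (f g h p : R[i] -> R[i]) (m V : R -> R).
Local Notation Re := complex.Re.
Local Notation Im := complex.Im.

Definition rherg m z : R[i] := herg (fun t => (m t)%:C) z.

Lemma Re_rherg m z : Re (rherg m z) = ravg (fun t => m t * pker z t).
Proof.
rewrite /rherg /herg Re_avg; apply: eq_ravg => t; rewrite /pker.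
by case: (hker z t) => a b /=; rewrite mul0r subr0.
Qed.

Lemma rL1_Mpker m z : rL1 m -> normc z < 1 -> rL1 (fun t => m t * pker z t).
Proof.
move=> hm z1; apply: (rL1M hm (ameas_pker z1) (M := 2 / (1 - normc z))) => t.
by rewrite ger0_norm ?pker_ge0 ?pker_le.
Qed.

Lemma Re_rherg_ge0 m z : normc z < 1 -> (forall t, 0 <= m t) -> 0 <= Re (rherg m z).
Proof.
by move=> z1 m0; rewrite Re_rherg; apply: ravg_ge0 => t; rewrite mulr_ge0 ?pker_ge0.
Qed.

Lemma Re_rherg_le m z (K : R) : normc z < 1 -> rL1 m -> (forall t, m t <= K) ->
  Re (rherg m z) <= K.
Proof.
move=> z1 hm mK; rewrite Re_rherg -[leRHS]mulr1 -(ravg_pker z1) -(ravgZ _ (rL1_pker z1)).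
apply: le_ravg; [exact: rL1_Mpker|exact/rL1Z/rL1_pker|].
by move=> t; rewrite ler_wpM2r ?pker_ge0.
Qed.

Lemma holo_rherg m : rL1 m -> holo (rherg m).
Proof. by move=> hm; apply: holo_herg; exact: aL1_real. Qed.

Lemma rherg0 m : rherg m 0 = (ravg m)%:C.
Proof. by rewrite /rherg herg0 avg_real. Qed.

Lemma rhergD m1 m2 z : rL1 m1 -> rL1 m2 -> normc z < 1 ->
  rherg (fun t => m1 t + m2 t) z = rherg m1 z + rherg m2 z.
Proof.
move=> h1 h2 z1; have i1 := aL1_hker z1 (aL1_real h1); have i2 := aL1_hker z1 (aL1_real h2).
by rewrite /rherg /herg -(avgD i1 i2); apply: eq_avg => t; rewrite toCD mulrDl.
Qed.

Definition rn n : R := 1 - (n.+2%:R)^-1.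

Lemma rn01 n : 0 < rn n < 1.
Proof.
rewrite /rn subr_gt0 invf_lt1 ?ltr0n// ltr1n /=.
by rewrite ltrBlDr ltrDl invr_gt0 ltr0n.
Qed.

Lemma rn01' n : 0 <= rn n < 1.
Proof. by have /andP[a b] := rn01 n; rewrite (ltW a). Qed.

Lemma rn_cvg1 : rn @ \oo --> (1 : R).
Proof.
rewrite -[X in _ --> X]subr0; apply: cvgB; first exact: cvg_cst.
apply: (@squeeze_cvgr _ _ _ _ (fun=> 0) (fun n => n.+1%:R^-1)); last exact: cvg_harmonic.
  apply: nearW => n; rewrite invr_ge0 ler0n/= lef_pV2 ?posrE ?ltr0n//.
  by rewrite ler_nat.
exact: cvg_cst.
Qed.

Lemma rn_cvg : rn @ \oo --> 1^'-.
Proof.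
move=> P [d d0 dP]; have /cvgrPdist_lt/(_ d d0)[N _ NP] := rn_cvg1.
by exists N => // k Nk; apply: dP => /=; [exact: NP|have /andP[] := rn01 k].
Qed.

(** Continuity in the chordal distance makes [m] periodic and continuous on the circle, also across
    the point 1, as [pois_cvg] requires. *)
Definition circle_continuous m := forall t0 e, 0 < e -> exists2 d : R, 0 < d &
  forall t, normc (expi t - expi t0) < d -> `|m t - m t0| <= e.

Lemma circle_continuous_continuous m : circle_continuous m -> continuous m.
Proof.
move=> cm t; apply/cvgrPdist_le => e e0; have [d d0 dP] := cm t e e0.
have /cvgCP/(_ d d0) := @continuous_expi R t; apply: filterS => s sd.
by rewrite distrC; exact: dP.
Qed.

Lemma rherg_radial m t : rL1 m -> circle_continuous m ->
  (fun r => Re (rherg m (r%:C * expi t))) @ 1^'- --> m t.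
Proof.
move=> hm cm.
have h : (fun r : R => pois (fun s => (m s)%:C) (r%:C * expi t)) @ 1^'- --> (m t)%:C.
  apply: pois_cvg; first exact: aL1_real.
  move=> e e0; have [d d0 dP] := cm t e e0; exists d => // s sd.
  by rewrite -toCB normcR; exact: dP.
have -> : (fun r => Re (rherg m (r%:C * expi t))) =
    (fun r => Re (pois (fun s => (m s)%:C) (r%:C * expi t))).
  apply/funext => r; rewrite Re_rherg /pois Re_avg; apply: eq_ravg => s.
  by rewrite Re_mulR.
exact: (cvg_Re h).
Qed.

(* Jensen's inequality for the subharmonic function |p exp(-herg m)|^2 *)
Lemma szego p (P r : R) m : holo p -> (forall z, normc z < 1 -> normc (p z) <= P) ->
  0 <= r < 1 -> circle_continuous m -> (forall t, 0 <= m t) -> rL1 m ->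
  normc (p 0) ^+ 2 * expR (- 2 * ravg m) <=
  ravg (fun t => normc (circf p r t) ^+ 2 * expR (- 2 * m t)).
Proof.
move=> hp pP r01 cm m0 hm; have [r0 r1] := andP r01.
pose G z := p (r%:C * z) * cexp (- rherg m z).
have nr z : normc z < 1 -> normc (r%:C * z) < 1.
  by move=> z1; apply: normc_scale => //; exact: ltW.
have hpr : holo (fun z => p (r%:C * z)).
  move=> z z1; have [d pd] := hp _ (nr z z1).
  by exists (d * (r%:C * 1)); apply: cder_comp pd; exact: cderZ (cder_id z).
have hex : holo (fun z => cexp (- rherg m z)).
  move=> z z1; have [d md] := holo_rherg hm z1.
  have c1 : cder (fun z => - rherg m z) z (- d).
    apply: (@cder_eq R _ z (- 1 * d)); last by rewrite mulN1r.
    apply: (cder_near _ (cderZ (- 1) md)); apply: (disc_near z1) => w _; exact: mulN1r.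
  exists (cexp (- rherg m z) * - d).
  exact: (@cder_comp R (@cexp R) (fun z => - rherg m z) z _ _ c1 (cder_cexp _)).
have hG : holo G := holoM hpr hex.
have GE z : normc (G z) ^+ 2 = normc (p (r%:C * z)) ^+ 2 * expR (- 2 * Re (rherg m z)).
  rewrite /G normcM exprMn normc_cexp -expRM_natl; congr (_ * expR _).
  by case: (rherg m z) => a b /=; rewrite mulrN mulNr.
have -> : normc (p 0) ^+ 2 * expR (- 2 * ravg m) = normc (G 0) ^+ 2.
  by rewrite GE mulr0 rherg0.
pose u n t := normc (circf G (rn n) t) ^+ 2.
pose v t := normc (circf p r t) ^+ 2 * expR (- 2 * m t).
have cv : continuous v.
  have c1 := continuous_normc_sqr (holo_circ hp r01).
  move=> t; apply: cvgM; first exact: c1.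
  apply: (@continuous_comp R R R (fun t => - 2 * m t) (@expR R)); last exact: continuous_expR.
  by apply: cvgM; [exact: cvg_cst|exact: circle_continuous_continuous].
have cu n : continuous (u n) := continuous_normc_sqr (holo_circ hG (rn01' n)).
have c2 (t : R) : (fun n => Re (rherg m ((rn n)%:C * expi t))) @ \oo --> m t.
  exact: (cvg_comp rn (fun x : R => Re (rherg m (x%:C * expi t))) rn_cvg (@rherg_radial m t hm cm)).
have uv (t : R) : u ^~ t @ \oo --> v t.
  have c1 : (fun n => normc (p (r%:C * ((rn n)%:C * expi t)))) @ \oo --> normc (p (r%:C * expi t)).
    apply: cvg_normc.
    have [d pd] := hp (r%:C * expi t) (eq_ind_r (fun x => x < 1) r1 (normc_circ t r0)).
    apply: (cvg_comp _ _ _ (cder_cont pd)).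
    apply: cvgCM; first exact: cvg_cst.
    rewrite -[X in _ --> X]mul1r; apply: cvgCM; last exact: cvg_cst.
    by apply: cvg_toC; exact: rn_cvg1.
  rewrite /u /v (_ : (fun n => _) = fun n => normc (p (r%:C * ((rn n)%:C * expi t))) *
     normc (p (r%:C * ((rn n)%:C * expi t))) * expR (- 2 * Re (rherg m ((rn n)%:C * expi t)))).
    rewrite expr2; apply: cvgM; first exact: cvgM.
    apply: (@cvg_comp _ _ _ _ (@expR R) _ (nbhs (- 2 * m t))); last exact: continuous_expR.
    by apply: cvgM => //; exact: cvg_cst.
  by apply/funext => n; rewrite /circf GE expr2.
have P0 : 0 <= P by apply: le_trans (pP 0 _); rewrite ?normc_ge0// normc0 ltr01.
have ub n t : `|u n t| <= P ^+ 2.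
  have w1 : normc ((rn n)%:C * expi t) < 1.
    by have /andP[a b] := rn01' n; rewrite normc_circ.
  rewrite ger0_norm ?sqr_ge0// /u /circf GE -[leRHS]mulr1; apply: ler_pM; rewrite ?sqr_ge0 ?expR_ge0//.
    by rewrite lerXn2r ?nnegrE ?normc_ge0// pP// nr.
  by rewrite expR_le1 mulNr oppr_le0 mulr_ge0// Re_rherg_ge0.
have mu n : measurable_fun (@D2 R) (u n) := rL1_meas (continuous_rL1 (@cu n)).
have uvae : {ae lam, forall t, D2 t -> u ^~ t @ \oo --> v t} by apply: aeW => t _; exact: uv.
have [_ lim] := ravg_dominated mu (rL1_meas (continuous_rL1 cv)) uvae (rL1_cst (P ^+ 2)) ub.
rewrite -(cvg_lim (@Rhausdorff R) lim); apply: limr_ge; first by apply/cvg_ex; exists (ravg v).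
apply: nearW => n; exact: (en_ge_center hG (rn01 n)).
Qed.

(** Two conclusions because they are used in turn in [boundary_log]: boundedness first shows that
    the boundary values of [f] do not vanish, and only then is the limit [V] identified. *)
Lemma beppo_levi (u : nat -> R -> R) (B : R) : (forall n, rL1 (u n)) ->
  (forall n t, 0 <= u n t) -> (forall n t, u n t <= u n.+1 t) -> (forall n, ravg (u n) <= B) ->
  {ae lam, forall t, D2 t -> exists C : R, forall n, u n t <= C} /\
  (forall V, measurable_fun D2 V -> (forall t, 0 <= V t) ->
    {ae lam, forall t, D2 t -> u ^~ t @ \oo --> V t} -> rL1 V).
Proof.
move=> hu u0 um uB; have mD := @mD2 R.
pose g n t := (u n t)%:E; pose G t := limn_esup (g ^~ t).
have mg n : measurable_fun (@D2 R) (g n) by apply/measurable_EFinP; exact: rL1_meas (hu n).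
have nd t : nondecreasing_seq (g ^~ t) by apply/nondecreasing_seqP => n; rewrite lee_fin.
have cg t : cvgn (g ^~ t) by exact: ereal_nondecreasing_is_cvgn.
have GE t : G t = limn (g ^~ t) by rewrite /G is_cvg_limn_esupE.
have mG : measurable_fun (@D2 R) G by exact: measurable_fun_limn_esup.
have gG n t : (g n t <= G t)%E.
  rewrite GE (cvg_lim _ (ereal_nondecreasing_cvgn (nd t)))//.
  by apply: ereal_sup_ubound; exists n.
have G0 t : (0 <= G t)%E by apply: le_trans (gG 0%N t); rewrite lee_fin.
have iG : (\int[lam]_(t in @D2 R) G t <= (2 * pi * B)%:E)%E.
  have -> : (\int[lam]_(t in @D2 R) G t = \int[lam]_(t in @D2 R) limn (g ^~ t))%E.
    by apply: eq_integral => t _; exact: GE.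
  have g0 n t : D2 t -> (0 <= g n t)%E by rewrite lee_fin.
  rewrite (@monotone_convergence _ _ _ lam (@D2 R) mD g mg g0 (fun t _ => nd t)).
  apply: lime_le.
    apply: ereal_nondecreasing_is_cvgn => m n mn; apply: ge0_le_integral => // t Dt; solve [exact: g0|exact: nd].
  apply: nearW => n; have hn := integral_fune_fin_num mD (hu n).
  rewrite -(fineK hn) lee_fin.
  by have := uB n; rewrite /ravg mulrC ler_pdivrMr ?pi2_gt0// mulrC.
have IG : lam.-integrable (@D2 R) G.
  apply/integrableP; split => //; under eq_integral do rewrite gee0_abs//.
  exact: le_lt_trans iG (ltry _).
have aeG := integrable_ae mD IG.
split.
  apply: ae_imp aeG => t tG Dt; exists (fine (G t)) => n.
  by rewrite -lee_fin fineK ?tG//; exact: gG.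
move=> V mV V0 uV; apply/integrableP; split; first exact/measurable_EFinP.
under eq_integral do rewrite /= ger0_norm//.
rewrite (@ge0_ae_eq_integral _ _ _ lam (@D2 R) (EFin \o V) G) => //.
- exact: le_lt_trans iG (ltry _).
- exact/measurable_EFinP.
- by move=> t _; rewrite lee_fin.
apply: ae_imp uV => t tV Dt; rewrite GE /=; apply/esym/cvg_lim => //.
by apply: cvg_EFin; [exact: nearW|exact: tV].
Qed.

(** [|v - V| = (v - V) + 2 (V - v)^+]: the first term has mean 0 by equality of the means, and the
    second is dominated by [V]. *)
Lemma scheffe (v : nat -> R -> R) V : (forall n, rL1 (v n)) -> rL1 V ->
  (forall n t, 0 <= v n t) -> (forall t, 0 <= V t) ->
  {ae lam, forall t, D2 t -> v ^~ t @ \oo --> V t} -> (forall n, ravg (v n) = ravg V) ->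
  (fun n => ravg (fun t => `|v n t - V t|)) @ \oo --> (0 : R).
Proof.
move=> hv hV v0 V0 vV E.
pose p n t := Num.max 0 (V t - v n t).
have mp n : measurable_fun (@D2 R) (p n).
  apply: measurable_maxr; first exact: measurable_cst.
  by apply: measurable_funB; exact: rL1_meas.
have pb n t : `|p n t| <= V t.
  rewrite ger0_norm; last by rewrite /p le_max lexx.
  by rewrite /p ge_max V0 /= gerBl.
have pc : {ae lam, forall t, D2 t -> p ^~ t @ \oo --> (0 : R)}.
  apply: ae_imp vV => t vt Dt; apply/cvgrPdist_le => e e0.
  have /cvgrPdist_le/(_ e e0) := vt Dt; apply: filterS => n h.
  rewrite sub0r normrN ger0_norm /p ?le_max ?lexx// ge_max (ltW e0)/=.
  exact: le_trans (ler_norm _) h.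
have [_ lim] := ravg_dominated mp (rL1_meas (rL1_cst 0)) pc hV pb.
have hp n : rL1 (p n) := rL1_le (mp n) (pb n) hV.
have -> : (fun n => ravg (fun t => `|v n t - V t|)) = (fun n => 2 * ravg (p n)).
  apply/funext => n.
  transitivity (ravg (fun t => (v n t - V t) + 2 * p n t)).
    apply: eq_ravg => t; rewrite /p; case: (lerP 0 (V t - v n t)) => h.
      by rewrite -normrN opprB ger0_norm//; lra.
    by rewrite gtr0_norm; lra.
  rewrite (ravgD (rL1B (hv n) hV) (rL1Z 2 (hp n))) (ravgB (hv n) hV) E subrr add0r.
  by rewrite (ravgZ _ (hp n)).
rewrite -[X in _ --> X](mulr0 2); apply: cvgM; first exact: cvg_cst.
by move: lim; rewrite ravg_cst.
Qed.

End RealHerglotz.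

Section OuterRepresentation.
Context {R : realType}.
Implicit Types (z w : R[i]) (r s t : R) (f g h p U : R[i] -> R[i]) (V : R -> R) (F : Hinf R).
Local Notation Re := complex.Re.
Local Notation Im := complex.Im.

Lemma min_lip (y y' k : R) : `|Num.min y k - Num.min y' k| <= `|y - y'|.
Proof.
case: (leP y k) => h1; case: (leP y' k) => h2; rewrite ?lexx ?subrr ?normr0 ?normr_ge0//.
  by rewrite [in leRHS]distrC [in leLHS]distrC !ger0_norm; lra.
by rewrite !ger0_norm; lra.
Qed.

Lemma zero_free_log f (M : R) : holo f -> (forall z, normc z < 1 -> f z != 0) ->
  (forall z, normc z < 1 -> normc (f z) <= M) ->
  exists (c : R[i]) U, [/\ holo U, normc c = M, forall z, normc z < 1 -> 0 <= Re (U z) &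
    forall z, normc z < 1 -> f z = c * cexp (- U z)].
Proof.
move=> hf f0 fM; have [c [u hu [c0 fE]]] := holo_log hf f0.
have nc : 0 < normc c.
  by rewrite lt_neqAle normc_ge0 andbT eq_sym; apply: contra_neq c0 => /eq0_normc.
have M0 : 0 < M.
  have n01 : normc (0 : R[i]) < 1 by rewrite normc0.
  apply: lt_le_trans (fM 0 n01).
  by rewrite lt_neqAle normc_ge0 andbT eq_sym; apply: contra_neq (f0 0 n01) => /eq0_normc.
set k := ln (M / normc c); have ek : expR k = M / normc c by rewrite lnK// posrE divr_gt0.
exists (c * (expR k)%:C), (fun z => k%:C - u z); split.
- by apply: holoB => //; exact: holo_csts.
- by rewrite normcM normcR gtr0_norm ?expR_gt0// ek mulrC divfK// gt_eqF.
- move=> z z1; have := fM z z1; rewrite fE// normcM normc_cexp mulrC -ler_pdivlMr// -ek.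
  by rewrite ler_expR; case: (u z) => a b /=; rewrite subr_ge0.
move=> z z1; rewrite fE// -mulrA; congr (_ * _).
have -> : (expR k)%:C = cexp k%:C by rewrite /cexp /= expi0 mulr1.
by rewrite -cexpD opprB addrC subrK.
Qed.

(** [log (M / x)] cut off to [0, n]. It is continuous also at [x = 0], so that limits can be taken
    before the boundary values are known to be nonzero. *)
Let phi (M : R) n x : R := Num.max 0 (ln M - ln (Num.max x (M * expR (- n%:R)))).

Let phi_expR M n v : 0 < M -> 0 <= v -> phi M n (M * expR (- v)) = Num.min v n%:R.
Proof.
move=> M0 v0; have lnM x : ln (M * expR (- x)) = ln M - x.
  by rewrite lnM ?posrE ?expR_gt0// expRK.
rewrite /phi; have [vn|nv] := lerP v n%:R.
  have -> : Num.max (M * expR (- v)) (M * expR (- n%:R)) = M * expR (- v).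
    by rewrite max_l// ler_pM2l// ler_expR lerN2.
  by rewrite lnM opprB addrC subrK max_r.
have -> : Num.max (M * expR (- v)) (M * expR (- n%:R)) = M * expR (- n%:R).
  by rewrite max_r// ler_pM2l// ler_expR lerN2 ltW.
by rewrite lnM opprB addrC subrK max_r.
Qed.

Let continuous_phi M n : 0 < M -> continuous (phi M n).
Proof.
move=> M0 x; have c0 : 0 < M * expR (- n%:R) by rewrite mulr_gt0// expR_gt0.
have c1 : (fun x => Num.max x (M * expR (- n%:R))) @ x --> Num.max x (M * expR (- n%:R)).
  apply: (@continuous_max _ _ (fun x => x) (fun=> M * expR (- n%:R))); first exact: cvg_id.
  exact: cvg_cst.
have c2 : (fun x => ln (Num.max x (M * expR (- n%:R)))) @ x --> ln (Num.max x (M * expR (- n%:R))).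
  apply: (cvg_comp _ _ c1); apply: continuous_ln.
  by rewrite lt_max c0 orbT.
apply: (@continuous_max _ _ (fun=> 0) (fun x => ln M - ln (Num.max x (M * expR (- n%:R))))).
  exact: cvg_cst.
by apply: cvgB => //; exact: cvg_cst.
Qed.

(** The means of [Re U] over circles all equal [Re (U 0)]. For fixed [n] the cut-off logarithms
    converge boundedly, so their limits [u n] have mean at most [Re (U 0)]; then [n] increases. *)
Lemma boundary_log f (c : R[i]) U : holo f -> holo U -> 0 < normc c ->
  (forall z, normc z < 1 -> 0 <= Re (U z)) ->
  (forall z, normc z < 1 -> f z = c * cexp (- U z)) ->
  exists V, [/\ forall t, 0 <= V t, rL1 V, ravg V <= Re (U 0),
    {ae lam, forall t, D2 t -> (fun n => Re (circf U (rn n) t)) @ \oo --> V t} &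
    {ae lam, forall t, D2 t -> exists2 l : R[i], (fun r : R => f (r%:C * expi t)) @ 1^'- --> l &
       normc l = normc c * expR (- V t)}].
Proof.
move=> hf hU; set M := normc c => M0 U0 fE.
have nf z : normc z < 1 -> normc (f z) = M * expR (- Re (U z)).
  by move=> z1; rewrite fE// normcM normc_cexp; case: (U z).
have fM z : normc z < 1 -> normc (f z) <= M.
  move=> z1; rewrite nf// ler_piMr ?(ltW M0)// expR_le1 oppr_le0; exact: U0.
have nr n t : normc ((@rn R n)%:C * expi t) < 1.
  by have /andP[a b] := @rn01' R n; rewrite normc_circ.
have radial := fatou_radial hf fM.
have cf n : continuous (circf f (rn n)) by exact: holo_circ (@rn01' R n).
have fb n t : normc (circf f (rn n) t) <= M by exact: fM.
have aeseq : {ae lam, forall t, D2 t -> exists l : R[i], (fun n => circf f (rn n) t) @ \oo --> l}.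
  apply: ae_imp radial => t tr Dt; have [l fl] := tr Dt; exists l.
  exact: (cvg_comp rn (fun x : R => f (x%:C * expi t)) (@rn_cvg R) fl).
have [h mh [_ hl]] := ae_lim_measurable (fun n => continuous_ameas (@cf n)) fb aeseq.
pose v n t := Re (circf U (rn n) t).
have v0 n t : 0 <= v n t by exact: U0.
have fv n t : normc (circf f (rn n) t) = M * expR (- v n t) by exact: nf.
have cv n : continuous (v n).
  by move=> t; apply: cvg_Re; exact: (holo_circ hU (@rn01' R n)).
have hv n : rL1 (v n) := continuous_rL1 (@cv n).
have av n : ravg (v n) = Re (U 0) by rewrite -Re_avg mean_value// rn01.
pose u n t := phi M n (normc (h t)).
have mh1 : measurable_fun (@D2 R) (fun t => normc (h t)) := cmeas_normc mh.
have mu n : measurable_fun (@D2 R) (u n).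
  apply: (measurableT_comp (f := phi M n)) => //.
  by apply: continuous_measurable_fun; exact: continuous_phi.
have minphi n k t : Num.min (v k t) n%:R = phi M n (normc (circf f (rn k) t)).
  by rewrite fv phi_expR.
have min_cvg n : {ae lam, forall t, D2 t -> (fun k => Num.min (v k t) n%:R) @ \oo --> u n t}.
  apply: ae_imp hl => t tl Dt; under eq_fun do rewrite minphi.
  exact: (cvg_comp (fun k => normc (circf f (rn k) t)) (phi M n) (cvg_normc (tl Dt)) (@continuous_phi M n M0 _)).
have mmin n k : measurable_fun (@D2 R) (fun t => Num.min (v k t) n%:R).
  by apply: measurable_minr; [exact: rL1_meas|exact: measurable_cst].
have minb n k t : `|Num.min (v k t) n%:R| <= n%:R.
  by rewrite ger0_norm ?le_min ?v0 ?ler0n// ge_min lexx orbT.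
have uL n : rL1 (u n) /\ ravg (u n) <= Re (U 0).
  have [i lim] := ravg_dominated (mmin n) (mu n) (min_cvg n) (rL1_cst n%:R) (minb n).
  split=> //; rewrite -(cvg_lim (@Rhausdorff R) lim); apply: limr_le.
    by apply/cvg_ex; exists (ravg (u n)).
  apply: nearW => k; rewrite -(av k); apply: le_ravg => //.
    exact: rL1_bdd (mmin n k) (minb n k).
  by move=> t; rewrite ge_min lexx.
have u0 n t : 0 <= u n t by rewrite /u /phi le_max lexx.
have pos n x : 0 < Num.max x (M * expR (- n%:R)) by rewrite lt_max mulr_gt0 ?orbT ?expR_gt0.
have um n t : u n t <= u n.+1 t.
  rewrite /u /phi ge_max le_max lexx /= le_max; apply/orP; right.
  rewrite lerB// ler_ln ?posrE ?pos// ge_max !le_max lexx /=; apply/orP; right.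
  by rewrite ler_pM2l// ler_expR lerN2 ler_nat.
have [bdd lev] := beppo_levi (fun n => (uL n).1) u0 um (fun n => (uL n).2).
pose V t := Num.max 0 (ln M - ln (normc (h t))).
have V0 t : 0 <= V t by rewrite /V le_max lexx.
have mV : measurable_fun (@D2 R) V.
  apply: measurable_maxr; first exact: measurable_cst.
  apply: measurable_funB; first exact: measurable_cst.
  exact: (measurableT_comp (@measurable_ln R) mh1).
(* At a zero of [h] the cut-off logarithm is [u n t = n], which is unbounded in [n]. *)
have h_neq0 : {ae lam, forall t, D2 t -> h t != 0}.
  apply: ae_imp bdd => t tb Dt; have [C CP] := tb Dt; apply/eqP => ht.
  have := CP (Num.truncn C).+1; rewrite /u /phi ht normc0 [Num.max 0 (M * _)]max_r; last first.
    by rewrite mulr_ge0 ?expR_ge0// ltW.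
  rewrite lnM ?posrE ?expR_gt0// expRK opprD opprK addrA subrr add0r max_r ?ler0n//.
  by rewrite leNgt truncnS_gt.
have uV : {ae lam, forall t, D2 t -> u ^~ t @ \oo --> V t}.
  apply: ae_imp h_neq0 => t tn Dt; have ht := tn Dt.
  have n0 : 0 < normc (h t).
    by rewrite lt_neqAle normc_ge0 andbT eq_sym; apply: contra_neq ht => /eq0_normc.
  set N := (Num.truncn (ln M - ln (normc (h t)))).+1.
  apply: (cvg_near_cst (V t)); exists N => // n /= Nn.
  rewrite /u /phi /V; congr (Num.max _ (_ - ln _)); apply/max_l.
  have -> : normc (h t) = M * expR (- (ln M - ln (normc (h t)))).
    by rewrite opprB expRD expRN !lnK ?posrE// mulrC divfK// gt_eqF.
  rewrite ler_pM2l// ler_expR lerN2; apply: (@le_trans _ _ N%:R); last by rewrite ler_nat.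
  by rewrite ltW// truncnS_gt.
have VL : rL1 V := lev V mV V0 uV.
have vV : {ae lam, forall t, D2 t -> (fun n => v n t) @ \oo --> ln M - ln (normc (h t))}.
  apply: ae_imp (ae_and hl h_neq0) => t [tl tn] Dt.
  have n0 : 0 < normc (h t).
    by rewrite lt_neqAle normc_ge0 andbT eq_sym; apply: contra_neq (tn Dt) => /eq0_normc.
  have -> : (fun n => v n t) = (fun n => ln M - ln (normc (circf f (rn n) t))).
    apply/funext => n; rewrite fv lnM ?posrE ?expR_gt0// expRK; ring.
  apply: cvgB; first exact: cvg_cst.
  exact: (cvg_comp _ _ (cvg_normc (tl Dt)) (continuous_ln n0)).
have VE : {ae lam, forall t, D2 t -> V t = ln M - ln (normc (h t))}.
  apply: ae_imp vV => t tv Dt; rewrite /V max_r//.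
  rewrite -(cvg_lim (@Rhausdorff R) (tv Dt)); apply: limr_ge.
    by apply/cvg_ex; exists (ln M - ln (normc (h t))); exact: tv.
  exact: nearW.
exists V; split=> //.
(* Where [h t = 0], [V] takes the default value of [ln] and [u n] may exceed it; the minimum with
   [V] restores a domination that holds everywhere. *)
- pose w n t := Num.min (u n t) (V t).
  have mw n : measurable_fun (@D2 R) (w n) by exact: measurable_minr.
  have wb n t : `|w n t| <= V t by rewrite ger0_norm ?le_min ?u0 ?V0// /w ge_min lexx orbT.
  have wV : {ae lam, forall t, D2 t -> w ^~ t @ \oo --> V t}.
    apply: ae_imp uV => t tu Dt.
    apply/cvgrPdist_le => e e0; have /cvgrPdist_le/(_ e e0) := tu Dt.
    by apply: filterS => n; apply: le_trans; rewrite -{1}[V t]minxx; exact: min_lip.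
  have [_ lim] := ravg_dominated mw mV wV VL wb.
  rewrite -(cvg_lim (@Rhausdorff R) lim); apply: limr_le; first by apply/cvg_ex; exists (ravg V).
  apply: nearW => n; apply: le_trans (uL n).2; apply: le_ravg.
  - exact: rL1_le (mw n) (wb n) VL.
  - exact: (uL n).1.
  - by move=> t; rewrite /w ge_min lexx.
- by apply: ae_imp (ae_and vV VE) => t [tv tE] Dt; rewrite tE//; exact: tv.
apply: ae_imp (ae_and (ae_and radial hl) (ae_and h_neq0 VE)) => t [[tr tl] [tn tE]] Dt.
have [l fl] := tr Dt; exists l => //.
have -> : l = h t.
  apply: (cvgC_uniq _ (tl Dt)).
  exact: (cvg_comp rn (fun x : R => f (x%:C * expi t)) (@rn_cvg R) fl).
have n0 : 0 < normc (h t).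
  by rewrite lt_neqAle normc_ge0 andbT eq_sym; apply: contra_neq (tn Dt) => /eq0_normc.
by rewrite tE// opprB expRD expRN !lnK ?posrE// mulrC divfK// gt_eqF.
Qed.

(** The means of [Re U] over circles are all [Re (U 0)], so the claim is that no mass is lost in the
    limit. Truncated at [K], the means converge. With [1 - p F] small, Szego's inequality bounds
    [|p 0|^2 exp(- 2 mean)] by about [M^-2], whereas [|p 0| |F 0|] is nearly 1: mass lost would be a
    factor [exp(2 x)] too many. *)
Lemma outer_jensen F (c : R[i]) U V : outer F -> holo U ->
  (forall z, normc z < 1 -> 0 <= Re (U z)) ->
  (forall z, normc z < 1 -> F z = c * cexp (- U z)) -> (forall t, 0 <= V t) -> rL1 V ->
  {ae lam, forall t, D2 t -> (fun n => Re (circf U (rn n) t)) @ \oo --> V t} ->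
  Re (U 0) <= ravg V.
Proof.
move=> oF hU U0 FE V0 VL vV; rewrite leNgt; apply/negP => lt_V.
set x := Re (U 0) - ravg V; have x0 : 0 < x by rewrite subr_gt0.
set M := normc c.
have nf z : normc z < 1 -> normc (F z) = M * expR (- Re (U z)).
  by move=> z1; rewrite FE// normcM normc_cexp; case: (U z).
have n01 : normc (0 : R[i]) < 1 by rewrite normc0.
have M0 : 0 < M.
  rewrite lt_neqAle normc_ge0 andbT eq_sym; apply: contra_neq (outer_neq0 oF n01) => M0.
  by apply: eq0_normc; rewrite nf// M0 mul0r.
(* The end is [(1 - e)^2 (1 + 3/2 x) <= (1 + e)^2 + e]. The difference of the constant terms is
   [5 e <= 5/8 x], less than [9/16 * 3/2 x]. *)
set e := Num.min (1 / 4) (x / 8).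
have e0 : 0 < e by rewrite lt_min !divr_gt0.
have e14 : e <= 1 / 4 by rewrite /e ge_min lexx.
have ex : e <= x / 8 by rewrite /e ge_min lexx orbT.
have [a [N pN]] := outer_approx oF (exprn_gt0 2 e0).
set p := psum a N in pN; have [P pP] := psum_bdd a N.
have hp : holo p := holo_psum a N.
have hF := @Hinf_holo R F.
have P0 : 0 <= P by apply: le_trans (pP 0 n01); rewrite normc_ge0.
(* Truncation replaces [exp(- 2 v)] by at most [exp(- 2 v) + exp(- 2 K)]; this [K] makes the cost of
   the second term at most [e]. It depends on the polynomial [p], hence is chosen after it. *)
have [K KP] : exists K : nat, (M * P) ^+ 2 * expR (- 2 * K%:R) <= e.
  exists (Num.truncn ((M * P) ^+ 2 / e)).+1; set k := (Num.truncn ((M * P) ^+ 2 / e)).+1%:R.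
  have hk : (M * P) ^+ 2 / e < k by rewrite truncnS_gt.
  have k0 : 0 <= k by exact: ler0n.
  rewrite mulNr expRN -ler_pdivlMr ?invr_gt0 ?expR_gt0// invrK.
  move: hk; rewrite ltr_pdivrMr// mulrC => /ltW/le_trans; apply.
  by rewrite [leLHS]mulrC ler_pM2l//; apply: le_trans (expR_ge1Dx _); lra.
pose v n t := Re (circf U (rn n) t).
have nr n t : normc ((@rn R n)%:C * expi t) < 1.
  by have /andP[a' b] := @rn01' R n; rewrite normc_circ.
have v0 n t : 0 <= v n t by exact: U0.
have cv n : continuous (v n).
  by move=> t; apply: cvg_Re; exact: (holo_circ hU (@rn01' R n)).
pose m n t := Num.min (v n t) K%:R.
have mc n : circle_continuous (m n).
  move=> t0 d d0; have [D /cder_cont/cvgCP/(_ d d0)/cvg_cnear[s s0 sP]] := hU _ (nr n t0).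
  exists s => // t ts; apply: le_trans (min_lip _ _ _) _; apply: ltW.
  have : normc ((rn n)%:C * expi t - (rn n)%:C * expi t0) < s.
    have /andP[a' /ltW b] := @rn01' R n.
    rewrite -mulrBr normcM normcR ger0_norm//; apply: le_lt_trans ts.
    by rewrite ler_piMl ?normc_ge0.
  move=> /sP; apply: le_lt_trans; apply: le_trans (Re_le_normc _).
  by rewrite /v /circf; case: (U _) (U _) => [? ?] [? ?] /=.
have m0 n t : 0 <= m n t by rewrite /m le_min v0 ler0n.
have mL n : rL1 (m n) := continuous_rL1 (circle_continuous_continuous (mc n)).
have mb n t : `|m n t| <= K%:R by rewrite ger0_norm// /m ge_min lexx orbT.
have mV : measurable_fun (@D2 R) (fun t => Num.min (V t) K%:R).
  by apply: measurable_minr; [exact: rL1_meas|exact: measurable_cst].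
have mlim : {ae lam, forall t, D2 t -> m ^~ t @ \oo --> Num.min (V t) K%:R}.
  apply: ae_imp vV => t tv Dt; apply/cvgrPdist_le => d d0.
  have /cvgrPdist_le/(_ d d0) := tv Dt; apply: filterS => n; apply: le_trans.
  exact: min_lip.
have [iV lim] := ravg_dominated (fun n => rL1_meas (mL n)) mV mlim (rL1_cst K%:R) mb.
have aV : ravg (fun t => Num.min (V t) K%:R) <= ravg V.
  by apply: le_ravg => // t; rewrite ge_min lexx.
have x40 : 0 < x / 4 by rewrite divr_gt0.
have /cvgrPdist_lt/(_ _ x40)[j _ /(_ j (leqnn j))] := lim.
move=> /= hj; have {hj} hj : ravg (m j) <= ravg V + x / 4.
  by move: hj; rewrite distrC => /(le_lt_trans (ler_norm _)); lra.
have := szego hp pP (@rn01' R j) (mc j) (m0 j) (mL j).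
have hpF : holo (fun z => p z * F z) := holoM hp hF.
have h1pF : holo (fun z => 1 - p z * F z) by apply: holoB => //; exact: holo_csts.
have i1 := rL1_en hpF (@rn01' R j); have i2 := rL1_en h1pF (@rn01' R j).
have i3 := rL1_en hp (@rn01' R j).
set T := (X in (_ <= X) -> _); have TE : M ^+ 2 * T <= (1 + e) ^+ 2 + e.
  have i4 : rL1 (fun t => normc (circf p (rn j) t) ^+ 2 * expR (- 2 * m j t)).
    apply: (rL1M i3 (M := 1)).
      apply: (measurableT_comp (@measurable_expR R)).
      by apply: measurable_funM; [exact: measurable_cst|exact: rL1_meas].
    by move=> t; rewrite ger0_norm ?expR_ge0// expR_le1 mulNr oppr_le0 mulr_ge0.
  rewrite -(ravgZ _ i4).
  (* [|p F|^2 <= (1 + q)^2 <= (1 + e) + (1 + 1/e) q^2] for [q = |1 - p F|], whose mean square is at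
     most [e^2]; the last [e] pays for the truncation. *)
  apply: (@le_trans _ _ (ravg (fun t => ((1 + e) + (1 + e^-1) * normc (circf (fun z => 1 - p z * F z) (rn j) t) ^+ 2) + e))).
    apply: le_ravg; [exact: rL1Z| |].
      by apply: rL1D; [apply: rL1D; [exact: rL1_cst|exact: rL1Z]|exact: rL1_cst].
    move=> t; rewrite /circf; set w := (rn j)%:C * expi t.
    have w1 : normc w < 1 := nr j t.
    have mE : expR (- 2 * m j t) <= expR (- 2 * v j t) + expR (- 2 * K%:R).
      rewrite /m; have [h|h] := lerP (v j t) K%:R; first by rewrite lerDl expR_ge0.
      by rewrite lerDr expR_ge0.
    have n2 : normc (p w) ^+ 2 <= P ^+ 2 by rewrite lerXn2r ?nnegrE ?normc_ge0 ?pP.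
    apply: (@le_trans _ _ (M ^+ 2 * (normc (p w) ^+ 2 * (expR (- 2 * v j t) + expR (- 2 * K%:R))))).
      by rewrite ler_wpM2l ?sqr_ge0// ler_wpM2l ?sqr_ge0.
    rewrite !mulrDr; apply: lerD; last first.
      apply: le_trans KP; rewrite exprMn -[leRHS]mulrA ler_wpM2l ?sqr_ge0// ler_wpM2r ?expR_ge0//.
    have -> : M ^+ 2 * (normc (p w) ^+ 2 * expR (- 2 * v j t)) = normc (p w * F w) ^+ 2.
      rewrite normcM exprMn nf// exprMn -expRM_natl mulrCA -/(circf U (rn j) t) -/(v j t).
      by congr (_ * (_ * expR _)); rewrite mulrN mulNr.
    set y := p w * F w; set q := normc (1 - y).
    have yq : normc y <= 1 + q.
      have := le_normcD 1 (- (1 - y)); rewrite normcN normc1.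
      by rewrite opprB [1 + (y - 1)]addrC subrK.
    have q0 : 0 <= q := normc_ge0 _.
    apply: (@le_trans _ _ ((1 + q) ^+ 2)); first by rewrite lerXn2r ?nnegrE ?normc_ge0 ?addr_ge0.
    rewrite -subr_ge0 (_ : _ - _ = e^-1 * (e - q) ^+ 2); last by field; rewrite gt_eqF.
    by rewrite mulr_ge0 ?invr_ge0 ?(ltW e0) ?sqr_ge0.
  have i5 := rL1Z (1 + e^-1) i2; have i6 := rL1D (rL1_cst (1 + e)) i5.
  rewrite (ravgD i6 (rL1_cst e)) (ravgD (rL1_cst (1 + e)) i5) !ravg_cst (ravgZ _ i2).
  have := pN _ (@rn01 R j); rewrite /en => h.
  have h2 : (1 + e^-1) * ravg (fun t => normc (circf (fun z => 1 - p z * F z) (rn j) t) ^+ 2) <= (1 + e^-1) * e ^+ 2.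
    by rewrite ler_wpM2l// addr_ge0// invr_ge0 ltW.
  have h3 : (1 + e^-1) * e ^+ 2 = e ^+ 2 + e by field; rewrite gt_eqF.
  by rewrite h3 in h2; lra.
have p0F : 1 - e <= normc (p 0) * (M * expR (- Re (U 0))).
  rewrite -nf// -normcM.
  have h := le_trans (en_ge_center h1pF (@rn01 R j)) (pN _ (@rn01 R j)).
  have h2 : normc (1 - p 0 * F 0) <= e by rewrite -(@ler_pXn2r _ 2) ?nnegrE ?normc_ge0 ?(ltW e0).
  have := le_normcD (1 - p 0 * F 0) (p 0 * F 0); rewrite subrK normc1; lra.
move=> sz.
have p0F2 : (1 - e) ^+ 2 <= normc (p 0) ^+ 2 * M ^+ 2 * expR (- 2 * Re (U 0)).
  apply: (@le_trans _ _ ((normc (p 0) * (M * expR (- Re (U 0)))) ^+ 2)).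
    rewrite lerXn2r ?nnegrE//; first lra.
    by rewrite !mulr_ge0 ?normc_ge0 ?expR_ge0 ?(ltW M0).
  by rewrite !exprMn -expRM_natl mulrA mulrN mulNr.
have A : (1 - e) ^+ 2 * expR (2 * Re (U 0) - 2 * ravg (m j)) <= (1 + e) ^+ 2 + e.
  apply: le_trans TE; apply: (@le_trans _ _ (M ^+ 2 * (normc (p 0) ^+ 2 * expR (- 2 * ravg (m j))))).
    have -> : 2 * Re (U 0) - 2 * ravg (m j) = 2 * Re (U 0) + - 2 * ravg (m j) by ring.
    rewrite expRD; apply: le_trans (ler_wpM2r _ p0F2) _.
      by rewrite mulr_ge0 ?expR_ge0.
    rewrite mulNr expRN le_eqVlt; apply/orP; left; apply/eqP.
    by field; rewrite gt_eqF// expR_gt0.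
  by rewrite ler_wpM2l ?sqr_ge0.
have B : 1 + 3 / 2 * x <= expR (2 * Re (U 0) - 2 * ravg (m j)).
  by apply: le_trans (expR_ge1Dx _); rewrite /x in hj *; lra.
have C : (1 - e) ^+ 2 * (1 + 3 / 2 * x) <= (1 + e) ^+ 2 + e.
  by apply: le_trans A; rewrite ler_wpM2l ?sqr_ge0.
have D : 9 / 16 <= (1 - e) ^+ 2.
  have : (3 / 4) ^+ 2 <= (1 - e) ^+ 2 by rewrite lerXn2r ?nnegrE//; lra.
  lra.
have E : 9 / 16 * (3 / 2 * x) <= (1 - e) ^+ 2 * (3 / 2 * x).
  by rewrite ler_wpM2r// mulr_ge0// ltW.
have e2 : e * e <= e * (1 / 4) by rewrite ler_wpM2l ?(ltW e0).
lra.
Qed.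

(** Equality of the means of [V] and [Re U] gives L^1-convergence of the real parts, and
    [schwarz_formula] carries it over to [U]. The remaining constant [Im (U 0)] is absorbed into [c]
    as a unimodular factor. *)
Theorem outer_repr F : outer F -> exists V (c : R[i]), [/\ forall t, 0 <= V t, rL1 V, 0 < normc c,
  forall z, normc z < 1 -> F z = c * cexp (- rherg V z) &
  {ae lam, forall t, D2 t -> exists2 l : R[i], (fun r : R => F (r%:C * expi t)) @ 1^'- --> l &
     normc l = normc c * expR (- V t)}].
Proof.
move=> oF; have hF := @Hinf_holo R F.
have F0 z : normc z < 1 -> F z != 0 by move=> z1; exact: outer_neq0.
have [c [U [hU cE U0 FE]]] := zero_free_log hF F0 (@normc_le_hnorm R F).
have n01 : normc (0 : R[i]) < 1 by rewrite normc0.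
have c0 : 0 < normc c.
  rewrite lt_neqAle normc_ge0 andbT eq_sym; apply: contra_neq (outer_neq0 oF n01) => c0.
  by rewrite FE// (eq0_normc c0) mul0r.
have [V [V0 VL aV vV rad]] := boundary_log hF hU c0 U0 FE.
have aVE : ravg V = Re (U 0).
  by apply/eqP; rewrite eq_le aV /=; exact: outer_jensen oF hU U0 FE V0 VL vV.
pose v n t := Re (circf U (rn n) t).
have hv n : rL1 (v n) by apply: aL1_Re; exact: aL1_circf (@rn01' R n).
have v0 n t : 0 <= v n t.
  by apply: U0; have /andP[a b] := @rn01' R n; rewrite normc_circ.
have av n : ravg (v n) = ravg V by rewrite aVE -Re_avg mean_value// rn01.
have sch := scheffe hv VL v0 V0 vV av.
set b := Im (U 0).
have UE z : normc z < 1 -> U z = rherg V z + b *i.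
  move=> z1.
  have c1 : (fun n => U ((rn n)%:C * z)) @ \oo --> U z.
    have [d /cder_cont Uc] := hU z z1.
    have c0' : (fun n => (rn n)%:C * z) @ \oo --> z.
      rewrite -[X in _ --> X]mul1r; apply: cvgCM; last exact: cvg_cst.
      by apply: cvg_toC; exact: rn_cvg1.
    exact: (cvg_comp (fun n => (rn n)%:C * z) U c0' Uc).
  have c2 : (fun n => U ((rn n)%:C * z)) @ \oo --> rherg V z + b *i.
    apply/cvgCP => e e0; set k := 2 / (1 - normc z).
    have k0 : 0 < k by rewrite divr_gt0// subr_gt0.
    have /cvgrPdist_lt/(_ _ (divr_gt0 e0 k0)) := sch.
    apply: filterS => n; rewrite sub0r normrN ger0_norm; last by apply: ravg_ge0.
    rewrite ltr_pdivlMr//; apply: le_lt_trans.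
    rewrite schwarz_formula ?rn01// -/b.
    have -> : herg (fun t => (Re (circf U (rn n) t))%:C) z + b *i - (rherg V z + b *i) =
       rherg (v n) z - rherg V z by rewrite opprD addrACA subrr addr0.
    have i1 := aL1_hker z1 (aL1_real (hv n)); have i2 := aL1_hker z1 (aL1_real VL).
    have i3 := rL1_norm (rL1B (hv n) VL).
    rewrite /rherg /herg -(avgB i1 i2); apply: le_trans (normc_avg_le (aL1B i1 i2)) _.
    rewrite mulrC -(ravgZ _ i3); apply: le_ravg; [exact/aL1_normc/aL1B|exact: rL1Z|].
    move=> t; rewrite -mulrBl -toCB normcM normcR mulrC ler_wpM2r//.
    exact: hker_le.
  exact: (cvgC_uniq c1 c2).
exists V, (c * cexp (- (b *i))); split=> //.
- by rewrite normcM normc_cexp /= oppr0 expR0 mulr1.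
- by move=> z z1; rewrite FE// UE// -mulrA -cexpD; congr (_ * cexp _); rewrite opprD addrC.
by rewrite normcM normc_cexp /= oppr0 expR0 mulr1.
Qed.

End OuterRepresentation.

(** * Approximate units *)

Section EssentialZeros.
Context {R : realType}.
Implicit Types (z w : R[i]) (r s t : R) (f g h : R[i] -> R[i]) (V : R -> R) (F : Hinf R).
Local Notation Re := complex.Re.
Local Notation Im := complex.Im.

Lemma radial_limitP h z (l : R[i]) : (fun r : R => h (r%:C * z)) @ 1^'- --> l -> radial_limit h z = l.
Proof. by move=> hl; apply: (cvgC_uniq (F := 1^'-) _ hl); exact: cvgP hl. Qed.

(** [lim] has the value 0 where there is no limit, so a nonzero value certifies convergence; the
    strict lower bound in [essential_zeros] supplies it. *)
Lemma radial_limit_neq0 h z : radial_limit h z != 0 ->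
  (fun r : R => h (r%:C * z)) @ 1^'- --> radial_limit h z.
Proof.
move=> h0; apply: contrapT => nc; move: h0.
have -> : radial_limit h z = 0 by rewrite /radial_limit dvgP.
by rewrite eqxx.
Qed.

Lemma circle_normc z : circle z -> normc z = 1. Proof. by move=> /circleE. Qed.

Lemma essential_zeros_sub F : outer F -> essential_zeros F `<=` ZT F.
Proof.
move=> oF z Fz; have [one oneE] := @Hinf_one_ex R.
exists one, F; split=> //.
  apply: aeW => w /circle_normc w1.
  rewrite (@radial_limitP one w 1) ?normc1//.
  apply/cvgCP => e e0; near=> r.
  have r0 : 0 < r by near: r; exact: nbhs_left_gt.
  have r1 : r < 1 by near: r; exact: nbhs_left_lt.
  by rewrite oneE ?subrr ?normc0// normcM w1 mulr1 normcR gtr0_norm.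
move=> w; have [w1|w1] := boolP (normc w < 1); first by rewrite oneE// mul1r.
have nw : ~ disc w by move/discE; exact/negP.
by have [_ F0 _] := HinfP F; rewrite F0// mulr0.
Unshelve. all: by end_near. Qed.

(** A set of nonzero measure contains a point, so near [z] there are points of the circle with small
    nonzero radial limit, and on their radii points of the disc where [F] is small. Continuity of
    the extension then forces [G z = 0]. *)
Lemma essential_zero_small F z (eta : R) : outer F -> Zinf F -> essential_zeros F z -> 0 < eta ->
  exists2 d : R, 0 < d & forall w, normc w < 1 -> normc (w - z) < d -> normc (F w) < eta.
Proof.
move=> oF [_ [G [/subspace_continuousP Gc GF]]] Zz eta0.
have cG := Gc z (or_intror (essential_zeros_sub oF Zz)).
have loc (e : R) : 0 < e -> exists2 d : R, 0 < d &
    forall w, normc w < 1 -> normc (w - z) < d -> normc (F w - G z) < e.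
  move=> e0; have /cvgCP/(_ e e0) := cG.
  rewrite near_withinE => /cvg_cnear[d d0 dP]; exists d => // w /discE w1 wd.
  by rewrite -GF//; apply: dP => //; left.
have G0 : G z = 0.
  apply: eq0_normc; apply/eqP; rewrite eq_le normc_ge0 andbT; apply/ler_addgt0Pr => e e0.
  rewrite add0r; have e3 : 0 < e / 3 by rewrite divr_gt0.
  have [d d0 dP] := loc _ e3.
  have d20 : 0 < d / 2 by rewrite divr_gt0.
  have oB : open [set w | normc (w - z) < d / 2].
    rewrite openE => w /= wd; apply/cvg_cnear.
    exists (d / 2 - normc (w - z)); first by rewrite subr_gt0.
    by move=> x; rewrite ltrBrDr; apply: le_lt_trans; have := le_normcD (x - w) (w - z); rewrite addrA subrK.
  have zB : [set w | normc (w - z) < d / 2] z by rewrite /= subrr normc0.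
  have [_ /(_ _ _ e3 oB zB) /eqP nz] := Zz.
  have [w [/andP[w0 we] [wd /circle_normc w1]]] : exists w, ([set w | 0 < normc (radial_limit F w) < e / 3]
      `&` ([set w | normc (w - z) < d / 2] `&` circle)) w.
    apply: contrapT => nw; apply: nz; rewrite (_ : _ `&` _ = set0) ?measure0//.
    by apply/seteqP; split => // w Aw; apply: nw; exists w.
  have rl0 : radial_limit F w != 0 by apply: contraTneq w0 => ->; rewrite normc0 ltxx.
  have /cvgCP/(_ _ e3) rl := radial_limit_neq0 rl0.
  have [r [r0 r1 rd rP]] : exists r : R, [/\ 0 < r, r < 1, 1 - r < d / 2 &
      normc (F (r%:C * w) - radial_limit F w) < e / 3].
    have : \forall r \near (1 : R)^'-, [/\ 0 < r, r < 1, 1 - r < d / 2 &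
      normc (F (r%:C * w) - radial_limit F w) < e / 3].
      near=> r; split.
      - by near: r; exact: nbhs_left_gt.
      - by near: r; exact: nbhs_left_lt.
      - suff : 1 - d / 2 < r by lra.
        by near: r; apply: nbhs_left_gt; rewrite ltrBlDr ltrDl.
      - by near: r.
    by move=> /filter_ex.
  have rw1 : normc (r%:C * w) < 1 by rewrite normcM w1 mulr1 normcR gtr0_norm.
  have rwz : normc (r%:C * w - z) < d.
    have -> : r%:C * w - z = (w - z) - (1 - r)%:C * w by rewrite toCB; ring.
    apply: le_lt_trans (le_normcD _ _) _; rewrite normcN normcM w1 mulr1 normcR gtr0_norm ?subr_gt0//.
    by rewrite /= in wd; lra.
  have := dP _ rw1 rwz.
  have E3 : G z = radial_limit F w + (F (r%:C * w) - radial_limit F w) - (F (r%:C * w) - G z) by ring.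
  move=> h; rewrite E3; apply: le_trans (le_normcD _ _) _; rewrite normcN.
  by have := le_normcD (radial_limit F w) (F (r%:C * w) - radial_limit F w); lra.
have [d d0 dP] := loc _ eta0; exists d => // w w1 wd.
by have := dP w w1 wd; rewrite G0 subr0.
Unshelve. all: by end_near. Qed.

Section Representation.
Variables (F : Hinf R) (c : R[i]) (V : R -> R).
Hypotheses (oF : outer F) (ZF : Zinf F) (V0 : forall t, 0 <= V t) (VL : rL1 V) (c0 : 0 < normc c).
Hypothesis FE : forall z, normc z < 1 -> F z = c * cexp (- rherg V z).
Hypothesis radial : {ae lam, forall t, D2 t ->
  exists2 l : R[i], (fun r : R => F (r%:C * expi t)) @ 1^'- --> l & normc l = normc c * expR (- V t)}.

(** Near [z] the set [0 < |F| < e] is null on the circle. As [|F| = |c| exp(- V)] is never 0, it is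
    at least [e] almost everywhere, which bounds [V] by [ln (|c| / e)]. *)
Lemma not_essential_bounded z : circle z -> ~ essential_zeros F z ->
  exists d (C : R), 0 < d /\ {ae lam, forall t, D2 t -> normc (expi t - z) < d -> V t <= C}.
Proof.
move=> cz nz.
have [e [U [e0 oU Uz mU]]] : exists (e : R) (U : set R[i]), [/\ 0 < e, open U, U z &
    circle_measure ([set w | 0 < normc (radial_limit F w) < e] `&` (U `&` circle)) = 0%E].
  apply: contrapT => h; apply: nz; split => // e U e0 oU Uz; apply/eqP => mU.
  by apply: h; exists e, U.
have /cvg_cnear[d d0 dU] : \forall w \near z, U w by exact: open_nbhs_nbhs.
exists d, (ln (normc c / e)); split => //.
set S := _ `&` _ in mU.
have nS : lam.-negligible (expi @^-1` S `&` `[0, 2 * pi[%classic).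
  apply/negligible_outer_measure; apply/eqP; move: mU => /eqP.
  rewrite /circle_measure /pushforward /mscale /= mule_eq0 => /orP[|//].
  by rewrite eqe invr_eq0 gt_eqF// pi2_gt0.
(* [circle_measure] says nothing about the endpoint [2 pi] of [D2]. *)
have nE : (@lam R).-negligible [set 2 * pi : R].
  exists [set 2 * pi : R]; split => //; solve [exact: measurable_set1|exact: lebesgue_measure_set1].
have aS : {ae lam, forall t, ~ ((expi @^-1` S `&` `[0, 2 * pi[%classic) t)}.
  by apply: negligibleS nS => t /= /contrapT.
have aE : {ae lam, forall t, t <> 2 * pi}.
  by apply: negligibleS nE => t /= /contrapT.
apply: ae_imp (ae_and (ae_and aS aE) radial) => t [[tS tE] tr] Dt td.
have [l Fl lE] := tr Dt; rewrite leNgt; apply/negP => ltV; apply: tS; split; last first.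
  move: Dt; rewrite /D2 /itv /= !in_itv /= => /andP[-> /=]; rewrite le_eqVlt => /predU1P[//|//].
rewrite /S /= (radial_limitP Fl) lE; split.
  rewrite mulr_gt0 ?expR_gt0//= mulrC -ltr_pdivlMr//.
  by rewrite -[e / normc c]invf_div expRN ltf_pV2 ?posrE ?expR_gt0 ?divr_gt0// -ltr_ln ?posrE ?expR_gt0 ?divr_gt0// expRK.
split; first exact: dU.
by apply/circleE; rewrite normc_expi.
Qed.

(** The integer [n] is at once the bound and the inverse of the radius, so that one filter at
    infinity runs through the covering argument. Near an essential zero the statement holds
    vacuously, since there [|F| < eta]; elsewhere [V] is locally bounded. *)
Lemma bounded_away (eta : R) : 0 < eta -> exists n : nat, {ae lam, forall t, D2 t ->
  forall z, normc z < 1 -> eta <= normc (F z) -> normc (expi t - z) < n.+1%:R^-1 -> V t <= n%:R}.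
Proof.
move=> eta0.
pose Q n t := forall z, normc z < 1 -> eta <= normc (F z) -> normc (expi t - z) < n.+1%:R^-1 -> V t <= n%:R.
pose P n (s : R) := {ae lam, forall t, D2 t -> `|t - s| < n.+1%:R^-1 -> Q n t}.
have archi (d C : R) : 0 < d -> exists N : nat, forall n, (N <= n)%N -> n.+1%:R^-1 < d /\ C <= n%:R.
  move=> d0; exists (maxn (Num.truncn d^-1).+1 (Num.truncn C).+1) => n; rewrite geq_max => /andP[n1 n2].
  split.
    rewrite invf_plt ?posrE ?ltr0n//; apply: lt_le_trans (truncnS_gt _) _.
    by rewrite ler_nat; apply: leq_trans n1 _.
  by rewrite ltW//; apply: lt_le_trans (truncnS_gt _) _; rewrite ler_nat.
have cov : near_covering (`[0, 2 * pi]%classic : set R) by apply/compact_near_coveringP; exact: segment_compact.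
have [N _ NP] : \forall n \near \oo, `[0, 2 * pi]%classic `<=` P n.
  apply: (cov nat \oo P) => s _.
  have cexpi (d : R) : 0 < d -> exists2 d' : R, 0 < d' &
      forall t, `|t - s| < d' -> normc (expi t - expi s) < d.
    move=> d0; have /cvgCP/(_ d d0)[d' d'0 dP] := @continuous_expi R s.
    by exists d' => // t ts; apply: dP; rewrite /ball_ /= distrC.
  suff [d [N [d0 H]]] : exists d (N : nat), 0 < d /\ forall s' n, (N <= n)%N -> `|s' - s| < d -> P n s'.
    exists ([set s' | `|s' - s| < d], [set n | (N <= n)%N]); last first.
      by move=> [s' n] [/= h1 h2]; exact: H.
    split => /=; last by exists N.
    by exists d => //= s' /=; rewrite /ball_ /= distrC.
  have [Zs|nZs] := pselect (essential_zeros F (expi s)).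
    have [d d0 dP] := essential_zero_small oF ZF Zs eta0.
    have d20 : 0 < d / 2 by rewrite divr_gt0.
    have [d' d'0 d'P] := cexpi _ d20.
    have d'20 : 0 < d' / 2 by rewrite divr_gt0.
    have m0 : 0 < Num.min (d / 2) (d' / 2) by rewrite lt_min d20.
    have [N NP] := archi _ 0 m0; exists (d' / 2), N; split=> // s' n Nn ss.
    apply: aeW => t _ ts z z1 Fz tz.
    have [] := NP n Nn; rewrite lt_min => /andP[n1 n2] _.
    have tss : `|t - s| < d'.
      rewrite -(subrK s' t) -addrA; apply: le_lt_trans (ler_normD _ _) _.
      by rewrite [d']splitr ltrD// (lt_trans ts).
    have := d'P t tss => h.
    have : normc (z - expi s) < d.
      rewrite -(subrK (expi t) z) -addrA; apply: le_lt_trans (le_normcD _ _) _.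
      by rewrite [d]splitr ltrD// normcB (lt_trans tz).
    by move=> /(dP z z1); rewrite ltNge Fz.
  have cs : circle (expi s) by apply/circleE; rewrite normc_expi.
  have [d [C [d0 dP]]] := not_essential_bounded cs nZs.
  have [d' d'0 d'P] := cexpi _ d0.
  have d'20 : 0 < d' / 2 by rewrite divr_gt0.
  have [N NP] := archi _ C d'20; exists (d' / 2), N; split=> // s' n Nn ss.
  apply: ae_imp dP => t tP Dt ts z z1 Fz tz; have [n1 n2] := NP n Nn.
  apply: le_trans n2; apply: tP => //; apply: d'P.
  rewrite -(subrK s' t) -addrA; apply: le_lt_trans (ler_normD _ _) _.
  by rewrite [d']splitr ltrD// (lt_trans ts).
have {NP} NP := NP N (leqnn N).
(* The null set of [P N s] depends on the centre [s]; the countably many centres [j / (N + 1)] reach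
   every point and leave a single null set. *)
exists N; pose sj (j : nat) : R := j%:R / N.+1%:R.
have all_j : {ae lam, forall t, forall j : nat, D2 (sj j) -> D2 t -> `|t - sj j| < N.+1%:R^-1 -> Q N t}.
  apply: ae_foralln => j; have [Dj|Dj] := pselect (D2 (sj j)); last by apply: aeW => t /Dj.
  by apply: ae_imp (NP _ Dj) => t h _.
apply: ae_imp all_j => t tj Dt; have n0 : 0 < N.+1%:R :> R by rewrite ltr0n.
have [t0 t2] : 0 <= t /\ t <= 2 * pi by move: Dt; rewrite /D2 /itv /= in_itv /= => /andP.
set j := Num.truncn (t * N.+1%:R).
have tn0 : 0 <= t * N.+1%:R by rewrite mulr_ge0// ltW.
have j1 : sj j <= t by rewrite /sj ler_pdivrMr// truncn_le.
have j2 : t - sj j < N.+1%:R^-1.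
  have : t * N.+1%:R < j.+1%:R := truncnS_gt _.
  by rewrite -ltr_pdivlMr// -[j.+1%:R]natr1 mulrDl mul1r ltrBlDl.
apply: (tj j) => //; last by rewrite ger0_norm ?subr_ge0.
rewrite /D2 /itv /= in_itv /= (le_trans j1 t2) andbT.
by rewrite /sj divr_ge0 ?ler0n.
Qed.

Definition cutoff (K : R) t : R := Num.max 0 (V t - K).

Lemma cutoff_ge0 K t : 0 <= cutoff K t. Proof. by rewrite /cutoff le_max lexx. Qed.

Lemma cutoff_le K t : 0 <= K -> cutoff K t <= V t.
Proof. by move=> K0; rewrite /cutoff ge_max V0 /= gerBl. Qed.

Lemma rL1_cutoff K : 0 <= K -> rL1 (cutoff K).
Proof.
move=> K0; apply: (rL1_le _ _ VL).
  apply: measurable_maxr; first exact: measurable_cst.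
  by apply: measurable_funB; [exact: rL1_meas|exact: measurable_cst].
by move=> t; rewrite ger0_norm ?cutoff_ge0// cutoff_le.
Qed.

Lemma rL1_min K : 0 <= K -> rL1 (fun t => Num.min (V t) K).
Proof.
move=> K0; apply: (rL1_le _ _ VL).
  by apply: measurable_minr; [exact: rL1_meas|exact: measurable_cst].
by move=> t; rewrite ger0_norm ?le_min ?V0 ?K0// ge_min lexx.
Qed.

Lemma rherg_split K z : 0 <= K -> normc z < 1 ->
  rherg V z = rherg (cutoff K) z + rherg (fun t => Num.min (V t) K) z.
Proof.
move=> K0 z1; rewrite -(rhergD (rL1_cutoff K0) (rL1_min K0) z1).
apply: eq_avg => t; congr (_%:C * _); rewrite /cutoff.
by case: (leP (V t) K) => h; [rewrite max_l ?add0r// subr_le0|rewrite max_r ?subrK// subr_ge0 ltW].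
Qed.

Lemma ravg_cutoff_cvg0 : (fun K : nat => ravg (cutoff K%:R)) @ \oo --> (0 : R).
Proof.
have pc : {ae lam, forall t, D2 t -> (fun K : nat => cutoff K%:R t) @ \oo --> (0 : R)}.
  apply: aeW => t _; apply: (cvg_near_cst 0); exists (Num.truncn (V t)).+1 => // n /= Nn.
  rewrite /cutoff max_l// subr_le0 ltW//; apply: lt_le_trans (truncnS_gt _) _.
  by rewrite ler_nat.
have mk (n : nat) : measurable_fun (@D2 R) (cutoff n%:R) by apply: rL1_meas; apply: rL1_cutoff; exact: ler0n.
have b (n : nat) t : `|cutoff n%:R t| <= V t by rewrite ger0_norm ?cutoff_ge0// cutoff_le.
have [_] := ravg_dominated mk (rL1_meas (rL1_cst 0)) pc VL b.
by rewrite ravg_cst.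
Qed.

Lemma le_ravg_ae (u v : R -> R) : rL1 u -> rL1 v -> (forall t, 0 <= u t) -> (forall t, 0 <= v t) ->
  {ae lam, forall t, D2 t -> u t <= v t} -> ravg u <= ravg v.
Proof.
move=> hu hv u0 v0 uv; rewrite ler_wpM2l ?invr_ge0 ?pi2_ge0//.
have mD := @mD2 R.
rewrite /rI /Rintegral fine_le ?(integral_fune_fin_num mD)//.
apply: ae_ge0_le_integral => //.
- by move=> t _; rewrite lee_fin.
- by apply/measurable_EFinP; exact: rL1_meas hu.
- by move=> t _; rewrite lee_fin.
- by apply/measurable_EFinP; exact: rL1_meas hv.
Qed.

(** Where the truncation is nonzero, [V > n], so by [bounded_away] the point [expi t] has distance
    at least [1 / (n + 1)] from [z]. The kernel is then at most [2 (n + 1)], and the mean of the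
    truncation tends to 0. *)
Lemma rherg_cutoff_small (eta e : R) : 0 < eta -> 0 < e -> exists K : nat,
  forall z, normc z < 1 -> eta <= normc (F z) -> normc (rherg (cutoff K%:R) z) <= e.
Proof.
move=> eta0 e0; have [n nP] := bounded_away eta0.
set k : R := 2 * n.+1%:R; have k0 : 0 < k by rewrite mulr_gt0 ?ltr0n.
have /cvgrPdist_lt/(_ _ (divr_gt0 e0 k0))[N _ NP] := ravg_cutoff_cvg0.
set K := maxn N n; exists K => z z1 Fz.
have K0 : 0 <= K%:R :> R by exact: ler0n.
have := NP K (leq_maxl _ _); rewrite /= sub0r normrN ger0_norm; last by apply: ravg_ge0 => t; exact: cutoff_ge0.
rewrite ltr_pdivlMr// mulrC => h; apply: le_trans (ltW h).
have hK := rL1_cutoff K0; have i := aL1_hker z1 (aL1_real hK).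
apply: le_trans (normc_avg_le i) _; rewrite -(ravgZ _ hK).
apply: le_ravg_ae; [exact: aL1_normc|exact: rL1Z|by move=> t; exact: normc_ge0| |].
  by move=> t; rewrite mulr_ge0 ?cutoff_ge0// ltW.
apply: ae_imp nP => t tP Dt; rewrite normcM normcR ger0_norm ?cutoff_ge0// mulrC.
have [->|m0] := eqVneq (cutoff K%:R t) 0; first by rewrite !mulr0.
rewrite ler_wpM2r ?cutoff_ge0//.
have Vn : n%:R < V t.
  have Kn : n%:R <= K%:R :> R by rewrite ler_nat leq_maxr.
  apply: (le_lt_trans Kn); rewrite ltNge; apply: contra_neqN m0 => h1.
  by rewrite /cutoff max_l// subr_le0.
have tz : n.+1%:R^-1 <= normc (expi t - z).
  by rewrite leNgt; apply/negP => h1; have := tP Dt z z1 Fz h1; rewrite leNgt Vn.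
have iz : 0 < n.+1%:R^-1 :> R by rewrite invr_gt0 ltr0n.
rewrite normc_div /k; apply: ler_pM; rewrite ?invr_ge0 ?normc_ge0//.
  by apply: le_trans (le_normcD _ _) _; rewrite normc_expi; lra.
by rewrite -[leRHS]invrK lef_pV2 ?posrE//; exact: lt_le_trans tz.
Qed.

(* E = (1 + A)^(-2^(-k-1)) for a truncation A of the Herglotz integral of V:
   E is near 1 where F is not small, and small where F is small. *)
Lemma approximate_unit (e : R) : 0 < e -> exists E : Hinf R, [/\ Hinf_ideal F E,
  forall z, normc z < 1 -> normc (E z) + normc (1 - E z) <= 1 + e &
  forall z, normc z < 1 -> normc ((1 - E z) * F z) <= e].
Proof.
move=> e0; have h0 := hnorm_ge0 F; set H := hnorm F in h0.
(* Where [|F| < e / 2], the crude bound [|1 - E| <= 2] is enough for [(1 - E) F]; elsewhere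
   [|1 - E| <= e / (H + 1)] is wanted. *)
have [K KP] := rherg_cutoff_small (divr_gt0 e0 (ltr0Sn _ 1)) (divr_gt0 e0 (ltr_wpDl h0 ltr01)).
have [k kP] : exists k : nat, 2 * 2 ^- k <= e.
  set n := (Num.truncn (2 / e)).+1; exists n.
  have n0 : 0 < 2 ^+ n :> R by rewrite exprn_gt0.
  rewrite ler_pdivrMr// mulrC -ler_pdivrMr//; apply: ltW.
  apply: lt_le_trans (truncnS_gt _) _; rewrite -/n -natrX ler_nat ltnW// ltn_expl//.
have K0 : 0 <= K%:R :> R by exact: ler0n.
pose A z := rherg (cutoff K%:R) z.
have hA : holo A := holo_rherg (rL1_cutoff K0).
have A0 z : normc z < 1 -> 0 <= Re (A z) by move=> z1; apply: Re_rherg_ge0 => // t; exact: cutoff_ge0.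
have A1 z : normc z < 1 -> 1 + Re (A z) <= normc (1 + A z).
  move=> z1; apply: le_trans (Re_le_normc _); apply: le_trans (ler_norm _).
  by case: (A z).
have A1' z : normc z < 1 -> 1 <= normc (1 + A z).
  by move=> z1; apply: le_trans (A1 z z1); rewrite lerDl A0.
have An0 z : normc z < 1 -> 1 + A z != 0.
  by move=> z1; apply/eqP => h; have := A1' z z1; rewrite h normc0; lra.
pose w z := (1 + A z)^-1.
have hw : holo w by apply: holoV => //; apply: holoD => //; exact: holo_csts.
have w1 z : normc z < 1 -> normc (w z) <= 1.
  by move=> z1; rewrite normcV invf_le1 ?A1'// (lt_le_trans ltr01)// A1'.
have w0 z : normc z < 1 -> 0 < Re (w z).
  move=> z1; have : 0 < Re (1 + A z) by have := A0 z z1; case: (A z) => x y /=; lra.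
  by rewrite /w; case: (1 + A z) => x y /= x0; rewrite divr_gt0// ltr_wpDr ?sqr_ge0// exprn_gt0.
have hr : holo (fun z => root2 k.+1 (w z)) by exact: holo_root2.
have r1 z : normc z < 1 -> normc (root2 k.+1 (w z)) <= 1.
  move=> z1; have e2 : (0 < 2 ^ k.+1)%N by rewrite expn_gt0.
  by rewrite -(ler_pXn2r e2) ?nnegrE ?normc_ge0// normc_root2 expr1n w1.
have [E EE] := Hinf_ex hr r1.
have E2 z : normc z < 1 -> normc (1 - E z) <= 2.
  move=> z1; have := le_normcD 1 (- E z); rewrite normcN normc1 EE//.
  by have := r1 z z1; lra.
exists E; split; last 2 first.
- move=> z z1; rewrite EE//; apply: le_trans (normc_root2_lens k (w0 z z1) (w1 z z1)) _.
  by rewrite lerD2l.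
- move=> z z1; rewrite normcM; have [Fz|Fz] := lerP (e / 2) (normc (F z)); last first.
    have -> : e = 2 * (e / 2) by rewrite mulrC divfK.
    by apply: ler_pM; rewrite ?normc_ge0 ?E2 ?(ltW Fz).
  have : normc (1 - E z) <= e / (H + 1).
    apply: le_trans (KP z z1 Fz); rewrite EE//; apply: le_trans (root2_sub1_le _ (w0 z z1)) _.
    have -> : 1 - w z = A z * w z by rewrite /w; field; exact: An0.
    by rewrite normcM ler_piMr ?normc_ge0 ?w1.
  move=> h; apply: (@le_trans _ _ (e / (H + 1) * (H + 1))); last by rewrite divfK// gt_eqF// ltr_wpDl.
  apply: ler_pM; rewrite ?normc_ge0//; apply: le_trans (normc_le_hnorm F z1) _.
  by rewrite lerDl.
apply/ideal_HinfP => d d0.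
set q := (d / 2) ^+ (2 ^ k.+1); have q0 : 0 < q by rewrite exprn_gt0// divr_gt0.
(* [|F| < eta] means that the real part of the full Herglotz integral exceeds [K + 1 / q]. The part
   below the cut is at most [K], so [Re (A z) > 1 / q], hence [|w| <= q] and [|E| <= d / 2]. *)
set eta := normc c * expR (- (K%:R + q^-1)); have eta0 : 0 < eta by rewrite mulr_gt0 ?expR_gt0.
have Esmall z : normc z < 1 -> normc (F z) < eta -> normc (E z) <= d / 2.
  move=> z1 Fz; rewrite EE//; have e2 : (0 < 2 ^ k.+1)%N by rewrite expn_gt0.
  rewrite -(ler_pXn2r e2) ?nnegrE ?normc_ge0 ?divr_ge0 ?(ltW d0)// normc_root2 -/q.
  rewrite normcV invf_ple ?posrE//; last by rewrite (lt_le_trans ltr01)// A1'.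
  apply: le_trans (A1 z z1).
  move: Fz; rewrite /eta FE// normcM normc_cexp ltr_pM2l// ltr_expR (rherg_split K0 z1) -/(A z).
  have := Re_rherg_le z1 (rL1_min K0) (fun t => _ : Num.min (V t) K%:R <= K%:R).
  move=> /(_ (fun t => ltac:(rewrite ge_min lexx orbT; exact isT))).
  case: (A z) (rherg _ z) => [a b] [a' b'] /=; lra.
have [rho rho0 rhoP] : exists2 rho : R, 0 < rho & forall x : R[i], normc x < rho -> normc (1 - cexp x) <= d.
  have /cder_cont/cvgCP/(_ d d0)/cvg_cnear[rho rho0 rhoP] := @cder_cexp0 R.
  exists rho => // x xr; rewrite normcB ltW//.
  by have := rhoP x; rewrite subr0 cexp0; apply.
have rho20 : 0 < rho / 2 by rewrite divr_gt0.
(* A second, usually higher, cut makes a bounded quotient: [1 / F] itself is unbounded, while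
   [exp (B) / c] is bounded and [F exp (B) / c] is the exponential of minus a truncated integral. *)
have [K2 K2P] := rherg_cutoff_small eta0 rho20.
have K20 : 0 <= K2%:R :> R by exact: ler0n.
pose B z := rherg (fun t => Num.min (V t) K2%:R) z.
have hB : holo B := holo_rherg (rL1_min K20).
have hcB : holo (fun z => cexp (B z)).
  move=> z z1; have [b Bb] := hB z z1; exists (cexp (B z) * b).
  exact: cder_comp Bb (cder_cexp _).
have hG : holo (fun z => root2 k.+1 (w z) * (cexp (B z) * c^-1)).
  by apply: holoM => //; apply: holoM => //; exact: holo_csts.
have Gb z : normc z < 1 -> normc (root2 k.+1 (w z) * (cexp (B z) * c^-1)) <= expR K2%:R / normc c.
  move=> z1; rewrite normcM -[leRHS]mul1r; apply: ler_pM; rewrite ?normc_ge0 ?r1//.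
  rewrite normcM normcV ler_wpM2r ?invr_ge0 ?normc_ge0// normc_cexp ler_expR.
  by apply: Re_rherg_le => //; [exact: rL1_min|move=> t; rewrite ge_min lexx orbT].
have [G GE] := Hinf_ex hG Gb; exists G => z z1.
have cn0 : c != 0 by apply: contraTneq c0 => ->; rewrite normc0 ltxx.
(* The second factor is small where [|F| >= eta], by the choice of [K2]; elsewhere it is at most 2
   in modulus and [E] is small. *)
have -> : E z - F z * G z = E z * (1 - cexp (- rherg (cutoff K2%:R) z)).
  rewrite FE// GE// EE// (rherg_split K20 z1) -/(B z) opprD cexpD.
  have e1 : cexp (- B z) * cexp (B z) = 1 by rewrite -cexpD addNr cexp0.
  rewrite mulrBr mulr1; congr (_ - _).
  transitivity (c * c^-1 * (cexp (- B z) * cexp (B z)) * (cexp (- rherg (cutoff K2%:R) z) * root2 k.+1 (w z))).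
    by ring.
  by rewrite e1 mulfV// !mul1r mulrC.
rewrite normcM; have [Fz|Fz] := lerP eta (normc (F z)).
  rewrite -[leRHS]mul1r; apply: ler_pM; rewrite ?normc_ge0//; first by rewrite EE// r1.
  by apply: rhoP; rewrite normcN; apply: le_lt_trans (K2P z z1 Fz) _; lra.
have -> : d = d / 2 * 2 by rewrite divfK.
apply: ler_pM; rewrite ?normc_ge0 ?Esmall//.
apply: le_trans (le_normcD _ _) _; rewrite normc1 normcN normc_cexp.
have : expR (Re (- rherg (cutoff K2%:R) z)) <= 1.
  rewrite expR_le1; have : 0 <= Re (rherg (cutoff K2%:R) z).
    by apply: Re_rherg_ge0 => // t; exact: cutoff_ge0.
  by case: (rherg _ z) => a b /=; rewrite oppr_le0.
lra.
Qed.

End Representation.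

End EssentialZeros.

(** * The M-projection *)

Section UltrafilterLimit.
Context {R : realType}.
Variable U : set_system nat.
Hypothesis UU : UltraFilter U.
Hypothesis oo_U : forall A : set nat, (\forall n \near \oo, A n) -> U A.
Implicit Types (u v : nat -> R[i]) (l m : R[i]) (A : set nat).
Local Notation Re := complex.Re.
Local Notation Im := complex.Im.

Definition ulim u l := forall e : R, 0 < e -> U [set n | normc (u n - l) < e].

Lemma ultra_sub A B : U A -> A `<=` B -> U B.
Proof. by move=> UA AB; exact: filterS AB UA. Qed.

Lemma ultra_and A B : U A -> U B -> U (A `&` B).
Proof. exact: filterI. Qed.

(** Compactness of [[- M, M]] gives a cluster point of each component; for an ultrafilter a cluster
    point is a limit. *)
Lemma ulim_ex u (M : R) : (forall n, normc (u n) <= M) -> exists l, ulim u l.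
Proof.
move=> uM.
have re (v : nat -> R) : (forall n, `|v n| <= M) ->
    exists p : R, forall e : R, 0 < e -> U [set n | `|v n - p| < e].
  move=> vM; have FF : ProperFilter (v @ U) by exact: fmap_proper_filter.
  have : (v @ U) `[- M, M]%classic.
    by apply: (ultra_sub (A := setT)); [exact: filterT|move=> n _ /=; rewrite in_itv /= -ler_norml].
  move=> /(@segment_compact R (- M) M _ FF)[p [_ clp]]; exists p => e e0.
  have [//|UC] := in_ultra_setVsetC [set n | `|v n - p| < e] UU.
  have [y [/= hy]] := clp (~` [set y | `|y - p| < e]) _ UC (nbhsx_ballx p e e0).
  by rewrite -ball_normE /= distrC.
have [p pP] := re (fun n => Re (u n)) (fun n => le_trans (Re_le_normc _) (uM n)).
have [q qP] := re (fun n => Im (u n)) (fun n => le_trans (Im_le_normc _) (uM n)).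
exists (p +i* q) => e e0; have e20 : 0 < e / 2 by rewrite divr_gt0.
apply: ultra_sub (ultra_and (pP _ e20) (qP _ e20)) _ => n [/= h1 h2].
apply: le_lt_trans (normc_le_ReIm _) _; rewrite [e]splitr.
move: h1 h2; case: (u n) => a b /= h1 h2; exact: ltrD.
Qed.

Lemma ulim_unique u l m : ulim u l -> ulim u m -> l = m.
Proof.
move=> ul um; apply/eqP; rewrite -subr_eq0; apply/eqP; apply: eq0_normc; apply/eqP.
rewrite eq_le normc_ge0 andbT; apply/ler_addgt0Pr => e e0; rewrite add0r.
have e20 : 0 < e / 2 by rewrite divr_gt0.
have /filter_ex[n [/= h1 h2]] := ultra_and (ul _ e20) (um _ e20).
rewrite -(subrK (u n) l) -addrA; apply: le_trans (le_normcD _ _) _.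
by rewrite [e]splitr ltW// ltrD// normcB.
Qed.

Lemma ulim_lin (a : R[i]) u v l m : ulim u l -> ulim v m ->
  ulim (fun n => a * u n + v n) (a * l + m).
Proof.
move=> ul vm e e0; have a0 := normc_ge0 a.
have k0 : 0 < 2 * (normc a + 1) by rewrite mulr_gt0// ltr_wpDl.
have e20 : 0 < e / 2 by rewrite divr_gt0.
apply: ultra_sub (ultra_and (ul _ (divr_gt0 e0 k0)) (vm _ e20)) _ => n [/= h1 h2].
have -> : a * u n + v n - (a * l + m) = a * (u n - l) + (v n - m) by ring.
apply: le_lt_trans (le_normcD _ _) _; rewrite [e]splitr ler_ltD// normcM.
move: h1; rewrite ltr_pdivlMr// => h1.
have := normc_ge0 (u n - l); move: h1; set x := normc (u n - l); set y := normc a => h1 x0.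
by clear -h1 x0; nra.
Qed.

Lemma ulim_cst l : ulim (fun=> l) l.
Proof. by move=> e e0; apply: ultra_sub (@filterT _ U _) _ => n _ /=; rewrite subrr normc0. Qed.

Lemma ulim0 u (v : nat -> R) : (forall n, normc (u n) <= v n) -> v @ \oo --> (0 : R) -> ulim u 0.
Proof.
move=> uv /cvgrPdist_lt v0 e e0; apply: oo_U; have := v0 e e0; apply: filterS => n.
rewrite /= sub0r normrN subr0 => h; apply: le_lt_trans (uv n) (le_lt_trans (ler_norm _) h).
Qed.

Lemma ulim_le u v l m (c : R) (w : nat -> R) : ulim u l -> ulim v m ->
  (forall n, normc (u n) + normc (v n) <= c + w n) -> w @ \oo --> (0 : R) -> normc l + normc m <= c.
Proof.
move=> ul vm uvw /cvgrPdist_lt w0; apply/ler_addgt0Pr => e e0.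
have e30 : 0 < e / 3 by rewrite divr_gt0.
have h3 : U [set n | w n < e / 3].
  apply: oo_U; have := w0 _ e30; apply: filterS => n /=.
  by rewrite sub0r normrN; apply: le_lt_trans; exact: ler_norm.
have /filter_ex[n [[/= h1 h2] h]] := ultra_and (ultra_and (ul _ e30) (vm _ e30)) h3.
have := le_normcD (l - u n) (u n); have := le_normcD (m - v n) (v n); have := uvw n.
rewrite !subrK [normc (l - _)]normcB [normc (m - _)]normcB; lra.
Qed.

End UltrafilterLimit.

Section ApproximateUnit.
Context {R : realType}.
Implicit Types (z w : R[i]) (F G x y : Hinf R) (phi psi : dual (Hinf R)).
Local Notation Re := complex.Re.

Lemma dualZ phi (a : R[i]) x : phi (a *: x) = a * phi x.
Proof.
have p0 : phi 0 = 0 by have := dualD phi x (- x); rewrite dualN !subrr.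
by have := dual_linear phi a x 0; rewrite !addr0 p0 addr0.
Qed.

Lemma dnorm_ge0 phi : 0 <= dnorm phi.
Proof. by apply: le_trans (dual_le phi (x := 0) _); rewrite ?normc_ge0// /nrm normr0 ler01. Qed.

Lemma dual_le_hnorm phi x : normc (phi x) <= dnorm phi * hnorm x.
Proof.
have [h0|h0] := eqVneq (hnorm x) 0.
  have -> : x = 0.
    by apply/eqP; rewrite -normr_eq0 Hinf_normE h0.
  have -> : phi 0 = 0 by have := dualZ phi 0 0; rewrite scale0r mul0r.
  by rewrite normc0 mulr_ge0 ?dnorm_ge0 ?hnorm_ge0.
have h1 : 0 < hnorm x by rewrite lt_neqAle eq_sym h0 hnorm_ge0.
have := dual_le phi (x := (hnorm x)^-1%:C *: x).
rewrite nrmZ normcR gtr0_norm ?invr_gt0// mulVf// lexx => /(_ isT).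
by rewrite dualZ normcM normcR gtr0_norm ?invr_gt0// mulrC ler_pdivrMr.
Qed.

Lemma cvg0Ml (a : R) (u : nat -> R) : u @ \oo --> (0 : R) -> (fun n => a * u n) @ \oo --> (0 : R).
Proof.
move=> u0; rewrite -[X in _ --> X](mulr0 a); apply: cvgM => //; exact: cvg_cst.
Qed.

(** Unimodular factors align the two values of [phi], and the pointwise sum of moduli bounds the
    norm of the rotated sum. *)
Lemma dual_pair_le phi (x y : Hinf R) (M : R) :
  (forall z, normc z < 1 -> normc (x z) + normc (y z) <= M) ->
  normc (phi x) + normc (phi y) <= dnorm phi * M.
Proof.
move=> xyM; have [b b1 bE] := phase (phi x); have [c c1 cE] := phase (phi y).
have -> : normc (phi x) + normc (phi y) = normc (phi (b *: x + c *: y)).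
  by rewrite dualD !dualZ bE cE -toCD normcR ger0_norm// addr_ge0 ?normc_ge0.
apply: le_trans (dual_le_hnorm _ _) _; rewrite ler_wpM2l ?dnorm_ge0//.
apply: hnorm_le => z z1; rewrite HinfD !HinfZ; apply: le_trans (le_normcD _ _) _.
by rewrite !normcM b1 c1 !mul1r xyM.
Qed.

Lemma submod_closed_ideal F : submod_closed (mem (Hinf_ideal F)).
Proof.
split=> [|a x y]; first apply/mem_set.
  by apply/ideal_HinfP => e e0; exists 0 => z _; rewrite mulr0 subrr normc0 ltW.
move=> /set_mem/ideal_HinfP Fx /set_mem/ideal_HinfP Fy; apply/mem_set/ideal_HinfP => e e0.
have k0 : 0 < 2 * (normc a + 1) by rewrite mulr_gt0// ltr_wpDl ?normc_ge0.
have [K KP] := Fx _ (divr_gt0 e0 k0); have [L LP] := Fy (e / 2) (divr_gt0 e0 (ltr0Sn _ 1)).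
exists (a *: K + L) => z z1; rewrite !HinfD !HinfZ.
have -> : a * x z + y z - F z * (a * K z + L z) = a * (x z - F z * K z) + (y z - F z * L z) by ring.
apply: le_trans (le_normcD _ _) _; rewrite normcM [e]splitr; apply: lerD; last exact: LP.
have := KP z z1; rewrite ler_pdivlMr//; have := normc_ge0 (x z - F z * K z); have := normc_ge0 a.
set p := normc (_ - _); set q := normc a; clear; nra.
Qed.

Section Projection.
Variables (F : Hinf R) (E : nat -> Hinf R).
Hypothesis FE : forall n, Hinf_ideal F (E n).
Hypothesis E1 : forall n z, normc z < 1 -> normc (E n z) + normc (1 - E n z) <= 1 + n.+1%:R^-1.
Hypothesis EF : forall n z, normc z < 1 -> normc ((1 - E n z) * F z) <= n.+1%:R^-1.

Let v (n : nat) : R := n.+1%:R^-1.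

Let v_cvg : v @ \oo --> (0 : R). Proof. exact: cvg_harmonic. Qed.

Let v1 n : v n <= 1.
Proof. by rewrite /v invf_le1 ?ltr0n// ler1n. Qed.

(** Multiplication by [1 - E n] tends to 0 in norm on the ideal and is the identity modulo the
    ideal. So its dual action, in the limit, maps into the annihilator and fixes it. The ultrafilter
    gives every functional and every [x] a limit, depending linearly on both. *)
Lemma M_ideal_projection : M_ideal (Hinf_ideal F).
Proof.
split; [exact: closed_closure|exact: submod_closed_ideal|].
have [U [UU oU]] := @ultraFilterLemma _ (\oo : set_system nat) _.
have /choice[m mE] : forall nx : nat * Hinf R, exists y : Hinf R, forall z, y z = E nx.1 z * nx.2 z.
  by move=> nx; exact: HinfM_ex.
have E2 n z : normc z < 1 -> normc (1 - E n z) <= 2.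
  move=> z1; apply: (@le_trans _ _ (normc (E n z) + normc (1 - E n z))).
    by rewrite lerDr normc_ge0.
  by apply: le_trans (E1 n z1) _; rewrite -[2]/(1 + 1) lerD2l; exact: v1.
pose T n x : Hinf R := x - m (n, x).
have TE n x z : T n x z = (1 - E n z) * x z by rewrite /T HinfB mE mulrBl mul1r.
have T_lin n (a : R[i]) x y : T n (a *: x + y) = a *: T n x + T n y.
  by apply: Hinf_ext => z _; rewrite [RHS]HinfD HinfZ !TE HinfD HinfZ; ring.
have T_le n x : hnorm (T n x) <= 2 * hnorm x.
  apply: hnorm_le => z z1; rewrite TE normcM.
  by apply: ler_pM; rewrite ?normc_ge0 ?E2 ?normc_le_hnorm.
have P_ex phi : exists psi, forall x, ulim U (fun n => phi (T n x)) (psi x).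
  have b x n : normc (phi (T n x)) <= dnorm phi * 2 * hnorm x.
    by apply: le_trans (dual_le_hnorm _ _) _; rewrite -mulrA ler_wpM2l ?dnorm_ge0.
  have /choice[l lP] : forall x, exists l, ulim U (fun n => phi (T n x)) l.
    by move=> x; apply: ulim_ex => // n; exact: b.
  have ll : linear l.
    move=> a x y; apply: (ulim_unique UU (lP _)).
    have -> : (fun n => phi (T n (a *: x + y))) = (fun n => a * phi (T n x) + phi (T n y)).
      by apply/funext => n; rewrite T_lin dualD dualZ.
    exact: ulim_lin.
  have lb x : normc (l x) <= dnorm phi * 2 * nrm x.
    have h0 : (fun=> 0) @ \oo --> (0 : R) by exact: cvg_cst.
    have := @ulim_le _ _ UU oU _ _ _ _ (dnorm phi * 2 * nrm x) _ (lP x) (ulim_cst UU 0) _ h0.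
    by rewrite normc0 => h; rewrite -[leLHS]addr0; apply: h => n; rewrite !addr0; exact: b.
  by have [psi psiE] := dual_ex ll lb; exists psi => x; rewrite psiE.
have /choice[P PP] := P_ex.
have P_lin : linear P.
  move=> a phi psi; apply: val_inj; apply/funext => x /=.
  apply: (ulim_unique UU (PP _ x)); exact: (ulim_lin UU a (PP phi x) (PP psi x)).
have P_ann phi x : Hinf_ideal F x -> P phi x = 0.
  move=> Fx; apply: (ulim_unique UU (PP phi x)).
  apply: (ulim0 oU (v := fun n => dnorm phi * hnorm (T n x))) => [n|].
    exact: dual_le_hnorm.
  suff h0 : (fun n => hnorm (T n x)) @ \oo --> (0 : R).
    exact: cvg0Ml.
  apply/cvgrPdist_le => e e0; move/ideal_HinfP: Fx => Fx.
  have e40 : 0 < e / 4 by rewrite divr_gt0.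
  have [K KP] := Fx _ e40; have hK := hnorm_ge0 K.
  have k0 : 0 < e / 2 / (hnorm K + 1) by rewrite !divr_gt0// ltr_wpDl.
  have /cvgrPdist_lt/(_ _ k0) := v_cvg; apply: filterS => n.
  have vn0 : 0 <= v n by rewrite /v invr_ge0.
  rewrite /= !sub0r !normrN (ger0_norm vn0) (ger0_norm (hnorm_ge0 _)) => vn.
  apply: hnorm_le => z z1; rewrite TE.
  (* The generator is small under [1 - E n] by [EF]; the error of approximating [x] by a multiple of
     [F] is at most doubled. *)
  have -> : (1 - E n z) * x z = (1 - E n z) * (x z - F z * K z) + (1 - E n z) * F z * K z by ring.
  apply: le_trans (le_normcD _ _) _; rewrite [e]splitr; apply: lerD.
    rewrite normcM; have -> : e / 2 = 2 * (e / 4) by field.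
    by apply: ler_pM; rewrite ?normc_ge0 ?E2 ?KP.
  rewrite normcM -(divfK (_ : hnorm K + 1 != 0) (e / 2)) ?gt_eqF ?ltr_wpDl//.
  apply: ler_pM; rewrite ?normc_ge0//; first by apply: le_trans (EF n z1) _; exact: ltW.
  by apply: le_trans (normc_le_hnorm K z1) _; rewrite lerDl.
(* [x - T n x = E n x] lies in the ideal, so [phi (T n x)] does not depend on [n]. *)
have P_id phi : annihilator (Hinf_ideal F) phi -> P phi = phi.
  move=> aphi; apply: val_inj; apply/funext => x /=; apply: (ulim_unique UU (PP phi x)).
  have -> : (fun n => phi (T n x)) = fun=> phi x; last exact: ulim_cst.
  apply/funext => n; rewrite /T dualD dualN (aphi (m (n, x))) ?subr0//.
  have mE' z : normc z < 1 -> m (n, x) z = E n z * x z by rewrite mE.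
  refine (@ideal_mul R F (E n) (m (n, x)) x (hnorm x) (@FE n) (@Hinf_holo _ x) _ mE').
  exact: normc_le_hnorm.
have P_norm phi : dnorm (P phi) + dnorm (phi - P phi) = dnorm phi.
  apply/eqP; rewrite eq_le; apply/andP; split; last first.
    have := ler_normD (P phi) (phi - P phi); rewrite addrC subrK.
    by rewrite -[leRHS]/((dnorm (P phi))%:C + (dnorm (phi - P phi))%:C) -toCD lecR.
  have ub (x : Hinf R) : @unit_ball R (Hinf R) x -> hnorm x <= 1.
    by rewrite /unit_ball /= Hinf_normE lecR.
  rewrite -lerBrDr; apply: sup_norm_le; first exact: unit_ball0.
  move=> x /ub x1; rewrite lerBrDr -lerBrDl; apply: sup_norm_le; first exact: unit_ball0.
  move=> y /ub y1; rewrite lerBrDl.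
  (* For [x], [y] in the unit ball the two parts are limits of [phi ((1 - E n) x)] and
     [phi (E n y)]; their moduli add up to at most [dnorm phi * (1 + v n)] by the lens bound
     [E1]. *)
  have h : ulim U (fun n => phi (m (n, y))) ((phi - P phi) y).
    have := ulim_lin UU (- 1) (PP phi y) (ulim_cst UU (phi y)).
    rewrite mulN1r addrC; congr (ulim U _ _); apply/funext => n.
    by rewrite /T dualD dualN; ring.
  apply: (ulim_le UU oU (PP phi x) h (w := fun n => dnorm phi * v n)) => [n|].
    rewrite -[X in _ <= X + _](mulr1 (dnorm phi)) -mulrDr; apply: dual_pair_le => z z1.
    rewrite TE mE !normcM addrC; apply: le_trans (E1 n z1); apply: lerD.
      by rewrite ler_piMr ?normc_ge0// (le_trans (normc_le_hnorm y z1)).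
    by rewrite ler_piMr ?normc_ge0// (le_trans (normc_le_hnorm x z1)).
  exact: cvg0Ml.
pose PL : {linear dual (Hinf R) -> dual (Hinf R)} :=
  HB.pack P (GRing.isLinear.Build R[i] (dual (Hinf R)) (dual (Hinf R)) *:%R P P_lin).
exists PL; split.
- move=> phi A /nbhs_ballP[e /= e0 eA]; apply: filterS (nbhsx_ballx phi e e0) => psi.
  rewrite -ball_normE /= => h; apply: eA; rewrite -ball_normE /=.
  apply: le_lt_trans h; rewrite -[P phi - P psi]/(PL phi - PL psi) -raddfB /=.
  rewrite -[leLHS]/((dnorm (P (phi - psi)))%:C) -[leRHS]/((dnorm (phi - psi))%:C) lecR.
  by rewrite -[leRHS]P_norm lerDl dnorm_ge0.
- by move=> phi; apply: P_id => x; exact: P_ann.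
- apply/seteqP; split=> [_ [phi _ <-] x|phi aphi]; first exact: P_ann.
  by exists phi => //; exact: P_id.
- move=> phi; rewrite -[RHS]/((dnorm phi)%:C) -[LHS]/((dnorm (P phi))%:C + (dnorm (phi - P phi))%:C).
  by rewrite -toCD P_norm.
Qed.

End Projection.

Lemma M_ideal_of_outer F : outer F -> Zinf F -> M_ideal (Hinf_ideal F).
Proof.
move=> oF ZF; have [V [c [V0 VL c0 FE rad]]] := outer_repr oF.
have /choice[E EP] : forall n : nat, exists E : Hinf R, [/\ Hinf_ideal F E,
  forall z, normc z < 1 -> normc (E z) + normc (1 - E z) <= 1 + n.+1%:R^-1 &
  forall z, normc z < 1 -> normc ((1 - E z) * F z) <= n.+1%:R^-1].
  by move=> n; apply: (approximate_unit oF ZF V0 VL c0 FE rad); rewrite invr_gt0 ltr0n.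
by apply: (@M_ideal_projection F E) => n; case: (EP n).
Qed.

End ApproximateUnit.

Theorem theorem1p9 (R : realType) (f : Hinf R) (hf : Zinf f) :
  M_ideal (Hinf_ideal f) <-> outer f.
Proof.
split=> [|fO]; first exact: M_ideal_outer hf.1.
exact: M_ideal_of_outer.
Qed.
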